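(* Let $n\ge 3$, let $\overline{M}_{0,n}$ be the moduli space of stable $n$-pointed rational curves over $\mathbb{C}$, and let $\Delta=\overline{M}_{0,n}\setminus M_{0,n}$ be its boundary divisor. Then the pair $(\overline{M}_{0,n},\Delta)$ is algebraically hyperbolic. Moreover, for $n\ge 4$ one may take $\epsilon=\frac{1}{(n-3)^2}$ with respect to the polarization $K_{\overline{M}_{0,n}}+\Delta$; that is, for every integral curve $C\subset\overline{M}_{0,n}$ not contained in $\Delta$, $$2g(C)-2+i(C,\Delta)\ \ge\ \frac{1}{(n-3)^2}\,\deg_{K_{\overline{M}_{0,n}}+\Delta} C .$$
   Context: Everything is over $\mathbb{C}$. $M_{0,n}=\{(\mathbb{P}^1,p_1,\ldots,p_n)\mid p_i\ne p_j \text{ for } i\neq j\}/\mathrm{PGL}_2$ has dimension $n-3$, and $\overline{M}_{0,n}$ is its Deligne–Mumford–Knudsen compactification, a smooth projective variety parametrizing stable $n$-pointed rational curves. The boundary $\Delta=\overline{M}_{0,n}\setminus M_{0,n}$ is a (reduced) simple normal crossings divisor whose irreducible components $D_{I,J}$ are indexed by unordered partitions $I\sqcup J=\{1,\ldots,n\}$ with $2\le|I|,|J|\le n-2$. ($\overline{M}_{0,3}$ is a point; $\overline{M}_{0,4}\simeq\mathbb{P}^1$ with $\Delta=\{0,1,\infty\}$.) It is known that $K_{\overline{M}_{0,n}}+\Delta$ is very ample. Definition: given a complex projective variety $X$ and an effective divisor $D_X$, the pair $(X,D_X)$ is algebraically hyperbolic if there exist $\epsilon>0$ and an ample divisor $A$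 on $X$ such that for every integral curve $C\subset X$ not contained in $D_X$, $$2g(C)-2+i(C,D_X)\ge\epsilon\cdot\deg_A C,$$ where $\deg_A C=A\cdot C$, $g(C)$ is the geometric genus of $C$, and $i(C,D_X)=|f^{-1}(D_X)|$ is the number of points (counted without multiplicity) in the preimage of the support of $D_X$ under $f:\widehat{C}\to X$, the normalization of $C$ composed with the inclusion $C\subset X$. *)

(* Defs.v *)
From HB Require Import structures.
From mathcomp Require Import all_boot all_order all_algebra.
From mathcomp Require Import boolp classical_sets cardinality reals complex mpoly.

Set Implicit Arguments.
Unset Strict Implicit.
Unset Printing Implicit Defensive.

Import Order.TTheory GRing.Theory Num.Theory.
Local Open Scope classical_set_scope.
Local Open Scope ring_scope.

(* Varieties are treated classically, as spaces with functions: a set of closed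
   points, its Zariski open sets, and for each point x the functions that are
   regular in some neighbourhood of x.  Functions are total; their values away
   from the relevant neighbourhood (or off the domain of definition of a
   rational function) are junk and are ignored by every definition below. *)
Record space (k : fieldType) := Space {
  pt :> Type;
  zopen : set (set pt);
  regular : pt -> set (pt -> k) }.

Arguments zopen {k} _ _.
Arguments regular {k} [_] _ _.

Definition zclosed {k : fieldType} (X : space k) (A : set X) : Prop :=
  zopen X (~` A).

Definition near_pt {k : fieldType} {X : space k} (x : X) (P : set X) : Prop :=
  exists U : set X, [/\ zopen X U, U x & U `<=` P].

(* Only used on irreducible X, where nonempty open sets are dense. *)
Definition generic {k : fieldType} {X : space k} (P : set X) : Prop :=
  exists U : set X, [/\ zopen X U, U !=set0 & U `<=` P].

Definition irreducible {k : fieldType} {X : space k} (Z : set X) : Prop :=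
  Z !=set0 /\
  forall A B : set X, zclosed A -> zclosed B -> Z `<=` A `|` B ->
    Z `<=` A \/ Z `<=` B.

(* Closed, irreducible, of Krull dimension one. *)
Definition integral_curve {k : fieldType} {X : space k} (C : set X) : Prop :=
  [/\ zclosed C, irreducible C, ~ (exists x, C = [set x]) &
      forall Z : set X, zclosed Z -> irreducible Z -> Z `<=` C ->
        Z = C \/ exists x, Z = [set x]].

Definition pull_open {k : fieldType} {T : Type} {X : space k} (i : T -> X)
  (U : set T) : Prop :=
  exists V : set X, zopen X V /\ U = i @^-1` V.

Definition pull_regular {k : fieldType} {T : Type} {X : space k} (i : T -> X)
  (x : T) (f : T -> k) : Prop :=
  exists g : X -> k, regular (i x) g /\
    exists V : set X, [/\ zopen X V, V (i x) & forall y, V (i y) -> f y = g (i y)].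

Definition subspace {k : fieldType} {X : space k} (C : set X) : space k :=
  @Space k C (pull_open (fun y : C => val y : X))
    (pull_regular (fun y : C => val y : X)).

Definition morphism_on {k : fieldType} {X Z : space k} (U : set X)
  (f : X -> Z) : Prop :=
  forall x, U x ->
    (forall W : set Z, zopen Z W -> W (f x) -> near_pt x (f @^-1` W)) /\
    (forall h : Z -> k, regular (f x) h -> regular x (h \o f)).

Definition birational {k : fieldType} {X Z : space k} (f : X -> Z) : Prop :=
  exists (g : Z -> X) (U : set X) (V : set Z),
    [/\ zopen X U /\ U !=set0, zopen Z V /\ V !=set0,
        morphism_on U f /\ morphism_on V g,
        (forall x, U x -> V (f x) /\ g (f x) = x) &
        (forall z, V z -> U (g z) /\ f (g z) = z)].

Definition closed_immersion {k : fieldType} {X Z : space k} (i : X -> Z) : Prop :=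
  [/\ injective i, zclosed (range i),
      (forall U : set X, zopen X U <-> pull_open i U) &
      (forall (x : X) (f : X -> k), regular x f <-> pull_regular i x f)].

(* Points of P^N are the lines of k^(N+1), evaluated at a chosen nonzero
   vector; only ratios of forms of equal degree are ever evaluated. *)
Definition line (k : fieldType) (N : nat) :=
  {L : {vspace 'rV[k]_N.+1} | \dim L == 1%N}.

Definition hcoord {k : fieldType} {N : nat} (L : line k N) : 'I_N.+1 -> k :=
  fun i => vpick (val L) 0 i.

Definition Pn_open {k : fieldType} {N : nat} (U : set (line k N)) : Prop :=
  forall L, U L -> exists (d : nat) (Q : {mpoly k[N.+1]}),
    [/\ Q \is d.-homog, Q.@[hcoord L] != 0 &
        forall M, Q.@[hcoord M] != 0 -> U M].

Definition Pn_regular {k : fieldType} {N : nat} (L : line k N)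
  (f : line k N -> k) : Prop :=
  exists (d : nat) (P Q : {mpoly k[N.+1]}),
    [/\ P \is d.-homog, Q \is d.-homog, Q.@[hcoord L] != 0 &
        forall M, Q.@[hcoord M] != 0 -> f M = P.@[hcoord M] / Q.@[hcoord M]].

Definition Pn (k : fieldType) (N : nat) : space k :=
  @Space k (line k N) Pn_open Pn_regular.

Definition linear_form {k : fieldType} {N : nat} (c : 'I_N.+1 -> k)
  (L : Pn k N) : k :=
  \sum_i c i * hcoord (L : line k N) i.

Definition projective {k : fieldType} (X : space k) : Prop :=
  exists (N : nat) (i : X -> Pn k N), closed_immersion i.

(* The square of the maximal ideal of the local ring at x. *)
Definition in_max2 {k : fieldType} {X : space k} (x : X) (f : X -> k) : Prop :=
  exists (r : nat) (a b : 'I_r -> X -> k),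
    (forall j, [/\ regular x (a j), a j x = 0, regular x (b j) & b j x = 0]) /\
    near_pt x [set y | f y = \sum_j a j y * b j y].

(* The t_i vanish at x and form a basis of the cotangent space m_x / m_x^2. *)
Definition local_params {k : fieldType} {X : space k} (d : nat) (x : X)
  (t : 'I_d -> X -> k) : Prop :=
  (forall i, regular x (t i) /\ t i x = 0) /\
  forall f : X -> k, regular x f -> f x = 0 ->
    exists! c : 'rV[k]_d, in_max2 x (fun y => f y - \sum_i c 0 i * t i y).

(* Point derivations of the local ring at x. *)
Definition tangent {k : fieldType} {X : space k} (x : X)
  (D : (X -> k) -> k) : Prop :=
  [/\ (forall f g, regular x f -> regular x g ->
         near_pt x [set y | f y = g y] -> D f = D g),
      (forall (a : k) f g, regular x f -> regular x g ->
         D (fun y => a * f y + g y) = a * D f + D g) &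
      (forall f g, regular x f -> regular x g ->
         D (fun y => f y * g y) = f x * D g + g x * D f)].

Definition nonsingular_curve {k : fieldType} (Y : space k) : Prop :=
  integral_curve [set: Y] /\
  forall y : Y, exists t : 'I_1 -> Y -> k, local_params y t.

(* The normalization of a projective curve C: the nonsingular projective curve
   with a birational morphism onto C. *)
Definition normalization {k : fieldType} {X : space k} (C : set X)
  (Y : space k) (f : Y -> subspace C) : Prop :=
  [/\ nonsingular_curve Y, projective Y, morphism_on [set: Y] f,
      (forall c : subspace C, exists y, f y = c) & birational f].

(* A 1-form assigns a number to each tangent vector, and is regular if it is
   locally of the form \sum_i a_i d(g_i) with a_i, g_i regular. *)
Definition regular_1form {k : fieldType} {Y : space k}
  (w : Y -> ((Y -> k) -> k) -> k) : Prop :=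
  forall y : Y, exists (r : nat) (a g : 'I_r -> Y -> k),
    near_pt y [set z |
      (forall j, regular z (a j) /\ regular z (g j)) /\
      (forall D, tangent z D -> w z D = \sum_j a j z * D (g j))].

(* g = dim H^0(Y, Omega^1). *)
Definition is_genus {k : fieldType} (Y : space k) (g : nat) : Prop :=
  exists w : 'I_g -> Y -> ((Y -> k) -> k) -> k,
    (forall i, regular_1form (w i)) /\
    forall eta : Y -> ((Y -> k) -> k) -> k, regular_1form eta ->
      exists! c : 'rV[k]_g,
        forall (y : Y) D, tangent y D -> eta y D = \sum_i c 0 i * w i y D.

Definition rat_nonzero {k : fieldType} {X : space k} (f : X -> k) : Prop :=
  generic [set x | regular x f /\ f x != 0].

(* The rational functions f and h have the same divisor near x. *)
Definition assoc_at {k : fieldType} {X : space k} (x : X) (f h : X -> k) : Prop :=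
  exists u : X -> k,
    [/\ regular x u, u x != 0 & generic [set y | f y = u y * h y]].

(* A Cartier divisor A is given by a local equation A x (a rational function)
   near each point x; so the sum of divisors is the product of equations. *)
Definition cartier {k : fieldType} {X : space k} (A : X -> X -> k) : Prop :=
  forall x, rat_nonzero (A x) /\ near_pt x [set y | assoc_at y (A y) (A x)].

Definition add_div {k : fieldType} {X : space k} (A B : X -> X -> k) :
  X -> X -> k :=
  fun x y => A x y * B x y.

Definition mul_div {k : fieldType} {X : space k} (m : nat) (A : X -> X -> k) :
  X -> X -> k :=
  fun x y => A x y ^+ m.

Definition lin_equiv {k : fieldType} {X : space k} (A B : X -> X -> k) : Prop :=
  exists h : X -> k, rat_nonzero h /\
    forall x, assoc_at x (B x) (fun y => h y * A x y).

(* A is ample if, for some m > 0, m A is linearly equivalent to the divisor cut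
   out by a hyperplane l = 0 under a closed immersion in projective space. *)
Definition ample {k : fieldType} {X : space k} (A : X -> X -> k) : Prop :=
  cartier A /\
  exists (m N : nat) (i : X -> Pn k N) (l : 'I_N.+1 -> k)
         (c : X -> 'I_N.+1 -> k),
    [/\ (0 < m)%N, closed_immersion i,
        (exists x, linear_form l (i x) != 0),
        (forall x, linear_form (c x) (i x) != 0) &
        lin_equiv (mul_div m A)
          (fun x y => linear_form l (i y) / linear_form (c x) (i y))].

(* Order of vanishing at a point of a nonsingular curve; the value of f at y
   itself is irrelevant. *)
Definition is_order {k : fieldType} {Y : space k} (y : Y) (f : Y -> k)
  (m : int) : Prop :=
  exists (t : 'I_1 -> Y -> k) (u : Y -> k),
    [/\ local_params y t, regular y u, u y != 0 &
        near_pt y [set z | z <> y -> f z = t ord0 z ^ m * u z]].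

(* d = deg f^*A for f from a nonsingular projective curve Y to X: move A in its
   linear equivalence class to a divisor B not containing f(Y), and count the
   zeros and poles p_0, ..., p_(r-1) of the pulled back local equations. *)
Definition is_degree {k : fieldType} {X Y : space k} (f : Y -> X)
  (A : X -> X -> k) (d : int) : Prop :=
  exists B : X -> X -> k,
    [/\ cartier B, lin_equiv A B,
        (forall y : Y, exists y' : Y,
           near_pt (f y') [set z | regular z (B (f y)) /\ B (f y) z != 0]) &
        exists (r : nat) (p : 'I_r -> Y) (m : 'I_r -> int),
          [/\ injective p,
              (forall i, is_order (p i) (B (f (p i)) \o f) (m i)),
              (forall y, ~ (exists i, p i = y) -> is_order y (B (f y) \o f) 0) &
              d = \sum_i m i]].

(* K is the divisor of a nonzero rational top form phi dg_1 /\ ... /\ dg_d on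
   the nonsingular variety X: at x this form is K_x dt_1 /\ ... /\ dt_d for
   local parameters t_i.  Forms are compared on d-tuples of tangent vectors. *)
Definition canonical_divisor {k : fieldType} {X : space k}
  (K : X -> X -> k) : Prop :=
  exists (d : nat) (phi : X -> k) (g : 'I_d -> X -> k),
    forall x, rat_nonzero (K x) /\
      exists t : 'I_d -> X -> k, local_params x t /\
        generic [set y |
          [/\ regular y phi, regular y (K x),
              (forall j, regular y (g j) /\ regular y (t j)) &
              forall D : 'I_d -> (X -> k) -> k, (forall i, tangent y (D i)) ->
                phi y * \det (\matrix_(i, j) D i (g j)) =
                K x y * \det (\matrix_(i, j) D i (t j))]].

(* E is the closed set S as a reduced effective divisor: E x generates the
   ideal of S in the local ring at x. *)
Definition reduced_divisor {k : fieldType} {X : space k} (S : set X)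
  (E : X -> X -> k) : Prop :=
  forall x, [/\ rat_nonzero (E x), regular x (E x) &
    forall f : X -> k, regular x f ->
      (near_pt x [set y | S y -> f y = 0] <->
       exists a : X -> k, regular x a /\ near_pt x [set y | f y = a y * E x y])].

(* 2 g(C) - 2 + i(C, S) >= eps deg_A C for all integral curves C not contained
   in S, the support of the divisor of the pair. *)
Definition hyperbolic_bound {R : realType} {X : space R[i]} (S : set X)
  (eps : R) (A : X -> X -> R[i]) : Prop :=
  forall C : set X, integral_curve C -> ~ (C `<=` S) ->
  forall (Y : space R[i]) (f : Y -> subspace C), normalization f ->
  forall (g i : nat) (d : int),
    is_genus Y g ->
    ([set y : Y | S (val (f y))] #= `I_i)%card ->
    is_degree (fun y => val (f y) : X) A d ->
    eps * d%:~R <= 2 * g%:R - 2 + i%:R.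

Definition algebraically_hyperbolic {R : realType} (X : space R[i])
  (S : set X) : Prop :=
  exists (eps : R) (A : X -> X -> R[i]),
    [/\ 0 < eps, ample A & hyperbolic_bound S eps A].

(* The projective line k + {oo}, with None the point at infinity. *)
Definition P1 (k : fieldType) := option k.

(* The determinant of the homogeneous coordinates (a : 1) and oo = (1 : 0). *)
Definition bracket {k : fieldType} (z w : P1 k) : k :=
  match z, w with
  | Some a, Some b => a - b
  | Some _, None => -1
  | None, Some _ => 1
  | None, None => 0
  end.

(* For distinct a, b, c: the image of d under the element of PGL_2 that maps
   a, b, c to 0, 1, oo. *)
Definition cross_ratio {k : fieldType} (a b c d : P1 k) : P1 k :=
  if bracket d c * bracket b a == 0 then None
  else Some ((bracket d a * bracket b c) / (bracket d c * bracket b a)).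

(* The product of copies of P^1 indexed by I, covered by affine spaces with
   coordinates z_i or 1 / z_i, according to b i. *)
Definition in_chart {k : fieldType} (b : bool) (z : P1 k) : bool :=
  if b then z != Some 0 else z != None.

Definition chart {k : fieldType} (b : bool) (z : P1 k) : k :=
  if z is Some a then (if b then a^-1 else a) else 0.

Definition in_charts {k : fieldType} {I : finType} (b : I -> bool)
  (x : I -> P1 k) : Prop :=
  forall i, in_chart (b i) (x i).

Definition charts {k : fieldType} {I : finType} (b : I -> bool)
  (x : I -> P1 k) : 'I_#|I| -> k :=
  fun j => chart (b (enum_val j)) (x (enum_val j)).

Definition P1s_open {k : fieldType} {I : finType} (U : set (I -> P1 k)) : Prop :=
  forall x, U x -> exists (b : I -> bool) (Q : {mpoly k[#|I|]}),
    [/\ in_charts b x, Q.@[charts b x] != 0 &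
        forall y, in_charts b y -> Q.@[charts b y] != 0 -> U y].

Definition P1s_regular {k : fieldType} {I : finType} (x : I -> P1 k)
  (f : (I -> P1 k) -> k) : Prop :=
  exists (b : I -> bool) (P Q : {mpoly k[#|I|]}),
    [/\ in_charts b x, Q.@[charts b x] != 0 &
        forall y, in_charts b y -> Q.@[charts b y] != 0 ->
          f y = P.@[charts b y] / Q.@[charts b y]].

Definition P1s (k : fieldType) (I : finType) : space k :=
  @Space k (I -> P1 k) P1s_open P1s_regular.

(* An n-pointed nodal curve with all components equal to P^1: the point
   node v w of v is glued to the point node w v of w whenever adj v w, and the
   i-th marked point is the point mpos i of the component mcomp i. *)
Record pointed_curve (k : fieldType) (n : nat) := PointedCurve {
  comp : finType;
  adj : rel comp;
  node : comp -> comp -> P1 k;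
  mcomp : 'I_n -> comp;
  mpos : 'I_n -> P1 k }.

Arguments adj {k n} _ _ _.
Arguments node {k n} _ _ _.
Arguments mcomp {k n} _ _.
Arguments mpos {k n} _ _.

Definition simple_path {T : finType} (e : rel T) (v w : T) (p : seq T) : Prop :=
  [/\ path e v p, last v p = w & uniq (v :: p)].

(* Stable of arithmetic genus 0: the dual graph is a tree, nodes and marked
   points are distinct, and each component carries at least three of them. *)
Definition stable_rational {k : fieldType} {n : nat} (S : pointed_curve k n) :
  Prop :=
  [/\ ssrbool.symmetric (adj S) /\ irreflexive (adj S),
      (forall v w : comp S, exists! p, simple_path (adj S) v w p),
      (forall v w w' : comp S, adj S v w -> adj S v w' ->
         node S v w = node S v w' -> w = w'),
      (forall i j, mcomp S i = mcomp S j -> mpos S i = mpos S j -> i = j) /\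
      (forall i w, adj S (mcomp S i) w -> mpos S i <> node S (mcomp S i) w) &
      (forall v : comp S,
         3 <= #|[set w | adj S v w]%SET| + #|[set i | mcomp S i == v]%SET|)%N].

(* z is the image of the i-th marked point under the retraction of S onto its
   component v. *)
Definition retracts_to {k : fieldType} {n : nat} (S : pointed_curve k n)
  (v : comp S) (i : 'I_n) (z : P1 k) : Prop :=
  (mcomp S i = v /\ z = mpos S i) \/
  (exists (w : comp S) (p : seq (comp S)),
     simple_path (adj S) v (mcomp S i) (w :: p) /\ z = node S v w).

Definition quad (n : nat) := {q : 4.-tuple 'I_n | uniq q}.

Definition mark {n : nat} (q : quad n) (j : 'I_4) : 'I_n := tnth (val q) j.

(* z is the cross ratio of the four marked points q, on the component where the
   first three are separated. *)
Definition has_cross_ratio {k : fieldType} {n : nat} (S : pointed_curve k n)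
  (q : quad n) (z : P1 k) : Prop :=
  exists (v : comp S) (a : 'I_4 -> P1 k),
    [/\ (forall j, retracts_to v (mark q j) (a j)),
        [/\ a (inord 0) <> a (inord 1), a (inord 1) <> a (inord 2) &
            a (inord 0) <> a (inord 2)] &
        z = cross_ratio (a (inord 0)) (a (inord 1)) (a (inord 2)) (a (inord 3))].

Definition represents {k : fieldType} {n : nat} (x : P1s k (quad n))
  (S : pointed_curve k n) : Prop :=
  stable_rational S /\ forall q, has_cross_ratio S q (x q).

(* The moduli space of stable n-pointed rational curves (n >= 3).  Stable curves
   are isomorphic exactly when all their cross ratios agree, and the cross
   ratios, i.e. the forgetful maps to the spaces Mbar_{0,4} = P^1, embed
   Mbar_{0,n} as a closed subvariety of a product of projective lines
   (Gerritzen, Herrlich, van der Put, Stable n-pointed trees of projective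
   lines, 1988); this fixes the points and the structure of variety. *)
Definition Mbar0 (k : fieldType) (n : nat) : space k :=
  @subspace k (P1s k (quad n)) [set x | exists S, represents x S].

Definition M0 (k : fieldType) (n : nat) : set (Mbar0 k n) :=
  [set x | exists S, represents (val x) S /\ #|comp S| = 1%N].

Definition boundary (k : fieldType) (n : nat) : set (Mbar0 k n) :=
  ~` M0 (k := k) (n := n).
Arguments boundary : clear implicits.

(* Main.v *)
(* Let m = n - 3.  A curve f : Y -> Mbar_{0,n} that meets M_{0,n} composes with
   every cross ratio to a map from Y to P^1, and the points over 0, 1 and oo lie
   in the preimage of the boundary.  By the Hurwitz inequality for three points,
   the pole divisor of such a map has degree at most 2 g - 2 + i if it is not
   constant, and some cross ratio is not constant on the curve.  So it is enough
   to bound a divisor by pole divisors of cross ratios.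

   The sum of the pole divisors of all cross ratios is the hyperplane class of a
   Segre embedding, hence ample.  For K + Delta, send three marked points to 0, 1
   and oo, and let z_1, ..., z_m be the positions of the others.  If t_1, ..., t_m
   are regular at a point x, then disc(z) * det (d t_j / d z_i), multiplied by
   z_i^(-m) for every i such that z_i(x) = oo, extends to a function that is
   regular at x and vanishes on the boundary.  To see this, write the d t_j as
   combinations of logarithmic differentials of the differences of the positions,
   in a coordinate where they are all finite, and expand the determinant: every
   term uses m differences that form a forest, so it has simple poles at most, and
   disc(z) cancels them.  Therefore deg (K + Delta) is at most m times the sum of
   the degrees of the m functions z_i on the curve, hence at most
   m^2 (2 g - 2 + i).

   For the Hurwitz inequality, take a reduced basis of the function field over
   k[x] in the sense of Dedekind and Weber.  The ramification over three points
   bounds its discriminant from below, and the trace dual basis gives enough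
   regular forms to bound the genus from below. *)
From HB Require Import structures.
From mathcomp Require Import all_boot all_order all_algebra.
From mathcomp Require Import boolp classical_sets cardinality reals complex mpoly.
From mathcomp Require Import ring lra zify.
Require Import Defs.

Set Implicit Arguments.
Unset Strict Implicit.
Unset Printing Implicit Defensive.

Import Order.TTheory GRing.Theory Num.Theory.
Local Open Scope ring_scope.

(** * Function fields over k[x] *)

(** The spaces are bare sets of points with functions, and this shapes the proof. A point of [Mbar0]
    is one that some stable curve represents; the relations [crsys] between cross ratios turn this
    into polynomial equations, because the tree of components can be rebuilt from any solution.
    Local equations of divisors are compared generically, so the space must be irreducible; explicit
    one-parameter families provide this, and their derivatives at points of [M0] serve as the
    tangent vectors on which top forms are evaluated. On the curve, [is_genus] counts regular forms,
    so that exhibiting independent ones bounds it from below. A degree is read off from a moved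
    divisor [B]. Hence every comparison has the form alpha * B = unit * H * P, with one rational
    function [H] for all points, [P] the local equation of a sum of pole divisors, and [alpha]
    regular and nonzero over [M0]; since principal divisors have degree 0, deg B is at most deg P.
    For K + Delta, [P] is the m-th power of the equation of m pole divisors, which is the origin of
    m^2. *)

Lemma trace_idem_nil (k : numClosedFieldType) (n N : nat) (A : 'M[k]_n.+1) :
  (A * (A - 1)) ^+ N = 0 ->
  exists2 m, \tr A = m%:R & m = 0%N -> A ^+ n.+1 = 0.
Proof.
move=> AN0; have [r rE] := closed_field_poly_normal (char_poly A).
have lc1 : lead_coef (char_poly A) = 1 by apply/eqP; exact: char_poly_monic.
rewrite lc1 scale1r in rE.
have szr : size r = n.+1.
  have := size_char_poly A; rewrite rE size_prod_XsubC => -[->] //.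
(* The eigenvalues of [A] are 0 and 1, so the trace counts the eigenvalue 1. If it does not occur,
   the characteristic polynomial is a power of 'X, and Cayley-Hamilton gives nilpotency. *)
have r01 z : z \in r -> z = 0 \/ z = 1.
  move=> zr; have: eigenvalue A z.
    by rewrite eigenvalue_root_char rE root_prod_XsubC.
  case/eigenvalueP=> w wA w0.
  have wAN : w *m (A * (A - 1)) = (z * (z - 1)) *: w.
    rewrite mulmxA wA -scalemxAl mulmxBr wA mulmx1 -{2}[w]scale1r -scalerBl.
    by rewrite scalerA.
  have wANi i : w *m (A * (A - 1)) ^+ i = (z * (z - 1)) ^+ i *: w.
    elim: i => [|i IH]; first by rewrite !expr0 scale1r mulmx1.
    by rewrite exprSr mulmxA IH -scalemxAl wAN scalerA -exprSr.
  have := wANi N; rewrite AN0 mulmx0 => /esym/eqP.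
  rewrite scaler_eq0 (negbTE w0) orbF expf_eq0 mulf_eq0 subr_eq0.
  by case/andP=> _ /orP [] /eqP ->; [left|right].
have trE : \tr A = \sum_(z <- r) z.
  have := char_poly_trace A isT; rewrite rE.
  have -> : n.+1.-1 = (size r).-1 by rewrite szr.
  by rewrite coefPn_prod_XsubC ?szr // => /oppr_inj.
exists (count_mem 1 r).
  rewrite trE; elim: (r) r01 => [|z s IH] r01; first by rewrite big_nil.
  rewrite big_cons IH => [|y ys]; last by apply: r01; rewrite inE ys orbT.
  case: (r01 z (mem_head _ _)) => -> /=.
    by rewrite eq_sym oner_eq0 add0r add0n.
  by rewrite eqxx natrD.
move=> c0; have := Cayley_Hamilton A; rewrite rE.
have -> : \prod_(z <- r) ('X - z%:P) = ('X : {poly k}) ^+ n.+1.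
  rewrite -szr; elim: (r) r01 c0 => [|z s IH] r01; first by rewrite big_nil expr0.
  rewrite big_cons exprS /= => /eqP; rewrite addn_eq0 => /andP [z1 /eqP s0].
  rewrite IH // => [|y ys]; last by apply: r01; rewrite inE ys orbT.
  case: (r01 z (mem_head _ _)) z1 => ->; last by rewrite eqxx.
  by rewrite subr0.
by rewrite rmorphXn /= horner_mx_X.
Qed.

(** Row operations over [k] clear all but [\rank] many rows of [A] at [a]; each cleared row is
    divisible by 'X - a. *)
Lemma det_vanish_order (k : fieldType) (n : nat) (A : 'M[{poly k}]_n) (a : k) :
  ('X - a%:P) ^+ (n - \rank (map_mx (horner_eval a) A)) %| \det A.
Proof.
set A0 := map_mx _ A; set r := \rank A0.
pose C := invmx (col_ebase A0); pose B := map_mx polyC C *m A.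
have Cu : C \in unitmx by rewrite unitmx_inv col_ebase_unit.
have B0 (i : 'I_n) j : (r <= i)%N -> (B i j).[a] = 0.
  move=> ri; have -> : (B i j).[a] = (C *m A0) i j.
    rewrite !mxE horner_sum; apply: eq_bigr => l _.
    by rewrite hornerM !mxE /horner_eval hornerC.
  rewrite -(mulmx_ebase A0) /C !mulmxA mulVmx ?col_ebase_unit // mul1mx mxE.
  by rewrite big1 // => l _; rewrite mxE ltnNge ri andbF mul0r.
pose D : 'rV[{poly k}]_n := \row_i (if (i < r)%N then 1 else 'X - a%:P).
pose N : 'M[{poly k}]_n :=
  \matrix_(i, j) (if (i < r)%N then B i j else B i j %/ ('X - a%:P)).
have BE : B = diag_mx D *m N.
  apply/matrixP=> i j; rewrite mul_diag_mx !mxE.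
  case: ltnP => ir; first by rewrite mul1r.
  by have := B0 i j ir; rewrite mxE mulrC => Bij; rewrite divpK // dvdp_XsubCl; apply/rootP.
have dD : \det (diag_mx D) = ('X - a%:P) ^+ (n - r).
  rewrite det_diag (bigID (fun i : 'I_n => (i < r)%N)) /= big1 ?mul1r; last first.
    by move=> i ir; rewrite mxE ir.
  rewrite (eq_bigr (fun=> 'X - a%:P)) => [|i ir]; last by rewrite mxE (negbTE ir).
  rewrite prodr_const; congr (_ ^+ _).
  rewrite -sum1_card /= -(big_mkord (fun i => ~~ (i < r)%N) (fun=> 1%N)).
  have rn : (r <= n)%N by exact: rank_leq_row.
  rewrite (big_cat_nat _ rn) //= big_nat_cond big1 ?add0n; last first.
    by move=> i /andP [/andP[_ ->]].
  rewrite big_nat_cond (eq_bigl (fun i => (r <= i < n)%N)) => [|i].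
    by rewrite -big_nat sum_nat_const_nat muln1.
  by rewrite -leqNgt; lia.
have dB : \det B = (\det C)%:P * \det A by rewrite det_mulmx det_map_mx.
have dC : \det C != 0 by rewrite -unitfE -unitmxE.
have -> : \det A = (\det C)^-1%:P * \det B.
  by rewrite dB mulrA -polyCM mulVf // mul1r.
by rewrite BE det_mulmx dD dvdp_mull // dvdp_mulr.
Qed.

Section CurveField.
Variables (k : numClosedFieldType) (F : fieldType) (iota : {rmorphism k -> F}).
Variables (T : eqType) (v : T -> F -> int).

Definition vge (P : T) (m : int) (h : F) : bool := (h == 0) || (m <= v P h).

Record curve_field : Prop := CurveField {
  v_mul : forall P h g, h != 0 -> g != 0 -> v P (h * g) = v P h + v P g;
  v_add : forall P m h g, vge P m h -> vge P m g -> vge P m (h + g);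
  v_const : forall P c, c != 0 -> v P (iota c) = 0;
  v_res : forall P h, vge P 0 h -> exists c, vge P 1 (h - iota c);
  v_unif : forall P, exists2 t : F, t != 0 & v P t = 1;
  v_fin : forall h, h != 0 -> exists s : seq T, forall P, v P h != 0 -> P \in s;
  v_pole : forall h, (forall P, vge P 0 h) -> exists c, h = iota c;
  v_sep : forall P (s : seq T), P \notin s ->
    exists z : F, [/\ z != 0, v P z = 0 & forall Q, Q \in s -> vge Q 1 z] }.

Hypothesis H : curve_field.

Lemma vge0 P m : vge P m 0. Proof. by rewrite /vge eqxx. Qed.
Lemma vgeE P m h : h != 0 -> vge P m h = (m <= v P h).
Proof. by rewrite /vge => /negbTE ->. Qed.
Lemma vge_le P m l h : l <= m -> vge P m h -> vge P l h.
Proof. by rewrite /vge => lm /orP [->//|mh]; rewrite (le_trans lm mh) orbT. Qed.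
Lemma vgeM P m l h g : vge P m h -> vge P l g -> vge P (m + l) (h * g).
Proof.
have [->|h0] := eqVneq h 0; first by move=> *; rewrite mul0r vge0.
have [->|g0] := eqVneq g 0; first by move=> *; rewrite mulr0 vge0.
rewrite !vgeE ?mulf_neq0 // (v_mul H) // => a b; exact: lerD.
Qed.
Lemma vge_const P c : vge P 0 (iota c).
Proof.
have [->|c0] := eqVneq c 0; first by rewrite rmorph0 vge0.
by rewrite vgeE ?fmorph_eq0 // (v_const H).
Qed.
Lemma vge_constM P m c h : vge P m h -> vge P m (iota c * h).
Proof. by move=> mh; have := vgeM (vge_const P c) mh; rewrite add0r. Qed.
Lemma vgeN P m h : vge P m h -> vge P m (- h).
Proof. by move=> mh; rewrite -mulN1r -(rmorph1 iota) -rmorphN vge_constM. Qed.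
Lemma vgeB P m h g : vge P m h -> vge P m g -> vge P m (h - g).
Proof. by move=> mh mg; apply: (v_add H) => //; apply: vgeN. Qed.
Lemma vge_sum P m (I : Type) (r : seq I) (Q : pred I) (h : I -> F) :
  (forall i, Q i -> vge P m (h i)) -> vge P m (\sum_(i <- r | Q i) h i).
Proof.
move=> mh; elim/big_ind: _ => //; [exact: vge0|exact: (v_add H)].
Qed.
Lemma v1 P : v P 1 = 0.
Proof. by rewrite -(rmorph1 iota) (v_const H) ?oner_eq0. Qed.
Lemma vge1 P : vge P 0 1.
Proof. by rewrite vgeE ?oner_eq0 // v1. Qed.
Lemma vV P h : h != 0 -> v P h^-1 = - v P h.
Proof.
move=> h0; apply/eqP; rewrite -subr_eq0 opprK addrC -(v_mul H) ?invr_eq0 //.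
by rewrite divff // v1.
Qed.
Lemma vX P h n : h != 0 -> v P (h ^+ n) = n%:Z * v P h.
Proof.
move=> h0; elim: n => [|n IH]; first by rewrite expr0 v1 mul0r.
by rewrite exprS (v_mul H) ?expf_neq0 // IH -{1}[v P h]mul1r -mulrDl.
Qed.
Lemma vgeX P m h n : vge P m h -> vge P (n%:Z * m) (h ^+ n).
Proof.
move=> mh; elim: n => [|n IH]; first by rewrite expr0 mul0r vge1.
by rewrite exprS -add1n PoszD mulrDl mul1r vgeM.
Qed.
Lemma vgeMl P m h g : h != 0 -> vge P m (h * g) = vge P (m - v P h) g.
Proof.
move=> h0; have [->|g0] := eqVneq g 0; first by rewrite mulr0 !vge0.
by rewrite !vgeE ?mulf_neq0 // (v_mul H) // lerBlDl.
Qed.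
Lemma vge_eq P m h : h != 0 -> vge P m h -> ~~ vge P (m + 1) h -> v P h = m.
Proof. by move=> h0; rewrite !vgeE // => a b; lia. Qed.
Lemma v_addl P h g : h != 0 -> vge P (v P h + 1) g -> h + g != 0 /\ v P (h + g) = v P h.
Proof.
move=> h0 hg.
have n1 : ~~ vge P (v P h + 1) (h + g).
  apply/negP => /vgeB /(_ hg); rewrite addrK vgeE //; lia.
have hg0 : h + g != 0 by apply: contraNneq n1 => ->; rewrite vge0.
split=> //; apply: vge_eq => //; apply: (v_add H); first by rewrite vgeE.
by apply: vge_le hg; lia.
Qed.

(** The pivot [i0] is an element of exact order [m] at [P], if there is one; [v_res] gives the
    residues of the quotients by it. If all orders exceed [m], nothing has to be cancelled. *)
Lemma vge_cancel P m (n : nat) (h : 'I_n.+1 -> F) : (forall i, vge P m (h i)) ->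
  exists (i0 : 'I_n.+1) (al : 'I_n.+1 -> k),
    forall i, i != i0 -> vge P (m + 1) (h i - iota (al i) * h i0).
Proof.
move=> mh; have [|/forallPn [i0 ni0]] := boolP [forall i, vge P (m + 1) (h i)].
  move=> /forallP mh1; exists ord0, (fun=> 0) => i _.
  by rewrite rmorph0 mul0r subr0.
have h0 : h i0 != 0 by apply: contraNneq ni0 => ->; rewrite vge0.
have vh := vge_eq h0 (mh i0) ni0.
have q i : exists c, vge P 1 (h i / h i0 - iota c).
  by apply: (v_res H); rewrite mulrC vgeMl ?invr_eq0 // vV // vh opprK add0r.
have [al ale] := choice q; exists i0, al => i _.
have := vgeM (ale i) (mh i0); rewrite mulrBl divfK //; apply: vge_le; lia.
Qed.

(* Each point of [ps] imposes one linear condition. *)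
Lemma vge_conditions (ps : seq T) (l : T -> int) (n : nat) (h : 'I_n -> F) :
  (size ps < n)%N -> (forall i P, vge P (l P) (h i)) ->
  exists c : 'I_n -> k, (exists i, c i != 0) /\
    forall P, vge P (l P + (count_mem P ps)%:Z) (\sum_i iota (c i) * h i).
Proof.
elim: ps l n h => [|P ps IH] l [|n] //= h szn lh.
  exists (fun=> 1); split; first by exists ord0; apply: oner_neq0.
  by move=> P; rewrite addr0; apply: vge_sum => i _; apply: vge_constM.
have [i0 [al ale]] := vge_cancel (fun i => lh i P).
pose l' Q := if Q == P then l Q + 1 else l Q.
pose h' (i : 'I_n) := h (lift i0 i) - iota (al (lift i0 i)) * h i0.
have [//||c [[i ci] cP]] := IH l' n h'.
  move=> i Q; rewrite /l'; case: eqP => [->|_]; first by apply: ale; rewrite eq_sym neq_lift.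
  by apply: vgeB => //; apply: vge_constM.
(* The coefficient of the pivot is chosen so that the combination of the [h] equals that of the
   [h']. *)
pose c' j := if unlift i0 j is Some i then c i
  else - \sum_i c i * al (lift i0 i).
exists c'; split; first by exists (lift i0 i); rewrite /c' liftK.
move=> Q; have -> : \sum_i iota (c' i) * h i = \sum_i iota (c i) * h' i.
  rewrite (bigD1_ord i0) //= /c' unlift_none.
  rewrite (eq_bigr (fun i => iota (c i) * h (lift i0 i))) => [|j _]; last by rewrite liftK.
  rewrite rmorphN mulNr rmorph_sum /= mulr_suml -sumrN -big_split /=.
  by apply: eq_bigr => j _; rewrite /h' rmorphM /=; ring.
apply: vge_le (cP Q); rewrite /l' eq_sym; case: (Q == P) => /=; lia.
Qed.

(** An effective divisor as a list with repetitions, the form in which [vge_conditions] takes it. *)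
Lemma count_list (N : T -> nat) (s : seq T) : (forall P, N P != 0%N -> P \in s) ->
  exists ps, forall P, count_mem P ps = N P.
Proof.
move=> Ns; exists (flatten [seq nseq (N P) P | P <- undup s]) => P.
rewrite count_flatten -map_comp sumnE big_map.
rewrite (eq_bigr (fun Q => if Q == P then N Q else 0%N)) => [|Q _]; last first.
  by rewrite /= count_nseq /=; case: eqP; rewrite ?mul1n ?mul0n.
have [Ps|nPs] := boolP (P \in s).
  rewrite (bigD1_seq P) ?mem_undup ?undup_uniq //= eqxx big1 ?addn0 //.
  by move=> Q /negbTE ->.
have -> : N P = 0%N by apply/eqP; apply: contraNT nPs; apply: Ns.
rewrite big_seq big1 // => Q; rewrite mem_undup => Qs; case: eqP => // QP.
by rewrite -QP Qs in nPs.
Qed.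

Definition ev (x : F) (p : {poly k}) : F := (map_poly iota p).[x].
HB.instance Definition _ x := GRing.RMorphism.copy (ev x) (horner_eval x \o map_poly iota).

Lemma evC x c : ev x c%:P = iota c.
Proof. by rewrite /ev map_polyC hornerC. Qed.
Lemma evX x : ev x 'X = x.
Proof. by rewrite /ev map_polyX hornerX. Qed.
Lemma evXsubC x c : ev x ('X - c%:P) = x - iota c.
Proof. by rewrite rmorphB /= evX evC. Qed.
Lemma evE x p : ev x p = \sum_(i < size p) iota p`_i * x ^+ i.
Proof.
rewrite /ev horner_coef size_map_poly.
by apply: eq_bigr => i _; rewrite coef_map.
Qed.

Section Element.
Variable x : F.
Hypothesis xnc : forall c, x != iota c.

(** [k] is algebraically closed: a polynomial splits into linear factors, none of which vanishes at
    the nonconstant [x]. So [x] is transcendental. *)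
Lemma ev_eq0 p : (ev x p == 0) = (p == 0).
Proof.
apply/eqP/eqP => [p0|->]; last by rewrite rmorph0.
have [r rE] := closed_field_poly_normal p.
apply/eqP; rewrite -lead_coef_eq0; apply/negPn/negP => lp.
move/eqP: p0; rewrite rE -mul_polyC rmorphM /= evC mulf_eq0 fmorph_eq0 (negbTE lp) orFb.
rewrite rmorph_prod; elim: (r) => [|z s IH]; first by rewrite big_nil oner_eq0.
by rewrite big_cons mulf_eq0 => /orP [|//] /=; rewrite evXsubC subr_eq0 (negbTE (xnc z)).
Qed.

Lemma nonconst_neq0 : x != 0.
Proof. by have := xnc 0; rewrite rmorph0. Qed.

(** [- w P] is the order of the pole of [x] at [P], and [LL r] is the Riemann-Roch space of [r]
    times the pole divisor of [x]. *)
Definition w P : int := Order.min 0 (v P x).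
Definition LL (r : int) (h : F) : Prop := forall P, vge P (r * w P) h.

Lemma w_le0 P : w P <= 0. Proof. by rewrite /w ge_min lexx. Qed.
Lemma w_lev P : w P <= v P x. Proof. by rewrite /w ge_min lexx orbT. Qed.
Lemma LL_le r s h : r <= s -> LL r h -> LL s h.
Proof. by move=> rs Lh P; apply: vge_le (Lh P); have := w_le0 P; nia. Qed.
Lemma LL0 r : LL r 0. Proof. by move=> P; rewrite vge0. Qed.
Lemma LLB r h g : LL r h -> LL r g -> LL r (h - g).
Proof. by move=> Lh Lg P; apply: vgeB. Qed.
Lemma LLM r s h g : LL r h -> LL s g -> LL (r + s) (h * g).
Proof. by move=> Lh Lg P; rewrite mulrDl; apply: vgeM. Qed.
Lemma LLZ r c h : LL r h -> LL r (iota c * h).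
Proof. by move=> Lh P; apply: vge_constM. Qed.
Lemma LL_sum r (I : Type) (s : seq I) (Q : pred I) (h : I -> F) :
  (forall i, Q i -> LL r (h i)) -> LL r (\sum_(i <- s | Q i) h i).
Proof. by move=> Lh P; apply: vge_sum => i Qi; apply: Lh. Qed.
Lemma LLx n : LL n%:Z (x ^+ n).
Proof. by move=> P; rewrite vgeE ?expf_neq0 ?nonconst_neq0 // vX ?nonconst_neq0 //; have := w_lev P; nia. Qed.
Lemma LL1 : LL 0 1. Proof. by move=> P; rewrite mul0r vge1. Qed.
Lemma LLev (p : {poly k}) : LL (size p).-1%:Z (ev x p).
Proof.
rewrite evE; apply: LL_sum => i _; apply: LLZ; apply: LL_le (LLx i).
by have := ltn_ord i; lia.
Qed.

(** Having no poles, [h] is a constant; it vanishes at the poles of [x], and there is one because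
    [x] is not constant. *)
Lemma LLN1 h : LL (-1) h -> h = 0.
Proof.
move=> Lh; have [|c hc] := v_pole H (h := h).
  by move=> P; apply: vge_le (Lh P); have := w_le0 P; lia.
have [P vP] : exists P, v P x < 0.
  apply: contrapT => nP; have [|a xa] := v_pole H (h := x).
    move=> P; rewrite vgeE ?nonconst_neq0 //.
    by rewrite leNgt; apply/negP => vP; apply: nP; exists P.
  by have := xnc a; rewrite xa eqxx.
have [-> //|h0] := eqVneq h 0.
have c0 : c != 0 by apply: contraNneq h0 => c0; rewrite hc c0 rmorph0.
by have := Lh P; rewrite vgeE // hc (v_const H) // /w (min_idPr (ltW vP)); lia.
Qed.

Lemma LL_cancelX r m i h : (0 <= r) -> m = r + i%:Z -> LL r h -> LL (m - 1) (x ^+ i * h) ->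
  LL (r - 1) h.
Proof.
move=> r0 -> Lh Lxh P; have x0 := nonconst_neq0.
have := Lh P; have := Lxh P.
rewrite vgeMl ?expf_neq0 // vX // => a b.
case: (ltrP (v P x) 0) => vx.
  apply: vge_le a; rewrite /w (min_idPr (ltW vx)); nia.
by apply: vge_le b; rewrite /w (min_idPl vx) !mulr0.
Qed.

Lemma pole_list : exists ps, forall P, (count_mem P ps)%:Z = - w P.
Proof.
have [s sP] := v_fin H nonconst_neq0.
have [|ps psP] := @count_list (fun P => `|w P|%N) s.
  move=> P; rewrite /w => wP; apply: sP; apply: contraNneq wP => ->.
  by rewrite minxx.
by exists ps => P; rewrite psP; have := w_le0 P; lia.
Qed.

Definition indep (n : nat) (y : 'I_n -> F) : Prop :=
  forall p : 'I_n -> {poly k}, \sum_i ev x (p i) * y i = 0 -> forall i, p i = 0.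

Definition psystem (n : nat) (y : 'I_n -> F) (a : 'I_n -> nat) : Prop :=
  indep y /\ forall j, LL (a j)%:Z (y j).

(** If [n] exceeds the degree of the pole divisor of [x], there are more products [x ^+ l * y j]
    with l < r than conditions that push a combination of them into [LL (-1)], which is zero. *)
Lemma psystem_bound : exists D, forall n y a, @psystem n y a -> (n <= D)%N.
Proof.
have [ps psP] := pole_list.
exists (size ps) => n y a [yi ya]; rewrite leqNgt; apply/negP => psn.
pose r0 := (\max_(j < n) a j)%N; pose p := size ps.
(* With n > p this gives r * n >= r * p + r > (r0 + r + 1) * p, the number of conditions. *)
pose r := (r0.+1 * p).+1.
pose h (c : 'I_(#|{: 'I_r * 'I_n}|)) := x ^+ (enum_val c).1 * y (enum_val c).2.
pose qs := flatten (nseq (r0 + r).+1 ps).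
have qsP P : (count_mem P qs)%:Z = - ((r0 + r).+1%:Z * w P).
  rewrite -mulrN -psP /qs; elim: (_.+1) => [|m IH]; first by rewrite mul0r.
  by rewrite /= count_cat PoszD IH -add1n PoszD mulrDl mul1r.
have szqs : size qs = ((r0 + r).+1 * p)%N.
  rewrite /qs; elim: (_.+1) => [|m IH] //.
  by rewrite /= size_cat IH mulSn.
have [||c [[i ci] cP]] := @vge_conditions qs (fun P => (r0 + r)%:Z * w P) _ h.
- rewrite szqs card_prod !card_ord.
  have : (r * p.+1 <= r * n)%N by rewrite leq_mul2l psn orbT.
  rewrite /r /p; nia.
- move=> j P; rewrite /h; have := LLM (LLx (enum_val j).1) (ya (enum_val j).2).
  move=> /(_ P); apply: vge_le.
  have := w_le0 P; have := ltn_ord (enum_val j).1.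
  have := leq_bigmax (F := a) (enum_val j).2; rewrite -/r0; nia.
have s0 : \sum_i iota (c i) * h i = 0.
  apply: LLN1 => P; apply: vge_le (cP P); rewrite qsP; lia.
pose q (j : 'I_n) := \poly_(l < r) (if insub l is Some l' then c (enum_rank (l', j)) else 0).
have q0 : forall j, q j = 0.
  apply: yi; rewrite -[RHS]s0 (reindex (fun u => enum_rank u)) /=; last first.
    by apply: onW_bij; apply: enum_rank_bij.
  rewrite (eq_bigr (fun j => \sum_(l < r) iota (c (enum_rank (l, j))) * (x ^+ l * y j))); last first.
    move=> j _; rewrite /q (poly_def) rmorph_sum mulr_suml; apply: eq_bigr => l _.
    by rewrite -mul_polyC rmorphM rmorphXn /= evC evX valK mulrA.
  rewrite exchange_big pair_big /=; apply: eq_bigr => -[l j] _.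
  by rewrite /h enum_rankK.
case: (negP ci); apply/eqP.
have := congr1 (fun f : {poly k} => f`_(enum_val i).1) (q0 (enum_val i).2).
by rewrite /= /q coef_poly ltn_ord coef0 valK -surjective_pairing enum_valK.
Qed.

Lemma psystem1 : psystem (fun _ : 'I_1 => 1) (fun=> 0%N).
Proof.
split=> [p|j]; last exact: LL1.
by rewrite big_ord1 mulr1 => /eqP; rewrite ev_eq0 => /eqP p0 i; rewrite ord1.
Qed.

(* [y] is a reduced basis in the sense of Dedekind and Weber: it exhibits the
   sheaf of regular functions, pushed forward along [x], as the sum of the line
   bundles [O(- a j)]. *)
Record reduced_basis (n : nat) (y : 'I_n -> F) (a : 'I_n -> nat) : Prop := ReducedBasis {
  rb_indep : indep y;
  rb_LL : forall j, LL (a j)%:Z (y j);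
  rb_span : forall (r : nat) h, LL r%:Z h -> exists2 p : 'I_n -> {poly k},
    h = \sum_i ev x (p i) * y i & forall i, p i != 0 -> (size (p i) + a i <= r.+1)%N }.

(** The exchange step of linear algebra over the field k(x), with denominators cleared. *)
Lemma indep_replace n (y : 'I_n -> F) (s : {poly k}) (p : 'I_n -> {poly k}) j0 z :
  indep y -> s != 0 -> p j0 != 0 -> ev x s * z = \sum_i ev x (p i) * y i ->
  indep (fun j => if j == j0 then z else y j).
Proof.
move=> yi s0 pj sz q qz.
have := yi (fun j => if j == j0 then q j0 * p j0 else s * q j + q j0 * p j) _.
have -> : \sum_i ev x (if i == j0 then q j0 * p j0 else s * q i + q j0 * p i) * y i = 0.
  have := congr1 (fun t => ev x s * t) qz; rewrite mulr0 => E0; rewrite -[RHS]E0.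
  rewrite (bigD1 j0) //= eqxx [in RHS](bigD1 j0) //= eqxx mulrDr.
  rewrite [ev x s * (_ * z)]mulrCA sz (bigD1 j0 (F := fun i => ev x (p i) * y i)) //= mulrDr.
  rewrite rmorphM /= mulrA -addrA; congr (_ + _).
  rewrite !mulr_sumr -big_split /=; apply: eq_bigr => i ij.
  by rewrite (negbTE ij) rmorphD !rmorphM /=; ring.
move=> /(_ erefl) E.
have qj0 : q j0 = 0.
  by have := E j0; rewrite eqxx => /eqP; rewrite mulf_eq0 (negbTE pj) orbF => /eqP.
move=> j; have := E j; case: eqP => [->//|_].
by rewrite qj0 mul0r addr0 => /eqP; rewrite mulf_eq0 (negbTE s0) => /eqP.
Qed.

(** A system of maximal length and, among these, of least [\sum_j a j] is a reduced basis: any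
    failure of [rb_span] yields an element [z] that can replace some [y j0] with a smaller pole
    bound. *)
Lemma reduced_basis_exists :
  exists n (y : 'I_n.+1 -> F) (a : 'I_n.+1 -> nat), reduced_basis y a.
Proof.
have [D DP] := psystem_bound.
pose Q n := `[< exists (y : 'I_n.+1 -> F) a, psystem y a >].
have exQ : exists n, Q n by exists 0%N; apply/asboolP; do 2!eexists; exact: psystem1.
have leQ n : Q n -> (n <= D)%N by move=> /asboolP [y [a /DP]]; apply: leq_trans.
case: (ex_maxnP exQ leQ) => n /asboolP Qn nmax.
pose S m := `[< exists (y : 'I_n.+1 -> F) a, psystem y a /\ (\sum_j a j)%N = m >].
have exS : exists m, S m.
  by case: Qn => y [a ya]; exists (\sum_j a j)%N; apply/asboolP; exists y, a.
case: (ex_minnP exS) => m /asboolP [y [a [[yi ya] am]]] mmin {exS exQ}.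
exists n, y, a.
(* Minimality: no element of [LL (a j0 - 1)] may take the place of [y j0]. If [a j0] is 0, such an
   element is 0 by [LLN1] and does not fit into an independent system. *)
have best (s : {poly k}) (p : 'I_n.+1 -> {poly k}) j0 z : s != 0 -> p j0 != 0 ->
    ev x s * z = \sum_i ev x (p i) * y i -> LL ((a j0)%:Z - 1) z -> False.
  move=> s0 pj sz Lz; have zi := indep_replace yi s0 pj sz.
  have aj : (0 < a j0)%N.
    rewrite lt0n; apply/negP => /eqP aj; rewrite aj in Lz.
    have := zi (fun j => (j == j0)%:R); rewrite (bigD1 j0) //= eqxx rmorph1 mul1r.
    rewrite (LLN1 Lz) add0r big1 => [/(_ erefl j0)/eqP|i /negbTE ij].
      by rewrite eqxx oner_eq0.
    by rewrite ij rmorph0 mul0r.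
  pose a' j := if j == j0 then (a j0).-1 else a j.
  have : S (\sum_j a' j)%N.
    apply/asboolP; eexists; exists a'; split => //; split; first exact: zi.
    move=> j; rewrite /a'; case: eqP => // _; apply: LL_le Lz; lia.
  move=> /mmin; rewrite -am (bigD1 j0) //= [in X in (_ <= X)%N](bigD1 j0) //=.
  rewrite /a' eqxx [in X in (_ <= X)%N](eq_bigr a) => [|i /negbTE ->] //.
  by rewrite leq_add2r; lia.
split=> // r h Lh.
(* By maximality of the length [h] has a denominator [q]; one of least degree turns out to be
   constant. *)
pose E l := `[< exists (q : {poly k}) (p : 'I_n.+1 -> {poly k}), [/\ q != 0, size q = l & ev x q * h = \sum_i ev x (p i) * y i] >].
have exE : exists l, E l.
  have : ~ psystem (fun j : 'I_n.+2 => oapp y h (unlift ord_max j))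
                   (fun j => oapp a r (unlift ord_max j)).
    by move=> Sy; have := nmax n.+1; rewrite ltnn => Qn1; have // : false; apply: Qn1; apply/asboolP; do 2!eexists; exact: Sy.
  move=> nS; have : ~ indep (fun j : 'I_n.+2 => oapp y h (unlift ord_max j)).
    move=> i; apply: nS; split=> // j.
    by case: unliftP => [j' _|_] /=; [exact: ya|exact: Lh].
  move=> /existsNP [p] /not_implyP []; rewrite (bigD1_ord ord_max) //= unlift_none /=.
  move=> p0 pn0.
  exists (size (p ord_max)); apply/asboolP; exists (p ord_max), (fun i => - p (lift ord_max i)).
  have E1 : ev x (p ord_max) * h = \sum_i ev x (- p (lift ord_max i)) * y i.
    apply/eqP; rewrite -subr_eq0 -sumrN -[X in _ == X]p0; apply/eqP; congr (_ + _).
    by apply: eq_bigr => i _; rewrite liftK /= rmorphN mulNr opprK.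
  split=> //; apply/eqP => pm0; apply: pn0 => i.
  case: (unliftP ord_max i) => [j ->|->] //.
  have := yi (fun j => - p (lift ord_max j)); rewrite -E1 pm0 rmorph0 mul0r.
  by move=> /(_ erefl j) /eqP; rewrite oppr_eq0 => /eqP.
case: (ex_minnP exE) => l /asboolP [q [p [q0 ql qh]]] lmin {exE}.
have size1 : size q = 1%N.
  apply/eqP; rewrite eqn_leq lt0n size_poly_eq0 q0 andbT leqNgt; apply/negP => sq.
  have [al ral] : exists al, root q al.
    by have /closed_rootP := negbT (gtn_eqF sq).
  have [q' qE] : exists q' : {poly k}, q = q' * ('X - al%:P) by apply/factor_theorem.
  have q'0 : q' != 0 by apply: contraNneq q0 => q'0; rewrite qE q'0 mul0r.
  pose p' i := (p i - (p i).[al]%:P) %/ ('X - al%:P).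
  have pE i : p i = (p i).[al]%:P + p' i * ('X - al%:P).
    have dv : 'X - al%:P %| p i - (p i).[al]%:P.
      by rewrite dvdp_XsubCl /root !hornerE subrr.
    by rewrite /p' (divpK dv) addrC subrK.
  (* At a root [al] of [q], division with remainder leaves an element [z] whose product with 'X - al
     is a constant combination of the [y i]. At the poles of [x] this factor lowers the bound by
     one; [j0] below has the largest [a] among the nonzero coefficients. *)
  pose z := ev x q' * h - \sum_i ev x (p' i) * y i.
  have zE : ev x ('X - al%:P) * z = \sum_i ev x (p i).[al]%:P * y i.
    rewrite /z mulrBr mulrA -rmorphM [_ * q']mulrC -qE qh mulr_sumr -sumrB.
    apply: eq_bigr => i _; rewrite {1}[p i]pE rmorphD !rmorphM /=; ring.
  have Oz P : 0 <= v P x -> vge P 0 z.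
    move=> vx; have L0 s u : LL s u -> vge P 0 u.
      by move=> /(_ P); rewrite /w (min_idPl vx) mulr0.
    apply: vgeB; first exact: L0 _ _ (LLM (LLev q') Lh).
    by apply: vge_sum => i _; exact: L0 _ _ (LLM (LLev (p' i)) (ya i)).
  have [/existsP [i0 pi0]|/existsPn /= np] := boolP [exists i, (p i).[al] != 0].
    case: (arg_maxnP (P := fun i => (p i).[al] != 0) a pi0) => j0 pj0 jmax.
    apply: (best ('X - al%:P) (fun i => (p i).[al]%:P) j0 z) => //.
    - by rewrite polyXsubC_eq0.
    - by rewrite polyC_eq0.
    move=> P; case: (lerP 0 (v P x)) => vx.
      by rewrite /w (min_idPl vx) mulr0; apply: Oz.
    have vxa : v P (ev x ('X - al%:P)) = v P x.
      rewrite evXsubC; have [|_ //] := v_addl (P := P) (h := x) (g := - iota al) nonconst_neq0.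
      by apply: vgeN; apply: vge_le (vge_const P al); lia.
    have : vge P ((a j0)%:Z * w P) (ev x ('X - al%:P) * z).
      rewrite zE; apply: vge_sum => i _; rewrite evC.
      have [pi|] := boolP ((p i).[al] == 0); first by rewrite (eqP pi) rmorph0 mul0r vge0.
      move=> /jmax ij; apply: vge_constM; apply: vge_le (ya i P).
      have := w_le0 P; move: ij; rewrite /geq /=; nia.
    rewrite vgeMl ?ev_eq0 ?polyXsubC_eq0 // vxa /w (min_idPr (ltW vx)).
    by apply: vge_le; lia.
  have : E (size q').
    apply/asboolP; exists q', p'; split=> //.
    have X0 : ev x ('X - al%:P) != 0 by rewrite ev_eq0 polyXsubC_eq0.
    apply: (mulfI X0); apply/eqP; rewrite -subr_eq0 -mulrBr -/z zE.
    by rewrite big1 // => i _; move/negPn/eqP: (np i) => ->; rewrite rmorph0 mul0r.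
  by move=> /lmin; rewrite -ql qE size_mul ?polyXsubC_eq0 // size_XsubC addn2 /= ltnn.
have [c qc] : exists c, q = c%:P by move/eqP/size_poly1P: size1 => -[c _ ->]; exists c.
have c0 : c != 0 by rewrite qc polyC_eq0 in q0.
pose p1 i : {poly k} := c^-1 *: p i.
have hE : h = \sum_i ev x (p1 i) * y i.
  apply: (mulfI (x := ev x q)); first by rewrite ev_eq0.
  rewrite qh mulr_sumr; apply: eq_bigr => i _; rewrite mulrA; congr (_ * _).
  by rewrite -rmorphM qc /p1 mul_polyC scalerA divff // scale1r.
clearbody p1; exists p1 => // i0 pi0; rewrite leqNgt; apply/negP => ri0.
(* [dg i] bounds the i-th term over oo. If the largest one, [M], exceeds [r], the leading terms must
   cancel over oo, and their combination [z] again contradicts minimality. *)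
pose dg i := ((size (p1 i)).-1 + a i)%N.
case: (arg_maxnP (P := fun i => p1 i != 0) dg pi0) => i1 pi1 imax.
have [M ME] : exists M, M = dg i1 by exists (dg i1).
rewrite -ME in imax.
have dgE i : dg i = ((size (p1 i)).-1 + a i)%N by [].
clearbody dg; have rM : (r < M)%N.
  have : (dg i0 <= M)%N by exact: imax.
  by rewrite dgE; move: ri0; rewrite -size_poly_gt0 in pi0; lia.
pose S1 i := (p1 i != 0) && (dg i == M).
have S1i1 : S1 i1 by rewrite /S1 pi1 ME eqxx.
(* The choice of the largest [a] makes all exponents [a j0 - a i] in [top] true differences. *)
case: (arg_maxnP a S1i1) => j0 Sj0 jmax.
pose top i : {poly k} := if S1 i then lead_coef (p1 i) *: 'X^(a j0 - a i) else 0.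
pose z := \sum_i ev x (top i) * y i.
have Lz : LL (a j0)%:Z z.
  apply: LL_sum => i _; rewrite /top; case: ifP => [Si|_]; last by rewrite rmorph0 mul0r; exact: LL0.
  rewrite -mul_polyC rmorphM rmorphXn /= evC evX -mulrA; apply: LLZ.
  by apply: LL_le (LLM (LLx _) (ya i)); have := jmax _ Si; rewrite /geq /=; lia.
have a_le i : S1 i -> (a i <= M)%N by case/andP=> _ /eqP <-; rewrite dgE leq_addl.
apply: (best 1 top j0 z) => //; first exact: oner_neq0.
- rewrite /top Sj0 scaler_eq0 negb_or lead_coef_eq0; case/andP: (Sj0) => -> _ /=.
  by rewrite -size_poly_eq0 size_polyXn.
- by rewrite rmorph1 mul1r.
apply: (LL_cancelX (m := M%:Z) (i := (M - a j0)%N)) Lz _ => //.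
  by have := a_le _ Sj0; lia.
have -> : x ^+ (M - a j0) * z = h - \sum_i ev x (if S1 i then p1 i - lead_coef (p1 i) *: 'X^((size (p1 i)).-1) else p1 i) * y i.
  rewrite hE -sumrB /z mulr_sumr; apply: eq_bigr => i _; rewrite /top -mulrBl -rmorphB mulrA.
  rewrite -{1}(evX x) -rmorphXn -rmorphM; congr (ev x _ * _).
  case: ifP => Si; last by rewrite mulr0 subrr.
  rewrite opprB addrCA subrr addr0 -scalerAr -exprD; congr (_ *: 'X^_).
  have := a_le _ Si; have := jmax _ Si; have := a_le _ Sj0; rewrite /geq /=.
  by case/andP: Si => _ /eqP; rewrite dgE; move: (size (p1 i)) (a i) (a j0) => *; lia.
apply: LLB; first by apply: LL_le Lh; lia.
apply: LL_sum => i _; case: ifP => Si.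
  set f : {poly k} := (p1 i - _); have [->|f0] := eqVneq f 0; first by rewrite rmorph0 mul0r; exact: LL0.
  have sf : (size f < size (p1 i))%N.
    have p0 : p1 i != 0 by case/andP: Si.
    rewrite -(prednK (n := size (p1 i))) ?size_poly_gt0 // ltnS.
    apply/leq_sizeP => j; rewrite leq_eqVlt => /predU1P [<-|jl].
      by rewrite /f coefB coefZ (coefXn k) eqxx mulr1 lead_coefE subrr.
    rewrite /f coefB coefZ (coefXn k) gtn_eqF // mulr0 subr0 nth_default //.
    by rewrite -size_poly_gt0 in p0; move: jl p0; move: (size (p1 i)) => [|s].
  apply: LL_le (LLM (LLev f) (ya i)).
  have : dg i = M by case/andP: Si => _ /eqP.
  by rewrite -size_poly_gt0 in f0; rewrite dgE; lia.
have [->|p0] := eqVneq (p1 i) 0; first by rewrite rmorph0 mul0r; exact: LL0.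
apply: LL_le (LLM (LLev (p1 i)) (ya i)).
move: Si; rewrite /S1 p0 /= => /negbT; have := imax _ p0; rewrite /geq /=.
by rewrite dgE; move: (size (p1 i)) (a i) => *; lia.
Qed.

End Element.
End CurveField.

(** All multiples of [A] are nilpotent, so by [trace_idem_nil] every [c * \tr A] is a natural
    number; taking c = 1/(m + 1) for m = [\tr A] leaves only m = 0. *)
Lemma trace_nil (k : numClosedFieldType) (n N : nat) (A : 'M[k]_n.+1) :
  A ^+ N = 0 -> \tr A = 0.
Proof.
move=> AN; have nil (c : k) : exists m : nat, c * \tr A = m%:R.
  have [|m trm _] := @trace_idem_nil k n N (c *: A).
    rewrite exprMn_comm ?exprZn ?AN ?scaler0 ?mul0r //.
    by apply: commrB => //; apply: commr1.
  by exists m; rewrite -trm mxtraceZ.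
have [m] := nil 1; rewrite mul1r => trm; have [l] := nil (m.+1%:R)^-1.
rewrite trm => /(congr1 (fun z => m.+1%:R * z)).
rewrite mulrA divff ?pnatr_eq0 // mul1r -natrM => /eqP; rewrite eqr_nat.
by case: l => [|l]; [rewrite muln0 => /eqP -> | move=> /eqP; nia].
Qed.

Section Reduced.
Variables (k : numClosedFieldType) (F : fieldType) (iota : {rmorphism k -> F}).
Variables (T : eqType) (v : T -> F -> int).
Hypothesis H : curve_field iota v.

Section Inverse.
Variable x : F.
Hypothesis xnc : forall c, x != iota c.

Lemma inv_nonconst c : x^-1 != iota c.
Proof. by apply: contraNneq (xnc c^-1) => E; rewrite -[x]invrK E fmorphV. Qed.

Lemma w_inv P : w v x P - w v x^-1 P = v P x.
Proof. by rewrite /w (vV H) ?(nonconst_neq0 xnc) //; lia. Qed.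

Lemma LL_inv (r : nat) h : LL v x^-1 r h <-> LL v x r (x ^+ r * h).
Proof.
have x0 := nonconst_neq0 xnc.
by split=> L P; have := L P; rewrite (vgeMl H) ?expf_neq0 // (vX H) //;
  apply: vge_le; have := w_inv P; nia.
Qed.

(** X^N p(1/X) for [p] of degree at most [N]: the passage between the two charts of the projective
    line. *)
Definition revp (N : nat) (p : {poly k}) := \poly_(i < N.+1) p`_(N - i).

Lemma revp_eq0 N (p : {poly k}) : (size p <= N.+1)%N -> revp N p = 0 -> p = 0.
Proof.
move=> sp rp; apply/polyP => i; rewrite coef0; case: (leqP i N) => iN; last first.
  by rewrite nth_default // (leq_trans sp).
have := congr1 (fun q : {poly k} => q`_(N - i)) rp.
by rewrite coef_poly coef0 ltnS leq_subr subKn.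
Qed.

Lemma ev_wide m (z : F) (p : {poly k}) : (size p <= m)%N ->
  ev iota z p = \sum_(i < m) iota p`_i * z ^+ i.
Proof.
move=> pm; rewrite /ev (horner_coef_wide (n := m)) ?size_map_poly //.
by apply: eq_bigr => i _; rewrite coef_map.
Qed.

Lemma ev_revp N (p : {poly k}) : (size p <= N.+1)%N -> x ^+ N * ev iota x^-1 p = ev iota x (revp N p).
Proof.
move=> sp; rewrite (ev_wide x^-1 sp) (ev_wide x (size_poly _ _)) mulr_sumr.
rewrite [RHS](reindex_inj rev_ord_inj); apply: eq_bigr => i _ /=.
have iN : (i <= N)%N by rewrite -ltnS.
rewrite coef_poly subSS ltnS leq_subr subKn //.
by rewrite mulrCA exprVn -expfB_cond // (negbTE (nonconst_neq0 xnc)).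
Qed.

Lemma ev_revpV N (p : {poly k}) : (size p <= N.+1)%N -> ev iota x p = x ^+ N * ev iota x^-1 (revp N p).
Proof.
move=> sp; rewrite (ev_wide x sp) (ev_wide x^-1 (size_poly _ _)) mulr_sumr.
rewrite [RHS](reindex_inj rev_ord_inj); apply: eq_bigr => i _ /=.
have iN : (i <= N)%N by rewrite -ltnS.
rewrite coef_poly subSS ltnS leq_subr subKn // mulrCA exprVn -expfB_cond ?subKn //.
by rewrite (negbTE (nonconst_neq0 xnc)) leq_subr.
Qed.

(** The other chart of the line: near oo the summand O(- a j) is generated by [x ^- a j * y j]. *)
Lemma reduced_basis_inv n (y : 'I_n -> F) a :
  reduced_basis iota v x y a -> reduced_basis iota v x^-1 (fun j => x ^- a j * y j) a.
Proof.
have x0 := nonconst_neq0 xnc.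
case=> yi ya ysp; split.
- move=> p p0; pose M := (\sum_j (a j + size (p j)))%N.
  have aM j : (a j + size (p j) <= M)%N by rewrite /M (bigD1 j) //= leq_addr.
  have := yi (fun j => revp (M - a j) (p j)).
  have -> : \sum_i ev iota x (revp (M - a i) (p i)) * y i = 0.
    rewrite -[RHS](mulr0 (x ^+ M)) -[X in _ = x ^+ M * X]p0 mulr_sumr; apply: eq_bigr => i _.
    have := aM i => aMi.
    rewrite -ev_revp; last by lia.
    by rewrite expfB_cond ?x0 //=; [ring|lia].
  by move=> /(_ erefl) r0 i; apply: (revp_eq0 _ (r0 i)); have := aM i; lia.
- move=> j; apply/LL_inv; rewrite mulrA divff ?mul1r ?expf_neq0 //; exact: ya.
- move=> r h /LL_inv /ysp [p hE pr].
  have pr0 i : p i = 0 \/ (size (p i) <= (r - a i).+1)%N /\ (a i <= r)%N.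
    have [->|pi0] := eqVneq (p i) 0; first by left.
    by right; have := pr i pi0; rewrite -size_poly_gt0 in pi0; lia.
  exists (fun i => if p i == 0 then 0 else revp (r - a i) (p i)).
    apply: (mulfI (expf_neq0 r x0)); rewrite hE mulr_sumr; apply: eq_bigr => i _.
    case: (pr0 i) => [->|[sp ar]]; first by rewrite eqxx !rmorph0 !mul0r mulr0.
    case: eqP => [->|_]; first by rewrite !rmorph0 !mul0r mulr0.
    by rewrite (ev_revpV sp) expfB_cond ?(negbTE x0) //=; ring.
  move=> i; case: (pr0 i) => [->|[sp ar]]; first by rewrite eqxx eqxx.
  case: (p i == 0); first by rewrite eqxx.
  move=> _; have := size_poly (r - a i).+1 (fun j => (p i)`_(r - a i - j)).
  by rewrite -/(revp _ _); lia.
Qed.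

End Inverse.

(** * The trace form, its discriminant and the different *)

Section Trace.
Variables (x : F) (n : nat) (y : 'I_n.+1 -> F) (a : 'I_n.+1 -> nat).
Hypothesis xnc : forall c, x != iota c.
Hypothesis rb : reduced_basis iota v x y a.
Local Notation ev := (ev iota x).

(** The coordinate ring of the part of the curve over the affine line; by [OOP], the functions whose
    poles all lie over oo. *)
Definition OO (h : F) : Prop := exists r : nat, LL v x r h.

Lemma OOP h : OO h <-> forall P, 0 <= v P x -> vge v P 0 h.
Proof.
split=> [[r Lh] P vx|Oh]; first by have := Lh P; rewrite /w (min_idPl vx) mulr0.
have [->|h0] := eqVneq h 0; first by exists 0%N; exact: LL0.
have [s sP] := v_fin H h0; exists (\sum_(P <- s) `|v P h|)%N => P.
case: (lerP 0 (v P x)) => vx; first by rewrite /w (min_idPl vx) mulr0; apply: Oh.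
have [vh|vh] := eqVneq (v P h) 0.
  by apply: (@vge_le _ _ _ _ 0); [have := w_le0 v x P; nia|rewrite vgeE // vh].
rewrite vgeE // (big_rem P) ?sP //= /w (min_idPr (ltW vx)).
by set S := (\sum_(_ <- _) _)%N; nia.
Qed.

Lemma OOD h g : OO h -> OO g -> OO (h + g).
Proof. by rewrite !OOP => Oh Og P vx; apply: (v_add H); [exact: Oh|exact: Og]. Qed.
Lemma OOM h g : OO h -> OO g -> OO (h * g).
Proof.
rewrite !OOP => Oh Og P vx; rewrite -[0]addr0; apply: (vgeM H); [exact: Oh|exact: Og].
Qed.
Lemma OOev p : OO (ev p). Proof. by eexists; exact: LLev. Qed.
Lemma OO1 : OO 1. Proof. by rewrite -(rmorph1 ev); exact: OOev. Qed.
Lemma OOconst c : OO (iota c). Proof. by rewrite -(evC iota x); exact: OOev. Qed.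
Lemma OOy i : OO (y i). Proof. by exists (a i); exact: (rb_LL rb). Qed.
Lemma OO_sum (I : Type) (s : seq I) (Q : pred I) (h : I -> F) :
  (forall i, Q i -> OO (h i)) -> OO (\sum_(i <- s | Q i) h i).
Proof.
move=> Oh; elim/big_ind: _ => //; last exact: OOD.
by exists 0%N; exact: LL0.
Qed.
Lemma OOX h m : OO h -> OO (h ^+ m).
Proof.
by move=> Oh; elim: m => [|m IH]; rewrite ?expr0 ?exprS; [exact: OO1|exact: OOM].
Qed.

Definition cf (h : F) : 'I_n.+1 -> {poly k} :=
  xget (fun=> 0) [set p : 'I_n.+1 -> {poly k} | h = \sum_i ev (p i) * y i]%classic.

Lemma cfP h : OO h -> h = \sum_i ev (cf h i) * y i.
Proof.
case=> r /(rb_span rb) [p hE _].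
by apply: (@xgetPex _ (fun=> 0) [set p : 'I_n.+1 -> {poly k} | h = \sum_i ev (p i) * y i]%classic); exists p.
Qed.

Lemma comb_inj (p q : 'I_n.+1 -> {poly k}) :
  \sum_i ev (p i) * y i = \sum_i ev (q i) * y i -> forall i, p i = q i.
Proof.
move=> E i; apply/eqP; rewrite -subr_eq0; apply/eqP; move: i.
apply: (rb_indep rb); move/eqP: E; rewrite -subr_eq0 => /eqP E; rewrite -[RHS]E -sumrB.
by apply: eq_bigr => i _; rewrite rmorphB mulrBl.
Qed.

Definition mulmat (h : F) : 'M[{poly k}]_n.+1 := \matrix_(i, j) cf (h * y i) j.

Lemma mulmatP h i : OO h -> h * y i = \sum_j ev (mulmat h i j) * y j.
Proof.
move=> Oh; rewrite {1}(cfP (OOM Oh (OOy i))).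
by apply: eq_bigr => j _; rewrite mxE.
Qed.

Lemma mulmat_uniq h (A : 'M[{poly k}]_n.+1) : OO h -> (forall i, h * y i = \sum_j ev (A i j) * y j) -> mulmat h = A.
Proof.
move=> Oh E; apply/matrixP => i j; move: j; apply: comb_inj.
by rewrite -E -mulmatP.
Qed.

Lemma mulmatM h g : OO h -> OO g -> mulmat (h * g) = mulmat g * mulmat h.
Proof.
move=> Oh Og; apply: mulmat_uniq => [|i]; first exact: OOM.
rewrite -mulrA (mulmatP i Og) mulr_sumr.
under eq_bigr => j _ do rewrite mulrCA (mulmatP j Oh) mulr_sumr.
rewrite exchange_big; apply: eq_bigr => l _ /=; rewrite mxE rmorph_sum mulr_suml.
by apply: eq_bigr => j _; rewrite rmorphM mulrA.
Qed.

Lemma mulmatD h g : OO h -> OO g -> mulmat (h + g) = mulmat h + mulmat g.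
Proof.
move=> Oh Og; apply: mulmat_uniq => [|i]; first exact: OOD.
rewrite mulrDl !mulmatP // -big_split; apply: eq_bigr => j _ /=.
have -> : (mulmat h + mulmat g) i j = mulmat h i j + mulmat g i j by rewrite [LHS]mxE.
by rewrite rmorphD mulrDl.
Qed.

Lemma mulmat_ev p : mulmat (ev p) = p%:M.
Proof.
apply: mulmat_uniq => [|i]; first exact: OOev.
rewrite (bigD1 i) //= mxE eqxx mulr1n big1 ?addr0 // => j /negbTE ji.
by rewrite mxE eq_sym ji rmorph0 mul0r.
Qed.

Lemma mulmatX h m : OO h -> mulmat (h ^+ m) = mulmat h ^+ m.
Proof.
move=> Oh; elim: m => [|m IH]; first by rewrite !expr0 -(rmorph1 ev) mulmat_ev.
by rewrite exprS mulmatM ?IH -?exprSr //; apply: OOX.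
Qed.

Definition tr (h : F) : {poly k} := \tr (mulmat h).

Lemma trD h g : OO h -> OO g -> tr (h + g) = tr h + tr g.
Proof. by move=> Oh Og; rewrite /tr mulmatD // raddfD. Qed.

Lemma tr_evM p h : OO h -> tr (ev p * h) = p * tr h.
Proof.
move=> Oh; rewrite /tr mulmatM ?mulmat_ev //; last exact: OOev.
by rewrite -[_ * _]/(_ *m _) scalar_mxC mul_scalar_mx mxtraceZ.
Qed.

Lemma tr_sum (I : Type) (s : seq I) (h : I -> F) : (forall i, OO (h i)) ->
  tr (\sum_(i <- s) h i) = \sum_(i <- s) tr (h i).
Proof.
move=> Oh; elim: s => [|i s IH]; last by rewrite !big_cons trD ?IH //; apply: OO_sum.
by rewrite !big_nil /tr -(rmorph0 ev) mulmat_ev mxtrace_scalar mul0rn.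
Qed.

Definition over (b : k) (P : T) : bool := 0 < v P (x - iota b).

Lemma x_sub_neq0 b : x - iota b != 0. Proof. by rewrite subr_eq0. Qed.

Lemma over_ge0 b P : over b P -> 0 <= v P x.
Proof.
move=> ob; rewrite -(vgeE v P 0 (nonconst_neq0 xnc)) -(subrK (iota b) x).
apply: (v_add H); last exact: (vge_const H).
by rewrite vgeE ?x_sub_neq0 //; exact: ltW.
Qed.

Lemma OO_div b h : OO h -> (forall P, over b P -> vge v P (v P (x - iota b)) h) ->
  exists2 g, OO g & h = (x - iota b) * g.
Proof.
rewrite OOP => Oh oh; exists (h / (x - iota b)); last by rewrite mulrC divfK // x_sub_neq0.
apply/OOP => P vx; rewrite mulrC (vgeMl H) ?invr_eq0 ?x_sub_neq0 // (vV H) ?x_sub_neq0 // add0r opprK.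
have [oP|] := boolP (over b P); first exact: oh.
rewrite /over -leNgt => ob; apply: vge_le ob _; exact: Oh.
Qed.

(** Multiplication by [h] on the fibre over [b], the quotient of the ring by x - b. *)
Definition matat (b : k) (h : F) : 'M[k]_n.+1 := map_mx (horner_eval b) (mulmat h).

Lemma matat_eq0 b h : OO h -> (matat b h == 0) <-> exists2 g, OO g & h = (x - iota b) * g.
Proof.
move=> Oh; split=> [/eqP m0|[g Og ->]]; last first.
  rewrite -evXsubC /matat mulmatM ?mulmat_ev //; last exact: OOev.
  rewrite map_mxM map_scalar_mx /= /horner_eval !hornerE subrr.
  by rewrite mul_mx_scalar scale0r.
have [d dE] : exists d : 'M[{poly k}]_n.+1, forall i j, mulmat h i j = ('X - b%:P) * d i j.
  exists (\matrix_(i, j) (mulmat h i j %/ ('X - b%:P))) => i j.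
  rewrite [X in _ * X]mxE mulrC divpK // dvdp_XsubCl; apply/rootP.
  by have := congr1 (fun A : 'M_n.+1 => A i j) m0; rewrite !mxE.
exists (\sum_i ev (cf 1 i) * \sum_j ev (d i j) * y j).
  apply: OO_sum => i _; apply: OOM; first exact: OOev.
  by apply: OO_sum => j _; apply: OOM; [exact: OOev|exact: OOy].
rewrite -[LHS]mulr1 {1}(cfP OO1) !mulr_sumr; apply: eq_bigr => i _.
rewrite mulrCA mulmatP // -evXsubC [RHS]mulrCA; congr (_ * _).
by rewrite mulr_sumr; apply: eq_bigr => j _; rewrite dE rmorphM mulrA.
Qed.

Lemma matatX b h m : OO h -> matat b (h ^+ m) = matat b h ^+ m.
Proof. by move=> Oh; rewrite /matat mulmatX // rmorphXn. Qed.

Lemma v_bound h : h != 0 -> exists N : nat, forall P, v P h <= N%:Z /\ - v P h <= N%:Z.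
Proof.
move=> h0; have [s sP] := v_fin H h0; exists (\sum_(P <- s) `|v P h|)%N => P.
have [->|/sP Ps] := eqVneq (v P h) 0; first by split.
by rewrite (big_rem P) //=; set S := (\sum_(_ <- _) _)%N; split; lia.
Qed.

Lemma matat_nil b h : OO h -> (forall P, over b P -> vge v P 1 h) ->
  exists N, matat b h ^+ N = 0.
Proof.
move=> Oh oh; have [N NP] := v_bound (x_sub_neq0 b); exists N.
rewrite -matatX //; apply/eqP/matat_eq0; first exact: OOX.
apply: OO_div => [|P oP]; first exact: OOX.
have := vgeX H N (oh P oP); apply: vge_le; have [] := NP P; lia.
Qed.

(** Such an [h] acts nilpotently on the fibre, since a power of it is divisible by x - b. *)
Lemma tr_vanish b h : OO h -> (forall P, over b P -> vge v P 1 h) -> (tr h).[b] = 0.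
Proof.
move=> Oh oh; have [N /trace_nil] := matat_nil Oh oh.
by rewrite /matat trace_map_mx.
Qed.

Lemma OON1 : OO (-1).
Proof. by rewrite -(rmorph1 iota) -rmorphN; exact: OOconst. Qed.

(** On the fibre [h] is idempotent up to nilpotents, so its trace is a natural number, and 0 only if
    [h] is nilpotent there; its value 1 at [P] excludes this. *)
Lemma tr_idem b h P : OO h -> over b P -> vge v P 1 (h - 1) ->
  (forall Q, over b Q -> Q != P -> vge v Q 1 h) -> (tr h).[b] != 0.
Proof.
move=> Oh oP hP hQ.
have Oh1 : OO (h - 1) by apply: OOD => //; exact: OON1.
have [|Q oQ|N] := @matat_nil b (h * (h - 1)); first exact: OOM.
  have Og u : OO u -> vge v Q 0 u by rewrite OOP; apply; exact: over_ge0 oQ.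
  have [QP|QP] := eqVneq Q P.
    by subst Q; have := vgeM H (Og _ Oh) hP; rewrite add0r.
  by have := vgeM H (hQ _ oQ QP) (Og _ Oh1); rewrite addr0.
have -> : matat b (h * (h - 1)) = matat b h * (matat b h - 1).
  rewrite /matat mulmatM // map_mxM -[-1](rmorphN1 ev) mulmatD ?mulmat_ev //; last exact: OOev.
  rewrite map_mxD map_scalar_mx /= /horner_eval hornerN hornerC.
  rewrite -[_ *m _]/(_ * _); set A := map_mx _ _.
  have -> : (-1)%:M = -1 :> 'M[k]_n.+1 by rewrite raddfN.
  by rewrite mulrBr mulrBl mulr1 mul1r.
move=> /trace_idem_nil [m trm m0]; apply/eqP => t0.
have : (m%:R == 0 :> k) by rewrite -trm /matat trace_map_mx /= /horner_eval -/(tr h) t0.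
rewrite pnatr_eq0 => /eqP /m0; rewrite -matatX // => /eqP /(matat_eq0 _ (OOX _ Oh)) [g Og hE].
have vh : v P h = 0 /\ h != 0.
  have E1 : 1 + (h - 1) = h by rewrite addrC subrK.
  have := v_addl H (P := P) (h := 1) (g := h - 1) (oner_neq0 _).
  by rewrite E1 (v1 H) add0r => /(_ hP) [].
have g0 : g != 0.
  by have := expf_neq0 n.+1 vh.2; rewrite hE mulf_eq0 negb_or => /andP [].
have := congr1 (v P) hE; rewrite (vX H) ?vh.2 // vh.1 mulr0 (v_mul H) ?x_sub_neq0 //.
have : 0 <= v P g by rewrite -vgeE //; have [+ _] := OOP g; apply => //; exact: over_ge0 oP.
by move: oP; rewrite /over; lia.
Qed.

Lemma over_list b : exists2 ps : seq T, uniq ps & forall P, (P \in ps) = over b P.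
Proof.
have [s sP] := v_fin H (x_sub_neq0 b).
exists (undup [seq P <- s | over b P]); first exact: undup_uniq.
move=> P; rewrite mem_undup mem_filter; have [oP|//] := boolP (over b P).
by rewrite sP //; move: oP; rewrite /over; lia.
Qed.

Definition trmat : 'M[{poly k}]_n.+1 := \matrix_(i, j) tr (y i * y j).

Lemma tr_comb (c : 'I_n.+1 -> {poly k}) u : OO u ->
  tr ((\sum_j ev (c j) * y j) * u) = \sum_j c j * tr (y j * u).
Proof.
move=> Ou; rewrite mulr_suml tr_sum => [|j]; last first.
  by apply: OOM => //; apply: OOM; [exact: OOev|exact: OOy].
apply: eq_bigr => j _; rewrite -mulrA tr_evM //; apply: OOM => //; exact: OOy.
Qed.

(** By [tr_vanish] an element that vanishes at all points over [b] is in the radical of the trace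
    form at [b]; so the form factors through the values at these points. *)
Lemma rank_trmat b (ps : seq T) : (forall P, over b P -> P \in ps) ->
  (\rank (map_mx (horner_eval b) trmat) <= size ps)%N.
Proof.
move=> psP; set T0 := map_mx _ _.
have q (jl : 'I_n.+1 * 'I_(size ps)) : exists c, over b (tnth (in_tuple ps) jl.2) ->
    vge v (tnth (in_tuple ps) jl.2) 1 (y jl.1 - iota c).
  have [o|no] := boolP (over b (tnth (in_tuple ps) jl.2)); last by exists 0.
  have [|c cP] := v_res H (P := tnth (in_tuple ps) jl.2) (h := y jl.1); last by exists c.
  by have [+ _] := OOP (y jl.1); apply; [exact: OOy|exact: over_ge0 o].
have [e eP] := choice q; pose E := \matrix_(j < n.+1, l < size ps) e (j, l).
have KT : kermx E *m T0 = 0.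
  apply/matrixP => i l; rewrite mxE [RHS]mxE.
  pose h := \sum_j ev (kermx E i j)%:P * y j.
  have Oh : OO h by apply: OO_sum => j _; apply: OOM; [exact: OOev|exact: OOy].
  have -> : \sum_j kermx E i j * T0 j l = (tr (h * y l)).[b].
    rewrite /h (tr_comb _ (OOy l)) horner_sum; apply: eq_bigr => j _.
    by rewrite hornerM hornerC !mxE.
  apply: tr_vanish; first by apply: OOM => //; exact: OOy.
  move=> P oP; have Oy : vge v P 0 (y l).
    by have [+ _] := OOP (y l); apply; [exact: OOy|exact: over_ge0 oP].
  suff hP : vge v P 1 h by have := vgeM H hP Oy; rewrite addr0.
  have /psP/(nthP P) [m ms mP] := oP; pose lm := Ordinal ms.
  have lmP : tnth (in_tuple ps) lm = P by rewrite (tnth_nth P).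
  have -> : h = \sum_j iota (kermx E i j) * (y j - iota (E j lm)).
    have : (kermx E *m E) i lm = 0 by rewrite mulmx_ker mxE.
    rewrite mxE => /(congr1 iota); rewrite rmorph_sum rmorph0 => E0.
    transitivity (h - \sum_j iota (kermx E i j * E j lm)); first by rewrite E0 subr0.
    rewrite /h -sumrB; apply: eq_bigr => j _.
    by rewrite evC rmorphM mulrBr.
  apply: (vge_sum H) => j _; apply: (vge_constM H).
  by have := eP (j, lm); rewrite /= lmP mxE; apply.
have := mxrankS (introT sub_kermxP KT); rewrite !mxrank_ker.
have := rank_leq_row T0; have := rank_leq_col E; lia.
Qed.

Lemma disc_dvd b (ps : seq T) : (forall P, over b P -> P \in ps) ->
  ('X - b%:P) ^+ (n.+1 - size ps) %| \det trmat.
Proof.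
move=> psP; apply: dvdp_trans (det_vanish_order trmat b).
by apply: dvdp_exp2l; apply: leq_sub2l; exact: rank_trmat.
Qed.

(** An element [h] of the radical divides its norm, h * u = N(h), and tr(h * u) = N(h) * tr(1) is
    nonzero in characteristic 0. *)
Lemma det_trmat_neq0 : \det trmat != 0.
Proof.
apply/negP => /det0P [c c0 cT]; pose h := \sum_j ev (c 0 j) * y j.
have Oh : OO h by apply: OO_sum => j _; apply: OOM; [exact: OOev|exact: OOy].
have h0 : h != 0.
  apply: contraNneq c0 => /(rb_indep rb) c0; apply/eqP/rowP => j.
  by rewrite mxE.
have trh l : tr (h * y l) = 0.
  rewrite (tr_comb _ (OOy l)); have := congr1 (fun A : 'rV_n.+1 => A 0 l) cT.
  rewrite mxE [in RHS]mxE => E0; apply: etrans E0; apply: eq_bigr => j _.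
  by rewrite [trmat _ _]mxE.
have dM : \det (mulmat h) != 0.
  apply/negP => /det0P [b b0 bM].
  have : h * \sum_i ev (b 0 i) * y i = 0.
    rewrite mulr_sumr; under eq_bigr => i _ do rewrite mulrCA mulmatP // mulr_sumr.
    rewrite exchange_big big1 //= => j _.
    have := congr1 (fun A : 'rV_n.+1 => ev (A 0 j)) bM.
    rewrite mxE [in RHS]mxE rmorph0 rmorph_sum => E0; apply: etrans (etrans (congr1 (fun z => z * y j) E0) (mul0r _)).
    rewrite mulr_suml; by apply: eq_bigr => i _; rewrite rmorphM mulrA.
  move/eqP; rewrite mulf_eq0 (negbTE h0) /= => /eqP /(rb_indep rb) b00.
  by case/eqP: b0; apply/rowP => j; rewrite mxE.
(* The adjugate applied to the coordinates of 1 gives the cofactor [u] of [h] in its norm. *)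
pose B := (\row_j cf 1 j) *m \adj (mulmat h).
pose u := \sum_i ev (B 0 i) * y i.
have hu : h * u = ev (\det (mulmat h)).
  rewrite mulr_sumr; under eq_bigr => i _ do rewrite mulrCA mulmatP // mulr_sumr.
  rewrite exchange_big /= -[RHS]mulr1 [in RHS](cfP OO1) mulr_sumr.
  apply: eq_bigr => j _.
  have : (B *m mulmat h) 0 j = \det (mulmat h) * cf 1 j.
    by rewrite /B -mulmxA mul_adj_mx mul_mx_scalar !mxE.
  rewrite mxE => /(congr1 ev); rewrite rmorphM rmorph_sum mulrA => <-.
  by rewrite mulr_suml; apply: eq_bigr => i _; rewrite rmorphM mulrA.
have : tr (u * h) = 0.
  by rewrite (tr_comb _ Oh) big1 // => i _; rewrite [y i * h]mulrC trh mulr0.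
rewrite mulrC hu -[ev _]mulr1 tr_evM; last exact: OO1.
rewrite -(rmorph1 ev) /tr mulmat_ev mxtrace_scalar => /eqP.
by rewrite mulf_eq0 (negbTE dM) /= -polyC1 -polyCMn polyC_eq0 pnatr_eq0.
Qed.

Definition evmat : 'M[F]_n.+1 := map_mx ev trmat.
(** The dual basis of [y] for the trace form. Its elements need not be in the ring, where alone [tr]
    is meaningful; statements about their traces are therefore multiplied by the discriminant. *)
Definition dual (j : 'I_n.+1) : F := \sum_l invmx evmat j l * y l.

Lemma evmat_unit : evmat \in unitmx.
Proof. by rewrite unitmxE det_map_mx unitfE ev_eq0 // det_trmat_neq0. Qed.

Lemma dualE j : ev (\det trmat) * dual j = \sum_l ev (\adj trmat j l) * y l.
Proof.
rewrite mulr_sumr; apply: eq_bigr => l _; rewrite mulrA; congr (_ * _).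
rewrite /invmx evmat_unit mxE det_map_mx mulrA divff ?ev_eq0 ?det_trmat_neq0 // mul1r.
by rewrite -map_mx_adj mxE.
Qed.

Lemma OOdual j : OO (ev (\det trmat) * dual j).
Proof.
by rewrite dualE; apply: OO_sum => l _; apply: OOM; [exact: OOev|exact: OOy].
Qed.

Lemma tr_dual u j : OO u -> tr (ev (\det trmat) * dual j * u) = \det trmat * cf u j.
Proof.
move=> Ou; rewrite dualE (tr_comb _ Ou).
have E l : tr (y l * u) = \sum_i cf u i * trmat i l.
  rewrite mulrC {1}(cfP Ou) (tr_comb _ (OOy l)).
  by apply: eq_bigr => i _; rewrite mxE.
rewrite (eq_bigr (fun l => \sum_i cf u i * (trmat i l * \adj trmat j l))); last first.
  move=> l _; rewrite E mulr_sumr; apply: eq_bigr => i _; ring.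
have symT i l : trmat i l = trmat l i by rewrite !mxE mulrC.
rewrite exchange_big /= (bigD1 j) //= [X in _ + X]big1 => [|i ij].
  rewrite addr0 -mulr_sumr mulrC; congr (_ * _).
  have := congr1 (fun A : 'M_n.+1 => A j j) (mul_adj_mx trmat).
  rewrite mxE [in RHS]mxE eqxx mulr1n => <-; apply: eq_bigr => l _.
  by rewrite mulrC symT.
rewrite -mulr_sumr; have := congr1 (fun A : 'M_n.+1 => A j i) (mul_adj_mx trmat).
rewrite mxE [in RHS]mxE eq_sym (negbTE ij) mulr0n => E0.
apply: etrans (etrans (congr1 (fun z => cf u i * z) E0) (mulr0 _)).
by congr (_ * _); apply: eq_bigr => l _; rewrite mulrC symT.
Qed.

(* Poles over places other than those over [b] can be cleared by a polynomial in [x]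
   that does not vanish at [b]. *)
Lemma clear_poles b g : (forall P, over b P -> vge v P 0 g) ->
  exists2 q : {poly k}, q.[b] != 0 & OO (ev q * g).
Proof.
move=> gP; have [->|g0] := eqVneq g 0.
  by exists 1; rewrite ?hornerC ?oner_eq0 // mulr0; exists 0%N; exact: LL0.
have [s sP] := v_fin H g0.
have r P : exists c, 0 <= v P x -> vge v P 1 (x - iota c).
  have [vx|_] := boolP (0 <= v P x); last by exists 0.
  have [|c cP] := v_res H (P := P) (h := x); last by exists c.
  by rewrite vgeE // (nonconst_neq0 xnc).
have [c cP] := choice r.
pose Q P := (0 <= v P x) && (c P != b).
exists (\prod_(P <- s | Q P) ('X - (c P)%:P) ^+ `|v P g|%N).
  rewrite horner_prod; elim/big_ind: _ => [|f g'|P /andP [_ cb]]; first exact: oner_neq0.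
    exact: mulf_neq0.
  by rewrite horner_exp hornerXsubC expf_neq0 // subr_eq0 eq_sym.
apply/OOP => P vx; have Oe p : vge v P 0 (ev p) by have [+ _] := OOP (ev p); apply=> //; exact: OOev.
have [vg|vg] := boolP (vge v P 0 g); first by have := vgeM H (Oe (\prod_(P <- s | Q P) ('X - (c P)%:P) ^+ `|v P g|%N)) vg; rewrite addr0.
have nP : v P g < 0 by move: vg; rewrite vgeE // -ltNge.
have Ps : P \in s by apply: sP; rewrite lt_eqF.
have QP : Q P.
  rewrite /Q vx; apply: contraNneq vg => cb; apply: gP; rewrite /over -cb.
  by have := cP P vx; rewrite vgeE ?x_sub_neq0.
rewrite (big_rem P) //= QP rmorphM rmorphXn /= evXsubC [_ * ev _]mulrC -mulrA.
rewrite -[0]add0r; apply: (vgeM H); first exact: Oe.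
have := vgeM H (vgeX H `|v P g|%N (cP P vx)) (_ : vge v P (v P g) g).
rewrite vgeE // lexx => /(_ isT); apply: vge_le; lia.
Qed.

(** Approximation: a power of a uniformizer at [P], times a high power of an element that vanishes
    at the other points over [b], with the poles elsewhere cleared. *)
Lemma local_elt b P (m : nat) (N : nat) : over b P ->
  exists u, [/\ OO u, u != 0, v P u = m%:Z &
    forall Q, over b Q -> Q != P -> vge v Q N%:Z u].
Proof.
move=> oP; have [ps psu psP] := over_list b; have [t t0 vt] := v_unif H P.
have [|z [z0 vz zP]] := v_sep H (P := P) (s := rem P ps).
  by rewrite mem_rem_uniq // inE eqxx.
have [N0 N0P] := v_bound (expf_neq0 m t0).
pose u0 := t ^+ m * z ^+ (N + N0).
have u00 : u0 != 0 by rewrite mulf_neq0 ?expf_neq0.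
have vu0 : v P u0 = m.
  by rewrite (v_mul H) ?expf_neq0 // !(vX H) // vt vz mulr0 addr0 mulr1.
have u0Q Q : over b Q -> Q != P -> vge v Q N u0.
  move=> oQ QP; have zQ : vge v Q 1 z by apply: zP; rewrite mem_rem_uniq // inE QP psP.
  have := vgeM H (_ : vge v Q (v Q (t ^+ m)) (t ^+ m)) (vgeX H (N + N0) zQ).
  rewrite vgeE ?expf_neq0 // lexx => /(_ isT); apply: vge_le.
  by have := (N0P Q).2; move: (v Q (t ^+ m)) => V; lia.
have [|q qb Oq] := @clear_poles b u0.
  move=> Q oQ; have [->|QP] := eqVneq Q P; first by rewrite vgeE // vu0.
  by apply: vge_le (u0Q _ oQ QP).
have q0 : ev q != 0 by rewrite ev_eq0 //; apply: contraNneq qb => ->; rewrite horner0.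
have vq : v P (ev q) = 0.
  rewrite -(subrK q.[b]%:P q) rmorphD addrC /= evC.
  have d : 'X - b%:P %| q - q.[b]%:P by rewrite dvdp_XsubCl /root !hornerE subrr.
  have := v_addl H (P := P) (h := iota q.[b]) (g := ev (q - q.[b]%:P)).
  rewrite (v_const H) // fmorph_eq0 => /(_ qb) [] //.
  rewrite add0r -(divpK d) rmorphM /= evXsubC.
  have Oe p : vge v P 0 (ev p).
    by have [+ _] := OOP (ev p); apply; [exact: OOev|exact: over_ge0 oP].
  have := vgeM H (Oe ((q - q.[b]%:P) %/ ('X - b%:P))) (_ : vge v P 1 (x - iota b)).
  by rewrite add0r; apply; rewrite vgeE // x_sub_neq0.
exists (ev q * u0); split=> //; first by rewrite mulf_neq0.
  by rewrite (v_mul H) // vq vu0 add0r.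
move=> Q oQ QP; rewrite -[N%:Z]add0r; apply: (vgeM H); last exact: u0Q.
by have [+ _] := OOP (ev q); apply; [exact: OOev|exact: over_ge0 oQ].
Qed.

(** Tame ramification: at a point of index e the inverse different has a pole of order e - 1. If the
    pole of [h] were worse, some (x - b) * h * u would be a unit at [P] and vanish at the other
    points over [b]; its trace would be nonzero at [b] by [tr_idem], yet divisible by x - b since h
    * u has an integral trace. *)
Lemma different_bound (dl : {poly k}) h b P : dl != 0 -> OO (ev dl * h) ->
  (forall u, OO u -> dl %| tr (ev dl * h * u)) -> over b P ->
  vge v P (1 - v P (x - iota b)) h.
Proof.
move=> dl0 Oh trh oP; have [->|h0] := eqVneq h 0; first exact: vge0.
rewrite vgeE // leNgt; apply/negP => vh.
set e := v P (x - iota b) in vh; have e1 : 0 < e by [].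
(* This exponent gives (x - b) * h * u order 0 at [P]; it is nonnegative by the assumption on the
   pole. *)
have [m mE] : exists m : nat, m%:Z = - v P h - e by exists (absz (- v P h - e)); lia.
have [N NP] := v_bound h0.
have [u [Ou u0 vu uQ]] := local_elt m N.+1 oP.
pose z := (x - iota b) * h * u.
have z0 : z != 0 by rewrite !mulf_neq0 // x_sub_neq0.
have vz : v P z = 0 by rewrite !(v_mul H) ?mulf_neq0 ?x_sub_neq0 // -/e vu; lia.
have zQ Q : over b Q -> Q != P -> vge v Q 1 z.
  move=> oQ QP; rewrite /z -mulrA (vgeMl H) ?x_sub_neq0 // (vgeMl H) //.
  by apply: vge_le (uQ Q oQ QP); have := (NP Q).2; move: oQ; rewrite /over; lia.
have [|q qb Oq] := @clear_poles b z.
  move=> Q oQ; have [->|QP] := eqVneq Q P; first by rewrite vgeE // vz.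
  exact: vge_le (zQ Q oQ QP).
have Oe p Q : over b Q -> vge v Q 0 (ev p).
  by move=> oQ; have [+ _] := OOP (ev p); apply; [exact: OOev|exact: over_ge0 oQ].
have zP : vge v P 0 (ev q * z) by have := Oq; rewrite OOP; apply; exact: over_ge0 oP.
have [c cP] := v_res H zP.
have c0 : c != 0.
  apply: contraTneq cP => ->; rewrite rmorph0 subr0 mulrC (vgeMl H) // vz subr0.
  have d : 'X - b%:P %| q - q.[b]%:P by rewrite dvdp_XsubCl /root !hornerE subrr.
  rewrite -(subrK q.[b]%:P q) rmorphD /= evC; apply/negP => /(fun a => vgeB H a).
  have q1 : vge v P 1 (ev (q - q.[b]%:P)).
    rewrite -(divpK d) rmorphM /= evXsubC.
    have := vgeM H (Oe ((q - q.[b]%:P) %/ ('X - b%:P)) P oP) (_ : vge v P 1 (x - iota b)).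
    by rewrite add0r; apply; rewrite vgeE // x_sub_neq0.
  by move=> /(_ _ q1); rewrite addrC addKr vgeE ?fmorph_eq0 // (v_const H).
pose w0 := iota c^-1 * (ev q * z).
have Ow : OO w0 by apply: OOM => //; exact: OOconst.
have tw : (tr w0).[b] != 0.
  apply: (@tr_idem b w0 P) => //.
    have -> : w0 - 1 = iota c^-1 * (ev q * z - iota c).
      by rewrite mulrBr -rmorphM mulVf // rmorph1.
    exact: (vge_constM H).
  move=> Q oQ QP; apply: (vge_constM H); rewrite -[1]add0r.
  by apply: (vgeM H); [exact: Oe|exact: zQ].
case/negP: tw; have [s sE] : exists s, tr (ev dl * h * u) = s * dl by apply/dvdpP; exact: trh.
have : dl * tr w0 = dl * (('X - b%:P) * q * (c^-1)%:P * s).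
  rewrite -tr_evM //.
  have -> : ev dl * w0 = ev (('X - b%:P) * q * (c^-1)%:P) * (ev dl * h * u).
    by rewrite !rmorphM /= evXsubC evC /w0 /z; ring.
  rewrite tr_evM ?sE; [ring|exact: OOM].
by move/(mulfI dl0) ->; rewrite !hornerM !hornerE subrr !mul0r.
Qed.

(** [qs] is the fibre with multiplicities. If it were shorter than the basis, a nonzero constant
    combination of the [y i] would be divisible by x - b. If it were longer, elements with the
    orders 0, ..., e - 1 at its points would be dependent modulo x - b. *)
Lemma degree_over b (ps : seq T) : uniq ps -> (forall P, (P \in ps) = over b P) ->
  \sum_(P <- ps) v P (x - iota b) = n.+1%:Z.
Proof.
move=> ups psP; pose e P := `|v P (x - iota b)|%N.
have eE P : over b P -> v P (x - iota b) = (e P)%:Z by rewrite /over /e; lia.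
pose qs := flatten [seq nseq (e P) P | P <- ps].
have cq P : over b P -> count_mem P qs = e P.
  move=> oP; rewrite count_flatten -map_comp sumnE big_map.
  rewrite (bigD1_seq P) ?psP //= count_nseq /= eqxx mul1n big1 ?addn0 // => Q QP.
  by rewrite count_nseq /= (negbTE QP) mul0n.
have szq : size qs = (\sum_(P <- ps) e P)%N.
  by rewrite size_flatten /shape -map_comp sumnE big_map; apply: eq_bigr => P _; rewrite /= size_nseq.
suff : size qs = n.+1.
  rewrite szq => <-; rewrite (big_morph _ PoszD (erefl 0%:Z)).
  by apply: eq_big_seq => P; rewrite psP; exact: eE.
apply/eqP; rewrite eqn_leq; apply/andP; split; last first.
  rewrite leqNgt; apply/negP => qn; pose r := (\max_i a i)%N.
  have [//||c [[i ci] cP]] := @vge_conditions _ _ _ _ _ H qs (fun P => r%:Z * w v x P) _ y.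
    by move=> i P; apply: LL_le (rb_LL rb i) P; have := leq_bigmax (F := a) i; rewrite -/r; lia.
  pose h := \sum_j ev (c j)%:P * y j.
  have hE : h = \sum_j iota (c j) * y j by apply: eq_bigr => j _; rewrite evC.
  have Oh : OO h by apply: OO_sum => j _; apply: OOM; [exact: OOev|exact: OOy].
  have [|g Og hg] := @OO_div b h Oh.
    move=> P oP; have := cP P; rewrite -hE cq // /w (min_idPl (over_ge0 oP)) mulr0 add0r.
    by rewrite eE.
  have : forall j, (c j)%:P = ('X - b%:P) * cf g j.
    apply: comb_inj; rewrite -/h hg {1}(cfP Og) mulr_sumr; apply: eq_bigr => j _.
    by rewrite rmorphM /= evXsubC mulrA.
  move=> /(_ i) ciE; case/negP: ci; apply/eqP.
  by have := congr1 (fun p => p.[b]) ciE; rewrite hornerM hornerC !hornerE subrr mul0r.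
rewrite leqNgt; apply/negP => qn.
have [N NP] := v_bound (x_sub_neq0 b).
have qo (i : 'I_(size qs)) : over b (tnth (in_tuple qs) i).
  have /flatten_mapP [P] : tnth (in_tuple qs) i \in qs by rewrite mem_tnth.
  by rewrite psP => oP; rewrite mem_nseq => /andP [_ /eqP ->].
(* Each copy of a point in [qs] is assigned the number of copies before it as an order. *)
pose rk (i : 'I_(size qs)) := count_mem (tnth (in_tuple qs) i) (take i qs).
have uex (i : 'I_(size qs)) : exists u, [/\ OO u, u != 0,
    v (tnth (in_tuple qs) i) u = (rk i)%:Z &
    forall Q, over b Q -> Q != tnth (in_tuple qs) i -> vge v Q N%:Z u].
  exact: local_elt.
have [u uP] := choice uex.
pose A := \matrix_(i < size qs, j < n.+1) (cf (u i) j).[b].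
have [c c0 cA] : exists2 c : 'rV_(size qs), c != 0 & c *m A = 0.
  have : kermx A != 0.
    rewrite -mxrank_eq0 mxrank_ker subn_eq0 -ltnNge.
    exact: leq_ltn_trans (rank_leq_col A) qn.
  case/rowV0Pn => c /sub_kermxP cA c0; by exists c.
pose h := \sum_i iota (c 0 i) * u i.
have Oh : OO h.
  by apply: OO_sum => i _; apply: OOM; [exact: OOconst|case: (uP i)].
have cfh j : cf h j = \sum_i (c 0 i)%:P * cf (u i) j.
  move: j; apply: comb_inj; rewrite -(cfP Oh) /h.
  under [RHS]eq_bigr => j _ do rewrite rmorph_sum mulr_suml.
  rewrite exchange_big; apply: eq_bigr => i _ /=.
  have [Oui _ _ _] := uP i; rewrite {1}(cfP Oui) mulr_sumr; apply: eq_bigr => j _.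
  by rewrite rmorphM /= evC mulrA.
have hx : exists2 g, OO g & h = (x - iota b) * g.
  have dj j : 'X - b%:P %| cf h j.
    rewrite dvdp_XsubCl /root cfh horner_sum; apply/eqP.
    have := congr1 (fun B : 'rV_n.+1 => B 0 j) cA; rewrite !mxE => E0.
    by rewrite -[RHS]E0; apply: eq_bigr => i _; rewrite hornerM hornerC mxE.
  exists (\sum_j ev (cf h j %/ ('X - b%:P)) * y j).
    by apply: OO_sum => j _; apply: OOM; [exact: OOev|exact: OOy].
  rewrite {1}(cfP Oh) mulr_sumr; apply: eq_bigr => j _.
  by rewrite -{1}(divpK (dj j)) rmorphM /= evXsubC; ring.
have [i0 ci0] : exists i, c 0 i != 0.
  apply: contrapT => nc; case/eqP: c0; apply/rowP => i; rewrite [RHS]mxE.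
  by apply/eqP/negPn/negP => ci; apply: nc; exists i.
(* The first nonzero coefficient belongs to the term of strictly least order at its point [P]; that
   order is below e, whereas [h] is divisible by x - b. *)
case: (arg_minnP (P := fun i => c 0 i != 0) (fun i : 'I_(size qs) => nat_of_ord i) ci0) => i ci imin.
set P := tnth (in_tuple qs) i; have oP : over b P by exact: qo.
have [Oui ui0 vui uiQ] := uP i.
have rki : (rk i < e P)%N.
  rewrite -cq // -[X in (_ < count_mem _ X)%N](cat_take_drop i.+1) count_cat.
  rewrite (take_nth P) // -cats1 count_cat /= -(tnth_nth P (in_tuple qs) i) -/P eqxx.
  by rewrite /rk -/P addn1; lia.
have hP : vge v P (e P) h.
  case: hx => g Og ->; rewrite -eE // -[v P _]addr0; apply: (vgeM H).
    by rewrite vgeE // x_sub_neq0.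
  by have [+ _] := OOP g; apply => //; exact: over_ge0 oP.
have rest : vge v P (rk i).+1%:Z (\sum_(j | j != i) iota (c 0 j) * u j).
  apply: (vge_sum H) => j ji; have [cj|cj] := eqVneq (c 0 j) 0.
    by rewrite cj rmorph0 mul0r vge0.
  apply: (vge_constM H); have ij : (i < j)%N.
    by rewrite ltn_neqAle eq_sym -(inj_eq val_inj) /= in ji *; rewrite ji imin.
  have [_ uj0 vuj ujQ] := uP j.
  have [Pj|Pj] := eqVneq P (tnth (in_tuple qs) j); last first.
    apply: vge_le (ujQ P oP Pj); have := (NP P).1; rewrite eE //; lia.
  rewrite vgeE // Pj vuj lez_nat /rk -Pj -(subnKC ij) takeD count_cat.
  by rewrite (take_nth P) // -cats1 count_cat /= -(tnth_nth P (in_tuple qs) i) -/P eqxx addn1; lia.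
have c1 : iota (c 0 i) * u i != 0 by rewrite mulf_neq0 // fmorph_eq0.
have vc : v P (iota (c 0 i) * u i) = rk i.
  by rewrite (v_mul H) ?fmorph_eq0 // (v_const H) // add0r.
have [|] := v_addl H (P := P) c1 (_ : vge v P _ (\sum_(j | j != i) iota (c 0 j) * u j)).
  by rewrite vc; apply: vge_le rest; lia.
have -> : iota (c 0 i) * u i + \sum_(j | j != i) iota (c 0 j) * u j = h.
  by rewrite /h [in RHS](bigD1 i).
by move=> h0; rewrite vc => vh; move: hP; rewrite vgeE // vh; lia.
Qed.

End Trace.
End Reduced.

(** * Hurwitz's inequality for three branch points *)

Section Genus.
Variables (k : numClosedFieldType) (F : fieldType) (iota : {rmorphism k -> F}).
Variables (T : eqType) (v : T -> F -> int).
Hypothesis H : curve_field iota v.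
Variable x : F.
Hypothesis xnc : forall c, x != iota c.

(** Transports the zeros of the discriminant over oo to its degree in [x]. *)
Lemma size_revp_dvd (c : nat) (p : {poly k}) : p != 0 -> 'X^c %| p ->
  (size (revp (size p).-1 p) + c <= size p)%N.
Proof.
move=> p0 /dvdpP [s ps]; have s0 : s != 0 by apply: contraNneq p0 => s0; rewrite ps s0 mul0r.
have szp : size p = (size s + c)%N by rewrite ps size_mulXn // addnC.
have s1 : (0 < size s)%N by rewrite size_poly_gt0.
rewrite szp leq_add2r; apply/leq_sizeP => j sj; rewrite coef_poly.
case: ltnP => // jp; rewrite ps coefMXn ifT //; lia.
Qed.

Section Inv.
Variables (n : nat) (y : 'I_n.+1 -> F) (a : 'I_n.+1 -> nat).
Hypothesis rb : reduced_basis iota v x y a.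
Let y' j := x ^- a j * y j.
Let x0 : x != 0. Proof. exact: nonconst_neq0 xnc. Qed.
Let rb' : reduced_basis iota v x^-1 y' a. Proof. exact: (reduced_basis_inv H). Qed.
Let xVnc c : x^-1 != iota c. Proof. exact: inv_nonconst. Qed.

(** Up to the factor [x ^- r], the two multiplication matrices are conjugate by the diagonal change
    of basis, so their diagonals agree up to this factor. [N] is large enough to write all entries
    as polynomials in [x]. *)
Lemma tr_inv (r : nat) u : LL v x r u ->
  ev iota x^-1 (tr iota x^-1 y' (x ^- r * u)) = x ^- r * ev iota x (tr iota x y u).
Proof.
move=> Lu; have Ou : OO v x u by exists r.
have Ou' : OO v x^-1 (x ^- r * u).
  by exists r; apply/(LL_inv H) => //; rewrite mulrA divff ?expf_neq0 // mul1r.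
rewrite /tr /mxtrace !rmorph_sum mulr_sumr; apply: eq_bigr => i _ /=.
set A := mulmat iota x y u; set A' := mulmat _ _ _ _.
pose N := (r + \sum_j (a j + size (A' i j)))%N.
have NP j : (r + a j + size (A' i j) <= N)%N.
  by rewrite /N (bigD1 j) //=; lia.
have E : forall j, revp (N - a j) (A' i j) = 'X^(N - r - a i) * A i j.
  apply: (comb_inj rb).
  transitivity (x ^+ N * (x ^- r * u * y' i)).
    rewrite (mulmatP H rb' i Ou') mulr_sumr; apply: eq_bigr => j _.
    rewrite -(ev_revp xnc); last by have := NP j; lia.
    by rewrite expfB_cond ?(negbTE x0) /y' -/A' //=; [ring|have := NP j; lia].
  transitivity (x ^+ (N - r - a i) * (u * y i)).
    have -> : N = (N - r - a i + (r + a i))%N by have := NP i; lia.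
    rewrite !exprD /y'; set m := (_ - r - a i)%N.
    have -> : (N - r - a i + (r + a i) - r - a i)%N = m by rewrite /m; lia.
    have xr := expf_neq0 r x0; have xa := expf_neq0 (a i) x0.
    by field; rewrite xr xa.
  rewrite (mulmatP H rb i Ou) mulr_sumr; apply: eq_bigr => j _.
  by rewrite rmorphM rmorphXn /= evX mulrA.
have := congr1 (ev iota x) (E i).
have sA : (size (A' i i) <= (N - a i).+1)%N by have := NP i; move: (size (A' i i)) => *; lia.
rewrite -(ev_revp xnc sA) rmorphM rmorphXn /= evX.
have xr := expf_neq0 r x0; have xm := expf_neq0 (N - r - a i) x0.
have -> : (N - a i)%N = (N - r - a i + r)%N by have := NP i; lia.
rewrite exprD -mulrA => /(mulfI xm) <-; by rewrite mulrA mulVf // mul1r.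
Qed.

Let D := diag_mx (\row_j x ^- a j) : 'M[F]_n.+1.

Let Du : D \in unitmx.
Proof.
rewrite unitmxE det_diag unitfE; apply/prodf_neq0 => i _.
by rewrite mxE invr_eq0 expf_neq0.
Qed.

Lemma evmat_inv : evmat iota x^-1 y' = D *m evmat iota x y *m D.
Proof.
apply/matrixP => i j; rewrite mul_mx_diag [RHS]mxE mul_diag_mx !mxE.
have -> : y' i * y' j = x ^- (a i + a j) * (y i * y j).
  by rewrite /y' exprD invfM; ring.
rewrite tr_inv; last by rewrite PoszD; apply: (LLM H); apply: (rb_LL rb).
by rewrite exprD invfM; ring.
Qed.

Lemma dual_inv j : dual iota x^-1 y' j = x ^+ a j * dual iota x y j.
Proof.
pose Y := \col_l y l; pose d := \col_l dual iota x y l; pose d' := \col_l dual iota x^-1 y' l.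
have dE : d = invmx (evmat iota x y) *m Y.
  by apply/colP => l; rewrite !mxE; apply: eq_bigr => m _; rewrite !mxE.
have d'E : d' = invmx (evmat iota x^-1 y') *m (D *m Y).
  apply/colP => l; rewrite !mxE; apply: eq_bigr => m _.
  by rewrite mul_diag_mx !mxE.
have : D *m d' = d.
  rewrite dE; apply: (canRL (mulKmx (evmat_unit H xnc rb))).
  apply: (can_inj (mulKmx Du)); rewrite !mulmxA -evmat_inv d'E.
  by rewrite mulKVmx ?(evmat_unit H xVnc rb').
move=> /(congr1 (fun A : 'cV_n.+1 => A j 0)); rewrite mul_diag_mx !mxE => <-.
by rewrite mulrA divff ?expf_neq0 // mul1r.
Qed.

(** The discriminant is a section of the line bundle of degree [2 * \sum_j a j] on the projective
    line. *)
Lemma det_trmat_inv : ev iota x (\det (trmat iota x y)) =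
  x ^+ (2 * \sum_j a j) * ev iota x^-1 (\det (trmat iota x^-1 y')).
Proof.
rewrite -!det_map_mx -!/(evmat _ _ _) evmat_inv !det_mulmx.
have -> : \det D = x ^- (\sum_j a j).
  rewrite det_diag -prodrXr -prodfV; apply: eq_bigr => j _; by rewrite mxE.
rewrite mul2n -addnn exprD; have := expf_neq0 (\sum_j a j) x0.
by move=> xs; field; rewrite xs.
Qed.

(** The discriminant, a section of degree [2 * \sum_j a j], vanishes at each of 0, 1, oo at least to
    the order n + 1 minus the number of points over it. *)
Lemma branch_bound (ps0 ps1 psoo : seq T) :
  (forall P, 0 < v P x -> P \in ps0) -> (forall P, 0 < v P (x - 1) -> P \in ps1) ->
  (forall P, v P x < 0 -> P \in psoo) ->
  (3 * n.+1 <= 2 * (\sum_j a j) + size ps0 + size ps1 + size psoo)%N.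
Proof.
move=> p0 p1 poo; set dl : {poly k} := \det (trmat iota x y).
have dl0 : dl != 0 by exact: (det_trmat_neq0 H xnc rb).
set dl' : {poly k} := \det (trmat iota x^-1 y').
have dl'0 : dl' != 0 by exact: (det_trmat_neq0 H xVnc rb').
have d0 : ('X - 0%:P) ^+ (n.+1 - size ps0) %| dl.
  by apply: (disc_dvd H xnc rb) => P; rewrite /over rmorph0 subr0; exact: p0.
have d1 : ('X - 1%:P) ^+ (n.+1 - size ps1) %| dl.
  by apply: (disc_dvd H xnc rb) => P; rewrite /over rmorph1; exact: p1.
have doo : 'X^(n.+1 - size psoo) %| dl'.
  rewrite -['X]subr0 -polyC0; apply: (disc_dvd H xVnc rb') => P.
  by rewrite /over rmorph0 subr0 (vV H) // oppr_gt0; exact: poo.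
have sz : ((n.+1 - size ps0) + (n.+1 - size ps1) < size dl)%N.
  have dd : ('X - 0%:P) ^+ (n.+1 - size ps0) * ('X - 1%:P) ^+ (n.+1 - size ps1) %| dl.
    rewrite Gauss_dvdp ?d0 ?d1 // coprimep_expl // coprimep_expr //.
    by rewrite coprimep_XsubC /root hornerXsubC subr0 oner_eq0.
  have := dvdp_leq dl0 dd.
  by rewrite size_mul ?expf_neq0 ?polyXsubC_eq0 // !size_exp_XsubC addnS addSn.
have soo := size_revp_dvd dl'0 doo.
have E : dl * 'X ^+ (size dl').-1 = 'X ^+ (2 * \sum_j a j) * revp (size dl').-1 dl'.
  apply/eqP; rewrite -subr_eq0 -(ev_eq0 xnc) rmorphB !rmorphM !rmorphXn /= evX.
  have s1 : (0 < size dl')%N by rewrite size_poly_gt0.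
  rewrite -(ev_revp xnc) ?prednK //.
  have -> : ev iota x dl = x ^+ (2 * \sum_j a j) * ev iota x^-1 dl' by exact: det_trmat_inv.
  by rewrite mulrAC -mulrA subrr.
have r0 : revp (size dl').-1 dl' != 0.
  apply/negP => /eqP /revp_eq0 r0; case/eqP: dl'0; apply: r0.
  exact: leqSpred.
have := congr1 (fun p : {poly k} => size p) E.
rewrite size_mulXn // mulrC size_mulXn //.
have : (0 < size dl')%N by rewrite size_poly_gt0.
move: sz soo; move: (size dl) (size dl') (size (revp _ _)) (\sum_j a j)%N => *; lia.
Qed.

(** Truncated subtraction: since 1 lies in [LL 0], some [a j] is 0 and loses nothing. *)
Lemma num_forms : (\sum_j a j <= \sum_j (a j).-1 + n)%N.
Proof.
have [p pE pP] := rb_span rb (r := 0) (LL1 H x).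
have [j0 aj0] : exists j, a j = 0%N.
  apply: contrapT => na; case/eqP: (oner_neq0 F); rewrite pE big1 // => j _.
  have [->|pj] := eqVneq (p j) 0; first by rewrite rmorph0 mul0r.
  exfalso; apply: na; exists j; have := pP j pj; rewrite -size_poly_gt0 in pj.
  by move: pj; move: (size (p j)) => *; lia.
rewrite (bigD1 j0) //= aj0 [X in (_ <= X + _)%N](bigD1 j0) //= aj0 /= !add0n.
apply: (@leq_trans (\sum_(i < n.+1 | i != j0) ((a i).-1 + 1))).
  by apply: leq_sum => i _; lia.
rewrite big_split /= leq_add2l sum1_card cardC1 card_ord //.
Qed.

(** The forms are x^m * dual_j * dx: [dual j] generates O(a j), and dx has a double pole at oo,
    which leaves the exponents m <= a j - 2. *)
Definition form_index := {j : 'I_n.+1 & 'I_(a j).-1}.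
Definition form (i : form_index) : F := x ^+ (tagged i) * dual iota x y (tag i).

(** The trace pairing with [y l] extracts the polynomial coefficient of [dual l]. *)
Lemma form_indep (c : form_index -> k) :
  \sum_i iota (c i) * form i = 0 -> forall i, c i = 0.
Proof.
move=> c0.
pose c' (j : 'I_n.+1) (m : nat) : k :=
  if insub m is Some m' then c (existT (fun j => 'I_(a j).-1) j m') else 0.
pose p (j : 'I_n.+1) : {poly k} := \poly_(m < (a j).-1) c' j m.
have pE : \sum_j ev iota x (p j) * dual iota x y j = 0.
  transitivity (\sum_j \sum_(m < (a j).-1)
      iota (c (existT (fun j => 'I_(a j).-1) j m)) * (x ^+ m * dual iota x y j)).
    apply: eq_bigr => j _; rewrite /p poly_def rmorph_sum mulr_suml /=.
    apply: eq_bigr => m _; rewrite -mul_polyC rmorphM rmorphXn /= evC evX /c' valK /=.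
    by rewrite mulrA.
  by rewrite sig_big_dep -[RHS]c0; apply: eq_bigr => -[j m] _.
have p0 l : p l = 0.
  pose dl := \det (trmat iota x y); have dl0 : dl != 0 by exact: (det_trmat_neq0 H xnc rb).
  have Od j := OOdual H xnc rb j; have Oy := OOy rb l.
  have : tr iota x y (\sum_j ev iota x (p j) * (ev iota x dl * dual iota x y j * y l)) = dl * p l.
    rewrite (tr_sum H xnc rb) => [|j]; last first.
      by apply: (OOM H); [exact: OOev|apply: (OOM H)].
    rewrite (bigD1 l) //= [X in _ + X]big1 => [|j jl].
      rewrite (tr_evM H xnc rb) ?(tr_dual H xnc rb) // ?addr0 -/dl; last exact: (OOM H).
      have -> : cf iota x y (y l) l = (l == l)%:R; last by rewrite eqxx mulr1 mulrC.
      move: {2 4}l; apply: (comb_inj rb); rewrite -(cfP rb Oy).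
      by rewrite (bigD1 l) //= eqxx rmorph1 mul1r big1 ?addr0 // => j jl; rewrite eq_sym (negbTE jl) rmorph0 mul0r.
    rewrite (tr_evM H xnc rb) ?(tr_dual H xnc rb) //; last exact: (OOM H).
    have -> : cf iota x y (y l) j = (j == l)%:R; last by rewrite (negbTE jl) !mulr0.
    move: {jl} j; apply: (comb_inj rb); rewrite -(cfP rb Oy).
    by rewrite (bigD1 l) //= eqxx rmorph1 mul1r big1 ?addr0 // => j /negbTE ->; rewrite rmorph0 mul0r.
  have -> : \sum_j ev iota x (p j) * (ev iota x dl * dual iota x y j * y l) = ev iota x 0 * 1.
    rewrite rmorph0 mul0r -[RHS](mul0r (ev iota x dl * y l)) -[in RHS]pE mulr_suml.
    by apply: eq_bigr => j _; ring.
  rewrite (tr_evM H xnc rb) ?mul0r; last exact: (OO1 H).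
  by move=> /esym/eqP; rewrite mulf_eq0 (negbTE dl0) => /eqP.
case=> j m; have := congr1 (fun q : {poly k} => q`_m) (p0 j).
by rewrite /p coef_poly ltn_ord coef0 /c' valK.
Qed.

Lemma form_finite i b P : 0 < v P (x - iota b) -> vge v P (1 - v P (x - iota b)) (form i).
Proof.
move=> oP; case: i => j m; rewrite /form /= (vgeMl H) ?expf_neq0 // (vX H) //.
have vx : 0 <= v P x := over_ge0 H xnc oP.
apply: (@vge_le _ _ _ _ (1 - v P (x - iota b))); first by nia.
apply: (different_bound H xnc rb (dl := \det (trmat iota x y))) => //.
- exact: (det_trmat_neq0 H xnc rb).
- exact: (OOdual H xnc rb).
- by move=> u Ou; rewrite (tr_dual H xnc rb) // dvdp_mulr.
Qed.

Lemma form_infinite i P : v P x < 0 -> vge v P (1 + v P x) (x ^+ 2 * form i).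
Proof.
move=> vx; case: i => j m; rewrite /form /= mulrA -exprD.
have aj := ltn_ord m.
have xs := expf_neq0 (a j - (2 + m)) x0.
have : vge v P (1 - v P (x^-1 - iota 0)) (dual iota x^-1 y' j).
  apply: (different_bound H xVnc rb' (dl := \det (trmat iota x^-1 y'))) => //.
  - exact: (det_trmat_neq0 H xVnc rb').
  - exact: (OOdual H xVnc rb').
  - by move=> u Ou; rewrite (tr_dual H xVnc rb') // dvdp_mulr.
  - by rewrite /over rmorph0 subr0 (vV H) // oppr_gt0.
rewrite rmorph0 subr0 (vV H) // opprK dual_inv.
(* From m < a j - 1 follows 2 + m <= a j; dividing by the remaining power of [x], which has a pole
   at [P], can only raise the order. *)
have -> : x ^+ a j = x ^+ (a j - (2 + m)) * x ^+ (2 + m) by rewrite -exprD subnK //; lia.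
rewrite -mulrA (vgeMl H) // (vX H) //; apply: vge_le; nia.
Qed.

End Inv.

(* The Hurwitz formula, in the form of an inequality for the ramification over
   [0], [1] and [oo] only. *)
Theorem three_point_genus :
  exists (d N : nat) (h : 'I_N -> F),
  [/\ forall b (ps : seq T), uniq ps -> (forall P, (P \in ps) = (0 < v P (x - iota b))) ->
        \sum_(P <- ps) v P (x - iota b) = d%:Z,
      forall ps : seq T, uniq ps -> (forall P, (P \in ps) = (v P x < 0)) ->
        \sum_(P <- ps) - v P x = d%:Z,
      forall ps0 ps1 psoo : seq T, (forall P, 0 < v P x -> P \in ps0) ->
        (forall P, 0 < v P (x - 1) -> P \in ps1) -> (forall P, v P x < 0 -> P \in psoo) ->
        (d + 2 <= 2 * N + size ps0 + size ps1 + size psoo)%N,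
      forall c : 'I_N -> k, \sum_i iota (c i) * h i = 0 -> forall i, c i = 0 &
      forall i P, (forall b, 0 < v P (x - iota b) -> vge v P (1 - v P (x - iota b)) (h i)) /\
        (v P x < 0 -> vge v P (1 + v P x) (x ^+ 2 * h i))].
Proof.
have [n [y [a rb]]] := reduced_basis_exists H xnc.
have x0 := nonconst_neq0 xnc; have xV c := inv_nonconst xnc c.
have rb' := reduced_basis_inv H xnc rb.
exists n.+1, #|{: form_index a}|, (fun i => form y (enum_val i)); split.
- by move=> b ps ups psP; apply: (degree_over H xnc rb).
- move=> ps ups psP; have <- := degree_over H xV rb' (b := 0) ups.
    by apply: eq_bigr => P _; rewrite rmorph0 subr0 (vV H).
  by move=> P; rewrite psP /over rmorph0 subr0 (vV H) // oppr_gt0.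
(* With d = n + 1, [branch_bound] gives 3d <= 2 * sum a + the number of points, and [num_forms]
   gives sum a <= N + d - 1. *)
- move=> ps0 ps1 psoo p0 p1 poo; have := branch_bound rb p0 p1 poo.
  have := num_forms rb.
  have -> : #|{: form_index a}| = (\sum_j (a j).-1)%N.
    by rewrite card_tagged sumnE big_map big_enum; apply: eq_bigr => j _; rewrite card_ord.
  by move: (\sum_j _)%N (\sum_j (a j).-1)%N => *; lia.
- move=> c c0 i; have := form_indep rb (c := fun u => c (enum_rank u)).
  rewrite -(enum_valK i); apply; rewrite -[RHS]c0 [RHS](reindex (fun u => enum_rank u)) /=.
    by apply: eq_bigr => u _; rewrite enum_rankK.
  by apply: onW_bij; apply: enum_rank_bij.
- by move=> i P; split=> [b|]; [exact: form_finite|exact: form_infinite].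
Qed.

End Genus.

(** Over a [b] that is neither a zero of the discriminant nor the value of [x] at a point of [s],
    the fibre has as many points as the degree, so each has multiplicity 1. *)
Lemma generic_unramified (k : numClosedFieldType) (F : fieldType) (iota : {rmorphism k -> F})
  (T : eqType) (v : T -> F -> int) (H : curve_field iota v) (x : F) (xnc : forall c, x != iota c)
  (s : seq T) : exists P b, P \notin s /\ v P (x - iota b) = 1.
Proof.
have [n [y [a rb]]] := reduced_basis_exists H xnc.
have cex P : exists c, 0 <= v P x -> 0 < v P (x - iota c).
  have [vx|vx] := boolP (0 <= v P x); last by exists 0.
  have [|c cP] := v_res H (P := P) (h := x); first by rewrite vgeE // (nonconst_neq0 xnc).
  by exists c => _; move: cP; rewrite vgeE ?(x_sub_neq0 xnc).
pose c P := sval (cid (cex P)).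
have cP P : 0 <= v P x -> 0 < v P (x - iota (c P)) by rewrite /c; case: cid.
have [b bP] : exists b, ~~ root (\det (trmat iota x y) * \prod_(P <- s) ('X - (c P)%:P)) b.
  apply/closed_nonrootP; rewrite mulf_neq0 ?(det_trmat_neq0 H xnc rb) // prodf_seq_neq0.
  by apply/allP => P _; rewrite /= polyXsubC_eq0.
move: bP; rewrite rootM negb_or => /andP [nd nc].
have [ps ups psP] := over_list H xnc b.
have szp : (n.+1 <= size ps)%N.
  rewrite leqNgt -subn_gt0; apply/negP => lt.
  have := disc_dvd H xnc rb (b := b) (ps := ps) (fun P oP => etrans (psP P) oP).
  rewrite -(prednK lt) exprS => /dvdp_trans - /(_ _ (dvdpp _)).
  move/(dvdp_trans (dvdp_mulr _ (dvdpp _))); rewrite dvdp_XsubCl.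
  by rewrite (negbTE nd).
have E := degree_over H xnc rb ups psP.
have all1 P : P \in ps -> v P (x - iota b) = 1.
  move=> Pps; have ge1 Q : Q \in ps -> 1 <= v Q (x - iota b) by rewrite psP.
  have := ge1 P Pps; have : \sum_(Q <- rem P ps) 1 <= \sum_(Q <- rem P ps) v Q (x - iota b).
    by rewrite !big_seq; apply: ler_sum => Q /mem_rem /ge1.
  have sz1 (r : seq T) : \sum_(Q <- r) 1 = (size r)%:Z.
    by elim: r => [|Q r IH]; rewrite ?big_nil // big_cons IH /=; lia.
  rewrite sz1 size_rem //; have := E; rewrite (big_rem P Pps) /=.
  by move: szp; move: (size ps) (v P _) (\sum_(Q <- _) _) => *; lia.
case: ps ups psP szp E all1 => // P ps ups psP szp E all1; exists P, b.
have oP := all1 P (mem_head _ _); split=> //; apply: contra nc => Ps.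
rewrite /root horner_prod (big_rem P Ps) /= hornerXsubC mulf_eq0 subr_eq0; apply/orP; left.
apply/negPn/negP => bc; have ov : over iota v x b P by rewrite /over oP.
have := v_const H P (c := b - c P); rewrite subr_eq0 => /(_ bc).
have cp := cP P (over_ge0 H xnc ov).
have : vge v P 1 (iota (b - c P)).
  rewrite (_ : iota (b - c P) = (x - iota (c P)) - (x - iota b)); last by rewrite rmorphB /=; ring.
  by apply: (vgeB H); rewrite vgeE ?(x_sub_neq0 xnc) ?oP.
by rewrite vgeE ?fmorph_eq0 ?subr_eq0 // => + E0; rewrite E0.
Qed.

(** * Cross ratios and trees of projective lines *)

Section CrossRatio.
Variable k : fieldType.
Implicit Types a b c d z w p q r : P1 k.

Definition hcrd z : k * k := if z is Some a then (a, 1) else (1, 0).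

Lemma bracketE z w : bracket z w = (hcrd z).1 * (hcrd w).2 - (hcrd z).2 * (hcrd w).1.
Proof. by case: z => [a|]; case: w => [b|] /=; ring. Qed.

Lemma bracket_eq0 z w : (bracket z w == 0) = (z == w).
Proof.
case: z => [a|]; case: w => [b|] /=; rewrite ?subr_eq0 ?oppr_eq0 ?oner_eq0 ?eqxx //.
Qed.

Lemma bracketzz z : bracket z z = 0. Proof. by apply/eqP; rewrite bracket_eq0. Qed.

(** The equation of the cross ratio with denominators cleared. It remains meaningful when points
    collide, and is vacuous when three of them do. *)
Definition crel a b c d z : Prop :=
  (hcrd z).1 * (bracket d c * bracket b a) = (hcrd z).2 * (bracket d a * bracket b c).

Lemma cross_ratioP a b c d z : a != b -> b != c -> a != c ->
  crel a b c d z <-> z = cross_ratio a b c d.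
Proof.
move=> ab bc ac; rewrite /crel /cross_ratio.
have n0 : (bracket d c * bracket b a != 0) || (bracket d a * bracket b c != 0).
  rewrite !mulf_eq0 !bracket_eq0 (eq_sym b a) (negbTE ab) (negbTE bc) !orbF.
  by have [->|//] := eqVneq d c; rewrite eq_sym ac.
case: eqP => [dc0|/eqP dc0].
  rewrite dc0 eqxx /= in n0 *; rewrite mulr0; case: z => [u|] /=.
    by split=> // /esym/eqP; rewrite mul1r (negbTE n0).
  by rewrite mul0r.
case: z => [u|] /=.
  rewrite mul1r; split=> [<-|[->]]; first by rewrite mulfK.
  by rewrite divfK.
by rewrite mul1r mul0r; split=> // /eqP; rewrite (negbTE dc0).
Qed.

Lemma cross_ratio_sep a b c d : a != b -> b != c -> a != c ->
  crel a b c d (cross_ratio a b c d).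
Proof. by move=> *; apply/cross_ratioP. Qed.

Lemma cross_ratio0 a b c : a != b -> b != c -> a != c -> cross_ratio a b c a = Some 0.
Proof.
move=> ab bc ac; apply/esym/cross_ratioP => //.
by rewrite /crel /= bracketzz !mul0r mulr0.
Qed.
Lemma cross_ratio1 a b c : a != b -> b != c -> a != c -> cross_ratio a b c b = Some 1.
Proof. by move=> ab bc ac; apply/esym/cross_ratioP => //; rewrite /crel /=; ring. Qed.
Lemma cross_ratiooo a b c : a != b -> b != c -> a != c -> cross_ratio a b c c = None.
Proof.
move=> ab bc ac; apply/esym/cross_ratioP => //.
by rewrite /crel /= bracketzz !mul0r mulr0.
Qed.

Lemma bracket_cross_ratio p q r : p != q -> q != r -> p != r ->
  exists (ka : k) (la : P1 k -> k), [/\ ka != 0, forall z, la z != 0 &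
    forall z w, bracket (cross_ratio p q r z) (cross_ratio p q r w) = ka * la z * la w * bracket z w].
Proof.
move=> pq qr pr.
pose la z : k := if bracket z r * bracket q p == 0 then (bracket z p * bracket q r)^-1
  else (bracket z r * bracket q p)^-1.
have qp0 : bracket q p != 0 by rewrite bracket_eq0 eq_sym.
have qr0 : bracket q r != 0 by rewrite bracket_eq0.
have la0 z : la z != 0.
  rewrite /la; case: ifP => [|/negbT]; rewrite invr_eq0 //.
  rewrite mulf_eq0 (negbTE qp0) orbF bracket_eq0 => /eqP ->.
  by rewrite mulf_eq0 negb_or qr0 bracket_eq0 eq_sym pr.
have laE z : (hcrd (cross_ratio p q r z)).1 = la z * (bracket z p * bracket q r) /\
             (hcrd (cross_ratio p q r z)).2 = la z * (bracket z r * bracket q p).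
  have := la0 z; rewrite /la /cross_ratio; case: ifP => [/eqP zr|/negbT zr] /=; rewrite invr_eq0 => l0.
    by rewrite zr mulr0 mulVf.
  by rewrite mulVf // mulrC.
exists (bracket q r * bracket q p * bracket p r), la; split=> //.
  by rewrite !mulf_neq0 // bracket_eq0.
move=> z w; rewrite bracketE !(laE z).1 !(laE z).2 !(laE w).1 !(laE w).2 !bracketE; ring.
Qed.

Lemma crel_moebius p q r a b c d z : p != q -> q != r -> p != r ->
  crel a b c d z -> crel (cross_ratio p q r a) (cross_ratio p q r b)
    (cross_ratio p q r c) (cross_ratio p q r d) z.
Proof.
move=> pq qr pr; have [ka [la [_ _ E]]] := bracket_cross_ratio pq qr pr.
rewrite /crel !E => R.
transitivity (ka ^+ 2 * la a * la b * la c * la d * ((hcrd z).1 * (bracket d c * bracket b a))); first by ring.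
by rewrite R; ring.
Qed.

End CrossRatio.

(** * Paths in a tree *)

Section Paths.
Variables (T : finType) (e : rel T).
Hypotheses (es : ssrbool.symmetric e).
Hypothesis eP : forall v w, exists! p, simple_path e v w p.

Definition pth (v w : T) : seq T := sval (cid (eP v w)).

Lemma pthP v w : simple_path e v w (pth v w).
Proof. by rewrite /pth; case: cid => p []. Qed.

Lemma pth_uniq v w p : simple_path e v w p -> p = pth v w.
Proof. by move=> sp; rewrite /pth; case: cid => q /= [_ qu]; apply/esym/qu. Qed.

Lemma pthvv v : pth v v = [::].
Proof. by apply/esym/pth_uniq; split. Qed.

Lemma pth_nil v w : pth v w = [::] -> v = w.
Proof. by have [_ + _] := pthP v w => /[swap] -> /=. Qed.

(** The neighbour of [v] in the direction of [w], with default [v] for w = v. *)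
Definition step v w := head v (pth v w).

Lemma step_prefix v w z : z \in pth v w -> step v z = step v w.
Proof.
move=> zp; have [pp lp up] := pthP v w.
rewrite /step; case/splitPr: (pth v w) / zp pp lp up => p1 p2.
rewrite -cat_rcons cat_path => /andP [p1p _] _ up.
have <- : rcons p1 z = pth v z.
  apply: pth_uniq; split=> //; first by rewrite last_rcons.
  by move: up; rewrite -cat_cons cat_uniq => /andP [].
by case: (p1) => [|? ?].
Qed.

(** When [u] is not in the direction of [w] from [v], the path from [w] to [u] is the reversed path
    from [v] to [w] followed by the one from [v] to [u]. *)
Lemma step_back v w u : v != w -> u = v \/ step v u != step v w -> 
  w != u /\ step w u = step w v.
Proof.
move=> vw vu.
set p := pth v w; set q := pth v u.
have [pp lp up] := pthP v w; have [pq lq uq] := pthP v u.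
rewrite -/p in pp lp up; rewrite -/q in pq lq uq.
have disj z : z \in q -> z \notin v :: p.
  move=> zq; rewrite inE negb_or; apply/andP; split.
    by apply: contraTneq uq => <- /=; rewrite zq.
  apply/negP => zp; case: vu => [uv|/eqP []].
    by move: zq; rewrite /q uv pthvv.
  by rewrite -(step_prefix zq) -(step_prefix zp).
have rv : rev (v :: p) = w :: rev (belast v p).
  by rewrite lastI rev_rcons lp.
have pr : path e w (rev (belast v p)).
  rewrite -{1}lp rev_path; rewrite (@eq_path _ _ e) // => x y; exact: es.
have lr : last w (rev (belast v p)) = v.
  have : last w (w :: rev (belast v p)) = last w (rev (v :: p)) by rewrite rv.
  by rewrite rev_cons last_rcons.
have s1 : rev (belast v p) = pth w v.
  by apply: pth_uniq; split=> //; rewrite -rv rev_uniq.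
have s2 : rev (belast v p) ++ q = pth w u.
  apply: pth_uniq; split.
  - by rewrite cat_path pr lr pq.
  - by rewrite last_cat lr.
  - rewrite -cat_cons -rv cat_uniq rev_uniq up; have /andP [_ ->] : (v \notin q) && uniq q := uq; rewrite andbT.
    by apply/hasPn => z zq; rewrite mem_rev; exact: disj.
have ne : rev (belast v p) != [::].
  by apply: contraNneq vw; rewrite s1 => /pth_nil ->.
split; last by rewrite /step -s1 -s2; case: (rev _) ne.
apply: contraNneq ne => wu; have : rev (belast v p) ++ q = [::] by rewrite s2 wu pthvv.
by case: (rev _).
Qed.

End Paths.

(** * Cross ratios of a stable curve *)

Section StableRelations.
Variables (k : fieldType) (n : nat).

Lemma quad_ex (a b c d : 'I_n) : uniq [:: a; b; c; d] -> exists q : quad n,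
  [/\ mark q (inord 0) = a, mark q (inord 1) = b, mark q (inord 2) = c & mark q (inord 3) = d].
Proof.
move=> u; exists (exist _ [tuple a; b; c; d] u).
by rewrite /mark /= !(tnth_nth a) /= !inordK.
Qed.

(** The coordinates of [x] as a function of four labels; where the fourth repeats one of the first
    three, the value is 0, 1 or oo, as for a cross ratio. *)
Definition xq (x : quad n -> P1 k) (i j l m : 'I_n) : P1 k :=
  if insub [tuple i; j; l; m] is Some q then x q
  else if m == i then Some 0 else if m == j then Some 1 else None.

Lemma xq_quad x (q : quad n) : xq x (mark q (inord 0)) (mark q (inord 1))
  (mark q (inord 2)) (mark q (inord 3)) = x q.
Proof.
rewrite /xq; have E : [tuple mark q (inord 0); mark q (inord 1); mark q (inord 2); mark q (inord 3)] = val q.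
  apply: eq_from_tnth => i; rewrite /mark (tnth_nth (tnth (val q) i)) /=.
  by case: i => [[|[|[|[|i]]]] Hi] //=; congr (tnth _ _); apply: val_inj; rewrite /= inordK.
by rewrite E valK.
Qed.

Lemma quad_uniq (q : quad n) : uniq [:: mark q (inord 0); mark q (inord 1);
  mark q (inord 2); mark q (inord 3)].
Proof.
have E : [tuple mark q (inord 0); mark q (inord 1); mark q (inord 2); mark q (inord 3)] = val q.
  apply: eq_from_tnth => i; rewrite /mark (tnth_nth (tnth (val q) i)) /=.
  by case: i => [[|[|[|[|i]]]] Hi] //=; congr (tnth _ _); apply: val_inj; rewrite /= inordK.
by rewrite (_ : [:: _; _; _; _] = val (val q)) ?(valP q) // -E.
Qed.

Lemma xq0 x i j l : xq x i j l i = Some 0.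
Proof. by rewrite /xq insubN ?eqxx //= !inE eqxx ?orbT. Qed.
Lemma xq1 x i j l : i != j -> xq x i j l j = Some 1.
Proof. by move=> ij; rewrite /xq insubN /= ?inE ?eqxx ?orbT ?andbF // eq_sym (negbTE ij). Qed.
Lemma xqoo x i j l : i != l -> j != l -> xq x i j l l = None.
Proof.
move=> il jl; rewrite /xq insubN /= ?inE ?eqxx ?orbT ?andbF //.
by rewrite eq_sym (negbTE il) eq_sym (negbTE jl).
Qed.

(** The equations of [Mbar0] in the product of projective lines: positions with respect to any base
    triple have the cross ratios prescribed by [x], as far as collisions leave these determined. *)
Definition crsys (x : quad n -> P1 k) : Prop :=
  forall i j l : 'I_n, uniq [:: i; j; l] -> forall q : quad n,
    crel (xq x i j l (mark q (inord 0))) (xq x i j l (mark q (inord 1)))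
         (xq x i j l (mark q (inord 2))) (xq x i j l (mark q (inord 3))) (x q).

Lemma crsysP x i j l a b c d : crsys x -> uniq [:: i; j; l] -> uniq [:: a; b; c] ->
  crel (xq x i j l a) (xq x i j l b) (xq x i j l c) (xq x i j l d) (xq x a b c d).
Proof.
move=> xs uijl uabc; have := uabc; rewrite /= !inE !negb_or andbT => /andP [/andP [ab ac] bc].
have [->|da] := eqVneq d a.
  by rewrite xq0 /crel /= bracketzz !mul0r mulr0.
have [->|db] := eqVneq d b.
  by rewrite xq1 // /crel /=; ring.
have [->|dc] := eqVneq d c.
  by rewrite xqoo // /crel /= bracketzz !mul0r mulr0.
have [|q [<- <- <- <-]] := @quad_ex a b c d.
  by rewrite /= !inE !negb_or ab ac bc [a == d]eq_sym da [b == d]eq_sym db [c == d]eq_sym dc.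
rewrite xq_quad; exact: xs.
Qed.

Section Curve.
Variable S : pointed_curve k n.
Hypothesis st : stable_rational S.

Let es : ssrbool.symmetric (adj S). Proof. by case: st => [[]]. Qed.
Let eP : forall v w : comp S, exists! p, simple_path (adj S) v w p. Proof. by case: st. Qed.

Definition retract (v : comp S) (i : 'I_n) : P1 k :=
  if mcomp S i == v then mpos S i else node S v (step eP v (mcomp S i)).
Definition toward v w := node S v (step eP v w).

Lemma retracts_toP v i z : retracts_to v i z <-> z = retract v i.
Proof.
rewrite /retract; split.
  case=> [[-> ->]|[w [p [sp ->]]]]; first by rewrite eqxx.
  have E := pth_uniq eP sp; case: eqP => [mv|_].
    by move: E; rewrite mv pthvv.
  by rewrite /step -E.
case: eqP => [mv ->|/eqP mv ->]; first by left.
right; have := pthP eP v (mcomp S i); rewrite /step.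
case E : (pth eP v (mcomp S i)) => [|w p] sp; last by exists w, p.
by move: mv; rewrite (pth_nil E) eqxx.
Qed.

(** By [step_back] the path from [w] to such a mark starts like the path to [v]. *)
Lemma retract_far v w i : v != w -> retract v i != toward v w -> retract w i = toward w v.
Proof.
move=> vw; rewrite /retract /toward => ri.
have [|wu E] := @step_back _ _ es eP v w (mcomp S i) vw.
  case: (mcomp S i =P v) ri => [->|_] ri; [by left|right].
  by apply: contraNneq ri => ->.
by rewrite eq_sym (negbTE wu) E.
Qed.

(** On another component [w], all marks that are not in the direction of [w] from [v] retract to one
    point; of three marks separated on [v], at least two are of this kind. *)
Lemma sep_comp_uniq v w (i j l : 'I_n) :
  retract v i != retract v j -> retract v j != retract v l -> retract v i != retract v l ->
  retract w i != retract w j -> retract w j != retract w l -> retract w i != retract w l -> v = w.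
Proof.
move=> v1 v2 v3 w1 w2 w3; apply/eqP/negPn/negP => vw.
have R m := @retract_far v w m vw.
have [Ei|/R Ei] := eqVneq (retract v i) (toward v w).
  rewrite Ei in v1 v3; rewrite eq_sym in v1; rewrite eq_sym in v3.
  by move: w2; rewrite (R _ v1) (R _ v3) eqxx.
have [Ej|/R Ej] := eqVneq (retract v j) (toward v w).
  by rewrite Ej eq_sym in v2; move: w3; rewrite Ei (R _ v2) eqxx.
by move: w1; rewrite Ei Ej eqxx.
Qed.

Lemma represents_cross_ratio (x : P1s k (quad n)) (q : quad n) : represents x S ->
  exists v, [/\ retract v (mark q (inord 0)) != retract v (mark q (inord 1)),
    retract v (mark q (inord 1)) != retract v (mark q (inord 2)),
    retract v (mark q (inord 0)) != retract v (mark q (inord 2)) &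
    x q = cross_ratio (retract v (mark q (inord 0))) (retract v (mark q (inord 1)))
      (retract v (mark q (inord 2))) (retract v (mark q (inord 3)))].
Proof.
case=> _ /(_ q) [v [a [ra [a1 a2 a3] ->]]]; exists v.
have E j : a j = retract v (mark q j) by apply/retracts_toP.
by rewrite !E in a1 a2 a3 *; split=> //; apply/eqP.
Qed.

Lemma represents_crsys (x : P1s k (quad n)) : represents x S -> crsys x.
Proof.
move=> rx i j l uijl q; have := uijl; rewrite /= !inE !negb_or andbT => /andP [/andP [ij il] jl].
(* A fourth label exists because [q] has four; it provides a cross ratio whose component separates
   [i], [j], [l]. *)
have [m mP] : exists m, m \notin [:: i; j; l].
  apply: contrapT => nm.
  have sub : {subset [:: mark q (inord 0); mark q (inord 1); mark q (inord 2); mark q (inord 3)] <= [:: i; j; l]}.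
    by move=> m _; apply/negPn/negP => mn; apply: nm; exists m.
  by have := uniq_leq_size (quad_uniq q) sub.
have [v [v1 v2 v3]] : exists v, [/\ retract v i != retract v j, retract v j != retract v l &
    retract v i != retract v l].
  have [|q' [<- <- <- _]] := @quad_ex i j l m.
    move: mP; rewrite /= !inE !negb_or ij il jl => /and3P [mi mj ml].
    by rewrite [i == m]eq_sym mi [j == m]eq_sym mj [l == m]eq_sym ml.
  by have [v [*]] := represents_cross_ratio q' rx; exists v.
have E u : xq x i j l u = cross_ratio (retract v i) (retract v j) (retract v l) (retract v u).
  have [->|ui] := eqVneq u i; first by rewrite xq0 cross_ratio0.
  have [->|uj] := eqVneq u j; first by rewrite xq1 // cross_ratio1.
  have [->|ul] := eqVneq u l; first by rewrite xqoo // cross_ratiooo.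
  have [|q' [qi qj ql qu]] := @quad_ex i j l u.
    by rewrite /= !inE !negb_or ij il jl [i == u]eq_sym ui [j == u]eq_sym uj [l == u]eq_sym ul.
  have [w [w1 w2 w3 xw]] := represents_cross_ratio q' rx.
  rewrite -qi -qj -ql -qu xq_quad xw.
  by rewrite -qi -qj -ql in v1 v2 v3; rewrite (sep_comp_uniq w1 w2 w3 v1 v2 v3).
rewrite !E; apply: crel_moebius => //.
have [w [w1 w2 w3 ->]] := represents_cross_ratio q rx.
set a := mark q (inord 0) in w1 w3 *; set b := mark q (inord 1) in w1 w2 *.
set c := mark q (inord 2) in w2 w3 *; set d := mark q (inord 3).
have [<-|wv] := eqVneq w v; first exact: cross_ratio_sep.
have vw : v != w by rewrite eq_sym.
(* [w] separates the first three marks of [q]. If it is not [v], at least two of them retract to the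
   same point [N] of [v], so that the relation degenerates and can be checked case by case. *)
have R u := @retract_far v w u vw.
set N := toward v w in R.
have [Ea|/R Ea] := eqVneq (retract v a) N; last first.
  have Eb : retract v b = N.
    by apply/eqP; apply: contraNT w1 => /R ->; rewrite Ea.
  have Ec : retract v c = N.
    by apply/eqP; apply: contraNT w3 => /R ->; rewrite Ea.
  rewrite /crel Eb Ec bracketzz !mulr0.
  have [->|/R Ed] := eqVneq (retract v d) N; first by rewrite bracketzz !mul0r mulr0.
  by rewrite Ed -Ea cross_ratio0 //= mul0r.
have [Eb|/R Eb] := eqVneq (retract v b) N.
  rewrite /crel Ea Eb bracketzz !mulr0.
  have [->|/R Ed] := eqVneq (retract v d) N; first by rewrite bracketzz !mul0r mulr0.
  have [->|/R Ec] := eqVneq (retract v c) N; first by rewrite bracketzz !mulr0.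
  by rewrite Ed -Ec cross_ratiooo //= mul0r.
have Ec : retract v c = N.
  by apply/eqP; apply: contraNT w2 => /R ->; rewrite Eb.
rewrite /crel Ea Ec.
have [->|/R Ed] := eqVneq (retract v d) N; first by rewrite bracketzz !mul0r !mulr0.
by rewrite Ed -Eb cross_ratio1.
Qed.

End Curve.
End StableRelations.

(** * Rooted trees as graphs *)

Section RootedTree.
Variables (T : finType) (le : rel T) (par : T -> T) (root : T).
Hypotheses (le_refl : reflexive le) (le_tr : transitive le) (le_anti : antisymmetric le).
Hypotheses (root_top : forall x, le x root)
  (par_gt : forall x, x != root -> le x (par x) /\ par x != x)
  (par_min : forall x y, x != root -> le x y -> x != y -> le (par x) y).

Definition padj (x y : T) : bool :=
  ((x != root) && (par x == y)) || ((y != root) && (par y == x)).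

Lemma padj_sym : ssrbool.symmetric padj.
Proof. by move=> x y; rewrite /padj orbC. Qed.

Lemma padj_irr : irreflexive padj.
Proof. by move=> x; rewrite /padj orbb; apply/negP => /andP [/par_gt [_ /negbTE ->]]. Qed.

Lemma par_ngt x : x != root -> ~~ le (par x) x.
Proof.
move=> xr; have [xp px] := par_gt xr; apply: contraNN px => pxx.
by rewrite (le_anti (introT andP (conj pxx xp))).
Qed.

(** The only edge that enters the set below [c] joins [c] to its parent; this forces the steps of a
    simple path. *)
Lemma cross_edge c y z : padj y z -> ~~ le y c -> le z c -> z = c /\ (c != root) && (par c == y).
Proof.
case/orP=> /andP [nr /eqP E] yc zc.
  have [yp _] := par_gt nr; rewrite E in yp.
  by rewrite (le_tr yp zc) in yc.
have [zE|zne] := eqVneq z c; first by split=> //; rewrite -zE nr E eqxx.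
by have := par_min nr zc zne; rewrite E (negbTE yc).
Qed.

Lemma path_cross (A : pred T) x p : path padj x p -> A x -> ~~ A (last x p) ->
  exists y z, [/\ y \in x :: p, z \in x :: p, padj y z, A y & ~~ A z].
Proof.
elim: p x => [|u p IH] x /=; first by move=> _ ->.
case/andP=> xu pp Ax Al; have [Au|nAu] := boolP (A u).
  have [y [z [yp zp *]]] := IH u pp Au Al; exists y, z.
  by split=> //; rewrite inE ?yp ?zp orbT.
by exists x, u; split=> //; rewrite !inE eqxx ?orbT.
Qed.

Lemma first_down v w c u p : c != root -> par c = v -> le w c ->
  simple_path padj v w (u :: p) -> u = c.
Proof.
move=> cr pc wc [/= /andP [vu pp] lp /andP [vp up]].
apply/eqP/negPn/negP => uc.
have nvc : ~~ le v c by rewrite -pc par_ngt.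
have nuc : ~~ le u c.
  by apply/negP => luc; have [E _] := cross_edge vu nvc luc; rewrite E eqxx in uc.
have [|y [z [yp zp yz yc]]] := @path_cross (fun z => ~~ le z c) u p pp nuc.
  by rewrite lp wc.
rewrite negbK => zc; have [_ /andP [_ /eqP E]] := cross_edge yz yc zc.
by move: vp; rewrite -pc E yp.
Qed.

Lemma first_up v w u p : ~~ le w v -> simple_path padj v w (u :: p) ->
  v != root /\ u = par v.
Proof.
move=> wv [/= /andP [vu pp] lp /andP [vp up]].
have vr : v != root by apply: contraNneq wv => ->; exact: root_top.
split=> //; case/orP: (vu) => /andP [nr /eqP E] //.
have luv : le u v by rewrite -E; case: (par_gt nr).
have [|y [z [yp zp yz yv zv]]] := @path_cross (fun z => le z v) u p pp luv.
  by rewrite lp.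
rewrite padj_sym in yz; have [Ey _] := cross_edge yz zv yv.
by move: vp; rewrite -Ey yp.
Qed.

Lemma child_toward v w : le w v -> w != v -> exists c, [/\ c != root, par c = v & le w c].
Proof.
move=> wv wne; pose A c := [&& le w c, le c v & c != v].
have Aw : A w by rewrite /A le_refl wv.
case: (arg_maxnP (P := A) (fun c => #|[set z | le z c]|) Aw) => c /and3P [wc cv cne] cmax.
have cr : c != root.
  apply: contraNneq cne => cE; apply/eqP/le_anti; rewrite cv {1}cE root_top //.
have [cp pc] := par_gt cr; exists c; split=> //; apply/eqP/negPn/negP => pv.
have : A (par c) by rewrite /A (le_tr wc cp) par_min.
move/cmax; apply/negP; rewrite -ltnNge; apply: proper_card; apply/properP; split.
  by apply/fintype.subsetP => z; rewrite !inE => zc; exact: le_tr zc cp.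
by exists (par c); rewrite inE ?le_refl // (negbTE (par_ngt cr)).
Qed.

(** Every vertex is joined to the root through its ancestors. The first step of a simple path is
    forced: to the child above the target, or else to the parent. *)
Lemma tree_paths v w : exists! p, simple_path padj v w p.
Proof.
have conn x : connect padj x root.
  move: {2}(#|[set z | le x z]|) (leqnn #|[set z | le x z]|) => m.
  elim: m x => [|m IH] x.
    by rewrite leqNgt card_gt0 => /negP []; apply/set0Pn; exists x; rewrite inE le_refl.
  have [->|xr] := eqVneq x root; first by rewrite connect0.
  move=> xm; have [xp px] := par_gt xr.
  apply: connect_trans (connect1 (_ : padj x (par x))) (IH _ _).
    by rewrite /padj xr eqxx.
  rewrite -ltnS; apply: leq_trans xm; apply: proper_card; apply/properP; split.
    by apply/fintype.subsetP => z; rewrite !inE; exact: le_tr.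
  by exists x; rewrite inE ?le_refl // par_ngt.
have : connect padj v w.
  apply: connect_trans (conn v) _; rewrite (sym_connect_sym padj_sym); exact: conn.
case/connectP => p0 pp0 lp0; case: (shortenP pp0) lp0 => p pp up _ lp.
exists p; split=> [|p']; first by split=> //; rewrite -lp.
have : simple_path padj v w p by split=> //; rewrite -lp.
move: p p' {pp up lp pp0 p0}; suff U v' w' p p' : simple_path padj v' w' p ->
    simple_path padj v' w' p' -> p = p' by move=> p p' s1 s2; exact: (U _ _ _ _ s1 s2).
elim: p v' p' => [|u p IH] v' p'.
  move=> [_ /= vw _] [_ + up]; rewrite -vw; case: p' up => //= u' p'.
  by move=> /andP [+ _] lp; rewrite -[X in X \notin _]lp mem_last.
case: p' => [|u' p'].
  move=> [_ + up] [_ /= vw _]; rewrite -vw /= => lp.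
  by move: up; rewrite /= -[X in X \notin _]lp mem_last.
move=> s1 s2; have vw : w' != v'.
  case: s1 => _ /= <- /= /andP [+ _]; apply: contraNneq => <-; exact: mem_last.
have uu : u = u'.
  have [wv|wv] := boolP (le w' v').
    have [c [cr pc wc]] := child_toward wv vw.
    by rewrite (first_down cr pc wc s1) (first_down cr pc wc s2).
  by rewrite (first_up wv s1).2 (first_up wv s2).2.
subst u'; congr (_ :: _); apply: (IH u).
  by case: s1 => /= /andP [_ ?] ? /andP [_ ?]; split.
by case: s2 => /= /andP [_ ?] ? /andP [_ ?]; split.
Qed.

Lemma path_step v w : v != w -> exists u p, simple_path padj v w (u :: p).
Proof.
move=> vw; have [[|u p] [sp _]] := tree_paths v w; last by exists u, p.
by case: sp => _ /= E; rewrite E eqxx in vw.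
Qed.

End RootedTree.

(** * The stable curve of a system of cross ratios *)

Section Clusters.
Variables (k : fieldType) (n : nat) (x : quad n -> P1 k).
Hypothesis xs : crsys x.
Variable rho : 'I_n.

Definition okpair (j l : 'I_n) : bool := [&& j != l, j != rho & l != rho].
(** The position of [m] in the coordinate with [j], [l], [rho] at 0, 1, oo. The marked point [rho]
    serves as the root of the tree. *)
Definition ps (j l m : 'I_n) : P1 k := xq x j l rho m.

Lemma ps0 j l : ps j l j = Some 0. Proof. exact: xq0. Qed.
Lemma ps1 j l : okpair j l -> ps j l l = Some 1. Proof. by case/and3P=> *; exact: xq1. Qed.
Lemma psoo j l : okpair j l -> ps j l rho = None. Proof. by case/and3P=> *; exact: xqoo. Qed.

Lemma ps_rel j l a b d : okpair j l -> okpair a b ->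
  crel (ps j l a) (ps j l b) None (ps j l d) (ps a b d).
Proof.
move=> jl ab; rewrite -(psoo jl); apply: crsysP => //.
  by case/and3P: jl => *; rewrite /= !inE negb_or; apply/and3P; split=> //; apply/andP.
by case/and3P: ab => *; rewrite /= !inE negb_or; apply/and3P; split=> //; apply/andP.
Qed.

(** Two distinct finite positions define an affine change of coordinates, which preserves finiteness
    and coincidences. *)
Lemma ps_affine j l a b d : okpair j l -> okpair a b -> ps j l a != None -> ps j l b != None ->
  ps j l a != ps j l b ->
  ((ps a b d == None) = (ps j l d == None)) /\
  (forall d', ps j l d != None -> ps j l d' != None ->
     (ps a b d == ps a b d') = (ps j l d == ps j l d')).
Proof.
move=> jl ab; case Ea : (ps j l a) => [A|] // _; case Eb : (ps j l b) => [B|] // _ AB.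
have AB0 : B - A != 0 by rewrite subr_eq0; apply: contraNneq AB => ->.
have R u : (ps a b u == None) = (ps j l u == None) /\
    forall D, ps j l u = Some D -> ps a b u = Some ((D - A) / (B - A)).
  have := ps_rel u jl ab; rewrite /crel Ea Eb.
  case: (ps j l u) => [D|]; case: (ps a b u) => [z|] //=.
  - move=> E; split=> // D' [<-]; congr Some; apply: (mulIf AB0); rewrite divfK //.
    by apply: oppr_inj; move: E; rewrite mulN1r mul1r mulrN1 => <-; ring.
  - by move=> /eqP; rewrite mul1r mul0r mulf_eq0 oppr_eq0 oner_eq0 (negbTE AB0).
  - by move=> /eqP; rewrite mul0r mulr0 eq_sym !mul1r oppr_eq0 oner_eq0.
split=> [|d']; first by case: (R d).
have [_ Rd] := R d; have [_ Rd'] := R d'.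
case: (ps j l d) Rd => [D|] // /(_ _ erefl) -> _.
case: (ps j l d') Rd' => [D'|] // /(_ _ erefl) -> _.
apply/eqP/eqP => [[E]|[->] //]; congr Some.
by have iv : (B - A)^-1 != 0; [rewrite invr_eq0|move: (mulIf iv E) => /addIr ->].
Qed.

Lemma ps_branch j l a b d : okpair j l -> okpair a b -> ps j l a != None ->
  ps j l a = ps j l b -> ps a b d != None -> ps j l d = ps j l a.
Proof.
move=> jl ab; case Ea : (ps j l a) => [A|] // _ Eb; have := ps_rel d jl ab.
rewrite /crel Ea -Eb /=; case: (ps j l d) => [D|]; case: (ps a b d) => [z|] //=.
  rewrite subrr !mulr0 mul1r mulrN1 => /esym/eqP; rewrite oppr_eq0 subr_eq0.
  by move=> /eqP ->.
by move=> /eqP; rewrite subrr !mulr0 eq_sym !mul1r oppr_eq0 oner_eq0.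
Qed.

Lemma ps_outer j l a b d : okpair j l -> okpair a b -> ps j l a != None -> ps j l b = None ->
  ps j l d != None -> ps a b d = Some 0.
Proof.
move=> jl ab; case Ea : (ps j l a) => [A|] // _ Eb.
have := ps_rel d jl ab; rewrite /crel Ea Eb /=.
case: (ps j l d) => [D|] // + _; case: (ps a b d) => [z|] //=.
  by rewrite mulr0 mulr0 => /eqP; rewrite mulr1 mulf_eq0 oppr_eq0 oner_eq0 orbF => /eqP ->.
by move=> /eqP; rewrite mulr1 mul1r mul0r oppr_eq0 oner_eq0.
Qed.

(** The marks that the component separating [j], [l], [rho] does not see in the direction of [rho].
    In the tree rooted at [rho] these are the marks at or below that component, so clusters are the
    vertices and inclusion is the order. *)
Definition cluster_of (j l : 'I_n) : {set 'I_n} := [set m | ps j l m != None]%SET.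
Definition is_cluster (C : {set 'I_n}) : bool :=
  [exists j, [exists l, okpair j l && (C == cluster_of j l)]].
Definition cluster := {C : {set 'I_n} | is_cluster C}.

Lemma cluster_ofP j l : okpair j l -> is_cluster (cluster_of j l).
Proof. by move=> jl; apply/existsP; exists j; apply/existsP; exists l; rewrite jl eqxx. Qed.

Definition mkcluster j l (jl : okpair j l) : cluster :=
  exist (fun C : {set 'I_n} => is_cluster C) _ (cluster_ofP jl).

Lemma cluster_rep (C : cluster) : exists jl : 'I_n * 'I_n,
  okpair jl.1 jl.2 /\ val C = cluster_of jl.1 jl.2.
Proof.
case: C => C /= /existsP [j /existsP [l /andP [jl /eqP ->]]].
by exists (j, l).
Qed.

Definition rep1 (C : cluster) := (sval (cid (cluster_rep C))).1.
Definition rep2 (C : cluster) := (sval (cid (cluster_rep C))).2.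
Definition pc (C : cluster) (m : 'I_n) : P1 k := ps (rep1 C) (rep2 C) m.

Lemma repP C : okpair (rep1 C) (rep2 C) /\ val C = cluster_of (rep1 C) (rep2 C).
Proof. by rewrite /rep1 /rep2; case: cid. Qed.

Lemma in_cluster (C : cluster) m : (m \in val C) = (pc C m != None).
Proof. by rewrite (repP C).2 inE. Qed.
Lemma rep1_in C : rep1 C \in val C.
Proof. by rewrite in_cluster /pc ps0. Qed.
Lemma rep2_in C : rep2 C \in val C.
Proof. by rewrite in_cluster /pc ps1 // (repP C).1. Qed.
Lemma pc_rep1 C : pc C (rep1 C) = Some 0. Proof. exact: ps0. Qed.
Lemma pc_rep2 C : pc C (rep2 C) = Some 1. Proof. by apply: ps1; case: (repP C). Qed.
Lemma pc_rho C : pc C rho = None. Proof. by apply: psoo; case: (repP C). Qed.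
Lemma in_cluster_rho (C : cluster) m : m \in val C -> m != rho.
Proof. by rewrite in_cluster; apply: contraNneq => ->; rewrite pc_rho. Qed.

Lemma other_branch (C : cluster) m : exists2 m', m' \in val C & pc C m' != pc C m.
Proof.
have [E|ne] := eqVneq (pc C (rep1 C)) (pc C m); last by exists (rep1 C) => //; exact: rep1_in.
exists (rep2 C); first exact: rep2_in.
by rewrite -E pc_rep1 pc_rep2; apply/eqP => -[/eqP]; rewrite oner_eq0.
Qed.

Lemma same_cluster (C : cluster) a b : a \in val C -> b \in val C -> pc C a != pc C b ->
  okpair a b /\ cluster_of a b = val C.
Proof.
move=> aC bC ab; have ok : okpair a b.
  rewrite /okpair !(in_cluster_rho aC) !(in_cluster_rho bC) !andbT.
  by apply: contraNneq ab => ->.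
split=> //; apply/setP => d; rewrite in_cluster inE.
have [jl _] := repP C; rewrite !in_cluster in aC bC.
by have [-> _] := ps_affine d jl ok aC bC ab.
Qed.

Lemma sub_cluster (C : cluster) a b : a \in val C -> b \in val C -> a != b -> pc C a = pc C b ->
  [/\ okpair a b, cluster_of a b \proper val C & forall d, d \in cluster_of a b -> pc C d = pc C a].
Proof.
move=> aC bC ab Eab; have ok : okpair a b.
  by rewrite /okpair ab !(in_cluster_rho aC) !(in_cluster_rho bC).
have [jl _] := repP C.
have B d : d \in cluster_of a b -> pc C d = pc C a.
  by rewrite inE => dab; apply: (ps_branch jl ok _ Eab dab); rewrite -/(pc C a) -in_cluster.
split=> //; apply/properP; split.
  by apply/fintype.subsetP => d dab; rewrite in_cluster B // -in_cluster.
have [m mC mne] := other_branch C a; exists m => //.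
by apply: contraNN mne => /B ->.
Qed.

(** Pick [j] in [D] on another branch than [m], so that [m] and [j] span [D]. If [j] is in [C], they
    span [C] or a smaller cluster in one of its branches; if not, [j] is at oo for [C], and all of
    [C] sits at one point of [D] by [ps_outer]. *)
Lemma laminar (C D : cluster) m : m \in val C -> m \in val D ->
  (val C \subset val D) || (val D \subset val C).
Proof.
move=> mC mD; have [j jD jm] := other_branch D m.
rewrite eq_sym in jm; have [ok E] := same_cluster mD jD jm.
have [jC|jC] := boolP (j \in val C).
  have [Ej|nj] := eqVneq (pc C m) (pc C j).
    have [|_ /proper_sub] := sub_cluster mC jC _ Ej; first by case/and3P: ok.
    by rewrite E => ->; rewrite orbT.
  by have [_ <-] := same_cluster mC jC nj; rewrite E fintype.subxx.
rewrite -E; apply/orP; left; apply/fintype.subsetP => d dC; rewrite inE.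
have [jl _] := repP C; rewrite !in_cluster in mC dC jC; move/negPn/eqP: jC => jC.
by rewrite (ps_outer jl ok mC jC dC).
Qed.

Lemma pc_const (C D : cluster) d d' : val D \proper val C -> d \in val D -> d' \in val D ->
  pc C d = pc C d'.
Proof.
move=> DC dD d'D; apply/eqP/negPn/negP => ne.
have /fintype.subsetP sub := proper_sub DC.
have [ok E] := same_cluster (sub _ dD) (sub _ d'D) ne.
have : val C \subset val D.
  rewrite -E; have [Ed|nd] := eqVneq (pc D d) (pc D d').
    by have [|_ /proper_sub] := sub_cluster dD d'D _ Ed; first by case/and3P: ok.
  by have [_ ->] := same_cluster dD d'D nd.
by apply/negP; case/andP: DC.
Qed.

Hypothesis n3 : (3 <= n)%N.

(** Take a largest cluster: a mark other than [rho] outside it would span a larger one with one of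
    its elements, by [ps_outer]. *)
Lemma root_exists : exists C : cluster, val C = [set~ rho]%SET.
Proof.
have [j [l jl]] : exists j l, okpair j l.
  have : (1 < #|[set~ rho]%SET|)%N by rewrite cardsC1 card_ord; lia.
  case/card_gt1P => j [l [jr lr jl]]; rewrite !inE in jr lr.
  by exists j, l; rewrite /okpair jl jr lr.
pose C0 : cluster := mkcluster jl.
case: (@arg_maxnP _ C0 xpredT (fun C : cluster => #|val C|) isT) => C _ Cmax.
exists C; apply/setP => b; rewrite !inE; apply/idP/idP => [/in_cluster_rho //|br].
apply/negPn/negP => bC; have aC := rep1_in C.
have ok : okpair (rep1 C) b.
  by rewrite /okpair (in_cluster_rho aC) br !andbT; apply: contraNneq bC => <-.
have := Cmax (mkcluster ok) isT; apply/negP; rewrite /= -ltnNge.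
apply: proper_card; apply/properP; split.
  apply/fintype.subsetP => d dC; rewrite inE; have [jl' _] := repP C.
  rewrite !in_cluster in aC dC bC; move/negPn/eqP: bC => bC.
  by rewrite (ps_outer jl' ok aC bC dC).
by exists b => //; rewrite inE ps1.
Qed.

Definition croot : cluster := sval (cid root_exists).
Lemma crootE : val croot = [set~ rho]%SET. Proof. by rewrite /croot; case: cid. Qed.

Definition cle (C D : cluster) : bool := val C \subset val D.
Definition cpar (C : cluster) : cluster :=
  if [pick D : cluster | val C \proper val D] is Some D0
  then [arg min_(D < D0 | val C \proper val D) #|val D|] else C.

Lemma cle_refl : reflexive cle. Proof. by move=> C; exact: fintype.subxx. Qed.
Lemma cle_tr : transitive cle. Proof. by move=> C D E; exact: fintype.subset_trans. Qed.
Lemma cle_anti : antisymmetric cle.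
Proof. by move=> C D CD; apply: val_inj; apply/eqP; rewrite finset.eqEsubset. Qed.
Lemma croot_top C : cle C croot.
Proof. by rewrite /cle crootE; apply/fintype.subsetP => m /in_cluster_rho; rewrite !inE. Qed.

Lemma cpar_spec C : C != croot -> val C \proper val (cpar C) /\
  forall D : cluster, val C \proper val D -> (#|val (cpar C)| <= #|val D|)%N.
Proof.
move=> Cr; rewrite /cpar; case: pickP => [D0 D0P|/(_ croot)]; first by case: arg_minnP.
have sub : val C \subset val croot := croot_top C.
by rewrite finset.properEneq sub andbT => /negbFE/eqP/val_inj E; rewrite E eqxx in Cr.
Qed.

Lemma cpar_gt C : C != croot -> cle C (cpar C) /\ cpar C != C.
Proof.
move=> /cpar_spec [CP _]; split; first exact: proper_sub CP.
by apply/eqP => E; move: CP; rewrite E fintype.properxx.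
Qed.

Lemma cpar_min C D : C != croot -> cle C D -> C != D -> cle (cpar C) D.
Proof.
move=> Cr CD CneD; have [CP Pmin] := cpar_spec Cr.
have CD' : val C \proper val D.
  have sub : val C \subset val D := CD.
  by rewrite finset.properEneq sub andbT; apply: contraNneq CneD => /val_inj ->.
have m1 : rep1 C \in val (cpar C) by apply: (fintype.subsetP (proper_sub CP)); exact: rep1_in.
have m2 : rep1 C \in val D by apply: (fintype.subsetP CD); exact: rep1_in.
case/orP: (laminar m1 m2) => // DP.
have := Pmin D CD'; rewrite leqNgt => nlt; rewrite /cle.
have [E|ne] := eqVneq (val D) (val (cpar C)); first by rewrite E fintype.subxx.
by case/negP: nlt; apply: proper_card; rewrite finset.properEneq ne.
Qed.

Lemma child_proper (C D : cluster) : D != croot -> cpar D = C -> val D \proper val C.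
Proof. by move=> /cpar_spec [+ _] <-. Qed.

Lemma child_max (C D G : cluster) : D != croot -> cpar D = C -> cle D G -> val G \proper val C -> G = D.
Proof.
move=> Dr pD DG GC; apply/eqP/negPn/negP => ne; rewrite eq_sym in ne.
by have := cpar_min Dr DG ne; rewrite pD /cle => CG; move: GC; rewrite properE CG andbF.
Qed.

(** Marks of two children at the same position of [C] span a cluster strictly below [C]; as children
    are maximal there, it lies in the first child, which then meets the second. *)
Lemma children_sep (C D D' : cluster) d d' : D != croot -> D' != croot -> cpar D = C -> cpar D' = C ->
  d \in val D -> d' \in val D' -> pc C d = pc C d' -> D = D'.
Proof.
move=> Dr D'r pD pD' dD d'D' E.
have DC := child_proper Dr pD; have D'C := child_proper D'r pD'.
have common m : m \in val D -> m \in val D' -> D = D'.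
  move=> mD mD'; case/orP: (laminar mD mD') => s.
    by apply/esym/(child_max Dr pD s D'C).
  exact: (child_max D'r pD' s DC).
have [Ed|nd] := eqVneq d d'; first by apply: (common d) => //; rewrite Ed.
have dC := fintype.subsetP (proper_sub DC) _ dD; have d'C := fintype.subsetP (proper_sub D'C) _ d'D'.
have [ok GC _] := sub_cluster dC d'C nd E.
pose G : cluster := mkcluster ok.
have dG : d \in val G by rewrite inE ps0.
have d'G : d' \in val G by rewrite inE ps1.
apply: (common d') => //; case/orP: (laminar dG dD) => [/fintype.subsetP|s]; first exact.
by rewrite -(child_max Dr pD s GC).
Qed.

Definition csmall (m : 'I_n) : cluster := [arg min_(D < croot | m \in val D) #|val D|].
Definition cmark (m : 'I_n) : cluster := if m == rho then croot else csmall m.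

Lemma csmallP m : m != rho -> m \in val (csmall m) /\
  forall D : cluster, m \in val D -> (#|val (csmall m)| <= #|val D|)%N.
Proof.
move=> mr; rewrite /csmall; case: arg_minnP; last by move=> C mC Cm; split.
by rewrite crootE !inE.
Qed.

Lemma cmark_in m : m != rho -> m \in val (cmark m).
Proof. by move=> mr; rewrite /cmark (negbTE mr); case: (csmallP mr). Qed.

Lemma cmark_min m (D : cluster) : m \in val D -> cle (cmark m) D.
Proof.
move=> mD; have mr := in_cluster_rho mD.
rewrite /cmark (negbTE mr); have [mS Sm] := csmallP mr.
case/orP: (laminar mS mD) => // DS.
have [E|ne] := eqVneq (val D) (val (csmall m)); first by rewrite /cle E fintype.subxx.
by have := Sm D mD; rewrite leqNgt proper_card // finset.properEneq ne.
Qed.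

(** Towards the root the node is oo; towards a smaller cluster it is the common position of the
    marks of that cluster, read off at one of them ([pc_const]). *)
Definition cnode (C D : cluster) : P1 k := if cle C D then None else pc C (rep1 D).

Definition ctree : pointed_curve k n :=
  @PointedCurve k n (cluster : finType) (padj cpar croot) cnode cmark (fun m => pc (cmark m) m).

Lemma cnode_par C : C != croot -> cnode C (cpar C) = None.
Proof. by move=> /cpar_gt [CP _]; rewrite /cnode CP. Qed.

Lemma cnode_child (C D : cluster) m : val D \proper val C -> m \in val D -> cnode C D = pc C m.
Proof.
move=> DC mD; rewrite /cnode ifF; last by apply/negbTE; case/andP: DC.
apply: (pc_const DC) => //; exact: rep1_in.
Qed.

(** Two marks at one position span a smaller cluster, on which the first would then sit. *)
Lemma mark_alone (C : cluster) m m' : cmark m = C -> m != rho -> m' \in val C -> pc C m = pc C m' ->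
  m = m'.
Proof.
move=> mC mr m'C E; apply/eqP/negPn/negP => ne.
have mC' : m \in val C by rewrite -mC cmark_in.
have [ok GC _] := sub_cluster mC' m'C ne E.
have := @cmark_min m (mkcluster ok); rewrite inE ps0 => /(_ isT).
by rewrite mC /cle /=; case/andP: GC => _ /negbTE ->.
Qed.

Lemma ctree_retract C m : retracts_to (S := ctree) C m (pc C m).
Proof.
have [E|ne] := eqVneq (cmark m) C; first by left; split=> //=; rewrite E.
right; rewrite eq_sym in ne.
have [u [p sp]] := path_step cle_refl cle_tr cle_anti croot_top cpar_gt cpar_min ne.
exists u, p; split=> //=.
have [mC|mC] := boolP (m \in val C).
  have mr := in_cluster_rho mC; have lm := cmark_min mC.
  rewrite eq_sym in ne.
  have [c [cr pE wc]] := child_toward cle_refl cle_tr cle_anti croot_top cpar_gt cpar_min lm ne.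
  have -> := first_down cle_tr cle_anti cpar_gt cpar_min cr pE wc sp.
  apply/esym/cnode_child; first exact: child_proper.
  by apply: (fintype.subsetP wc); exact: cmark_in.
have nl : ~~ cle (cmark m) C.
  have [mE|mr] := eqVneq m rho; last by apply: contraNN mC => /fintype.subsetP; apply; exact: cmark_in.
  rewrite mE /cmark eqxx; apply/negP => rC; rewrite /cmark mE eqxx in ne.
  by case/eqP: ne; apply: cle_anti; rewrite rC croot_top.
have [Cr ->] := first_up cle_tr croot_top cpar_gt cpar_min nl sp.
by rewrite cnode_par //; move: mC; rewrite in_cluster negbK => /eqP.
Qed.

Lemma ctree_stable : stable_rational ctree.
Proof.
split.
- split; [exact: padj_sym|exact: (padj_irr cpar_gt)].
- exact: (tree_paths cle_refl cle_tr cle_anti croot_top cpar_gt cpar_min).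
- move=> C D D' /=; case/orP=> /andP [r /eqP pE]; case/orP=> /andP [r' /eqP pE'].
  + by rewrite -pE -pE'.
  + rewrite -pE cnode_par // (cnode_child (child_proper r' pE') (rep1_in D')) => E.
    have := fintype.subsetP (proper_sub (child_proper r' pE')) _ (rep1_in D').
    by rewrite in_cluster -E.
  + rewrite -pE' cnode_par // (cnode_child (child_proper r pE) (rep1_in D)) => E.
    have := fintype.subsetP (proper_sub (child_proper r pE)) _ (rep1_in D).
    by rewrite in_cluster E.
  + rewrite (cnode_child (child_proper r pE) (rep1_in D)).
    rewrite (cnode_child (child_proper r' pE') (rep1_in D')).
    exact: (children_sep r r' pE pE' (rep1_in D) (rep1_in D')).
- split=> [m m' /= E|m D /=].
    have [Em|mr] := eqVneq m rho; have [Em'|mr'] := eqVneq m' rho.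
    + by rewrite Em Em'.
    + rewrite Em pc_rho => P; have := cmark_in mr'; rewrite in_cluster -P //.
    + rewrite Em' pc_rho => P; have := cmark_in mr; rewrite in_cluster P //.
    + rewrite -E; apply: (mark_alone erefl mr); rewrite E; exact: cmark_in.
  case/orP=> /andP [r /eqP pE] E.
    have [Em|mr] := eqVneq m rho; first by move: r; rewrite Em /cmark eqxx eqxx.
    by have := cmark_in mr; rewrite in_cluster E -pE cnode_par.
  have DC := child_proper r pE; have dC := fintype.subsetP (proper_sub DC) _ (rep1_in D).
  rewrite (cnode_child DC (rep1_in D)) in E.
  have [Em|mr] := eqVneq m rho; first by move: dC; rewrite in_cluster -E Em pc_rho.
  have mE := mark_alone erefl mr dC E.
  have := cmark_min (rep1_in D); rewrite -mE => CD.
  by case/andP: DC => _ /negP; apply.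
- move=> C /=; set A := [set w | _]%SET; set B := [set i | _]%SET.
  (* Stability: [rep1 C], [rep2 C] and [rho] retract to the different points 0, 1, oo of [C], each
     of which is a node or a mark of [C]. *)
  pose g (u : cluster + 'I_n) : P1 k := match u with inl D => cnode C D | inr i => pc C i end.
  have sp m : exists2 u, u \in (inl @: A :|: inr @: B : {set cluster + 'I_n})%SET & g u = pc C m.
    have [Em|ne] := eqVneq (cmark m) C.
      by exists (inr m) => //; rewrite inE; apply/orP; right; apply: imset_f; rewrite inE Em.
    have [[E1 E2]|[w [p [sp E]]]] := ctree_retract C m; first by move/eqP: ne; case; exact: E1.
    exists (inl w) => //; rewrite inE; apply/orP; left; apply: imset_f; rewrite inE.
    by case: sp => /= /andP [].
  have [u1 u1A g1] := sp (rep1 C); have [u2 u2A g2] := sp (rep2 C); have [u3 u3A g3] := sp rho.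
  rewrite pc_rep1 in g1; rewrite pc_rep2 in g2; rewrite pc_rho in g3.
  have -> : (#|A| + #|B| = #|(inl @: A :|: inr @: B : {set cluster + 'I_n})%SET|)%N.
    rewrite cardsU (card_imset A) ?(card_imset B); try by move=> ? ? [].
    rewrite [X in _ = (_ - X)%N](_ : _ = 0%N) ?subn0 //; apply/eqP; rewrite cards_eq0.
    apply/eqP/setP => u; rewrite !inE; apply/negP => /andP [/imsetP [? _ ->] /imsetP [? _]] //.
  have u12 : u1 != u2.
    by apply/eqP => E; move: g1; rewrite E g2 => -[/eqP]; rewrite oner_eq0.
  have u13 : u1 != u3 by apply/eqP => E; move: g1; rewrite E g3.
  have u23 : u2 != u3 by apply/eqP => E; move: g2; rewrite E g3.
  apply: (@leq_trans #|[set u1; u2; u3]%SET|).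
    by rewrite -finset.setUA !cardsU1 cards1 !inE (negbTE u12) (negbTE u13) (negbTE u23).
  apply: subset_leq_card; apply/fintype.subsetP => u; rewrite !inE -!orbA.
  by case/or3P => /eqP ->; [move: u1A|move: u2A|move: u3A]; rewrite !inE.
Qed.

(** If one of the marks is [rho], the other two span the cluster. Otherwise the position of [c] with
    respect to [a], [b] decides: where it coincides with that of [a] or [b], this pair is separated
    on a finer cluster, for which the third mark is at oo. *)
Lemma sep_cluster (a b c : 'I_n) : uniq [:: a; b; c] -> exists C : cluster,
  [/\ pc C a != pc C b, pc C b != pc C c & pc C a != pc C c].
Proof.
have lift j l : okpair j l -> exists C : cluster,
    forall m m', ps j l m != ps j l m' -> pc C m != pc C m'.
  move=> jl; pose C : cluster := mkcluster jl; exists C => m m'.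
  have jC : j \in val C by rewrite inE ps0.
  have lC : l \in val C by rewrite inE ps1.
  have jlC : pc C j != pc C l.
    apply/eqP => E; have [|_ + _] := sub_cluster jC lC _ E; first by case/and3P: (jl).
    by rewrite fintype.properxx.
  have [jl' _] := repP C; rewrite !in_cluster in jC lC.
  have R u := ps_affine u jl' jl jC lC jlC.
  have [E1 E2] := R m; have [E1' _] := R m'.
  have [m0|mN] := eqVneq (pc C m) None; have [m'0|m'N] := eqVneq (pc C m') None.
  - move: E1 E1'; rewrite -/(pc C m) -/(pc C m') m0 m'0 eqxx => /eqP -> /eqP ->.
    by rewrite eqxx.
  - by move=> _; apply: contraNneq m'N => <-; rewrite m0.
  - by move=> _; apply: contraNneq mN => ->; rewrite m'0.
  - by rewrite (E2 m').
rewrite /= !inE negb_or andbT => /andP [/andP [ab ac] bc].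
have sep01 (u v : P1 k) : u = Some 0 -> v = Some 1 -> u != v.
  by move=> -> ->; apply/eqP => -[/eqP]; rewrite eq_sym oner_eq0.
have [cr|cr] := eqVneq c rho.
  have ok : okpair a b by rewrite /okpair ab -cr ac bc.
  have [C CP] := lift _ _ ok; exists C; split; apply: CP.
  - by apply: sep01; [exact: ps0|exact: ps1].
  - by rewrite cr ps1 // psoo.
  - by rewrite cr ps0 psoo.
have [br|br] := eqVneq b rho.
  have ok : okpair a c by rewrite /okpair ac -br ab eq_sym bc.
  have [C CP] := lift _ _ ok; exists C; split; apply: CP.
  - by rewrite br ps0 psoo.
  - by rewrite br ps1 // psoo.
  - by apply: sep01; [exact: ps0|exact: ps1].
have [ar|ar] := eqVneq a rho.
  have ok : okpair b c by rewrite /okpair bc -ar eq_sym ab eq_sym ac.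
  have [C CP] := lift _ _ ok; exists C; split; apply: CP.
  - by rewrite ar ps0 psoo.
  - by apply: sep01; [exact: ps0|exact: ps1].
  - by rewrite ar ps1 // psoo.
have ok : okpair a b by rewrite /okpair ab ar br.
have [c0|c0] := eqVneq (ps a b c) (Some 0).
  have okc : okpair a c by rewrite /okpair ac ar cr.
  have bo : ps a c b = None.
    have [] := eqVneq (ps a c b) None => // nb.
    have := ps_branch ok okc (_ : ps a b a != None) _ nb.
    by rewrite ps0 c0 ps1 // => /(_ isT erefl) [/eqP]; rewrite oner_eq0.
  have [C CP] := lift _ _ okc; exists C; split; apply: CP.
  - by rewrite bo ps0.
  - by rewrite bo ps1.
  - by apply: sep01; [exact: ps0|exact: ps1].
have [c1|c1] := eqVneq (ps a b c) (Some 1).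
  have okc : okpair b c by rewrite /okpair bc br cr.
  have ao : ps b c a = None.
    have [] := eqVneq (ps b c a) None => // na.
    have := ps_branch ok okc (_ : ps a b b != None) _ na.
    by rewrite ps1 // c1 ps0 => /(_ isT erefl) [/eqP]; rewrite eq_sym oner_eq0.
  have [C CP] := lift _ _ okc; exists C; split; apply: CP.
  - by rewrite ao ps0.
  - by apply: sep01; [exact: ps0|exact: ps1].
  - by rewrite ao ps1.
have [C CP] := lift _ _ ok; exists C; split; apply: CP.
- by apply: sep01; [exact: ps0|exact: ps1].
- by rewrite ps1 // eq_sym.
- by rewrite ps0 eq_sym.
Qed.

Lemma cluster_cross_ratio (C : cluster) a b c d : uniq [:: a; b; c] ->
  pc C a != pc C b -> pc C b != pc C c -> pc C a != pc C c ->
  xq x a b c d = cross_ratio (pc C a) (pc C b) (pc C c) (pc C d).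
Proof.
move=> u ab bc ac; apply/cross_ratioP => //; apply: crsysP => //.
case: (repP C) => /and3P [jl jr lr] _.
by rewrite /= !inE negb_or; apply/and3P; split=> //; apply/andP.
Qed.

Lemma ctree_represents : represents (x : P1s k (quad n)) ctree.
Proof.
split; first exact: ctree_stable.
move=> q; have := quad_uniq q; rewrite -[[:: _; _; _; _]]/([:: _; _; _] ++ [:: _]) cat_uniq.
case/andP=> u _; have [C [ab bc ac]] := sep_cluster u.
exists C, (fun j => pc C (mark q j)); split.
- by move=> j; exact: ctree_retract.
- by split; apply/eqP.
- by rewrite -xq_quad; apply: cluster_cross_ratio.
Qed.

(** Two marks of a cluster strictly below the root have the same position on the root component,
    which makes a cross ratio 0. *)
Lemma cluster_unique : (forall q : quad n, [/\ x q != Some 0, x q != Some 1 & x q != None]) ->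
  #|{: cluster}| = 1%N.
Proof.
move=> nd; apply: (fintype.eq_card1 (x := croot)) => D; rewrite !inE.
apply/esym/eqP/val_inj/eqP; apply/negPn/negP => ne.
have DR : val D \proper val croot.
  have sub : val D \subset val croot := croot_top D.
  by rewrite finset.properEneq ne sub.
have dd' : rep1 D != rep2 D by case: (repP D) => /and3P [].
have E := pc_const DR (rep1_in D) (rep2_in D).
have dC := fintype.subsetP (proper_sub DR) _ (rep1_in D).
have d'C := fintype.subsetP (proper_sub DR) _ (rep2_in D).
have [j jC jne] := other_branch croot (rep1 D).
rewrite eq_sym in jne; have [ok _] := same_cluster dC jC jne.
have [jl _] := repP croot; rewrite !in_cluster in dC d'C jC.
have [_ A] := ps_affine (rep2 D) jl ok dC jC jne.
have := A (rep1 D) d'C dC; rewrite -/(pc _ _) -/(pc _ _) E eqxx ps0 => /eqP P0.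
have u : uniq [:: rep1 D; j; rho; rep2 D].
  case/and3P: ok => dj dr jr; have [/and3P [_ _ d'r] _] := repP D.
  rewrite /= !inE !negb_or dj dr jr dd' [rho == _]eq_sym d'r /= !andbT.
  by apply: contraNneq jne => ->; rewrite E.
have [q [q0 q1 q2 q3]] := quad_ex u; have [+ _ _] := nd q.
by rewrite -xq_quad q0 q1 q2 q3 -/(ps _ _ _) P0 eqxx.
Qed.

End Clusters.

Lemma representableP (k : fieldType) (n : nat) (x : P1s k (quad n)) : (3 <= n)%N ->
  (exists S, represents x S) <-> crsys x.
Proof.
case: n x => // n x n3; split=> [[S rS]|xs]; last by eexists; exact: (ctree_represents xs ord0 n3).
exact: (represents_crsys rS.1 rS).
Qed.

Lemma cross_ratio_distinct (k : fieldType) (a b c d : P1 k) : uniq [:: a; b; c; d] ->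
  [/\ cross_ratio a b c d != Some 0, cross_ratio a b c d != Some 1 & cross_ratio a b c d != None].
Proof.
rewrite /= !inE !negb_or andbT => /and3P [/and3P [ab ac ad] /andP [bc bd] cd].
have R := cross_ratio_sep d ab bc ac.
split; apply/eqP => E; move: R; rewrite E /crel /= ?mul0r ?mul1r.
- by move/esym/eqP; rewrite mulf_eq0 !bracket_eq0 (eq_sym d a) (negbTE ad) (negbTE bc).
- move/eqP; rewrite -subr_eq0.
  have -> : bracket d c * bracket b a - bracket d a * bracket b c = bracket c a * bracket d b.
    by rewrite !bracketE; ring.
  by rewrite mulf_eq0 !bracket_eq0 (eq_sym c) (negbTE ac) (eq_sym d) (negbTE bd).
- by move/eqP; rewrite mulf_eq0 !bracket_eq0 (eq_sym d c) (negbTE cd) (eq_sym b a) (negbTE ab).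
Qed.

Lemma M0P (k : fieldType) (n : nat) (x : Mbar0 k n) : (3 <= n)%N ->
  M0 x <-> forall q, [/\ val x q != Some 0, val x q != Some 1 & val x q != None].
Proof.
move=> n3; have : crsys (val x) by apply/representableP => //; have := valP x; rewrite in_setE.
rewrite /M0 /=; move: (val x) => {}x xs; split=> [[S [rS c1]] q|nd].
  have [v [_ _ _ ->]] := represents_cross_ratio rS.1 q rS.
  have vE w : w = v.
    have /fintype_le1P /(_ w v) // : (#|Defs.comp S| <= 1)%N by rewrite c1.
  have R i : retract rS.1 v i = mpos S i by rewrite /retract (vE (mcomp S i)) eqxx.
  rewrite !R; apply: cross_ratio_distinct.
  have inj : injective (mpos S).
    move=> i j E; case: (rS) => -[_ _ _ [+ _] _] _; apply => //.
    by rewrite (vE (mcomp S i)) (vE (mcomp S j)).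
  by have := quad_uniq q; rewrite -(map_inj_uniq inj).
case: n x n3 xs nd => // n x n3 xs nd.
exists (ctree xs ord0 n3); split; first exact: ctree_represents.
by have := cluster_unique xs ord0 n3 nd; rewrite cardT.
Qed.

(** * Determinants indexed by graphs *)

Lemma det_sum_rows (R : comNzRingType) (m : nat) (S : finType) (w : 'I_m -> S -> R) (v : S -> 'I_m -> R) :
  \det (\matrix_(j, i) \sum_s w j s * v s i) =
  \sum_(f : {ffun 'I_m -> S}) (\prod_j w j (f j)) * \det (\matrix_(j, i) v (f j) i).
Proof.
rewrite /determinant; under eq_bigr => s _.
  under eq_bigr => j _ do rewrite mxE.
  rewrite bigA_distr_bigA mulr_sumr; over.
rewrite exchange_big; apply: eq_bigr => f _ /=; rewrite mulr_sumr; apply: eq_bigr => s _.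
rewrite big_split /= mulrCA; congr (_ * (_ * _)); apply: eq_bigr => j _; by rewrite mxE.
Qed.

Section Edges.
Variables (k : fieldType) (m : nat).
Let n := m.+3.
Local Notation edge := ('I_m.+3 * 'I_m.+3)%type.

Definition cano (e : edge) : edge := if (e.1 < e.2)%N then e else (e.2, e.1).
Definition free_pairs : {set edge} := [set e : edge | (e.1 < e.2)%N & (3 <= e.2)%N]%SET.
(** The coefficient of dz_i in d(z_(e.1) - z_(e.2)); the first three positions are constant. *)
Definition inc (e : edge) (i : 'I_m) : k := (e.1 == rshift 3 i)%:R - (e.2 == rshift 3 i)%:R.

Lemma cano_eq e e' : cano e = cano e' -> e = e' \/ e = (e'.2, e'.1).
Proof.
case: e => a b; case: e' => c d; rewrite /cano /=; case: ifP => _; case: ifP => _ [-> ->]; by [left|right].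
Qed.
Lemma cano_lt e : e.1 != e.2 -> ((cano e).1 < (cano e).2)%N.
Proof.
case: e => a b /= ab; rewrite /cano /=; case: (ltngtP a b) => //= E; by rewrite (val_inj E) eqxx in ab.
Qed.

Definition orient (e : edge) : k := if (e.1 < e.2)%N then 1 else -1.
Lemma orient_neq0 e : orient e != 0. Proof. by rewrite /orient; case: ifP; rewrite ?oppr_eq0 oner_eq0. Qed.
Lemma inc_cano e i : orient e * inc (cano e) i = inc e i.
Proof. by rewrite /orient /cano /inc; case: ifP => _ /=; rewrite ?mul1r // mulN1r opprB. Qed.

Variable E : 'I_m -> edge.
Hypothesis lt : forall j, ((E j).1 < (E j).2)%N.
Hypothesis nz : \det (\matrix_(j, i) inc (E j) i) != 0.

Let indep (r : 'I_m -> k) : (forall i, \sum_j r j * inc (E j) i = 0) -> forall j, r j = 0.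
Proof.
move=> H j; have u : \matrix_(j, i) inc (E j) i \in unitmx by rewrite unitmxE unitfE.
have r0 : (\row_j r j) *m (\matrix_(j, i) inc (E j) i) = 0.
  by apply/rowP => i; rewrite !mxE -[RHS](H i); apply: eq_bigr => l _; rewrite !mxE.
have := congr1 (fun A : 'rV_m => A 0 j) (mulmxK u (\row_j r j)).
by rewrite r0 mul0mx !mxE.
Qed.

Let delta_sum (j : 'I_m) (F : 'I_m -> k) : \sum_l (l == j)%:R * F l = F j.
Proof. by rewrite (bigD1 j) //= eqxx mul1r big1 ?addr0 // => l /negbTE ->; rewrite mul0r. Qed.

(** A pair among the three fixed points would contribute a zero row. *)
Lemma edges_free j : E j \in free_pairs.
Proof.
rewrite inE lt /= leqNgt; apply/negP => e2.
have := indep (r := fun l => (l == j)%:R) _ j; rewrite eqxx => H.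
suff /H /eqP : forall i, \sum_l (l == j)%:R * inc (E l) i = 0 by rewrite oner_eq0.
move=> i; rewrite (delta_sum j (fun l => inc (E l) i)) /inc.
have ne (a : 'I_m.+3) : (a < 3)%N -> a == rshift 3 i = false.
  by move=> a3; apply/negbTE; rewrite -val_eqE /= neq_ltn (leq_trans a3) // leq_addr.
by rewrite !ne ?subrr //; exact: ltn_trans (lt j) e2.
Qed.

Lemma edges_inj : injective E.
Proof.
move=> j j' EE; apply/eqP/negPn/negP => ne.
have H : forall i, \sum_l ((l == j)%:R - (l == j')%:R) * inc (E l) i = 0.
  move=> i; under eq_bigr => l _ do rewrite mulrBl; rewrite sumrB.
  by rewrite (delta_sum j (fun l => inc (E l) i)) (delta_sum j' (fun l => inc (E l) i)) EE subrr.
by have /eqP := indep H j; rewrite eqxx (negbTE ne) subr0 oner_eq0.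
Qed.

(** The rows of the three sides of a triangle are linearly dependent, with signs from the
    orientations. *)
Lemma no_triangle a b c j1 j2 j3 : a != b -> b != c -> a != c ->
  E j1 = cano (a, b) -> E j2 = cano (b, c) -> E j3 = cano (a, c) -> False.
Proof.
move=> ab bc ac E1 E2 E3.
have j12 : j1 != j2.
  apply/eqP => j; move/eqP: ab => ab; move/eqP: ac => ac; have := E1; rewrite j E2 => /cano_eq [] [] *; congruence.
have j13 : j1 != j3.
  apply/eqP => j; move/eqP: ab => ab; move/eqP: bc => bc; have := E1; rewrite j E3 => /cano_eq [] [] *; congruence.
have H : forall i, \sum_l (orient (a, b) * (l == j1)%:R + orient (b, c) * (l == j2)%:R - orient (a, c) * (l == j3)%:R) * inc (E l) i = 0.
  move=> i; rewrite (eq_bigr (fun l => orient (a, b) * ((l == j1)%:R * inc (E l) i) +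
     orient (b, c) * ((l == j2)%:R * inc (E l) i) - orient (a, c) * ((l == j3)%:R * inc (E l) i))) => [|l _]; last by ring.
  rewrite sumrB big_split /= -!mulr_sumr (delta_sum j1 (fun l => inc (E l) i)) (delta_sum j2 (fun l => inc (E l) i)).
  rewrite (delta_sum j3 (fun l => inc (E l) i)) E1 E2 E3 !inc_cano /inc /=; ring.
have /eqP := indep H j1; rewrite eqxx (negbTE j12) (negbTE j13) mulr1 !mulr0 addr0 subr0.
by rewrite (negbTE (orient_neq0 _)).
Qed.
End Edges.

Lemma card_ord_geq n c : (c <= n)%N -> #|[pred b : 'I_n | (c <= b)%N]| = (n - c)%N.
Proof.
move=> cn; rewrite -sum1_card -(big_geq_mkord c n predT (fun=> 1%N)) /=.
by rewrite sum_nat_const_nat muln1.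
Qed.

(** In the graph of free pairs each of the three fixed points has degree m and each other point
    degree m + 2. *)
Lemma prod_free_pairs (k : comNzRingType) m (la : 'I_m.+3 -> k) :
  \prod_(e in free_pairs m) (la e.1 * la e.2) =
  (\prod_(l < 3) la (lshift m l)) ^+ m * \prod_(i < m) la (rshift 3 i) ^+ m.+2.
Proof.
rewrite big_split /=.
have E1 : \prod_(e in free_pairs m) la e.1 = \prod_a la a ^+ #|[pred b : 'I_m.+3 | (a < b)%N && (3 <= b)%N]|.
  rewrite (eq_bigl (fun e : 'I_m.+3 * 'I_m.+3 => (e.1 < e.2)%N && (3 <= e.2)%N)) => [|e]; last by rewrite inE.
  rewrite -(pair_big_dep predT (fun a b : 'I_m.+3 => (a < b)%N && (3 <= b)%N) (fun a b => la a)) /=.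
  by apply: eq_bigr => a _; rewrite prodr_const.
have E2 : \prod_(e in free_pairs m) la e.2 = \prod_b la b ^+ #|[pred a : 'I_m.+3 | (a < b)%N && (3 <= b)%N]|.
  rewrite (eq_bigl (fun e : 'I_m.+3 * 'I_m.+3 => (e.1 < e.2)%N && (3 <= e.2)%N)) => [|e]; last by rewrite inE.
  rewrite -(pair_big_dep predT (fun a b : 'I_m.+3 => (a < b)%N && (3 <= b)%N) (fun a b => la b)) /= (exchange_big_dep predT) //=.
  by apply: eq_bigr => a _; rewrite prodr_const.
rewrite E1 E2 -big_split /=.
have d (a : 'I_m.+3) : (#|[pred b : 'I_m.+3 | (a < b)%N && (3 <= b)%N]| + #|[pred b : 'I_m.+3 | (b < a)%N && (3 <= a)%N]|)%N =
    if (a < 3)%N then m else m.+2.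
  have [a3|a3] := ltnP a 3.
    rewrite (eq_card (B := [pred b : 'I_m.+3 | (3 <= b)%N])) => [|b]; last first.
      by rewrite !inE; case: (leqP 3 b) => b3; rewrite ?andbF // (leq_trans a3).
    rewrite card_ord_geq // subSS subSS subSS subn0 eq_card0 ?addn0 // => b; rewrite !inE; by rewrite andbF.
  rewrite (eq_card (B := [pred b : 'I_m.+3 | (a < b)%N])) => [|b]; last first.
    by rewrite !inE; case: (ltnP a b) => ab //=; rewrite (leq_trans a3) // ltnW.
  rewrite card_ord_geq // [X in (_ + X)%N](eq_card (B := [predC [pred b : 'I_m.+3 | (a <= b)%N]])) => [|b]; last first.
    by rewrite !inE -ltnNge andbT.
  have := cardC [pred b : 'I_m.+3 | (a <= b)%N]; rewrite card_ord_geq; last exact: ltnW.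
  have := ltn_ord a => am E; have {}E := etrans E (card_ord m.+3); move: E am.
  set c := #|predC _|; move: c (nat_of_ord a) => c b; lia.
rewrite (eq_bigr (fun a => la a ^+ (if (a < 3)%N then m else m.+2))) => [|a _]; last by rewrite -exprD d.
rewrite [LHS](@big_split_ord _ _ _ 3 m) /= -prodrXl; congr (_ * _); apply: eq_bigr => i _.
  by rewrite ltn_ord.
Qed.

(** * Function fields of projective curves *)

Definition is_ideal (R : comNzRingType) (I : R -> Prop) : Prop :=
  [/\ I 0, forall a b, I a -> I b -> I (a + b) & forall a b, I b -> I (a * b)].

Definition acc (R : comNzRingType) : Prop :=
  forall I : nat -> R -> Prop, (forall i, is_ideal (I i)) ->
    (forall i a, I i a -> I i.+1 a) -> exists m, forall i a, (m <= i)%N -> I i a -> I m a.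

Lemma chain_mono (T : Type) (I : nat -> T -> Prop) : (forall i a, I i a -> I i.+1 a) ->
  forall i j a, (i <= j)%N -> I i a -> I j a.
Proof.
move=> up i j a ij Ia; rewrite -(subnK ij); elim: (j - i)%N => [|d IH] //.
by rewrite addSn; apply: up.
Qed.

Lemma acc_field (k : fieldType) : acc k.
Proof.
move=> I idI up; have mono := chain_mono up.
have [[m Im]|no] := pselect (exists m, I m 1).
  by exists m => i a _ _; have [_ _ /(_ a 1 Im)] := idI m; rewrite mulr1.
exists 0%N => i a _ Ia; have [->|a0] := eqVneq a 0; first by case: (idI 0%N).
by case: no; exists i; have [_ _ /(_ a^-1 a Ia)] := idI i; rewrite mulVf.
Qed.

Lemma acc_surj (R S : comNzRingType) (phi : {rmorphism R -> S}) :
  (forall s, exists r, phi r = s) -> acc R -> acc S.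
Proof.
move=> sur aR I idI up; have [|i a|m Hm] := aR (fun i r => I i (phi r)).
- move=> i; case: (idI i) => I0 Ia IM; split; first by rewrite rmorph0.
    by move=> a b; rewrite rmorphD; apply: Ia.
  by move=> a b; rewrite rmorphM; apply: IM.
- exact: up.
- by exists m => i s mi; have [r <-] := sur s; apply: Hm.
Qed.

(* Hilbert's basis theorem: [L i d] consists of the leading coefficients of the elements of
   degree d of the i-th ideal; it increases with i and with d. *)
Lemma acc_poly (R : comNzRingType) : acc R -> acc {poly R}.
Proof.
move=> aR J idJ up; have mono := chain_mono up.
pose L i d (a : R) := exists p : {poly R}, [/\ J i p, (size p <= d.+1)%N & p`_d = a].
have idL i d : is_ideal (L i d).
  case: (idJ i) => J0 JD JM; split.
  - by exists 0; rewrite size_poly0 coef0.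
  - move=> _ _ [p [Jp sp <-]] [q [Jq sq <-]]; exists (p + q); split; [exact: JD| |by rewrite coefD].
    by rewrite (leq_trans (size_polyD _ _)) // geq_max sp sq.
  - move=> a _ [p [Jp sp <-]]; exists (a%:P * p); split; [exact: JM| |by rewrite coefCM].
    by rewrite mul_polyC (leq_trans (size_scale_leq _ _)).
have Lup i d a : L i d a -> L i.+1 d a.
  by case=> p [Jp sp pa]; exists p; split=> //; exact: up.
have Lud i d a : L i d a -> L i d.+1 a.
  case=> p [Jp sp pa]; exists (p * 'X); split.
  - by case: (idJ i) => _ _ JM; rewrite mulrC; exact: JM.
  - have [->|p0] := eqVneq p 0; first by rewrite mul0r size_poly0.
    by rewrite size_mulX.
  - by rewrite coefMX.
have Lmono i d i' d' a : (i <= i')%N -> (d <= d')%N -> L i d a -> L i' d' a.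
  move=> ii dd La; apply: (chain_mono (I := fun j => L j d')) ii _ => [j b|]; first exact: Lup.
  by apply: (chain_mono (I := L i)) dd La => j b; exact: Lud.
have [m Hm] := aR (fun i => L i i) (fun i => idL i i) (fun i a Li => Lud _ _ _ (Lup _ _ _ Li)).
have [M HM] : exists M, forall d i a, (d < m)%N -> L i d a -> L M d a.
  elim: m {Hm} => [|m [M HM]]; first by exists 0%N.
  have [M' HM'] := aR (fun i => L i m) (idL^~ m) (Lup^~ m).
  exists (maxn M M') => d i a; rewrite ltnS leq_eqVlt => /orP [/eqP -> Li|dm Li].
    apply: (Lmono M' m) => //; first exact: leq_maxr.
    by case: (leqP M' i) => [|/ltnW] le; [exact: HM' Li|exact: Lmono Li].
  by apply: (Lmono M d) => //; [exact: leq_maxl|exact: HM Li].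
pose K := maxn m M; exists K => i p _ Jp.
have [n sp] := ubnP (size p); elim: n p sp Jp => // n IH p sp Jp.
have [p0|p0] := eqVneq p 0; first by rewrite p0; case: (idJ K).
have Lp : L i (size p).-1 (lead_coef p) by exists p; split=> //; rewrite prednK // size_poly_gt0.
have LK : L K (size p).-1 (lead_coef p).
  case: (ltnP (size p).-1 m) => [sm|ms].
    by apply: (Lmono M (size p).-1) => //; [exact: leq_maxr|exact: HM sm Lp].
  apply: (Lmono m m) => //; first exact: leq_maxl.
  apply: (Hm (maxn i (size p).-1)); first by rewrite leq_max ms orbT.
  by apply: Lmono Lp; [exact: leq_maxl|exact: leq_maxr].
case: LK => q [Jq sq qE]; have [J0 JD JM] := idJ K.
case: (leqP i K) => [iK|/ltnW Ki]; first exact: mono Jp.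
rewrite -[p](subrK q); apply: (JD _ _ _ Jq); apply: IH.
  move: sp; rewrite ltnS; apply: leq_trans.
  have s0 : (0 < size p)%N by rewrite size_poly_gt0.
  rewrite -(prednK s0) ltnS; apply/leq_sizeP => j; rewrite leq_eqVlt => /orP [/eqP <-|lj].
    by rewrite coefB qE subrr.
  rewrite coefB (leq_sizeP _ _ (leqnn (size p))); last by lia.
  by rewrite (leq_sizeP _ _ sq) ?subrr.
have [_ JDi JMi] := idJ i; apply: JDi => //; rewrite -mulN1r; apply: JMi; exact: mono Jq.
Qed.

(** The variables are adjoined one at a time: an iterated univariate polynomial ring maps onto
    [{mpoly k[n]}]. *)
Lemma acc_mpoly (k : fieldType) (n : nat) : acc {mpoly k[n]}.
Proof.
suff H m : (m <= n)%N -> exists (R : comNzRingType) (phi : {rmorphism R -> {mpoly k[n]}}),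
    [/\ acc R, forall c : k, exists r, phi r = c%:MP &
        forall i : 'I_n, (i < m)%N -> exists r, phi r = 'X_i].
  have [R [phi [aR phic phiX]]] := H n (leqnn n); apply: (@acc_surj _ _ phi _ aR).
  elim/mpolyind => [|c m p _ _ [r rp]]; first by exists 0; rewrite rmorph0.
  have [a ac] := phic c.
  have [b bm] : exists b, phi b = 'X_[m].
    rewrite mpolyXE_id; elim/big_ind: _ => [|_ _ [u <-] [w <-]|i _].
    - by exists 1; rewrite rmorph1.
    - by exists (u * w); rewrite rmorphM.
    - have [u uE] := phiX i (ltn_ord i); exists (u ^+ m i); by rewrite rmorphXn /= uE.
  by exists (a * b + r); rewrite rmorphD rmorphM /= ac bm rp mul_mpolyC.
elim: m => [|m IH] mn.
  by exists k, (@mpolyC n k : {rmorphism k -> {mpoly k[n]}}); split=> [|c|//]; [exact: acc_field|exists c].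
have [R [phi [aR phic phiX]]] := IH (ltnW mn).
have cf : commr_rmorph phi ('X_(Ordinal mn) : {mpoly k[n]}) by move=> r; exact: mulrC.
exists {poly R}, (horner_morph cf); split; first exact: acc_poly.
  by move=> c; have [r rc] := phic c; exists r%:P; rewrite /= horner_morphC.
move=> i; rewrite ltnS leq_eqVlt => /orP [/eqP im|im].
  exists 'X; rewrite /= horner_morphX; congr ('X_ _); exact: val_inj.
by have [r rc] := phiX i im; exists r%:P; rewrite /= horner_morphC.
Qed.

Local Open Scope classical_set_scope.

Local Open Scope quotient_scope.

(** * Spaces with functions and their function fields *)

Section Ringed.
Variable k : fieldType.

(* What is used of a variety: enough to form its function field. *)
Record ringed (X : space k) : Prop := Ringed {
  open_T : zopen X setT;
  open_I : forall U V, zopen X U -> zopen X V -> zopen X (U `&` V);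
  reg_ext : forall (x : X) (f g : X -> k), regular x f ->
    near_pt x [set y | g y = f y] -> regular x g;
  reg_const : forall (x : X) c, regular x (fun=> c);
  reg_add : forall (x : X) (f g : X -> k), regular x f -> regular x g ->
    regular x (fun y => f y + g y);
  reg_mul : forall (x : X) (f g : X -> k), regular x f -> regular x g ->
    regular x (fun y => f y * g y);
  reg_inv : forall (x : X) (f : X -> k), regular x f -> f x != 0 ->
    regular x (fun y => (f y)^-1);
  reg_near : forall (x : X) (f : X -> k), regular x f -> near_pt x [set y | regular y f];
  reg_neq0 : forall (x : X) (f : X -> k), regular x f -> f x != 0 ->
    near_pt x [set y | f y != 0] }.

Lemma near_sub (X : space k) (x : X) (P Q : set X) : P `<=` Q -> near_pt x P -> near_pt x Q.
Proof. by move=> PQ [U [Uo Ux UP]]; exists U; split=> // y /UP /PQ. Qed.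

Lemma near_self (X : space k) (x : X) (P : set X) : near_pt x P -> P x.
Proof. by case=> U [_ Ux]; apply. Qed.

Lemma nearI (X : space k) (x : X) (P Q : set X) : ringed X ->
  near_pt x P -> near_pt x Q -> near_pt x (P `&` Q).
Proof.
move=> rX [U [Uo Ux UP]] [V [Vo Vx VQ]]; exists (U `&` V); split=> //.
  exact: open_I.
by move=> y [/UP ? /VQ ?].
Qed.

Lemma nearT (X : space k) (x : X) (P : set X) : ringed X -> (forall y, P y) -> near_pt x P.
Proof. by move=> rX PT; exists setT; split=> //; exact: open_T. Qed.

Lemma near_open (X : space k) (x : X) (P : set X) : near_pt x P -> 
  near_pt x [set y | near_pt y P].
Proof. by case=> U [Uo Ux UP]; exists U; split=> // y Uy; exists U. Qed.

Lemma reg_opp (X : space k) (x : X) (f : X -> k) : ringed X -> regular x f -> regular x (fun y => - f y).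
Proof.
move=> rX rf; have := reg_mul rX (reg_const rX x (-1)) rf.
by move=> /(reg_ext rX); apply; apply: nearT => // y /=; rewrite mulN1r.
Qed.

Lemma reg_sub (X : space k) (x : X) (f g : X -> k) : ringed X -> regular x f -> regular x g ->
  regular x (fun y => f y - g y).
Proof. by move=> rX rf rg; apply: reg_add => //; exact: reg_opp. Qed.

Lemma reg_sum (X : space k) (x : X) (I : Type) (s : seq I) (P : pred I) (f : I -> X -> k) : ringed X ->
  (forall i, P i -> regular x (f i)) -> regular x (fun y => \sum_(i <- s | P i) f i y).
Proof.
move=> rX rf; elim: s => [|i s IH].
  have := reg_const rX x 0; move=> /(reg_ext rX); apply; apply: nearT => // y /=; exact: big_nil.
case Pi : (P i).
  have := reg_add rX (rf i Pi) IH; move=> /(reg_ext rX); apply; apply: nearT => // y /=.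
  by rewrite big_cons Pi.
by have := IH; move=> /(reg_ext rX); apply; apply: nearT => // y /=; rewrite big_cons Pi.
Qed.

Lemma reg_prod (X : space k) (x : X) (I : Type) (s : seq I) (P : pred I) (f : I -> X -> k) : ringed X ->
  (forall i, P i -> regular x (f i)) -> regular x (fun y => \prod_(i <- s | P i) f i y).
Proof.
move=> rX rf; elim: s => [|i s IH].
  have := reg_const rX x 1; move=> /(reg_ext rX); apply; apply: nearT => // y /=; exact: big_nil.
case Pi : (P i).
  have := reg_mul rX (rf i Pi) IH; move=> /(reg_ext rX); apply; apply: nearT => // y /=.
  by rewrite big_cons Pi.
by have := IH; move=> /(reg_ext rX); apply; apply: nearT => // y /=; rewrite big_cons Pi.
Qed.

Lemma pull_near (X Z : space k) (i : X -> Z) (x : X) (P : set X) (Q : set Z) :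
  (forall U : set X, zopen X U <-> pull_open i U) ->
  near_pt (i x) Q -> (forall y, Q (i y) -> P y) -> near_pt x P.
Proof.
move=> io [V [Vo Vx VQ]] QP; exists (i @^-1` V); split=> //; first by apply/io; exists V.
by move=> y /VQ /QP.
Qed.

Lemma near_pull (X Z : space k) (i : X -> Z) (x : X) (P : set X) :
  (forall U : set X, zopen X U <-> pull_open i U) ->
  near_pt x P -> exists V, [/\ zopen Z V, V (i x) & forall y, V (i y) -> P y].
Proof. by move=> io [U [/io [V [Vo ->]] Vx VP]]; exists V; split. Qed.

Lemma pull_ringed (X Z : space k) (i : X -> Z) :
  (forall U : set X, zopen X U <-> pull_open i U) ->
  (forall (x : X) (f : X -> k), regular x f <-> pull_regular i x f) ->
  ringed Z -> ringed X.
Proof.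
move=> io ir rZ; split.
- by apply/io; exists setT; split; [exact: open_T|rewrite preimage_setT].
- move=> U V /io [U' [Uo ->]] /io [V' [Vo ->]]; apply/io; exists (U' `&` V').
  by split; [exact: open_I|rewrite preimage_setI].
- move=> x f g /ir [h [rh [V [Vo Vx Vh]]]] /(near_pull io) [W [Wo Wx Wfg]].
  apply/ir; exists h; split=> //; exists (V `&` W); split; [exact: open_I|by []|].
  by move=> y [/Vh <- /Wfg].
- move=> x c; apply/ir; exists (fun=> c); split; first exact: reg_const.
  by exists setT; split=> //; exact: open_T.
- move=> x f g /ir [h [rh [V [Vo Vx Vh]]]] /ir [h' [rh' [W [Wo Wx Wh]]]].
  apply/ir; exists (fun z => h z + h' z); split; first exact: reg_add.
  exists (V `&` W); split; [exact: open_I|by []|].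
  by move=> y [/Vh -> /Wh ->].
- move=> x f g /ir [h [rh [V [Vo Vx Vh]]]] /ir [h' [rh' [W [Wo Wx Wh]]]].
  apply/ir; exists (fun z => h z * h' z); split; first exact: reg_mul.
  exists (V `&` W); split; [exact: open_I|by []|].
  by move=> y [/Vh -> /Wh ->].
- move=> x f /ir [h [rh [V [Vo Vx Vh]]]] fx; apply/ir; exists (fun z => (h z)^-1).
  split; first by apply: reg_inv => //; rewrite -Vh.
  by exists V; split=> // y /Vh ->.
- move=> x f /ir [h [rh [V [Vo Vx Vh]]]].
  have [U [Uo Ux Uh]] := reg_near rZ rh.
  apply: (pull_near io (Q := U `&` V)); first by exists (U `&` V); split=> //; exact: open_I.
  by move=> y [Uy Vy]; apply/ir; exists h; split; [exact: Uh|exists V].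
- move=> x f /ir [h [rh [V [Vo Vx Vh]]]] fx.
  have [|U [Uo Ux Uh]] := reg_neq0 rZ rh; first by rewrite -Vh.
  apply: (pull_near io (Q := U `&` V)); first by exists (U `&` V); split=> //; exact: open_I.
  by move=> y [Uy Vy] /=; rewrite Vh //; exact: Uh.
Qed.

Lemma subspace_ringed (X : space k) (C : set X) : ringed X -> ringed (subspace C).
Proof. by apply: (@pull_ringed (subspace C) X (fun y : C => val y)). Qed.

Section FunctionField.
Variable X : space k.
Hypotheses (rX : ringed X) (iX : irreducible [set: X]).

Lemma generic_sub (P Q : set X) : P `<=` Q -> generic P -> generic Q.
Proof. by move=> PQ [U [Uo U0 UP]]; exists U; split=> // y /UP /PQ. Qed.

Lemma near_generic (x : X) (P : set X) : near_pt x P -> generic P.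
Proof. by move=> [U [Uo Ux UP]]; exists U; split=> //; exists x. Qed.

(** Irreducibility: if two nonempty open sets did not meet, their complements would cover the
    space. *)
Lemma genericI (P Q : set X) : generic P -> generic Q -> generic (P `&` Q).
Proof.
move=> [U [Uo [u Uu] UP]] [V [Vo [v Vv] VQ]]; exists (U `&` V); split.
- exact: open_I.
- apply: contrapT => UV0; case: iX => _ /(_ (~` U) (~` V)).
  rewrite /zclosed !setCK => /(_ Uo Vo) [y _|/(_ u I)|/(_ v I)] //.
  apply: contrapT => /not_orP [/contrapT Uy /contrapT Vy]; apply: UV0.
  by exists y.
- by move=> y [/UP ? /VQ ?].
Qed.

Lemma genericT (P : set X) : (forall y, P y) -> generic P.
Proof.
move=> PT; exists setT; split=> //; first exact: open_T.
by case: iX.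
Qed.

Lemma generic_ex (P : set X) : generic P -> exists x, near_pt x P.
Proof. by move=> [U [Uo [x Ux] UP]]; exists x, U. Qed.

Definition rational (f : X -> k) : Prop := generic [set y | regular y f].

Record ratfun := RatFun { ratval : X -> k; _ : `[< rational ratval >] }.
HB.instance Definition _ := [isSub for ratval].
HB.instance Definition _ := [Choice of ratfun by <:].

Lemma ratvalP (f : ratfun) : rational (ratval f).
Proof. by case: f => f /= /asboolP. Qed.

Definition rateq (f g : ratfun) : bool := `[< generic [set y | ratval f y = ratval g y] >].

Lemma rateq_refl : reflexive rateq.
Proof. by move=> f; apply/asboolP/genericT. Qed.
Lemma rateq_sym : ssrbool.symmetric rateq.
Proof.
by move=> f g; apply/asboolP/asboolP; apply: generic_sub => y /= ->.
Qed.
Lemma rateq_trans : transitive rateq.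
Proof.
move=> g f h /asboolP fg /asboolP gh; apply/asboolP.
by apply: generic_sub (genericI fg gh) => y /= [-> ->].
Qed.
Canonical rateq_equiv := EquivRel rateq rateq_refl rateq_sym rateq_trans.

Definition funfield := {eq_quot rateq}.
HB.instance Definition _ := Choice.on funfield.

Lemma rational_const c : rational (fun=> c).
Proof. by apply: genericT => y; exact: reg_const. Qed.

(** Total on functions, with the class of 0 as default for those that are not rational. *)
Definition cls (f : X -> k) : funfield :=
  \pi_funfield%qT (if pselect (rational f) is left Hf then RatFun (asboolT Hf)
          else RatFun (asboolT (rational_const 0))).

Definition rp (h : funfield) : X -> k := ratval (repr h).

Lemma rp_rational h : rational (rp h). Proof. exact: ratvalP. Qed.

Lemma cls_rp h : cls (rp h) = h.
Proof.
rewrite /cls; case: pselect => [Hf|[]]; last exact: rp_rational.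
rewrite -[RHS]reprK; congr (\pi_funfield%qT _); exact: val_inj.
Qed.

Lemma cls_eq f g : rational f -> rational g -> cls f = cls g <-> generic [set y | f y = g y].
Proof.
move=> rf rg; rewrite /cls; case: pselect => // rf'; case: pselect => // rg'.
by split=> [/eqmodP /asboolP //|fg]; apply/eqmodP/asboolP.
Qed.

Lemma rp_cls f : rational f -> generic [set y | rp (cls f) y = f y].
Proof. by move=> rf; apply/cls_eq => //; [exact: rp_rational|exact: cls_rp]. Qed.

Lemma rational_add f g : rational f -> rational g -> rational (fun y => f y + g y).
Proof.
by move=> rf rg; apply: generic_sub (genericI rf rg) => y /= [? ?]; exact: reg_add.
Qed.
Lemma rational_mul f g : rational f -> rational g -> rational (fun y => f y * g y).
Proof.
by move=> rf rg; apply: generic_sub (genericI rf rg) => y /= [? ?]; exact: reg_mul.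
Qed.
Lemma rational_opp f : rational f -> rational (fun y => - f y).
Proof. by apply: generic_sub => y /= ?; exact: reg_opp. Qed.

(** Where [f] is regular, its nonzeros form an open set, which is either empty or dense. *)
Lemma rational_dichotomy f : rational f ->
  generic [set y | f y = 0] \/ generic [set y | f y != 0].
Proof.
move=> rf; have [|nz] := pselect (generic [set y | f y != 0]); first by right.
left; apply: generic_sub rf => y /= ry; apply/eqP/negPn/negP => fy.
by apply: nz; apply: near_generic (reg_neq0 rX ry fy).
Qed.

Lemma rational_inv f : rational f -> rational (fun y => (f y)^-1).
Proof.
move=> rf; have [f0|f0] := rational_dichotomy rf.
  have [U [Uo U0 Uf]] := genericI f0 rf.
  exists U; split=> // y Uy; apply: (reg_ext rX (reg_const rX y 0)).
  by exists U; split=> // z /Uf [/= -> _]; rewrite invr0.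
by apply: generic_sub (genericI f0 rf) => y /= [? ?]; exact: reg_inv.
Qed.

Definition ffadd h g := cls (fun y => rp h y + rp g y).
Definition ffmul h g := cls (fun y => rp h y * rp g y).
Definition ffopp h := cls (fun y => - rp h y).
Definition ffinv h := cls (fun y => (rp h y)^-1).

Lemma cls_add f g : rational f -> rational g -> ffadd (cls f) (cls g) = cls (fun y => f y + g y).
Proof.
move=> rf rg; apply/cls_eq; try by apply: rational_add => //; exact: rp_rational.
by apply: generic_sub (genericI (rp_cls rf) (rp_cls rg)) => y /= [-> ->].
Qed.
Lemma cls_mul f g : rational f -> rational g -> ffmul (cls f) (cls g) = cls (fun y => f y * g y).
Proof.
move=> rf rg; apply/cls_eq; try by apply: rational_mul => //; exact: rp_rational.
by apply: generic_sub (genericI (rp_cls rf) (rp_cls rg)) => y /= [-> ->].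
Qed.
Lemma cls_opp f : rational f -> ffopp (cls f) = cls (fun y => - f y).
Proof.
move=> rf; apply/cls_eq; try by apply: rational_opp => //; exact: rp_rational.
by apply: generic_sub (rp_cls rf) => y /= ->.
Qed.
Lemma cls_inv f : rational f -> ffinv (cls f) = cls (fun y => (f y)^-1).
Proof.
move=> rf; apply/cls_eq; try by apply: rational_inv => //; exact: rp_rational.
by apply: generic_sub (rp_cls rf) => y /= ->.
Qed.

Lemma cls_ind (P : funfield -> Prop) : (forall f, rational f -> P (cls f)) -> forall h, P h.
Proof. by move=> Pf h; rewrite -(cls_rp h); apply: Pf; exact: rp_rational. Qed.

Lemma cls_ext f g : f =1 g -> cls f = cls g.
Proof. by move=> fg; congr cls; apply/funext. Qed.

Lemma ffaddA : associative ffadd.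
Proof.
elim/cls_ind=> f rf; elim/cls_ind=> g rg; elim/cls_ind=> h rh.
by rewrite !cls_add //; try exact: rational_add; apply: cls_ext => y; rewrite addrA.
Qed.
Lemma ffaddC : commutative ffadd.
Proof.
elim/cls_ind=> f rf; elim/cls_ind=> g rg.
by rewrite !cls_add //; apply: cls_ext => y; rewrite addrC.
Qed.
Lemma ffadd0 : left_id (cls (fun=> 0)) ffadd.
Proof.
elim/cls_ind=> f rf; rewrite cls_add //; last exact: rational_const.
by apply: cls_ext => y; rewrite add0r.
Qed.
Lemma ffaddN : left_inverse (cls (fun=> 0)) ffopp ffadd.
Proof.
elim/cls_ind=> f rf; rewrite cls_opp // cls_add //; last exact: rational_opp.
by apply: cls_ext => y; rewrite addNr.
Qed.
HB.instance Definition _ := GRing.isZmodule.Build funfield ffaddA ffaddC ffadd0 ffaddN.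

Lemma ffmulA : associative ffmul.
Proof.
elim/cls_ind=> f rf; elim/cls_ind=> g rg; elim/cls_ind=> h rh.
by rewrite !cls_mul //; try exact: rational_mul; apply: cls_ext => y; rewrite mulrA.
Qed.
Lemma ffmulC : commutative ffmul.
Proof.
elim/cls_ind=> f rf; elim/cls_ind=> g rg.
by rewrite !cls_mul //; apply: cls_ext => y; rewrite mulrC.
Qed.
Lemma ffmul1 : left_id (cls (fun=> 1)) ffmul.
Proof.
elim/cls_ind=> f rf; rewrite cls_mul //; last exact: rational_const.
by apply: cls_ext => y; rewrite mul1r.
Qed.
Lemma ffmulD : left_distributive ffmul ffadd.
Proof.
elim/cls_ind=> f rf; elim/cls_ind=> g rg; elim/cls_ind=> h rh.
rewrite (cls_add rf rg) (cls_mul rf rh) (cls_mul rg rh) cls_mul ?cls_add //;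
  try exact: rational_mul; try exact: rational_add.
by apply: cls_ext => y; rewrite mulrDl.
Qed.
Lemma ff1_neq0 : cls (fun=> 1) != cls (fun=> 0).
Proof.
apply/eqP => /(cls_eq (rational_const 1) (rational_const 0)) [U [_ [u Uu] U0]].
by have /eqP := U0 u Uu; rewrite oner_eq0.
Qed.
HB.instance Definition _ := GRing.Zmodule_isComNzRing.Build funfield
  ffmulA ffmulC ffmul1 ffmulD ff1_neq0.

Lemma cls_eq0 f : rational f -> (cls f == 0) <-> generic [set y | f y = 0].
Proof. by move=> rf; split=> [/eqP/(cls_eq rf (rational_const 0))|?] //; apply/eqP/cls_eq => //; exact: rational_const. Qed.

Lemma ffmulV : forall h : funfield, h != 0 -> ffinv h * h = 1.
Proof.
elim/cls_ind=> f rf f0; rewrite cls_inv // [LHS]cls_mul //; last exact: rational_inv.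
have [/(cls_eq0 rf) E|fn0] := rational_dichotomy rf; first by rewrite E in f0.
apply/cls_eq.
- by apply: rational_mul => //; exact: rational_inv.
- exact: rational_const.
- by apply: generic_sub fn0 => y /= fy; rewrite mulVf.
Qed.
Lemma ffinv0 : ffinv 0 = 0.
Proof.
rewrite [LHS]cls_inv; last exact: rational_const.
by apply: cls_ext => y; rewrite invr0.
Qed.
HB.instance Definition _ := GRing.ComNzRing_isField.Build funfield ffmulV ffinv0.

Lemma clsD f g : rational f -> rational g -> cls (fun y => f y + g y) = cls f + cls g.
Proof. by move=> *; rewrite -cls_add. Qed.
Lemma clsM f g : rational f -> rational g -> cls (fun y => f y * g y) = cls f * cls g.
Proof. by move=> *; rewrite -cls_mul. Qed.
Lemma clsN f : rational f -> cls (fun y => - f y) = - cls f.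
Proof. by move=> *; rewrite -cls_opp. Qed.
Lemma clsV f : rational f -> cls (fun y => (f y)^-1) = (cls f)^-1.
Proof. by move=> *; rewrite -cls_inv. Qed.

Definition ffconst (c : k) : funfield := cls (fun=> c).
Lemma ffconst_zmod : zmod_morphism ffconst.
Proof.
move=> a b; rewrite /ffconst -clsN -?clsD //; try exact: rational_const.
Qed.
Lemma ffconst_monoid : monoid_morphism ffconst.
Proof. by split=> // a b; rewrite /ffconst -clsM //; exact: rational_const. Qed.
HB.instance Definition _ := GRing.isZmodMorphism.Build k funfield ffconst ffconst_zmod.
HB.instance Definition _ := GRing.isMonoidMorphism.Build k funfield ffconst ffconst_monoid.

End FunctionField.
End Ringed.

Lemma meval_homog (k : fieldType) (N d : nat) (Q : {mpoly k[N]}) (a : 'I_N -> k) c :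
  Q \is d.-homog -> Q.@[fun i => c * a i] = c ^+ d * Q.@[a].
Proof.
move=> /dhomogP hQ; rewrite !mevalE mulr_sumr; apply: eq_big_seq => m mQ.
rewrite mulrCA; congr (_ * _).
have -> : d = (\sum_i m i)%N by rewrite -(hQ m mQ); exact: mdegE.
rewrite -prodrXr -big_split /=; apply: eq_bigr => i _.
by rewrite exprMn.
Qed.

(** * Projective space *)

Section Pn.
Variables (k : fieldType) (N : nat).
Implicit Types L M : line k N.

Lemma hcoord_neq0 L : exists i, hcoord L i != 0.
Proof.
apply: contrapT => no; have : vpick (val L) = 0.
  by apply/rowP => i; rewrite mxE; apply/eqP/negPn/negP => ni; apply: no; exists i.
move/eqP; rewrite vpick0 => /eqP L0; have := valP L; by rewrite L0 dimv0.
Qed.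

Lemma line_span L : val L = <[vpick (val L)]>%VS.
Proof.
apply/esym/eqP; rewrite eqEdim -memvE memv_pick (eqP (valP L)) dim_vline.
by rewrite vpick0 -dimv_eq0 (eqP (valP L)).
Qed.

Lemma line_inj L M : (forall i j, hcoord L i * hcoord M j = hcoord L j * hcoord M i) -> L = M.
Proof.
move=> E; apply: val_inj; rewrite (line_span L) (line_span M).
have [i Li] := hcoord_neq0 L; have [j Mj] := hcoord_neq0 M.
have Mi : hcoord M i != 0.
  apply: contra_neq Li => M0; have := E i j; rewrite M0 mulr0 => /eqP.
  by rewrite mulf_eq0 (negbTE Mj) orbF => /eqP.
have -> : vpick (val L) = (hcoord L i / hcoord M i) *: vpick (val M).
  apply/rowP => l; rewrite mxE; have := E i l; rewrite /hcoord => El.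
  by rewrite mulrAC El mulfK.
by apply/vspaceP => u; apply/vlineP/vlineP => -[c ->];
  [exists (c * (hcoord L i / hcoord M i))|exists (c / (hcoord L i / hcoord M i))];
  rewrite scalerA ?divfK // mulf_neq0 // invr_eq0.
Qed.

Lemma line_ex (a : 'I_N.+1 -> k) : (exists i, a i != 0) ->
  exists L c, c != 0 /\ forall i, hcoord L i = c * a i.
Proof.
case=> i ai; pose u := \row_i a i.
have u0 : u != 0 by apply: contra_neq ai => /rowP /(_ i); rewrite !mxE.
have d1 : \dim <[u]>%VS == 1%N by rewrite dim_vline u0.
exists (exist _ <[u]>%VS d1 : line k N).
have /vlineP [c cE] := memv_pick (<[u]>%VS).
exists c; split.
  apply/eqP => c0; have : vpick <[u]>%VS == 0 by rewrite cE c0 scale0r.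
  by rewrite vpick0 -dimv_eq0 (eqP d1).
by move=> l; rewrite /hcoord /= cE !mxE.
Qed.

Lemma Pn_openP d (Q : {mpoly k[N.+1]}) : Q \is d.-homog -> zopen (Pn k N) [set M | Q.@[hcoord M] != 0].
Proof. by move=> hQ L /= QL; exists d, Q. Qed.

Lemma Pn_nearP (L : Pn k N) (P : set (Pn k N)) : near_pt L P <-> exists d Q,
  [/\ Q \is d.-homog, Q.@[hcoord L] != 0 & forall M : Pn k N, Q.@[hcoord M] != 0 -> P M].
Proof.
split=> [[U [Uo UL UP]]|[d [Q [hQ QL QP]]]].
  by have [d [Q [hQ QL QU]]] := Uo L UL; exists d, Q; split=> // M /QU /UP.
by exists [set M | Q.@[hcoord M] != 0]; split=> //; exact: Pn_openP hQ.
Qed.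

Lemma Pn_ringed : ringed (Pn k N).
Proof.
split.
- by move=> L _; exists 0%N, 1; rewrite dhomog1 meval1 oner_eq0; split.
- move=> U V Uo Vo L [UL VL]; have [d [Q [hQ QL QU]]] := Uo L UL; have [e [P [hP PL PV]]] := Vo L VL.
  exists (d + e)%N, (Q * P); rewrite dhomogM // mevalM mulf_neq0 //; split=> // M.
  by rewrite mevalM mulf_eq0 negb_or => /andP [/QU ? /PV].
- move=> L f g [d [P [Q [hP hQ QL E]]]] /Pn_nearP [e [Q' [hQ' QL' E']]].
  exists (d + e)%N, (P * Q'), (Q * Q'); split; rewrite ?dhomogM ?mevalM ?mulf_neq0 // => M.
  rewrite !mevalM mulf_eq0 negb_or => /andP [QM QM'].
  by rewrite E' // E // -mulf_div divff // mulr1.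
- move=> L c; exists 0%N, c%:MP, 1; rewrite dhomog1 meval1 oner_eq0 -[c%:MP]mulr1 mul_mpolyC rpredZ ?dhomog1 //.
  by split=> // M; rewrite meval1 mevalZ meval1 mulr1 divr1.
- move=> L f g [d [P [Q [hP hQ QL E]]]] [e [P' [Q' [hP' hQ' QL' E']]]].
  exists (d + e)%N, (P * Q' + Q * P'), (Q * Q'); split; rewrite ?rpredD ?dhomogM ?mevalM ?mulf_neq0 // => M.
  rewrite !mevalD !mevalM mulf_eq0 negb_or => /andP [QM QM'].
  by rewrite E // E' // addf_div // [_.@[_] * P'.@[_]]mulrC.
- move=> L f g [d [P [Q [hP hQ QL E]]]] [e [P' [Q' [hP' hQ' QL' E']]]].
  exists (d + e)%N, (P * P'), (Q * Q'); split; rewrite ?dhomogM ?mevalM ?mulf_neq0 // => M.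
  rewrite !mevalM mulf_eq0 negb_or => /andP [QM QM'].
  by rewrite E // E' // mulf_div.
- move=> L f [d [P [Q [hP hQ QL E]]]]; rewrite E // mulf_eq0 negb_or => /andP [PL _].
  exists (d + d)%N, (Q * Q), (P * Q); split; rewrite ?dhomogM ?mevalM ?mulf_neq0 // => M.
  rewrite !mevalM mulf_eq0 negb_or => /andP [PM QM].
  by rewrite E // invf_div -mulf_div divff // mulr1.
- move=> L f [d [P [Q [hP hQ QL E]]]]; apply/Pn_nearP; exists d, Q; split=> // M QM.
  by exists d, P, Q.
- move=> L f [d [P [Q [hP hQ QL E]]]]; rewrite E // mulf_eq0 negb_or => /andP [PL _].
  apply/Pn_nearP; exists (d + d)%N, (P * Q); rewrite dhomogM // mevalM mulf_neq0 //; split=> // M.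
  rewrite !mevalM mulf_eq0 negb_or => /andP [PM QM] /=.
  by rewrite E // mulf_neq0 // invr_eq0.
Qed.
End Pn.

(** * Local rings whose maximal ideal is spanned by one element modulo its square *)

Section DVR.
Variables (k F : fieldType) (iota : {rmorphism k -> F}) (O : F -> Prop) (ev : F -> k).
Hypotheses (Oc : forall c, O (iota c)) (evc : forall c, ev (iota c) = c).
Hypotheses (OD : forall a b, O a -> O b -> O (a + b))
  (evD : forall a b, O a -> O b -> ev (a + b) = ev a + ev b).
Hypotheses (OM : forall a b, O a -> O b -> O (a * b))
  (evM : forall a b, O a -> O b -> ev (a * b) = ev a * ev b).
Hypothesis OV : forall a, O a -> ev a != 0 -> O a^-1.
Hypothesis Ofrac : forall h, exists a b, [/\ O a, O b, b != 0 & h = a / b].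
Definition inm h := O h /\ ev h = 0.
Variable t : F.
Hypotheses (t0 : t != 0) (mt : inm t).

Fixpoint span (s : seq F) (h : F) : Prop :=
  if s is g :: s' then exists2 a, O a & span s' (h - a * g) else h = 0.

Variable s0 : seq F.
Hypotheses (s0m : forall a, a \in s0 -> inm a) (s0P : forall h, inm h -> span s0 h).
Hypothesis tm2 : forall h, inm h -> exists (c : k) (r : nat) (a b : 'I_r -> F),
  [/\ forall j, inm (a j), forall j, inm (b j) & h = iota c * t + \sum_j a j * b j].
Hypothesis chain0 : forall g : nat -> F, (forall i, O (g i)) -> (forall i, g i = t * g i.+1) -> g 0%N = 0.

Lemma O0 : O 0. Proof. by rewrite -(rmorph0 iota). Qed.
Lemma O1 : O 1. Proof. by rewrite -(rmorph1 iota). Qed.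
Lemma ev0 : ev 0 = 0. Proof. by rewrite -(rmorph0 iota). Qed.
Lemma ev1 : ev 1 = 1. Proof. by rewrite -(rmorph1 iota) evc. Qed.
Lemma ON a : O a -> O (- a).
Proof. by move=> Oa; rewrite -mulN1r -(rmorphN1 iota); apply: OM. Qed.
Lemma evN a : O a -> ev (- a) = - ev a.
Proof. by move=> Oa; rewrite -mulN1r -(rmorphN1 iota) evM // evc mulN1r. Qed.
Lemma evV a : O a -> ev a != 0 -> ev a^-1 = (ev a)^-1.
Proof.
move=> Oa a0; have an0 : a != 0 by apply: contra_neq a0 => ->; rewrite ev0.
apply: (mulfI a0); rewrite -evM ?divff //; [exact: ev1|exact: OV].
Qed.
Lemma inmM a h : O a -> inm h -> inm (a * h).
Proof. by move=> Oa [Oh h0]; split; [exact: OM|rewrite evM // h0 mulr0]. Qed.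
Lemma inmD a h : inm a -> inm h -> inm (a + h).
Proof. by move=> [Oa a0] [Oh h0]; split; [exact: OD|rewrite evD // h0 a0 addr0]. Qed.

Lemma span_add s h g : span s h -> span s g -> span s (h + g).
Proof.
elim: s h g => [|a s IH] h g /=; first by move=> -> ->; rewrite addr0.
move=> [b Ob hb] [c Oc' gc]; exists (b + c); first exact: OD.
by rewrite (_ : _ - _ = (h - b * a) + (g - c * a)); [exact: IH|ring].
Qed.
Lemma span_mul s h c : O c -> span s h -> span s (c * h).
Proof.
elim: s h => [|a s IH] h /= Oc'; first by move=> ->; rewrite mulr0.
move=> [b Ob hb]; exists (c * b); first exact: OM.
by rewrite (_ : _ - _ = c * (h - b * a)); [exact: IH|ring].
Qed.
Lemma span0 s : span s 0.
Proof. by elim: s => //= a s IH; exists 0; [exact: O0|rewrite mul0r subr0]. Qed.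
Lemma span_cons g s h : span s h -> span (g :: s) h.
Proof. by move=> sh; exists 0; [exact: O0|rewrite mul0r subr0]. Qed.
Lemma span_head g s : span (g :: s) g.
Proof. by exists 1; [exact: O1|rewrite mul1r subrr; exact: span0]. Qed.

(* Nakayama's lemma, removing the generators of the maximal ideal one at a time. *)
Lemma nakayama s : (forall a, a \in s -> inm a) -> (forall h, inm h -> span (t :: s) h) ->
  forall h, inm h -> span [:: t] h.
Proof.
elim: s => // a s IH sm sp; apply: IH => [b bs|h hm].
  by apply: sm; rewrite inE bs orbT.
have am : inm a by apply: sm; rewrite mem_head.
(* Products of two elements of the maximal ideal have the form U t + V a + W with V in the ideal.
   Inserted in the expression of [a] modulo squares, this puts (1 - V) a in the span of [t] and [s],
   and 1 - V is a unit. *)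
pose P g := exists U V W, [/\ O U, inm V, span s W & g = U * t + V * a + W].
have PD g g' : P g -> P g' -> P (g + g').
  move=> [U [V [W [OU mV sW ->]]]] [U' [V' [W' [OU' mV' sW' ->]]]].
  exists (U + U'), (V + V'), (W + W').
  by split; [exact: OD|exact: inmD|exact: span_add|ring].
have Pp p q : inm p -> inm q -> P (p * q).
  move=> pm /sp [u Ou [v Ov sw]]; exists (p * u), (v * p), (p * (q - u * t - v * a)).
  by split; [apply: OM => //; case: pm|exact: inmM|apply: span_mul => //; case: pm|ring].
have [c [r [p [q [pm qm aE]]]]] := tm2 am.
have [U [V [W [OU [OV' V0] sW E]]]] : P (\sum_j p j * q j).
  elim/big_ind: _ => //; last by move=> j _; exact: Pp.
  by exists 0, 0, 0; split; [exact: O0|split; [exact: O0|exact: ev0]|exact: span0|ring].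
have Ow : O (1 - V) by apply: OD; [exact: O1|exact: ON].
have w1 : ev (1 - V) = 1 by rewrite evD ?evN ?V0 ?ev1 ?oppr0 ?addr0 //; [exact: O1|exact: ON].
have w0 : ev (1 - V) != 0 by rewrite w1 oner_neq0.
have wn0 : 1 - V != 0 by apply: contra_neq w0 => ->; rewrite ev0.
have asp : span (t :: s) a.
  have -> : a = (1 - V)^-1 * ((iota c + U) * t + W).
    apply: (mulfI wn0); rewrite mulVKf // mulrBl mul1r {1}aE E; ring.
  apply: span_mul; first exact: OV.
  exists (iota c + U); first exact: OD.
  by rewrite addrC addKr.
have [u Ou [v Ov sw]] := sp h hm.
have -> : h = u * t + (v * a + (h - u * t - v * a)) by ring.
apply: span_add; first by apply: span_mul => //; exact: span_head.
apply: span_add; first exact: span_mul.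
exact: span_cons.
Qed.

Lemma t_div h : inm h -> exists2 g, O g & h = t * g.
Proof.
move=> hm; have [|g Og /= /eqP] := nakayama s0m _ hm.
  by move=> g gm; apply: span_cons; exact: s0P.
by rewrite subr_eq0 mulrC => /eqP; exists g.
Qed.

(** Division by [t] goes on as long as the value is 0; if it never stopped, [chain0] would give h =
    0. *)
Lemma O_order h : O h -> h != 0 -> exists (n : nat) (u : F), [/\ O u, ev u != 0 & h = t ^+ n * u].
Proof.
move=> Oh h0; apply: contrapT => no.
pose B h := O h /\ ~ exists (n : nat) (u : F), [/\ O u, ev u != 0 & h = t ^+ n * u].
have Bn g : B g -> exists g', B g' /\ g = t * g'.
  move=> [Og ng]; have [g0|g0] := eqVneq (ev g) 0; last first.
    by case: ng; exists 0%N, g; rewrite expr0 mul1r.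
  have [g' Og' E] := t_div (conj Og g0); exists g'; split=> //; split=> // -[n [u [Ou u0 gE]]].
  by apply: ng; exists n.+1, u; rewrite E gE mulrA -exprS.
pose nx g := if pselect (exists g', B g' /\ g = t * g') is left H then sval (cid H) else 0.
have nxP g : B g -> B (nx g) /\ g = t * nx g.
  by move=> /Bn H; rewrite /nx; case: pselect => // H'; case: cid.
have BI i : B (iter i nx h) by elim: i => [|i /nxP []].
have := chain0 (g := fun i => iter i nx h).
move=> /(_ (fun i => (BI i).1) (fun i => (nxP _ (BI i)).2)) E.
by rewrite /= in E; rewrite E eqxx in h0.
Qed.

Definition is_unit u := O u /\ ev u != 0.
Lemma is_unitM u w : is_unit u -> is_unit w -> is_unit (u * w).
Proof. by move=> [Ou u0] [Ow w0]; split; [exact: OM|rewrite evM // mulf_neq0]. Qed.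
Lemma is_unitV u : is_unit u -> is_unit u^-1.
Proof. by move=> [Ou u0]; split; [exact: OV|rewrite evV // invr_eq0]. Qed.
Lemma is_unit_neq0 u : is_unit u -> u != 0.
Proof. by move=> [_]; apply: contra_neq => ->; exact: ev0. Qed.

Lemma order_ex h : h != 0 -> exists (n : int) (u : F), is_unit u /\ h = t ^ n * u.
Proof.
have [a [b [Oa Ob b0 ->]]] := Ofrac h.
rewrite mulf_eq0 invr_eq0 negb_or => /andP [a0 _].
have [m [u [Ou u0 ->]]] := O_order Oa a0; have [n [w [Ow w0 ->]]] := O_order Ob b0.
exists (m%:Z - n%:Z), (u / w); split; first by apply: is_unitM => //; apply: is_unitV.
by rewrite expfzDr // -invr_expz -!exprnP invfM mulrACA.
Qed.

Definition order h : int := if pselect (exists n : int, exists u, is_unit u /\ h = t ^ n * u) is left H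
  then sval (cid H) else 0.

Lemma t_pow_unit (n : int) u w : is_unit u -> is_unit w -> t ^ n * u = w -> n = 0.
Proof.
move=> uu uw E.
have nopos (m : nat) x : is_unit x -> t ^+ m.+1 != x.
  move=> [Ox /negP x0]; apply/eqP => X; apply: x0; rewrite -X exprS evM; last 1 first.
  - by elim: m {X} => [|m IH]; [exact: O1|rewrite exprS; apply: OM => //; case: mt].
  - by case: mt => _ ->; rewrite mul0r.
  - by case: mt.
case: n E => [[|m]|m] E //.
  have := nopos m _ (is_unitM uw (is_unitV uu)).
  by rewrite -E exprnP mulfK ?eqxx //; exact: is_unit_neq0.
have := nopos m _ (is_unitM uu (is_unitV uw)).
by rewrite -E invfM NegzE -exprnN invrK mulrCA mulfV ?mulr1 ?eqxx //; exact: is_unit_neq0.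
Qed.

Lemma orderE (n : int) u : is_unit u -> order (t ^ n * u) = n.
Proof.
move=> uu; rewrite /order; case: pselect => [H|[]]; last by exists n, u.
case: cid => m /= [w [uw E]]; apply/eqP; rewrite -subr_eq0; apply/eqP.
apply: (t_pow_unit uw uu); rewrite expfzDr // mulrAC -E -invr_expz mulrAC mulfV ?mul1r //.
by rewrite expfz_neq0.
Qed.

Lemma orderP h : h != 0 -> exists2 u, is_unit u & h = t ^ order h * u.
Proof. by move=> /order_ex [n [u [uu E]]]; exists u; rewrite // E orderE. Qed.

Lemma order_mul h g : h != 0 -> g != 0 -> order (h * g) = order h + order g.
Proof.
move=> /orderP [u uu {1}->] /orderP [w uw {1}->].
by rewrite mulrACA -expfzDr // orderE //; exact: is_unitM.
Qed.
Lemma order_unit u : is_unit u -> order u = 0.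
Proof. by move=> uu; rewrite -[u]mul1r -(expr0z t) orderE. Qed.
Lemma order_t : order t = 1.
Proof.
rewrite -{1}[t]mulr1 -{1}(expr1z t) orderE //.
by split; [exact: O1|rewrite ev1 oner_eq0].
Qed.

(** Turns inequalities for orders into membership in [O]; the ultrametric inequality then is closure
    under addition. *)
Lemma order_geP (m : int) h : (h == 0) || (m <= order h) <-> O (t ^ (- m) * h).
Proof.
have [->|h0] := eqVneq h 0; first by rewrite mulr0; split=> // _; exact: O0.
have [u uu E] := orderP h0; rewrite /= {2}E mulrA -expfzDr //.
split=> [mh|Oh].
  have -> : - m + order h = (absz (order h - m))%:Z by rewrite gez0_abs ?subr_ge0 // addrC.
  apply: OM; last by case: uu.
  by elim: `|_|%N => [|i IH]; [exact: O1|rewrite -exprnP exprS; apply: OM => //; case: mt].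
rewrite leNgt; apply/negP => hm.
have [i iE] : exists i : nat, - m + order h = - i.+1%:Z.
  exists (absz (m - order h)).-1; lia.
have un : is_unit (t ^ (- m + order h) * u).
  split=> //; apply/negP => /eqP v0.
  have : ev (t ^+ i.+1 * (t ^ (- m + order h) * u)) = 0.
    rewrite evM // ?v0 ?mulr0 //.
    by elim: i {iE v0} => [|i IH]; [rewrite expr1; case: mt|rewrite exprS; apply: OM => //; case: mt].
  rewrite iE -invr_expz -exprnP mulVKf ?expf_neq0 // => u0.
  by case: uu => _; rewrite u0 eqxx.
have := t_pow_unit uu un (n := - m + order h) erefl; lia.
Qed.

Lemma order_add (m : int) h g : (h == 0) || (m <= order h) -> (g == 0) || (m <= order g) ->
  (h + g == 0) || (m <= order (h + g)).
Proof. by move=> /order_geP Oh /order_geP Og; apply/order_geP; rewrite mulrDr; exact: OD. Qed.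

Lemma order_ge0 h : (h == 0) || (0 <= order h) <-> O h.
Proof. by have := order_geP 0 h; rewrite oppr0 expr0z mul1r. Qed.

Lemma order_ge1 h : (h == 0) || (1 <= order h) <-> inm h.
Proof.
split=> [/order_geP Oh|/t_div [g Og ->]].
  have -> : h = (t ^ (- 1) * h) * t by rewrite mulrAC exprN1 mulVf ?mul1r.
  exact: inmM.
by apply/order_geP; rewrite exprN1 mulKf.
Qed.

Lemma order_unitP h : h != 0 -> order h = 0 <-> is_unit h.
Proof.
move=> h0; split=> [h00|]; last exact: order_unit.
by have [u uu ->] := orderP h0; rewrite h00 expr0z mul1r.
Qed.
End DVR.

(** * Germs of regular functions inside the function field *)

Section LocalRing.
Variables (k : fieldType) (X : space k) (rX : ringed X) (iX : irreducible [set: X]).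
Let F := funfield rX iX.
Let cls := (@cls k X rX iX).

Lemma regular_rational y f : regular y f -> rational (X := X) f.
Proof. by move=> /(reg_near rX) /near_generic. Qed.

(** A nonzero value in the domain of regularity would make [f] nonzero on a nonempty open set,
    against its generic vanishing. *)
Lemma regular_zero y (f : X -> k) : regular y f -> generic [set z | f z = 0] -> near_pt y [set z | f z = 0].
Proof.
move=> /(reg_near rX) [U [Uo Uy Uf]] f0; exists U; split=> // z Uz /=.
apply/eqP/negPn/negP => fz; have := near_generic (reg_neq0 rX (Uf z Uz) fz).
by move=> /(genericI rX iX f0) /generic_ex [w /near_self [/= -> /eqP]].
Qed.

Lemma regular_eq y (f g : X -> k) : regular y f -> regular y g -> generic [set z | f z = g z] ->
  near_pt y [set z | f z = g z].
Proof.
move=> rf rg E; have := regular_zero (reg_sub rX rf rg).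
move=> []; first by apply: generic_sub E => z /= ->; rewrite subrr.
by move=> U [Uo Uy UE]; exists U; split=> // z /UE /= /eqP; rewrite subr_eq0 => /eqP.
Qed.

Definition reg_at (y : X) (h : F) : Prop := exists f, regular y f /\ h = cls f.
Definition ffval (y : X) (h : F) : k := if pselect (reg_at y h) is left H then sval (cid H) y else 0.

Lemma ffval_cls y f : regular y f -> ffval y (cls f) = f y.
Proof.
move=> rf; rewrite /ffval; case: pselect => [H|[]]; last by exists f.
case: cid => g /= [rg /(cls_eq rX iX (regular_rational rf) (regular_rational rg)) E].
by have := near_self (regular_eq rf rg E).
Qed.
Lemma reg_at_cls y f : regular y f -> reg_at y (cls f).
Proof. by exists f. Qed.

Lemma reg_at_const y c : reg_at y (ffconst rX iX c).
Proof. by exists (fun=> c); split=> //; exact: reg_const. Qed.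
Lemma ffval_const y c : ffval y (ffconst rX iX c) = c.
Proof. by rewrite ffval_cls //; exact: reg_const. Qed.
Lemma reg_atD y a b : reg_at y a -> reg_at y b -> reg_at y (a + b).
Proof.
move=> [f [rf ->]] [g [rg ->]]; rewrite /cls -clsD.
- by apply: reg_at_cls; exact: reg_add.
- exact: regular_rational rf.
- exact: regular_rational rg.
Qed.
Lemma ffvalD y a b : reg_at y a -> reg_at y b -> ffval y (a + b) = ffval y a + ffval y b.
Proof.
move=> [f [rf ->]] [g [rg ->]]; rewrite /cls -clsD; try exact: regular_rational; try eassumption.
- by rewrite !ffval_cls //; exact: reg_add.
- exact: regular_rational rf.
- exact: regular_rational rg.
Qed.
Lemma reg_atM y a b : reg_at y a -> reg_at y b -> reg_at y (a * b).
Proof.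
move=> [f [rf ->]] [g [rg ->]]; rewrite /cls -clsM.
- by apply: reg_at_cls; exact: reg_mul.
- exact: regular_rational rf.
- exact: regular_rational rg.
Qed.
Lemma ffvalM y a b : reg_at y a -> reg_at y b -> ffval y (a * b) = ffval y a * ffval y b.
Proof.
move=> [f [rf ->]] [g [rg ->]]; rewrite /cls -clsM.
- by rewrite !ffval_cls //; exact: reg_mul.
- exact: regular_rational rf.
- exact: regular_rational rg.
Qed.
Lemma reg_atV y a : reg_at y a -> ffval y a != 0 -> reg_at y a^-1.
Proof.
move=> [f [rf ->]]; rewrite ffval_cls // => f0; rewrite /cls -clsV; last exact: regular_rational rf.
by apply: reg_at_cls; exact: reg_inv.
Qed.

Lemma generic_reg_at h : generic [set y | reg_at y h].
Proof.
elim/cls_ind: h => f rf; apply: generic_sub rf => y /= ?; exact: reg_at_cls.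
Qed.

End LocalRing.

(** * Closed subvarieties of projective space *)

Section Projective.
Variables (k : fieldType) (Y : space k) (N : nat) (i : Y -> Pn k N).
Hypothesis ci : closed_immersion i.

Let io : forall U : set Y, zopen Y U <-> pull_open i U. Proof. by case: ci. Qed.
Let ir : forall (x : Y) (f : Y -> k), regular x f <-> pull_regular i x f. Proof. by case: ci. Qed.

Lemma proj_ringed : ringed Y. Proof. exact: pull_ringed io ir (Pn_ringed k N). Qed.
Let rY := proj_ringed.

Definition hc (y : Y) : 'I_N.+1 -> k := hcoord (i y).
Definition affcrd (l j : 'I_N.+1) (y : Y) : k := hc y j / hc y l.

Lemma proj_nearP (y : Y) (P : set Y) : near_pt y P <-> exists d (Q : {mpoly k[N.+1]}),
  [/\ Q \is d.-homog, Q.@[hc y] != 0 & forall z, Q.@[hc z] != 0 -> P z].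
Proof.
split=> [/(near_pull io) [V [Vo Vy VP]]|[d [Q [hQ Qy QP]]]].
  have /Pn_nearP [d [Q [hQ Qy QV]]] : @near_pt k (Pn k N) (i y) V by exists V; split.
  by exists d, Q; split=> // z /QV /VP.
apply: (pull_near io) (_ : near_pt (i y) [set M | Q.@[hcoord M] != 0]) _ => //.
by exists [set M | Q.@[hcoord M] != 0]; split=> //; exact: Pn_openP hQ.
Qed.

Lemma acrd_homog (d : nat) (P : {mpoly k[N.+1]}) l (y : Y) : P \is d.-homog -> hc y l != 0 ->
  P.@[hc y] = hc y l ^+ d * P.@[affcrd l ^~ y].
Proof.
move=> hP yl; rewrite -(meval_homog _ _ hP); apply: meval_eq => j.
by rewrite /affcrd mulrCA mulfV // mulr1.
Qed.

Lemma near_acrd y l : hc y l != 0 -> near_pt y [set z | hc z l != 0].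
Proof.
move=> yl; apply/proj_nearP; exists 1%N, 'X_l; rewrite mevalXU yl; split=> //.
  by rewrite dhomogX; apply/eqP; exact: mdeg1.
by move=> z; rewrite mevalXU.
Qed.

Lemma acrd_regular y l j : hc y l != 0 -> regular y (affcrd l j).
Proof.
move=> yl; apply/ir; exists (fun M : Pn k N => hcoord (M : line k N) j / hcoord (M : line k N) l); split.
  exists 1%N, 'X_j, 'X_l; rewrite !dhomogX mevalXU; split=> //; try by apply/eqP; exact: mdeg1.
  move=> M.
  by rewrite !mevalXU.
by exists setT; split=> //; exact: open_T (Pn_ringed k N).
Qed.

Lemma poly_regular y l (P : {mpoly k[N.+1]}) : hc y l != 0 -> regular y (fun z => P.@[affcrd l ^~ z]).
Proof.
move=> yl; elim/mpolyind: P => [|c m P _ _ IH].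
  by apply: (reg_ext rY (reg_const rY y 0)); apply: nearT => // z /=; rewrite meval0.
have rm : regular y (fun z => c * \prod_(j < N.+1) affcrd l j z ^+ m j).
  apply: (reg_mul rY (reg_const rY y c)); apply: (@reg_prod _ _ _ _ _ _ _ rY) => j _.
  elim: (m j) => [|e IHe].
    by apply: (reg_ext rY (reg_const rY y 1)); apply: nearT => // z /=; rewrite expr0.
  apply: (reg_ext rY (reg_mul rY (acrd_regular j yl) IHe)); apply: nearT => // z /=.
  by rewrite exprS.
apply: (reg_ext rY (reg_add rY rm IH)); apply: nearT => // z /=.
by rewrite mevalD mevalZ mevalX.
Qed.

Lemma regular_frac y f : regular y f -> exists d (P Q : {mpoly k[N.+1]}),
  [/\ P \is d.-homog, Q \is d.-homog, Q.@[hc y] != 0 &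
    near_pt y [set z | f z = P.@[hc z] / Q.@[hc z]]].
Proof.
move=> /ir [g [[d [P [Q [hP hQ Qy E]]]] [V [Vo Vy VE]]]].
exists d, P, Q; split=> //.
have nV : near_pt y [set z | V (i z)].
  by apply: (pull_near (Q := V) io) => //; exists V; split.
have nQ : near_pt y [set z | Q.@[hc z] != 0] by apply/proj_nearP; exists d, Q.
apply: near_sub (nearI rY nV nQ) => z [/= Vz Qz].
by rewrite VE // E.
Qed.

Lemma proj_openP (U : set Y) : zopen Y U <-> forall y, U y -> near_pt y U.
Proof.
split=> [Uo y Uy|H]; first by exists U; split.
apply/io; exists [set M | exists d (Q : {mpoly k[N.+1]}),
  [/\ Q \is d.-homog, Q.@[hcoord (M : line k N)] != 0 & forall z, Q.@[hc z] != 0 -> U z]]; split.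
  move=> M [d [Q [hQ QM QU]]]; exists d, Q; split=> // M' QM'; by exists d, Q.
apply/seteqP; split=> y /=; first by move=> /H /proj_nearP.
by move=> [d [Q [_ Qy QU]]]; exact: QU.
Qed.

Lemma proj_closedI (A B : set Y) : zclosed A -> zclosed B -> zclosed (A `&` B).
Proof.
rewrite /zclosed => Ao Bo; apply/proj_openP => y; rewrite setCI => -[nA|nB].
  by exists (~` A); split=> // z; left.
by exists (~` B); split=> // z; right.
Qed.

Lemma proj_point_closed (y : Y) : zclosed [set y].
Proof.
apply/proj_openP => z /= zy; apply: contrapT => nz; apply: zy; case: ci => inj _ _ _; apply: inj.
apply: line_inj => a b; apply/eqP; rewrite -subr_eq0; apply/negPn/negP => ab; apply: nz.
pose Q : {mpoly k[N.+1]} := (hc y b) *: 'X_a - (hc y a) *: 'X_b.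
have QE w : Q.@[hc w] = hc w a * hc y b - hc w b * hc y a.
  by rewrite /Q mevalB !mevalZ !mevalXU mulrC [hc y a * _]mulrC.
apply/proj_nearP; exists 1%N, Q; split.
- by rewrite rpredB // rpredZ // dhomogX; apply/eqP; exact: mdeg1.
- by rewrite QE.
- move=> w Qw /= E; move: Qw; rewrite QE E mulrC subrr eqxx //.
Qed.

(** A strictly decreasing sequence of closed sets gives a strictly increasing sequence of ideals,
    those of the polynomials that vanish at the chosen representatives of their points, against
    [acc_mpoly]. Homogeneous forms separate consecutive sets. *)
Lemma noeth_closed (P : set Y -> Prop) : (exists Z, zclosed Z /\ P Z) ->
  exists Z, [/\ zclosed Z, P Z & forall Z', zclosed Z' -> P Z' -> Z' `<=` Z -> Z `<=` Z'].
Proof.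
move=> [Z0 Z0P]; apply: contrapT => no.
pose B Z := zclosed Z /\ P Z.
have nxt Z : B Z -> exists Z', [/\ B Z', Z' `<=` Z & ~ Z `<=` Z'].
  move=> [cZ PZ]; apply: contrapT => H; apply: no; exists Z; split=> // Z' cZ' PZ' sub.
  by apply: contrapT => nsub; apply: H; exists Z'.
pose nx Z := if pselect (exists Z', [/\ B Z', Z' `<=` Z & ~ Z `<=` Z']) is left H then sval (cid H) else Z.
have nxP Z : B Z -> [/\ B (nx Z), nx Z `<=` Z & ~ Z `<=` nx Z].
  by move=> /nxt H; rewrite /nx; case: pselect => // H'; case: cid.
pose Zs j := iter j nx Z0.
have BZ j : B (Zs j) by elim: j => [|j /nxP []].
pose I j (Q : {mpoly k[N.+1]}) := forall z, Zs j z -> Q.@[hc z] = 0.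
have [|j Q IQ z|m Hm] := @acc_mpoly k N.+1 I.
- move=> j; split=> [z _|a b Ia Ib z Zz|a b Ib z Zz]; first by rewrite meval0.
    by rewrite mevalD Ia // Ib // addr0.
  by rewrite mevalM Ib // mulr0.
- by move=> Zz; apply: IQ; case: (nxP _ (BZ j)) => _ + _; apply.
have [_ _] := nxP _ (BZ m); apply=> z Zz; apply: contrapT => nz.
have [cZ _] := BZ m.+1; have /proj_openP /(_ z nz) /proj_nearP [d [Q [hQ Qz QZ]]] := cZ.
have : I m.+1 Q.
  by move=> w Zw; apply/eqP/negPn/negP => /QZ.
by move=> /(Hm m.+1 _ (leqnSn m)) /(_ z Zz) /eqP; rewrite (negbTE Qz).
Qed.

End Projective.

(** * Places with values in the base field *)

Section Place.
Variables (k : numClosedFieldType) (F : fieldType) (iota : {rmorphism k -> F}).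
Implicit Types G : set (F * k).

(* The graph of a partial homomorphism from F to k that extends the identity of k. *)
Record pre_place G : Prop := PrePlace {
  pl_const : forall c, G (iota c, c);
  pl_add : forall a b c d, G (a, b) -> G (c, d) -> G (a + c, b + d);
  pl_mul : forall a b c d, G (a, b) -> G (c, d) -> G (a * c, b * d);
  pl_fun : forall c, G (0, c) -> c = 0 }.

Section PrePlace.
Variables (G : set (F * k)) (gG : pre_place G).

Lemma pl_opp a b : G (a, b) -> G (- a, - b).
Proof. by move=> Gab; have := pl_mul gG (pl_const gG (-1)) Gab; rewrite rmorphN1 !mulN1r. Qed.
Lemma pl_zero : G (0, 0). Proof. by have := pl_const gG 0; rewrite rmorph0. Qed.
Lemma pl_sum (I : Type) (s : seq I) (P : pred I) (a : I -> F) (b : I -> k) :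
  (forall i, P i -> G (a i, b i)) -> G (\sum_(i <- s | P i) a i, \sum_(i <- s | P i) b i).
Proof.
move=> Gab; elim: s => [|i s IH]; first by rewrite !big_nil; exact: pl_zero.
by rewrite !big_cons; case: ifP => // Pi; apply: (pl_add gG) => //; exact: Gab.
Qed.
Lemma pl_exp a b n : G (a, b) -> G (a ^+ n, b ^+ n).
Proof.
move=> Gab; elim: n => [|n IH]; last by rewrite !exprS; exact: (pl_mul gG).
by have := pl_const gG 1; rewrite rmorph1.
Qed.

Definition pl_poly (p : {poly F}) (q : {poly k}) := forall i, G (p`_i, q`_i).

Lemma pl_polyD p q p' q' : pl_poly p q -> pl_poly p' q' -> pl_poly (p + p') (q + q').
Proof. by move=> H H' i; rewrite !coefD; exact: (pl_add gG). Qed.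
Lemma pl_polyM p q p' q' : pl_poly p q -> pl_poly p' q' -> pl_poly (p * p') (q * q').
Proof. by move=> H H' i; rewrite !coefM; apply: pl_sum => j _; exact: (pl_mul gG). Qed.
Lemma pl_polyC a b : G (a, b) -> pl_poly a%:P b%:P.
Proof. by move=> Gab i; rewrite !coefC; case: eqP => // _; exact: pl_zero. Qed.
Lemma pl_polyX : pl_poly 'X 'X.
Proof. by move=> i; rewrite !coefX; have := pl_const gG (i == 1%N)%:R; rewrite rmorph_nat. Qed.
Lemma pl_poly_map (q : {poly k}) : pl_poly (map_poly iota q) q.
Proof. by move=> i; rewrite coef_map; exact: pl_const. Qed.

Lemma pl_extend x xi : (forall p q, pl_poly p q -> p.[x] = 0 -> q.[xi] = 0) ->
  exists G', [/\ pre_place G', G `<=` G' & G' (x, xi)].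
Proof.
move=> ext; exists [set ab | exists p q, [/\ pl_poly p q, ab.1 = p.[x] & ab.2 = q.[xi]]]; split.
- split=> /=.
  + move=> c; exists (iota c)%:P, c%:P; rewrite !hornerC; split=> //.
    by apply: pl_polyC; exact: pl_const.
  + move=> _ _ _ _ [p [q [pq -> ->]]] [p' [q' [pq' -> ->]]].
    by exists (p + p'), (q + q'); rewrite !hornerD; split=> //; exact: pl_polyD.
  + move=> _ _ _ _ [p [q [pq -> ->]]] [p' [q' [pq' -> ->]]].
    by exists (p * p'), (q * q'); rewrite !hornerM; split=> //; exact: pl_polyM.
  + by move=> c [p [q [pq p0 ->]]]; exact: ext pq (esym p0).
- by move=> [a b] Gab /=; exists a%:P, b%:P; rewrite !hornerC; split=> //; exact: pl_polyC.
- by exists 'X, 'X; rewrite !hornerX; split=> //; exact: pl_polyX.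
Qed.

Hypothesis maxG : forall G', pre_place G' -> G `<=` G' -> G' `<=` G.

Lemma max_extend x xi : (forall p q, pl_poly p q -> p.[x] = 0 -> q.[xi] = 0) -> G (x, xi).
Proof. by move=> /pl_extend [G' [gG' sub G'x]]; exact: maxG G'x. Qed.

(** A relation for a^-1, multiplied by a power of [a], has all its terms in the domain of the place
    and so passes to values. *)
Lemma pl_inv a b : G (a, b) -> b != 0 -> G (a^-1, b^-1).
Proof.
move=> Gab b0; have a0 : a != 0.
  by apply: contra_neq b0 => a0; apply: (pl_fun gG); rewrite -a0.
apply: max_extend => p q pq p0; apply/eqP.
pose m := maxn (size p) (size q).
have hw (E : fieldType) (r : {poly E}) e : (size r <= m)%N -> e != 0 ->
    \sum_(i < m) r`_i * e ^+ (m - i) = e ^+ m * r.[e^-1].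
  move=> sr e0; rewrite (horner_coef_wide _ sr) mulr_sumr; apply: eq_bigr => i _.
  by rewrite mulrCA exprVn expfB_cond ?(negbTE e0) ?add0n //; apply: ltnW.
have : \sum_(i < m) q`_i * b ^+ (m - i) = 0.
  apply: (pl_fun gG); rewrite -[0](mulr0 (a ^+ m)) -p0 -hw ?leq_maxl //.
  by apply: pl_sum => i _; apply: (pl_mul gG) => //; exact: pl_exp.
rewrite hw ?leq_maxr // => /eqP; rewrite mulf_eq0 expf_eq0 (negbTE b0) andbF //.
Qed.

(** A relation showing that the maximal ideal generates the unit ideal after [x] is adjoined: the
    obstruction to giving [x] a value. *)
Definition nonint x n := exists p : {poly F},
  [/\ (size p <= n.+1)%N, p.[x] = 0, G (p`_0, 1) & forall i, (0 < i)%N -> G (p`_i, 0)].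

Lemma nonint0 x : ~ nonint x 0.
Proof.
move=> [p [sp p0 G1 _]]; move: p0 G1; rewrite (size1_polyC sp) hornerC coefC /= => -> /(pl_fun gG).
by move/eqP; rewrite oner_eq0.
Qed.

(** The residues of the relations of [x] form an ideal of k[X]. If it were zero, or proper with a
    root of its generator at hand, [x] could be given a value; so 1 is a residue. *)
Lemma nonint_ex x : ~ (exists xi, G (x, xi)) -> exists n, nonint x n.
Proof.
move=> nx; pose J (q : {poly k}) := exists2 p, pl_poly p q & p.[x] = 0.
have JD q q' : J q -> J q' -> J (q + q').
  move=> [p pq p0] [p' pq' p0']; exists (p + p'); first exact: pl_polyD.
  by rewrite hornerD p0 p0' addr0.
have JM r q : J q -> J (r * q).
  move=> [p pq p0]; exists (map_poly iota r * p); last by rewrite hornerM p0 mulr0.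
  by apply: pl_polyM => //; exact: pl_poly_map.
have [J1|nJ1] := pselect (J 1).
  case: J1 => p pq p0; exists (size p), p; split=> //.
    by have := pq 0%N; rewrite coef1.
  by case=> // j _; have := pq j.+1; rewrite coef1.
case: nx; have [[q [Jq q0]]|noq] := pselect (exists q, J q /\ q != 0); last first.
  exists 0; apply: max_extend => p q pq p0.
  have [->|q0] := eqVneq q 0; first by rewrite horner0.
  by case: noq; exists q; split=> //; exists p.
have [m [q' [Jq' q0' sq' minq]]] : exists m q', [/\ J q', q' != 0, size q' = m &
    forall r, J r -> r != 0 -> (m <= size r)%N].
  have exm : exists m, `[< exists q', [/\ J q', q' != 0 & size q' = m] >].
    by exists (size q); apply/asboolP; exists q.
  case: (ex_minnP exm) => m /asboolP [q' [Jq' q0' sq']] minm.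
  exists m, q'; split=> // r Jr r0; apply: minm; apply/asboolP; by exists r.
have dq r : J r -> q' %| r.
  move=> Jr; apply/eqP; have [//|r0] := eqVneq (r %% q') 0.
  have := minq _ _ r0; rewrite -sq' leqNgt ltn_modp q0' => /(_ _)/negP; case=> //.
  have -> : r %% q' = r + (- (r %/ q')) * q' by rewrite {2}(divp_eq r q') mulNr addrC addKr.
  by apply: JD => //; exact: JM.
have [xi xiq] : exists xi, root q' xi.
  apply/closed_rootP/eqP => s1; case: nJ1.
  have /size_poly1P [c c0 cE] := introT eqP s1.
  by have := JM (c^-1)%:P _ Jq'; rewrite cE -polyCM mulVf.
exists xi; apply: max_extend => p r pr p0; apply/rootP.
have /dvdpP [e ->] : q' %| r by apply: dq; exists p.
by rewrite rootM xiq orbT.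
Qed.

(** The relation for x^-1, reversed, has a unit as leading coefficient and removes the leading term
    of the longer relation for [x]. *)
Lemma nonint_descend x n m : x != 0 -> (0 < m <= n)%N -> nonint x n -> nonint x^-1 m ->
  exists2 n', (n' < n)%N & nonint x n'.
Proof.
move=> x0 /andP [m0 mn] [p [sp px p1 pm]] [q [sq qx q1 qm]].
exists n.-1; first by lia.
have q0i : G ((q`_0)^-1, 1) by have := pl_inv q1 (oner_neq0 _); rewrite invr1.
have q0n : q`_0 != 0.
  by apply: contra_neq (oner_neq0 k) => E; apply: (pl_fun gG); rewrite -E.
pose r : {poly F} := \poly_(j < m.+1) q`_(m - j).
have rx : r.[x] = 0.
  rewrite horner_poly; transitivity (x ^+ m * q.[x^-1]); last by rewrite qx mulr0.
  rewrite (horner_coef_wide _ sq) mulr_sumr (reindex_inj rev_ord_inj) /=.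
  apply: eq_bigr => j _; rewrite subSS subKn -1?ltnS // mulrCA; congr (_ * _).
  by rewrite exprVn expfB_cond ?(negbTE x0) ?add0n // -ltnS.
have rG j : exists c, G (r`_j, c).
  rewrite coef_poly; case: ifP => _; last by exists 0; exact: pl_zero.
  by case: (m - j)%N => [|l]; [exists 1|exists 0; apply: qm].
have pnG : G (p`_n / q`_0, 0).
  by rewrite -[X in (_, X)](mul0r 1); apply: (pl_mul gG) => //; apply: pm; lia.
pose p' := p - (p`_n / q`_0)%:P * ('X^(n - m) * r).
have cE j : p'`_j = p`_j - p`_n / q`_0 * (if (j < n - m)%N then 0 else r`_(j - (n - m))).
  by rewrite coefB coefCM coefXnM.
have dG j : G (p`_n / q`_0 * (if (j < n - m)%N then 0 else r`_(j - (n - m))), 0).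
  case: ifP => _; first by rewrite mulr0; exact: pl_zero.
  by have [c Gc] := rG (j - (n - m))%N; have := pl_mul gG pnG Gc; rewrite mul0r.
exists p'; split.
- rewrite prednK; last by lia.
  apply/leq_sizeP => j nj; rewrite cE; have [->|jn] := eqVneq j n.
    rewrite ifF; last by lia.
    by rewrite subKn // coef_poly ltnSn subnn divfK // subrr.
  rewrite (leq_sizeP _ _ sp); last by lia.
  rewrite ifF; last by lia.
  by rewrite coef_poly ifF ?mulr0 ?subr0 //; lia.
- by rewrite /p' hornerD hornerN !hornerM rx px !mulr0 subr0.
- by rewrite cE -[1](subr0 1); apply: (pl_add gG) => //; exact: pl_opp.
- move=> j j0; rewrite cE -[X in (_, X)](subr0 0); apply: (pl_add gG); last exact: pl_opp.
  exact: pm.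
Qed.

Lemma max_valuation x : x != 0 -> (exists c, G (x, c)) \/ (exists c, G (x^-1, c)).
Proof.
move=> x0; apply: contrapT => /not_orP [/nonint_ex [n xn] /nonint_ex [m xm]].
have [s] := ubnP (n + m); elim: s n m xn xm => // s IH n m xn xm; rewrite ltnS => nm.
have n0 : (0 < n)%N by case: n xn {nm} => // /nonint0.
have m0 : (0 < m)%N by case: m xm {nm} => // /nonint0.
case: (leqP m n) => [mn|/ltnW mn].
  have [|n' n'n xn'] := nonint_descend x0 _ xn xm; first by rewrite m0.
  by apply: (IH n' m xn' xm); lia.
have xv0 : x^-1 != 0 by rewrite invr_eq0.
have [||n' n'n xn'] := nonint_descend (n := m) (m := n) xv0 _ xm; rewrite ?n0 ?invrK //.
by apply: (IH n n' xn xn'); lia.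
Qed.

End PrePlace.

(* Zorn: a maximal extension of evaluation at 0 on k[u] is defined on a valuation ring. *)
Lemma place_exists (u : F) : (forall c, u != iota c) -> exists G, [/\ pre_place G, G (u, 0),
  forall a b, G (a, b) -> b != 0 -> G (a^-1, b^-1) &
  forall x, x != 0 -> (exists c, G (x, c)) \/ (exists c, G (x^-1, c))].
Proof.
move=> uc; pose G0 : set (F * k) := [set ab | exists q : {poly k}, ab = ((map_poly iota q).[u], q.[0])].
have gG0 : pre_place G0.
  split.
  - by move=> c; exists c%:P; rewrite map_polyC !hornerC.
  - by move=> _ _ _ _ [q [-> ->]] [q' [-> ->]]; exists (q + q'); rewrite rmorphD !hornerD.
  - by move=> _ _ _ _ [q [-> ->]] [q' [-> ->]]; exists (q * q'); rewrite rmorphM !hornerM.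
  - move=> c [q [q0 ->]]; have [->|qn] := eqVneq q 0; first by rewrite horner0.
    have [r rE] := closed_field_poly_normal q.
    move/esym: q0; rewrite rE map_polyZ hornerZ rmorph_prod /= horner_prod => /eqP.
    rewrite mulf_eq0 fmorph_eq0 lead_coef_eq0 (negbTE qn) /= prodf_seq_eq0.
    case/hasP => z _ /=; rewrite map_polyXsubC hornerXsubC subr_eq0.
    by rewrite (negbTE (uc z)).
pose P G := G = set0 \/ (pre_place G /\ G0 `<=` G).
have [|A [PA maxA]] := @Zorn_bigcup _ P.
  move=> FF FP tot; have [[X [FX X0]]|no] := pselect (exists X, FF X /\ X !=set0); last first.
    left; apply/seteqP; split=> // z [X FX Xz]; by apply: no; exists X; split=> //; exists z.
  right; have good Z : FF Z -> Z !=set0 -> pre_place Z /\ G0 `<=` Z.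
    by move=> FZ [z Zz]; case: (FP Z FZ) => // E; rewrite E in Zz.
  have [gX G0X] := good X FX X0.
  have dir z w : (\bigcup_(Z in FF) Z) z -> (\bigcup_(Z in FF) Z) w -> exists Z, [/\ FF Z, Z z & Z w].
    move=> [Z FZ Zz] [W FW Ww]; case: (tot Z W FZ FW) => sub.
      by exists W; split=> //; exact: sub.
    by exists Z; split=> //; exact: sub.
  split; last by move=> z /G0X Xz; exists X.
  split.
  - by move=> c; exists X => //; exact: pl_const.
  - move=> a b c d /dir H /H [Z [FZ Zab Zcd]]; exists Z => //.
    have [|gZ _] := good Z FZ; first by exists (a, b).
    exact: (pl_add gZ).
  - move=> a b c d /dir H /H [Z [FZ Zab Zcd]]; exists Z => //.
    have [|gZ _] := good Z FZ; first by exists (a, b).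
    exact: (pl_mul gZ).
  - move=> c [Z FZ Zc]; have [|gZ _] := good Z FZ; first by exists (0, c).
    exact: (pl_fun gZ Zc).
have [gA G0A] : pre_place A /\ G0 `<=` A.
  case: PA => // A0; case: (maxA G0); last by right; split.
  rewrite A0 properEneq; split; last exact: sub0set.
  by apply/eqP => E; have : G0 (iota 0, 0) by [exact: pl_const]; rewrite -E.
have maxA' G' : pre_place G' -> A `<=` G' -> G' `<=` A.
  move=> gG' AG'; apply: contrapT => nsub; apply: (maxA G'); first by split.
  by right; split=> // z /G0A /AG'.
exists A; split=> //.
- by apply: G0A; exists 'X; rewrite map_polyX !hornerX.
- by move=> a b; exact: pl_inv.
- by move=> x; exact: max_valuation.
Qed.

End Place.

(** * The valuations of a nonsingular projective curve *)

Section Curve.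
Variables (k : numClosedFieldType) (Y : space k) (N : nat) (i : Y -> Pn k N).
Hypothesis ci : closed_immersion i.
Hypothesis nsY : nonsingular_curve Y.
Let rY : ringed Y := proj_ringed ci.

Lemma curve_irr : irreducible [set: Y]. Proof. by case: nsY => -[]. Qed.
Let iY := curve_irr.
Definition kY : fieldType := funfield rY iY.
Definition iotaY : {rmorphism k -> kY} := ffconst rY iY.
Definition clY : (Y -> k) -> kY := cls rY iY.
Let hc := hc i.
Let acrd := affcrd i.

Definition tpar (y : Y) : 'I_1 -> Y -> k := sval (cid (nsY.2 y)).
Lemma tparP y : local_params y (tpar y). Proof. by rewrite /tpar; case: cid. Qed.
Definition ty (y : Y) : kY := clY (tpar y ord0).

Lemma tpar_reg y : regular y (tpar y ord0). Proof. by case: (tparP y) => /(_ ord0) []. Qed.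
Lemma tpar0 y : tpar y ord0 y = 0. Proof. by case: (tparP y) => /(_ ord0) []. Qed.

Definition Oy (y : Y) : kY -> Prop := reg_at (rX := rY) (iX := iY) y.
Definition evy (y : Y) : kY -> k := ffval (rX := rY) (iX := iY) y.

Lemma clYD f g y : regular y f -> regular y g -> clY (fun z => f z + g z) = clY f + clY g.
Proof. by move=> rf rg; rewrite /clY clsD //; [exact: (regular_rational rY rf)|exact: (regular_rational rY rg)]. Qed.
Lemma clYM f g y : regular y f -> regular y g -> clY (fun z => f z * g z) = clY f * clY g.
Proof. by move=> rf rg; rewrite /clY clsM //; [exact: (regular_rational rY rf)|exact: (regular_rational rY rg)]. Qed.
Lemma clYV f y : regular y f -> clY (fun z => (f z)^-1) = (clY f)^-1.
Proof. by move=> rf; rewrite /clY clsV //; exact: (regular_rational rY rf). Qed.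
Lemma clY_sum (I : Type) (s : seq I) (P : pred I) (f : I -> Y -> k) y : (forall j, P j -> regular y (f j)) ->
  clY (fun z => \sum_(j <- s | P j) f j z) = \sum_(j <- s | P j) clY (f j).
Proof.
move=> rf; elim: s => [|j s IH].
  by rewrite big_nil; transitivity (clY (fun=> 0)) => //; apply: cls_ext => z; rewrite big_nil.
rewrite big_cons -IH; case Pj : (P j); last by apply: cls_ext => z; rewrite big_cons Pj.
rewrite -(@clYD _ _ y); [|exact: rf|exact: (@reg_sum _ _ _ _ _ _ _ rY)].
by apply: cls_ext => z; rewrite big_cons Pj.
Qed.
Lemma clY_near y f g : regular y f -> regular y g -> near_pt y [set z | f z = g z] -> clY f = clY g.
Proof.
move=> rf rg /near_generic E; apply/(cls_eq rY iY) => //.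
- exact: (regular_rational rY rf).
- exact: (regular_rational rY rg).
Qed.

(** If the parameter vanished near [y], its coefficient in [local_params] would be arbitrary,
    against uniqueness. *)
Lemma ty_neq0 y : ty y != 0.
Proof.
apply/negP => /eqP t0.
have n0 : near_pt y [set z | tpar y ord0 z = 0].
  apply: (regular_zero rY iY (tpar_reg y)).
  apply/(cls_eq rY iY (regular_rational rY (tpar_reg y)) (rational_const rY iY 0)); exact: t0.
case: (tparP y) => _ /(_ (fun=> 0) (reg_const rY y 0) erefl) [c [_ cu]].
have all c' : c = c'.
  apply: cu; exists 0%N, (fun _ _ => 0), (fun _ _ => 0); split; first by case.
  by apply: near_sub n0 => z /= z0; rewrite big_ord1 big_ord0 z0 mulr0 subr0.
have := all (const_mx 1); rewrite (all 0) => /rowP /(_ ord0); rewrite !mxE => /eqP.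
by rewrite eq_sym oner_eq0.
Qed.

Definition pl (l : 'I_N.+1) (P : {mpoly k[N.+1]}) : kY := clY (fun z => P.@[acrd l ^~ z]).

Section Chart.
Variables (y : Y) (l : 'I_N.+1).
Hypothesis yl : hc y l != 0.

Lemma pl_reg P : regular y (fun z : Y => P.@[acrd l ^~ z]).
Proof. exact: (poly_regular ci). Qed.
Lemma plD P Q : pl l (P + Q) = pl l P + pl l Q.
Proof. by rewrite /pl -(clYD (pl_reg P) (pl_reg Q)); apply: cls_ext => z; rewrite mevalD. Qed.
Lemma plM P Q : pl l (P * Q) = pl l P * pl l Q.
Proof. by rewrite /pl -(clYM (pl_reg P) (pl_reg Q)); apply: cls_ext => z; rewrite mevalM. Qed.
Lemma plC c : pl l c%:MP = iotaY c.
Proof. by apply: cls_ext => z; rewrite mevalC. Qed.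
Lemma pl_Oy P : Oy y (pl l P). Proof. apply: reg_at_cls; exact: pl_reg. Qed.
Lemma pl_ev P : evy y (pl l P) = P.@[acrd l ^~ y].
Proof. by rewrite /evy ffval_cls //; exact: pl_reg. Qed.

Lemma Oy_frac h : Oy y h -> exists P Q : {mpoly k[N.+1]},
  [/\ Q.@[acrd l ^~ y] != 0, pl l Q != 0 & h = pl l P / pl l Q].
Proof.
move=> [f [rf ->]]; have [d [P [Q [hP hQ Qy fE]]]] := regular_frac ci rf.
have Qy' : Q.@[acrd l ^~ y] != 0.
  by move: Qy; rewrite (acrd_homog hQ yl) mulf_eq0 negb_or => /andP [].
have Q0 : pl l Q != 0.
  apply: contra_neq Qy' => E; rewrite -pl_ev E /evy -(rmorph0 iotaY); exact: ffval_const.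
exists P, Q; split=> //; rewrite -(clYV (pl_reg Q)).
have rV : regular y (fun z : Y => (Q.@[acrd l ^~ z])^-1) by apply: (reg_inv rY) => //; exact: pl_reg.
rewrite -(clYM (pl_reg P) rV); apply: (clY_near rf).
  by apply: (reg_mul rY) => //; exact: pl_reg.
have nl : near_pt y [set z | hc z l != 0] by exact: (near_acrd ci).
apply: near_sub (nearI rY nl fE) => z [/= zl ->].
by rewrite (acrd_homog hP zl) (acrd_homog hQ zl) -mulf_div divff ?mul1r // expf_neq0.
Qed.

End Chart.

Lemma frac_any y l h : hc y l != 0 -> exists P Q : {mpoly k[N.+1]},
  pl l Q != 0 /\ h = pl l P / pl l Q.
Proof.
move=> yl; have g1 := generic_reg_at (rX := rY) (iX := iY) h.
have g2 := near_generic (near_acrd ci yl).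
have [z /near_self [/= hz zl]] := generic_ex (genericI rY iY g1 g2).
by have [P [Q [_ Q0 E]]] := Oy_frac zl hz; exists P, Q.
Qed.

Section Point.
Variable y : Y.
Definition ly : 'I_N.+1 := sval (cid (hcoord_neq0 (i y))).
Lemma lyP : hc y ly != 0. Proof. by rewrite /ly; case: cid. Qed.

Lemma Oy_fracs h : exists a b, [/\ Oy y a, Oy y b, b != 0 & h = a / b].
Proof.
have [P [Q [Q0 ->]]] := frac_any h lyP; exists (pl ly P), (pl ly Q).
split=> //; exact: (pl_Oy lyP).
Qed.

Definition sy : seq kY := [seq pl ly ('X_j - (acrd ly j y)%:MP) | j <- enum 'I_N.+1].

Let Oc := reg_at_const rY iY y.
Let evc := ffval_const rY iY y.
Let OD := @reg_atD _ _ rY iY y.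
Let OM := @reg_atM _ _ rY iY y.
Let evD := @ffvalD _ _ rY iY y.
Let evM := @ffvalM _ _ rY iY y.
Let OV := @reg_atV _ _ rY iY y.

Lemma sy_m a : a \in sy -> inm (Oy y) (evy y) a.
Proof.
case/mapP => j _ ->; split; first exact: (pl_Oy lyP).
by rewrite (pl_ev lyP) mevalB mevalXU mevalC subrr.
Qed.

Lemma span_mem (O : kY -> Prop) (O0 : O 0) (O1 : O 1) s a : a \in s -> span O s a.
Proof.
elim: s => // b s IH; rewrite inE => /orP [/eqP <-|/IH sa] /=.
  by exists 1 => //; rewrite mul1r subrr; elim: s {IH} => //= c s IH; exists 0; rewrite ?mul0r ?subr0.
by exists 0; rewrite ?mul0r ?subr0.
Qed.

Lemma pl_span P : span (Oy y) sy (pl ly P - iotaY (P.@[acrd ly ^~ y])).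
Proof.
have O0 : Oy y 0 by rewrite -(rmorph0 iotaY); exact: Oc.
have O1 : Oy y 1 by rewrite -(rmorph1 iotaY); exact: Oc.
pose S P := span (Oy y) sy (pl ly P - iotaY (P.@[acrd ly ^~ y])).
have SC c : S c%:MP by rewrite /S (plC ly) mevalC subrr; apply: (span0 Oc).
have SD Q Q' : S Q -> S Q' -> S (Q + Q').
  move=> SQ SQ'; rewrite /S (plD lyP) mevalD rmorphD /=.
  rewrite (_ : _ - _ = (pl ly Q - iotaY Q.@[acrd ly ^~ y]) + (pl ly Q' - iotaY Q'.@[acrd ly ^~ y])); last by ring.
  exact: (span_add OD).
have SM Q Q' : S Q -> S Q' -> S (Q * Q').
  move=> SQ SQ'; rewrite /S (plM lyP) mevalM rmorphM /=.
  rewrite (_ : _ - _ = pl ly Q * (pl ly Q' - iotaY Q'.@[acrd ly ^~ y]) +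
    iotaY Q'.@[acrd ly ^~ y] * (pl ly Q - iotaY Q.@[acrd ly ^~ y])); last by ring.
  by apply: (span_add OD); apply: (span_mul OM) => //; [exact: (pl_Oy lyP)|exact: Oc].
have SX j : S 'X_j.
  rewrite /S mevalXU -(plC ly) -[_ - _]/(_ + - _) -mulN1r -(rmorphN1 iotaY) -(plC ly) -(plM lyP) -(plD lyP).
  rewrite mpolyCN mpolyC1 mulN1r; apply: (span_mem O0 O1); apply/mapP; exists j => //.
  by rewrite mem_enum.
elim/mpolyind: P => [|c m P _ _ SP]; first by have := SC 0; rewrite mpolyC0.
apply: SD => //; rewrite -mul_mpolyC; apply: (SM); first exact: SC.
rewrite mpolyXE_id; elim/big_ind: _ => [|Q Q' SQ SQ'|j _].
- by have := SC 1.
- exact: SM.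
- by elim: (m j) => [|e IH]; [have := SC 1|rewrite exprS; exact: SM].
Qed.

Lemma sy_span h : inm (Oy y) (evy y) h -> span (Oy y) sy h.
Proof.
move=> [Oh h0]; have [P [Q [Qy Q0 hE]]] := Oy_frac lyP Oh.
have P0 : P.@[acrd ly ^~ y] = 0.
  rewrite -(pl_ev lyP) (_ : pl ly P = h * pl ly Q); last by rewrite hE divfK.
  by rewrite /evy evM //; [rewrite -/(evy y h) h0 mul0r|exact: (pl_Oy lyP)].
have := pl_span P; rewrite P0 rmorph0 subr0 hE mulrC => sP.
apply: (span_mul OM) sP; apply: OV; first exact: (pl_Oy lyP).
by have := pl_ev lyP Q; rewrite /evy => ->.
Qed.

Lemma ty_m : inm (Oy y) (evy y) (ty y).
Proof.
split; first by apply: reg_at_cls; exact: tpar_reg.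
by rewrite /evy ffval_cls ?tpar0 //; exact: tpar_reg.
Qed.

Lemma ty_m2 h : inm (Oy y) (evy y) h -> exists (c : k) (r : nat) (a b : 'I_r -> kY),
  [/\ forall j, inm (Oy y) (evy y) (a j), forall j, inm (Oy y) (evy y) (b j) &
     h = iotaY c * ty y + \sum_j a j * b j].
Proof.
move=> [[f [rf ->]]]; rewrite /evy ffval_cls // => f0.
case: (tparP y) => _ /(_ f rf f0) [c [[r [a [b [ab nE]]]] _]].
exists (c 0 ord0), r, (fun j => clY (a j)), (fun j => clY (b j)); split=> [j|j|].
- by have [ra a0 _ _] := ab j; split; [exact: reg_at_cls|rewrite /evy ffval_cls].
- by have [_ _ rb b0] := ab j; split; [exact: reg_at_cls|rewrite /evy ffval_cls].
have rc : regular y (fun=> c 0 ord0) := reg_const rY y _.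
have rs : regular y (fun z : Y => \sum_j a j z * b j z).
  by apply: (@reg_sum _ _ _ _ _ _ _ rY) => j _; have [ra _ rb _] := ab j; exact: (reg_mul rY).
have rct := reg_mul rY rc (tpar_reg y).
rewrite -[iotaY _]/(clY (fun=> c 0 ord0)) -(clYM rc (tpar_reg y)).
rewrite (eq_bigr (fun j => clY (fun z => a j z * b j z))) => [|j _]; last first.
  by have [ra _ rb _] := ab j; rewrite (clYM ra rb).
rewrite -(@clY_sum _ _ _ _ y) => [|j _]; last by have [ra _ rb _] := ab j; exact: (reg_mul rY).
rewrite -(clYD rct rs); apply: (clY_near rf); first exact: (reg_add rY).
by apply: near_sub nE => z /= <-; rewrite big_ord1 addrC subrK.
Qed.

(** Krull's intersection theorem: the polynomials that are multiples of [g n] in the local ring form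
    increasing ideals. Where these become stationary, g_(m+1) is a multiple of t * g_(m+1), hence
    0. *)
Lemma ty_chain (g : nat -> kY) : (forall n, Oy y (g n)) -> (forall n, g n = ty y * g n.+1) -> g 0%N = 0.
Proof.
move=> Og gE; pose I n (P : {mpoly k[N.+1]}) := exists2 a, Oy y a & pl ly P = a * g n.
have O0 : Oy y 0 by rewrite -(rmorph0 iotaY); exact: Oc.
have [|n P [a Oa E]|m Hm] := @acc_mpoly k N.+1 I.
- move=> n; split.
  + by exists 0 => //; rewrite -mpolyC0 plC rmorph0 mul0r.
  + by move=> P Q [a Oa Ea] [b Ob Eb]; exists (a + b); [exact: OD|rewrite (plD lyP) Ea Eb mulrDl].
  + move=> P Q [b Ob Eb]; exists (pl ly P * b); last by rewrite (plM lyP) Eb mulrA.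
    by apply: OM => //; exact: (pl_Oy lyP).
- by exists (a * ty y); [apply: OM => //; case: ty_m|rewrite E gE mulrA].
have [P [Q [Qy Q0 hE]]] := Oy_frac lyP (Og m.+1).
have [|a Oa E] := Hm m.+1 P (leqnSn m).
  by exists (pl ly Q); [exact: (pl_Oy lyP)|rewrite hE mulrC divfK].
have gm : g m.+1 = 0.
  have : (pl ly Q - a * ty y) * g m.+1 = 0.
    by rewrite mulrBl -mulrA -gE -E hE mulrC divfK // subrr.
  move/eqP; rewrite mulf_eq0 => /orP [/eqP E0|/eqP //].
  have [Ot t0] := ty_m; have : evy y (pl ly Q) = 0.
    rewrite (_ : pl ly Q = a * ty y); last by apply/eqP; rewrite -subr_eq0 E0.
    by rewrite /evy evM // -/(evy y (ty y)) t0 mulr0.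
  by rewrite (pl_ev lyP) => E1; rewrite E1 eqxx in Qy.
have : forall n, (n <= m.+1)%N -> g (m.+1 - n)%N = 0.
  elim=> [|n IH] nm; first by rewrite subn0.
  by rewrite gE (_ : (m.+1 - n.+1).+1 = m.+1 - n)%N ?IH ?mulr0 //; lia.
by move=> /(_ m.+1 (leqnn _)); rewrite subnn.
Qed.

End Point.

Definition vY (y : {classic Y}) (h : kY) : int := order (Oy y) (evy y) (ty y) h.

Section Valuation.
Variable y : Y.
Let Oc := reg_at_const rY iY y.
Let evc := ffval_const rY iY y.
Let OD := @reg_atD _ _ rY iY y.
Let OM := @reg_atM _ _ rY iY y.
Let evD := @ffvalD _ _ rY iY y.
Let evM := @ffvalM _ _ rY iY y.
Let OV := @reg_atV _ _ rY iY y.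

Lemma vY_ge0 h : vge vY y 0 h <-> Oy y h.
Proof.
exact: (order_ge0 Oc evc OD evD OM evM OV (@Oy_fracs y) (ty_neq0 y) (ty_m y) (@sy_m y) (@sy_span y)
  (@ty_m2 y) (@ty_chain y)).
Qed.
Lemma vY_ge1 h : vge vY y 1 h <-> inm (Oy y) (evy y) h.
Proof.
exact: (order_ge1 Oc evc OD evD OM evM OV (@Oy_fracs y) (ty_neq0 y) (ty_m y) (@sy_m y) (@sy_span y)
  (@ty_m2 y) (@ty_chain y)).
Qed.
Lemma vY_mul h g : h != 0 -> g != 0 -> vY y (h * g) = vY y h + vY y g.
Proof.
exact: (order_mul Oc evc OD evD OM evM OV (@Oy_fracs y) (ty_neq0 y) (ty_m y) (@sy_m y) (@sy_span y)
  (@ty_m2 y) (@ty_chain y)).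
Qed.
Lemma vY_add m h g : vge vY y m h -> vge vY y m g -> vge vY y m (h + g).
Proof.
exact: (order_add Oc evc OD evD OM evM OV (@Oy_fracs y) (ty_neq0 y) (ty_m y) (@sy_m y) (@sy_span y)
  (@ty_m2 y) (@ty_chain y)).
Qed.
Lemma vY_unit h : is_unit (Oy y) (evy y) h -> vY y h = 0.
Proof.
exact: (order_unit Oc evc OM evM OV (ty_neq0 y) (ty_m y)).
Qed.
Lemma vY_t : vY y (ty y) = 1.
Proof.
exact: (order_t Oc evc OM evM OV (ty_neq0 y) (ty_m y)).
Qed.
Lemma vY_unitP h : h != 0 -> vY y h = 0 <-> is_unit (Oy y) (evy y) h.
Proof.
exact: (order_unitP Oc evc OD evD OM evM OV (@Oy_fracs y) (ty_neq0 y) (ty_m y) (@sy_m y) (@sy_span y)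
  (@ty_m2 y) (@ty_chain y)).
Qed.
Lemma vY_const c : c != 0 -> vY y (iotaY c) = 0.
Proof. by move=> c0; apply: vY_unit; split; [exact: Oc|rewrite /evy evc]. Qed.
Lemma vY_res h : vge vY y 0 h -> exists c, vge vY y 1 (h - iotaY c).
Proof.
move=> /vY_ge0 Oh; exists (evy y h); apply/vY_ge1; rewrite -rmorphN; split; first by apply: OD => //; exact: Oc.
by rewrite /evy evD ?evc ?subrr //; exact: Oc.
Qed.
End Valuation.

(** A minimal infinite proper closed set is irreducible, since its proper closed subsets are finite;
    dimension one then makes it a point or the whole curve. *)
Lemma closed_finite (Z : set Y) : zclosed Z -> ~ (forall y, Z y) ->
  exists s : seq {classic Y}, forall z, Z z -> z \in s.
Proof.
move=> cZ nZ; apply: contrapT => nf.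
have [|W [cW [nfW nW] minW]] := noeth_closed ci (P := fun W => ~ (exists s : seq {classic Y},
   forall z, W z -> z \in s) /\ ~ (forall y, W y)).
  by exists Z.
have irrW : irreducible W.
  split.
    by apply: contrapT => W0; apply: nfW; exists [::] => z Wz; case: W0; exists z.
  move=> A B cA cB WAB; apply: contrapT => /not_orP [nA nB].
  have fin D : zclosed D -> ~ W `<=` D -> exists s : seq {classic Y}, forall z, (W `&` D) z -> z \in s.
    move=> cD nD; apply: contrapT => nfD; apply: nD.
    have sub : W `<=` W `&` D.
      apply: minW; [exact: (proj_closedI ci)| |by move=> z []].
      by split=> // WDT; apply: nW => y; case: (WDT y).
    by move=> z /sub [].
  have [s1 H1] := fin A cA nA; have [s2 H2] := fin B cB nB.
  apply: nfW; exists (s1 ++ s2) => z Wz; rewrite (@mem_cat {classic Y}); apply/orP.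
  by case: (WAB z Wz) => [Az|Bz]; [left; apply: H1|right; apply: H2].
case: nsY => -[_ _ _ dim1] _; case: (dim1 W cW irrW) => [//|E|[x E]].
  by apply: nW => y; rewrite E.
by apply: nfW; exists [:: x] => z; rewrite E /= => ->; exact: (mem_head (x : {classic Y})).
Qed.

Lemma vY_fin h : h != 0 -> exists s : seq {classic Y}, forall y, vY y h != 0 -> y \in s.
Proof.
elim/cls_ind: h => f rf f0.
have [/(cls_eq0 rY iY rf) E|fn0] := rational_dichotomy rY rf; first by rewrite E in f0.
have [U [Uo [u Uu] UP]] := genericI rY iY rf fn0.
have [||s Hs] := @closed_finite (~` U); first by rewrite /zclosed setCK.
  by move=> /(_ u).
exists s => y vy; apply: Hs => Uy; have [ry fy] := UP y Uy.
move/eqP: vy; apply; apply: vY_unit; split; first exact: reg_at_cls.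
by rewrite /evy ffval_cls.
Qed.

Lemma ratio_regular d (P Q : {mpoly k[N.+1]}) (y : Y) : P \is d.-homog -> Q \is d.-homog ->
  Q.@[hc y] != 0 -> regular y (fun z : Y => P.@[hc z] / Q.@[hc z]).
Proof.
move=> hP hQ Qy; case: ci => _ _ _ ir; apply/ir.
exists (fun M : Pn k N => P.@[hcoord (M : line k N)] / Q.@[hcoord (M : line k N)]); split.
  by exists d, P, Q; split.
by exists setT; split=> //; exact: open_T (Pn_ringed k N).
Qed.

Lemma sep_form (P Q : Y) : P <> Q -> exists L : {mpoly k[N.+1]},
  [/\ L \is 1.-homog, L.@[hc P] != 0 & L.@[hc Q] = 0].
Proof.
move=> PQ; apply: contrapT => no; apply: PQ; case: ci => inj _ _ _; apply: inj.
apply: line_inj => a b; apply/eqP; rewrite -subr_eq0; apply/negPn/negP => ab; apply: no.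
pose L : {mpoly k[N.+1]} := (hc Q b) *: 'X_a - (hc Q a) *: 'X_b.
have LE w : L.@[hc w] = hc w a * hc Q b - hc w b * hc Q a.
  by rewrite /L mevalB !mevalZ !mevalXU mulrC [hc Q a * _]mulrC.
exists L; split; last by rewrite LE mulrC subrr.
- by rewrite rpredB // rpredZ // dhomogX; apply/eqP; exact: mdeg1.
- by rewrite LE.
Qed.

(** The form \sum_j c^j X_j vanishes at a point only if [c] is a root of the polynomial whose
    coefficients are the coordinates of the point. *)
Lemma avoid_form (s : seq {classic Y}) : exists M : {mpoly k[N.+1]},
  M \is 1.-homog /\ forall Q, Q \in s -> M.@[hc Q] != 0.
Proof.
pose q (y : Y) := \poly_(j < N.+1) (if insub j is Some o then hc y o else 0).
have q0 y : q y != 0.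
  have [j yj] := hcoord_neq0 (i y); apply: contra_neq yj => E.
  have : (q y)`_j = 0 by rewrite E coef0.
  by rewrite coef_poly ltn_ord valK.
have [c cP] : exists c, ~~ root (\prod_(y <- s) q y) c.
  by apply/closed_nonrootP; rewrite prodf_seq_neq0; apply/allP => y _; exact: q0.
exists (\sum_(j < N.+1) (c ^+ j) *: 'X_j); split.
  by apply: rpred_sum => j _; rewrite rpredZ // dhomogX; apply/eqP; exact: mdeg1.
move=> Q Qs; rewrite (_ : _.@[_] = (q Q).[c]); last first.
  rewrite rmorph_sum /= horner_poly; apply: eq_bigr => j _.
  by rewrite mevalZ mevalXU valK mulrC.
apply: contra cP => /eqP E; rewrite /root horner_prod; apply/eqP.
by rewrite (big_rem Q Qs) /= E mul0r.
Qed.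

(** A product of quotients of linear forms: each numerator vanishes at one point of [s] but not at
    [P], the common denominator at none of these points. *)
Lemma vY_sep (P : {classic Y}) (s : seq {classic Y}) : P \notin s ->
  exists z : kY, [/\ z != 0, vY P z = 0 & forall Q, Q \in s -> vge vY Q 1 z].
Proof.
move=> Ps; have [M [hM MP]] := avoid_form (P :: s).
have [L LP] : exists L : {classic Y} -> {mpoly k[N.+1]}, forall Q, Q \in s ->
    [/\ L Q \is 1.-homog, (L Q).@[hc P] != 0 & (L Q).@[hc Q] = 0].
  pose L (Q : {classic Y}) := if pselect (P <> Q) is left H then sval (cid (sep_form H)) else 0.
  exists L => Q Qs; rewrite /L; case: pselect => [H|]; first by case: cid.
  by case=> E; rewrite E Qs in Ps.
pose f (Q z : Y) := (L Q).@[hc z] / M.@[hc z].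
have rf Q y : Q \in s -> y \in P :: s -> regular y (f Q).
  by move=> Qs ys; have [hL _ _] := LP Q Qs; apply: (ratio_regular hL hM); exact: MP.
pose z := \prod_(Q <- s) clY (f Q).
have key (y : {classic Y}) r : y \in P :: s -> {subset r <= s} ->
    Oy y (\prod_(Q <- r) clY (f Q)) /\ evy y (\prod_(Q <- r) clY (f Q)) = \prod_(Q <- r) f Q y.
  move=> ys; elim: r => [|Q r IH] rs.
    by rewrite !big_nil -(rmorph1 iotaY); split; [exact: reg_at_const|exact: ffval_const].
  have [|Or er] := IH; first by move=> Q' Q'r; apply: rs; rewrite inE Q'r orbT.
  have Qs : Q \in s by apply: rs; exact: mem_head.
  have OQ : Oy y (clY (f Q)) by apply: reg_at_cls; exact: rf.
  rewrite !big_cons; split; first exact: reg_atM.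
  by rewrite /evy ffvalM // -/(evy _ _) -/(evy _ _) er /evy ffval_cls //; exact: rf.
have uz : is_unit (Oy P) (evy P) z.
  have [Oz ez] := key P s (mem_head _ _) (fun _ H => H); split=> //; rewrite ez prodf_seq_neq0.
  by apply/allP => Q Qs /=; have [_ LQ _] := LP Q Qs; rewrite mulf_neq0 // invr_neq0 // MP // mem_head.
exists z; split.
- by have [_ +] := uz; apply: contra_neq => ->; rewrite -(rmorph0 iotaY); exact: ffval_const.
- exact: vY_unit.
- move=> Q Qs; apply/vY_ge1; have [|Oz ez] := @key Q s _ (fun _ H => H); first by rewrite inE Qs orbT.
  split=> //; rewrite ez (big_rem Q Qs) /= /f; have [_ _ ->] := LP Q Qs.
  by rewrite !mul0r.
Qed.

(** For nonconstant [h] there is a place with h^-1 at 0. The curve is projective, so the place has a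
    centre on it; there [h] is regular and gets a finite value, which contradicts h * h^-1 = 1. *)
Lemma vY_pole h : (forall y, vge vY y 0 h) -> exists c, h = iotaY c.
Proof.
move=> hreg; apply: contrapT => nc.
have uc c : h^-1 != iotaY c.
  by apply/eqP => E; apply: nc; exists c^-1; rewrite fmorphV -E invrK.
have [G [gG Gu Ginv Gval]] := place_exists uc.
have [y0 _] := curve_irr.1; have [l0 yl0] := hcoord_neq0 (i y0).
pose x j := pl l0 'X_j.
have xl0 : x l0 = 1.
  rewrite -(rmorph1 iotaY); apply: (clY_near (y := y0)).
  - exact: (poly_regular ci).
  - exact: reg_const rY y0 _.
  - apply: near_sub (near_acrd ci yl0) => z zl /=; by rewrite mevalXU /acrd /affcrd divff.
(* The valuation property singles out a coordinate [x l] by which all others are divisible in the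
   valuation ring. *)
have [l [xl Gl]] : exists l, x l != 0 /\ forall j, exists c, G (x j / x l, c).
  suff H (s : seq 'I_N.+1) : exists l, x l != 0 /\ forall j, j \in s -> exists c, G (x j / x l, c).
    have [l [xl Gl]] := H (enum 'I_N.+1); exists l; split=> // j; apply: Gl; by rewrite mem_enum.
  elim: s => [|j s [l [xl Gl]]]; first by exists l0; rewrite xl0 oner_neq0.
  have [xj|xj] := eqVneq (x j) 0.
    exists l; split=> // a; rewrite inE => /orP [/eqP ->|]; last exact: Gl.
    by exists 0; rewrite xj mul0r; exact: (pl_zero gG).
  case: (Gval (x j / x l)); first by rewrite mulf_neq0 // invr_eq0.
    by move=> Gj; exists l; split=> // a; rewrite inE => /orP [/eqP ->|]; last exact: Gl.
  rewrite invf_div => -[c Gc]; exists j; split=> // a; rewrite inE => /orP [/eqP ->|/Gl [d Gd]].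
    by exists 1; rewrite divff // -(rmorph1 iotaY); exact: (pl_const gG).
  exists (d * c); rewrite (_ : x a / x j = (x a / x l) * (x l / x j)); first exact: (pl_mul gG).
  by rewrite mulrA divfK.
pose a j := sval (cid (Gl j)).
have aG j : G (x j / x l, a j) by rewrite /a; case: cid.
have [y1 [yl yl1]] : exists y1, hc y1 l0 != 0 /\ hc y1 l != 0.
  apply: contrapT => no; move/negP: xl; apply; apply/eqP; rewrite -(rmorph0 iotaY).
  apply: (clY_near (y := y0)).
  - exact: (poly_regular ci).
  - exact: reg_const rY y0 _.
  - apply: near_sub (near_acrd ci yl0) => z zl /=; rewrite mevalXU /acrd /affcrd.
    have [E|nz] := eqVneq (hc z l) 0; first by rewrite -/(hc z) E mul0r.
    by case: no; exists z.
have xE j : pl l 'X_j = x j / x l.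
  apply: (mulIf xl); rewrite divfK // /x /pl.
  rewrite -(@clYM _ _ y1); try exact: (poly_regular ci).
  apply: (clY_near (y := y1)); try exact: (poly_regular ci).
    by apply: (reg_mul rY); exact: (poly_regular ci).
  apply: near_sub (near_acrd ci yl1) => z zl /=; rewrite !mevalXU /acrd /affcrd.
  by rewrite mulrA divfK.
have al : a l = 1.
  have := aG l; rewrite divff // => G1; have := pl_const gG (-1); rewrite rmorphN1 => Gm.
  have := pl_add gG G1 Gm; rewrite subrr => /(pl_fun gG) /eqP; by rewrite subr_eq0 => /eqP.
have GP P : G (pl l P, P.@[a]).
  elim/mpolyind: P => [|c m P _ _ IH]; first by rewrite -mpolyC0 plC mevalC; exact: (pl_const gG).
  rewrite (plD yl1) mevalD; apply: (pl_add gG) => //.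
  rewrite -mul_mpolyC (plM yl1) mevalM plC mevalC; apply: (pl_mul gG); first exact: (pl_const gG).
  rewrite mpolyXE_id; elim/big_ind: _ => [|Q Q' GQ GQ'|j _].
  - by rewrite -[1]mpolyC1 plC mevalC; exact: (pl_const gG).
  - by rewrite (plM yl1) mevalM; exact: (pl_mul gG).
  - elim: (m j) => [|e IHe]; first by rewrite expr0 -[1]mpolyC1 plC mevalC; exact: (pl_const gG).
    by rewrite exprS (plM yl1) mevalM xE mevalXU; exact: (pl_mul gG).
(* The centre is the point whose coordinates are the values of x_j / x_l. Every form that vanishes
   on the curve vanishes there, so it lies on the closed set [range i]. *)
have [|L [c [c0 LE]]] := @line_ex k N a; first by exists l; rewrite al oner_neq0.
have [y _ yE] : range i L.
  apply: contrapT => nL; case: ci => _ cr _ _.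
  have [d [Q [hQ QL QU]]] := cr L nL.
  have Qa : Q.@[a] != 0.
    by move: QL; rewrite (meval_eq _ LE) (meval_homog _ _ hQ) mulf_eq0 negb_or => /andP [].
  have Q0 z : hc z l != 0 -> Q.@[acrd l ^~ z] = 0.
    move=> zl; apply/eqP/negPn/negP => Qz; case: (QU (i z)); last by exists z.
    by rewrite -[hcoord _]/(hc z) (acrd_homog hQ zl) mulf_neq0 // expf_neq0.
  have E : pl l Q = 0.
    rewrite -(rmorph0 iotaY); apply: (clY_near (y := y1)); first exact: (poly_regular ci).
      exact: reg_const rY y1 _.
    by apply: near_sub (near_acrd ci yl1) => z zl /=; exact: Q0.
  by have := GP Q; rewrite E => /(pl_fun gG) /eqP; rewrite (negbTE Qa).
have hyE j : hc y j = c * a j by rewrite -LE -yE.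
have yl' : hc y l != 0 by rewrite hyE al mulr1.
have aE j : acrd l j y = a j.
  by rewrite /acrd /affcrd -!/(hc y _) !hyE al mulr1 mulrAC mulfV ?mul1r.
have [P [Q [Qy Q0 hE]]] := Oy_frac yl' ((vY_ge0 y h).1 (hreg y)).
have Qa : Q.@[a] != 0 by move: Qy; rewrite (meval_eq _ aE).
have Gh : G (h, P.@[a] / Q.@[a]) by rewrite hE; apply: (pl_mul gG) => //; exact: Ginv.
have h0 : h != 0 by apply: contra_not_neq nc => ->; exists 0; rewrite rmorph0.
have := pl_mul gG Gh Gu; rewrite divff // mulr0 => G1.
have := pl_const gG (-1); rewrite rmorphN1 => Gm.
have := pl_add gG G1 Gm; rewrite subrr add0r => /(pl_fun gG) /eqP.
by rewrite oppr_eq0 oner_eq0.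
Qed.

Theorem curve_fieldY : curve_field iotaY (vY : {classic Y} -> kY -> int).
Proof.
split.
- exact: vY_mul.
- exact: vY_add.
- exact: vY_const.
- exact: vY_res.
- by move=> P; exists (ty P); [exact: ty_neq0|exact: vY_t].
- exact: vY_fin.
- exact: vY_pole.
- exact: vY_sep.
Qed.

End Curve.

(** * Regular forms and the three-point inequality *)

Section Forms.
Variables (k : numClosedFieldType) (Y : space k) (N : nat) (i : Y -> Pn k N).
Hypothesis ci : closed_immersion i.
Hypothesis nsY : nonsingular_curve Y.
Let rY : ringed Y := proj_ringed ci.
Let iY := curve_irr nsY.
Let F := kY ci nsY.
Let cl := clY ci nsY.
Let iota := iotaY ci nsY.
Let O := Oy (ci := ci) (nsY := nsY).
Let ev := evy (ci := ci) (nsY := nsY).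
Let v := vY (ci := ci) (nsY := nsY).
Let cF : curve_field iota v := curve_fieldY ci nsY.

(** A function that represents [h] near [z], with default 0; it lets tangent vectors, which act on
    functions, be applied to elements of the function field. *)
Definition rep (z : Y) (h : F) : Y -> k := if pselect (O z h) is left H then sval (cid H) else (fun=> 0).
Definition dval (z : Y) (D : (Y -> k) -> k) (h : F) : k := D (rep z h).

Lemma rep_reg z h : regular z (rep z h).
Proof. by rewrite /rep; case: pselect => [H|_]; [case: cid => f []|exact: reg_const]. Qed.
Lemma rep_cl z h : O z h -> cl (rep z h) = h.
Proof. by rewrite /rep; case: pselect => // H _; case: cid => f []. Qed.
Lemma ev_cl z f : regular z f -> ev z (cl f) = f z.
Proof. exact: ffval_cls. Qed.
Lemma rep_val z h : O z h -> rep z h z = ev z h.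
Proof. by move=> Oh; rewrite -{2}(rep_cl Oh) ev_cl //; exact: rep_reg. Qed.

Lemma OD z a b : O z a -> O z b -> O z (a + b). Proof. exact: reg_atD. Qed.
Lemma OM z a b : O z a -> O z b -> O z (a * b). Proof. exact: reg_atM. Qed.
Lemma Oc z c : O z (iota c). Proof. exact: reg_at_const. Qed.
Lemma evD z a b : O z a -> O z b -> ev z (a + b) = ev z a + ev z b. Proof. exact: ffvalD. Qed.
Lemma evM z a b : O z a -> O z b -> ev z (a * b) = ev z a * ev z b. Proof. exact: ffvalM. Qed.
Lemma evc z c : ev z (iota c) = c. Proof. exact: ffval_const. Qed.
Lemma OX z a n : O z a -> O z (a ^+ n).
Proof.
move=> Oa; elim: n => [|n IH]; first by rewrite expr0 -(rmorph1 iota); exact: Oc.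
by rewrite exprS; exact: OM.
Qed.
Lemma ev_exp z a n : O z a -> ev z (a ^+ n) = ev z a ^+ n.
Proof.
move=> Oa; elim: n => [|n IH]; first by rewrite !expr0 -(rmorph1 iota) evc.
by rewrite !exprS evM ?IH //; exact: OX.
Qed.
Lemma O_vge z a : O z a <-> vge v z 0 a.
Proof. by symmetry; exact: vY_ge0. Qed.

Section Tangent.
Variables (z : Y) (D : (Y -> k) -> k).
Hypothesis tD : tangent z D.

Lemma dval_cl f : regular z f -> dval z D (cl f) = D f.
Proof.
move=> rf; case: tD => near _ _; apply: near; [exact: rep_reg|exact: rf|].
apply: (regular_eq rY iY) => //; first exact: rep_reg.
apply/(cls_eq rY iY).
- exact: (regular_rational rY (rep_reg z (cl f))).
- exact: (regular_rational rY rf).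
- by apply: rep_cl; exact: reg_at_cls.
Qed.

Lemma dvalZD c a b : O z a -> O z b -> dval z D (iota c * a + b) = c * dval z D a + dval z D b.
Proof.
move=> Oa Ob; have [ra rb] := (rep_reg z a, rep_reg z b).
case: (tD) => _ lin _; rewrite [dval z D a]/dval [dval z D b]/dval -lin //.
have rc := reg_mul rY (reg_const rY z c) ra.
rewrite -dval_cl; last exact: (reg_add rY).
rewrite [cl _](clYD ci nsY rc rb) -/cl (rep_cl Ob); congr (dval _ _ (_ + _)).
by rewrite [RHS](clYM ci nsY (reg_const rY z c) ra) -/cl (rep_cl Oa).
Qed.
Lemma dvalM a b : O z a -> O z b -> dval z D (a * b) = ev z a * dval z D b + ev z b * dval z D a.
Proof.
move=> Oa Ob; have [ra rb] := (rep_reg z a, rep_reg z b).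
case: (tD) => _ _ lei; rewrite -(rep_val Oa) -(rep_val Ob) [dval z D a]/dval [dval z D b]/dval -lei //.
have rm := reg_mul rY ra rb; rewrite -dval_cl //.
by rewrite [cl _](clYM ci nsY ra rb) -/cl !rep_cl.
Qed.
Lemma dval1 : dval z D 1 = 0.
Proof.
have O1 : O z 1 by rewrite -(rmorph1 iota); exact: Oc.
have := dvalM O1 O1; rewrite mulr1 -{2 4}(rmorph1 iota) evc !mul1r => /eqP.
by rewrite -subr_eq0 opprD addNKr oppr_eq0 => /eqP.
Qed.
Lemma dval0 : dval z D 0 = 0.
Proof.
have O0 : O z 0 by rewrite -(rmorph0 iota); exact: Oc.
have := dvalM O0 O0; rewrite mulr0 -{2 4}(rmorph0 iota) evc !mul0r addr0 //.
Qed.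
Lemma dval_c c : dval z D (iota c) = 0.
Proof.
have O0 : O z 0 by rewrite -(rmorph0 iota); exact: Oc.
have O1 : O z 1 by rewrite -(rmorph1 iota); exact: Oc.
by have := dvalZD c O1 O0; rewrite mulr1 !addr0 dval1 dval0 mulr0 addr0.
Qed.
Lemma dvalB a c : O z a -> dval z D (a - iota c) = dval z D a.
Proof.
move=> Oa; have O1 := Oc z (- c); rewrite -rmorphN.
by have := dvalZD 1 Oa O1; rewrite rmorph1 !mul1r dval_c addr0.
Qed.
Lemma dvalXS a n : O z a -> dval z D (a ^+ n.+1) = n.+1%:R * ev z a ^+ n * dval z D a.
Proof.
move=> Oa; elim: n => [|n IH]; first by rewrite expr1 expr0 !mul1r.
rewrite exprS dvalM //; last exact: OX.
by rewrite IH ev_exp // [n.+2%:R]mulrS [ev z a ^+ n.+1]exprS; ring.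
Qed.
End Tangent.

Lemma near_fin (s : seq {classic Y}) y : near_pt y [set z : Y | (z : {classic Y}) \in s -> z = y].
Proof.
elim: s => [|a s IH]; first by exists setT; split=> //; exact: open_T rY.
have [->|/eqP ay] := eqVneq a (y : {classic Y}).
  by apply: near_sub IH => z /= H; rewrite inE => /orP [/eqP|].
have na : near_pt y (~` [set a : Y]).
  exists (~` [set a : Y]); split=> //; first exact: (proj_point_closed ci).
  by move=> /esym.
apply: near_sub (nearI rY na IH) => z /= [za H]; rewrite inE => /orP [/eqP E|] //.
Qed.

Lemma O_fin h : exists s : seq {classic Y}, forall z : Y, (z : {classic Y}) \notin s -> O z h.
Proof.
have [->|h0] := eqVneq h 0; first by exists [::] => z _; rewrite -(rmorph0 iota); exact: Oc.
have [s sP] := vY_fin h0; exists s => z zs; apply/O_vge; rewrite vgeE //.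
by move: zs; apply: contraNT => vz; apply: sP; rewrite -ltNge in vz; rewrite lt_eqF.
Qed.
Lemma ev_fin h : h != 0 -> exists s : seq {classic Y}, forall z : Y, (z : {classic Y}) \notin s -> O z h /\ ev z h != 0.
Proof.
move=> h0; have [s sP] := vY_fin h0; exists s => z zs; apply/vY_unitP => //.
by apply/eqP; move: zs; apply: contraNT => vz; apply: sP.
Qed.

(* [h dx] is represented near y by [a0 dg0 + a1 dg1]. *)
Definition pres (x h : F) (y : Y) (ag : F * F * F * F) : Prop :=
  let: (a0, g0, a1, g1) := ag in
  [/\ O y a0, O y g0, O y a1, O y g1 & near_pt y [set z | z <> y -> [/\ O z x, O z h &
    forall D, tangent z D -> ev z a0 * dval z D g0 + ev z a1 * dval z D g1 = ev z h * dval z D x]]].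

(** With x = t^(e+1) u and h = t^(-e) h', the form h dx is (e+1) h' u dt + h' t du. *)
Lemma pres_local x h y (e : nat) : x != 0 -> v y x = e.+1%:Z -> vge v y (- e%:Z) h ->
  exists ag, pres x h y ag.
Proof.
move=> x0 vx vh; pose t := ty ci nsY y; have t0 : t != 0 := ty_neq0 ci nsY y.
have vt : v y t = 1 := vY_t ci nsY y.
pose u := x / t ^+ e.+1; pose h' := t ^+ e * h.
have u0 : u != 0 by rewrite mulf_neq0 // invr_eq0 expf_neq0.
have Ot : O y t by apply/O_vge; rewrite vgeE // vt.
have Ou : O y u.
  by apply/O_vge; rewrite vgeE // (v_mul cF) ?invr_eq0 ?expf_neq0 // (vV cF) ?expf_neq0 // (vX cF) // vx vt; lia.
have Oh' : O y h'.
  apply/O_vge; have : vge v y (e%:Z + - e%:Z) (t ^+ e * h).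
    by apply: (vgeM cF) => //; rewrite vgeE ?expf_neq0 // (vX cF) // vt; lia.
  by rewrite subrr.
have xE : x = t ^+ e.+1 * u by rewrite mulrC divfK // expf_neq0.
clearbody u.
exists (iota e.+1%:R * (h' * u), t, h' * t, u); split=> //.
- by apply: OM; [exact: Oc|exact: OM].
- exact: OM.
have [s1 H1] := O_fin u; have [s2 H2] := O_fin t; have [s3 H3] := O_fin h.
apply: near_sub (near_fin (s1 ++ s2 ++ s3) y) => z /= zs zy.
have : (z : {classic Y}) \notin s1 ++ s2 ++ s3 by apply/negP => /zs.
rewrite !mem_cat !negb_or => /and3P [/H1 Ou' /H2 Ot' /H3 Oh].
have Ox : O z x by rewrite xE; apply: OM => //; exact: OX.
split=> // D tD; rewrite xE (dvalM tD) ?(dvalXS tD) //; last exact: OX.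
rewrite /h' !evM ?ev_exp ?evc //; try (by apply: OX); try (by apply: Oc); try (by apply: OM => //; apply: OX).
  by rewrite exprS; ring.
by apply: OM => //; apply: OM => //; apply: OX.
Qed.

Lemma pres_subst x h x' h' y ag : near_pt y [set z | z <> y -> [/\ O z x, O z h &
    forall D, tangent z D -> ev z h' * dval z D x' = ev z h * dval z D x]] ->
  pres x' h' y ag -> pres x h y ag.
Proof.
case: ag => -[[a0 g0] a1] g1 nE [Oa0 Og0 Oa1 Og1 nP]; split=> //.
apply: near_sub (nearI rY nE nP) => z [/= E P] zy; have [Ox Oh EQ] := E zy; have [_ _ PQ] := P zy.
by split=> // D tD; rewrite PQ // EQ.
Qed.

Variable x : F.
Hypothesis xnc : forall c, x != iota c.

(** Regularity of h dx in terms of orders: where x - b has order e, dx has order e - 1; at a pole of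
    [x], the form is written - x^2 h d(1/x). *)
Definition regular_form (h : F) : Prop := forall y : Y,
  (forall b, 0 < v y (x - iota b) -> vge v y (1 - v y (x - iota b)) h) /\
  (v y x < 0 -> vge v y (1 + v y x) (x ^+ 2 * h)).

Lemma pres_ex h y : regular_form h -> exists ag, pres x h y ag.
Proof.
move=> /(_ y) [fin inf]; have x0 : x != 0 by rewrite -(rmorph0 iota) xnc.
have [s1 H1] := O_fin x; have [s2 H2] := O_fin h; have [s3 H3] := ev_fin x0.
have [vx|vx] := boolP (0 <= v y x).
  have [|c] := v_res cF (P := y) (h := x); first by rewrite vgeE.
  have xc0 : x - iota c != 0 by rewrite subr_eq0.
  rewrite vgeE // => vc; have [e eE] : exists e : nat, v y (x - iota c) = e.+1%:Z.
    by move: vc; move: (v y _) => m m1; exists (absz m).-1; lia.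
  have [|ag P] := pres_local xc0 eE (h := h).
    have := fin c; rewrite eE => /(_ isT); congr (vge _ _ _ _); lia.
  exists ag; apply: pres_subst P; apply: near_sub (near_fin (s1 ++ s2) y) => z /= zs zy.
  have : (z : {classic Y}) \notin s1 ++ s2 by apply/negP => /zs.
  rewrite mem_cat negb_or => /andP [/H1 Ox /H2 Oh]; split=> // D tD.
  by rewrite (dvalB tD).
rewrite -ltNge in vx; have xV0 : x^-1 != 0 by rewrite invr_eq0.
have [e eE] : exists e : nat, v y x^-1 = e.+1%:Z.
  by exists (absz (v y x^-1)).-1; rewrite (vV cF) //; lia.
have [|ag P] := pres_local xV0 eE (h := - (x ^+ 2 * h)).
  apply: (vgeN cF); have := inf vx; congr (vge _ _ _ _).
  by move: eE; rewrite (vV cF) //; lia.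
exists ag; apply: pres_subst P; apply: near_sub (near_fin (s2 ++ s3) y) => z /= zs zy.
have : (z : {classic Y}) \notin s2 ++ s3 by apply/negP => /zs.
rewrite mem_cat negb_or => /andP [/H2 Oh /H3 [Ox xz0]]; split=> // D tD.
have OV : O z x^-1 by exact: reg_atV.
have Ox2h : O z (x ^+ 2 * h) by apply: OM => //; exact: OX.
have evV : ev z x^-1 = (ev z x)^-1.
  apply: (mulfI xz0); rewrite -evM // !divff // -(rmorph1 iota); exact: evc.
have : dval z D (x * x^-1) = 0 by rewrite divff // dval1.
rewrite (dvalM tD) // evV => E.
rewrite -mulN1r -(rmorphN1 iota) evM ?evc //; last exact: Oc.
rewrite evM ?ev_exp //; last exact: OX.
have -> : dval z D x^-1 = - (ev z x)^-1 ^+ 2 * dval z D x.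
  by apply: (mulfI xz0); apply/eqP; rewrite -subr_eq0 -[X in _ == X]E; apply/eqP; field.
by field.
Qed.

Section OneForm.
Variable h : F.
Hypothesis rh : regular_form h.

Definition good (z : Y) := O z x /\ O z h.
(** A form needs a value at every point. Where [x] and [h] are regular it is h dx; at the remaining
    points a chosen presentation gives the value. *)
Definition oneform (z : Y) (D : (Y -> k) -> k) : k :=
  if pselect (good z) is left _ then ev z h * dval z D x
  else let: (a0, g0, a1, g1) := sval (cid (pres_ex z rh)) in ev z a0 * dval z D g0 + ev z a1 * dval z D g1.

Lemma oneform_good z D : good z -> oneform z D = ev z h * dval z D x.
Proof. by rewrite /oneform; case: pselect. Qed.

Lemma near_rep y a : O y a -> near_pt y [set z | regular z (rep y a) /\
  (ev z a = rep y a z /\ forall D, tangent z D -> dval z D a = D (rep y a))].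
Proof.
move=> Oa; apply: near_sub (reg_near rY (rep_reg y a)) => z /= rz; split=> //.
by rewrite -{1}(rep_cl Oa) ev_cl //; split=> // D tD; rewrite -{1}(rep_cl Oa) (dval_cl tD).
Qed.

Lemma oneform_regular : regular_1form oneform.
Proof.
move=> y; have [[Ox Oh]|ng] := pselect (good y).
  exists 1%N, (fun=> rep y h), (fun=> rep y x).
  apply: near_sub (nearI rY (near_rep Oh) (near_rep Ox)) => z /= [[rh' [eh dh]] [rx [ex dx]]].
  split=> // D tD; rewrite big_ord1 oneform_good ?eh ?dx //.
  by rewrite /good -(rep_cl Ox) -(rep_cl Oh); split; exact: reg_at_cls.
have oE D : oneform y D = let: (a0, g0, a1, g1) := sval (cid (pres_ex y rh)) in
    ev y a0 * dval y D g0 + ev y a1 * dval y D g1.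
  by rewrite /oneform; case: pselect.
move: oE; case: cid => -[[[a0 g0] a1] g1] /= [Oa0 Og0 Oa1 Og1 nP] oE.
exists 2%N, (fun j => if j == ord0 then rep y a0 else rep y a1),
  (fun j => if j == ord0 then rep y g0 else rep y g1).
have n1 := nearI rY (near_rep Oa0) (near_rep Og0); have n2 := nearI rY (near_rep Oa1) (near_rep Og1).
apply: near_sub (nearI rY (nearI rY n1 n2) nP) => z.
move=> [[[/= [ra0 [ea0 _]] [rg0 [_ dg0]]] [[ra1 [ea1 _]] [rg1 [_ dg1]]]] P].
split=> [j|D tD]; first by case: ifP.
rewrite big_ord_recl big_ord1 /= -ea0 -ea1 -dg0 // -dg1 //.
have [->|/eqP zy] := eqVneq (z : {classic Y}) y; first exact: oE.
by have [Ox Oh E] := P zy; rewrite oneform_good // E.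
Qed.
End OneForm.

(* The tangent vector dual to the uniformizer. *)
Definition dtan (y : Y) (f : Y -> k) : k := ev y ((cl f - iota (f y)) / ty ci nsY y).

Lemma dtan_O y f : regular y f -> O y ((cl f - iota (f y)) / ty ci nsY y).
Proof.
move=> rf; have t0 := ty_neq0 ci nsY y; apply/O_vge.
rewrite (_ : 0 = 1 + - 1) //; apply: (vgeM cF); last first.
  by rewrite vgeE ?invr_eq0 // (vV cF) // [v y _](vY_t ci nsY y).
apply/vY_ge1; split; first by apply: OD; [exact: reg_at_cls|rewrite -rmorphN; exact: Oc].
rewrite -/ev -rmorphN evD ?evc ?ev_cl ?subrr //; [exact: reg_at_cls|exact: Oc].
Qed.

Lemma dtan_tangent y : tangent y (dtan y).
Proof.
have t0 := ty_neq0 ci nsY y; split=> [f g rf rg E|a f g rf rg|f g rf rg].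
- by rewrite /dtan [cl f](clY_near ci nsY rf rg E) (near_self E).
- have rc := reg_const rY y a; have rcf := reg_mul rY rc rf.
  rewrite /dtan [cl _](clYD ci nsY rcf rg) (clYM ci nsY rc rf) -/cl.
  rewrite -[cl (fun=> a)]/(iota a) rmorphD rmorphM /=.
  rewrite (_ : _ / _ = iota a * ((cl f - iota (f y)) / ty ci nsY y) + (cl g - iota (g y)) / ty ci nsY y); last by ring.
  move: (dtan_O rf) (dtan_O rg); set qf := _ / _; set qg := _ / _ => Of Og.
  clearbody qf qg; have Oa := Oc y a; have Oaf := OM Oa Of.
  by rewrite (evD Oaf Og) (evM Oa Of) evc.
- have Of' : O y (cl f) by exact: reg_at_cls.
  rewrite /dtan [cl _](clYM ci nsY rf rg) -/cl rmorphM /=.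
  rewrite (_ : _ / _ = cl f * ((cl g - iota (g y)) / ty ci nsY y) + iota (g y) * ((cl f - iota (f y)) / ty ci nsY y)); last by ring.
  move: (dtan_O rf) (dtan_O rg); set qf := (cl f - _) / _; set qg := (cl g - _) / _ => Of Og.
  clearbody qf qg; have Oa := Oc y (g y); have Oaf := OM Oa Of; have Ofg := OM Of' Og.
  by rewrite (evD Ofg Oaf) (evM Oa Of) (evM Of' Og) evc (ev_cl rf).
Qed.

Lemma dval_dtan y b : O y x -> v y (x - iota b) = 1 -> dval y (dtan y) x != 0.
Proof.
move=> Ox vb; have t0 := ty_neq0 ci nsY y; have xb0 : x - iota b != 0 by rewrite subr_eq0.
have [_ eb] : inm (O y) (ev y) (x - iota b) by apply/vY_ge1; rewrite vgeE // -/v vb.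
have xy : rep y x y = b.
  move/eqP: eb; rewrite -rmorphN evD ?evc ?(rep_val Ox) ?subr_eq0 => // [/eqP //|]; exact: Oc.
rewrite /dval /dtan xy (rep_cl Ox).
have : is_unit (O y) (ev y) ((x - iota b) / ty ci nsY y).
  apply/vY_unitP; first by rewrite mulf_neq0 // invr_eq0.
  by rewrite -/v (v_mul cF) ?invr_eq0 // (vV cF) // vb [v y _](vY_t ci nsY y).
by case.
Qed.

Hypothesis unram : forall s : seq {classic Y}, exists P b, P \notin s /\ v P (x - iota b) = 1.

(** More than [g] forms would satisfy a linear relation. At a point where [x] is unramified and the
    combination of the [h j] is regular and nonzero, the tangent vector [dtan] contradicts it. *)
Theorem forms_le_genus (g M : nat) (h : 'I_M -> F) : is_genus Y g ->
  (forall j, regular_form (h j)) ->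
  (forall c : 'I_M -> k, \sum_j iota (c j) * h j = 0 -> forall j, c j = 0) -> (M <= g)%N.
Proof.
move=> [w [rw wP]] rh hi.
have [C CP] : exists C : 'I_M -> 'rV[k]_g, forall j y D, tangent y D -> oneform (rh j) y D = \sum_l C j 0 l * w l y D.
  have ex j : exists c : 'rV[k]_g, forall y D, tangent y D -> oneform (rh j) y D = \sum_l c 0 l * w l y D.
    by have [c [cP _]] := wP _ (oneform_regular (rh j)); exists c.
  by exists (fun j => sval (cid (ex j))) => j; case: cid.
pose A : 'M[k]_(M, g) := \matrix_(j, l) C j 0 l.
suff : row_free A by rewrite /row_free => /eqP <-; exact: rank_leq_col.
rewrite -kermx_eq0; apply/eqP/row_matrixP => r; rewrite row0; set u := row r _.
have uA : u *m A = 0 by apply/sub_kermxP; exact: row_sub.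
have : \sum_j iota (u 0 j) * h j = 0; last first.
  by move=> /hi E; apply/rowP => j; rewrite E mxE.
apply/eqP/negPn/negP => H0.
have [s1 H1] := ev_fin H0.
have [s2 H2] : exists s2 : seq {classic Y}, forall z : Y, (z : {classic Y}) \notin s2 -> forall j, O z (h j).
  have ex j := O_fin (h j); exists (flatten [seq sval (cid (ex j)) | j <- enum 'I_M]) => z zs j.
  apply: (svalP (cid (ex j)) z); apply: contra zs => zs.
  by apply/flattenP; exists (sval (cid (ex j))) => //; apply/mapP; exists j; rewrite ?mem_enum.
have [s3 H3] := O_fin x.
have [P [b [Ps vb]]] := unram (s1 ++ s2 ++ s3).
move: Ps; rewrite !mem_cat !negb_or => /and3P [/H1 [_ eH] /H2 Oh /H3 Ox].
have dx := dval_dtan Ox vb; have tD := dtan_tangent P.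
move/negP: eH; apply; rewrite -(mulIr_eq0 _ (mulIf dx)); apply/eqP.
have : \sum_j u 0 j * oneform (rh j) P (dtan P) = 0.
  under eq_bigr => j _ do rewrite CP // mulr_sumr.
  rewrite exchange_big big1 // => l _ /=; have /rowP /(_ l) := uA; rewrite !mxE => E.
  transitivity ((\sum_j u 0 j * A j l) * w l P (dtan P)); last by rewrite E mul0r.
  rewrite mulr_suml; apply: eq_bigr => j _; by rewrite [A j l]mxE mulrA.
move=> <-; have : O P (\sum_j iota (u 0 j) * h j) /\ ev P (\sum_j iota (u 0 j) * h j) = \sum_j u 0 j * ev P (h j).
  elim/big_rec2: _ => [|j a c _ [Oa <-]].
    by rewrite -(rmorph0 iota); split; [exact: Oc|rewrite evc].
  by split; [apply: OD => //; apply: OM => //; exact: Oc|rewrite evD ?evM ?evc //; try exact: Oc; apply: OM => //; exact: Oc].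
move=> [_ ->]; rewrite mulr_suml; apply: eq_bigr => j _.
by rewrite oneform_good // mulrA.
Qed.

End Forms.

Lemma count_disjoint3 (T : Type) (p q r : pred T) (s : seq T) :
  (forall x, p x + q x + r x <= 1)%N -> (count p s + count q s + count r s <= size s)%N.
Proof. by move=> H; elim: s => //= x s; have := H x; lia. Qed.

(** * Counting zeros and poles *)

Section Degrees.
Variables (k : numClosedFieldType) (F : fieldType) (iota : {rmorphism k -> F}).
Variables (T : eqType) (v : T -> F -> int).
Hypothesis H : curve_field iota v.

Definition npole (P : T) (x : F) : int := if v P x < 0 then - v P x else 0.

Lemma sum_supp (f : T -> int) (p : pred T) (ps : seq T) : (forall P, f P != 0 -> p P) ->
  \sum_(P <- ps) f P = \sum_(P <- [seq P <- ps | p P]) f P.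
Proof.
move=> fp; rewrite big_filter (bigID p) /= [X in _ + X]big1 ?addr0 // => P np.
by apply/eqP; apply: contraNT np; exact: fp.
Qed.

(** Zeros and poles of a nonconstant [h] are both counted by the number [d] of [three_point_genus],
    applied to x = h. *)
Lemma principal_degree h ps : h != 0 -> uniq ps -> (forall P, v P h != 0 -> P \in ps) ->
  \sum_(P <- ps) v P h = 0.
Proof.
move=> h0 ups psP; have [[c hc]|nc] := pselect (exists c, h = iota c).
  rewrite big1 // => P _; rewrite hc (v_const H) //.
  by apply: contra_neq h0 => c0; rewrite hc c0 rmorph0.
have hnc c : h != iota c by apply/eqP => E; apply: nc; exists c.
have [d [N [w [dz dp _ _ _]]]] := three_point_genus H hnc.
have E1 : \sum_(P <- [seq P <- ps | 0 < v P h]) v P h = d%:Z.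
  rewrite -(dz 0 [seq P <- ps | 0 < v P h] (filter_uniq _ ups)) => [|P].
    by apply: eq_bigr => P _; rewrite rmorph0 subr0.
  rewrite rmorph0 subr0 mem_filter; case vP : (0 < v P h) => //=.
  by apply: psP; rewrite gt_eqF.
have E2 : \sum_(P <- [seq P <- ps | v P h < 0]) - v P h = d%:Z.
  apply: dp; first exact: filter_uniq.
  move=> P; rewrite mem_filter; case vP : (v P h < 0) => //=.
  by apply: psP; rewrite lt_eqF.
rewrite (bigID (fun P => 0 < v P h)) /= -big_filter E1 (bigID (fun P => v P h < 0)) /=.
rewrite [X in _ + (_ + X)]big1 ?addr0 => [|P /andP [n1 n2]]; last first.
  by apply/eqP; rewrite eq_le leNgt n1 leNgt n2.
rewrite -E2 big_filter sumrN; apply/eqP; rewrite addrC subr_eq0; apply/eqP.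
by apply: eq_bigl => P; case: (ltgtP (v P h) 0).
Qed.

End Degrees.

Section Bound.
Variables (k : numClosedFieldType) (Y : space k) (N : nat) (i : Y -> Pn k N).
Hypothesis ci : closed_immersion i.
Hypothesis nsY : nonsingular_curve Y.
Let iota := iotaY ci nsY.
Let v := vY (ci := ci) (nsY := nsY).
Let cF : curve_field iota v := curve_fieldY ci nsY.

(** The pole divisor of [x] has degree [d], the forms of [three_point_genus] are at most [g] in
    number, and the fibres over 0, 1, oo are disjoint parts of [S]. *)
Theorem pole_bound (x : kY ci nsY) g (ps S : seq {classic Y}) : (forall c, x != iota c) -> is_genus Y g ->
  uniq ps -> (forall P, v P x < 0 -> P \in ps) -> uniq S ->
  (forall P, [|| 0 < v P x, 0 < v P (x - 1) | v P x < 0] -> P \in S) ->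
  \sum_(P <- ps) npole v P x + 2 <= 2 * g%:Z + (size S)%:Z.
Proof.
move=> xnc gY ups psP uS SP.
have [d [M [h [dz dp bd hi hr]]]] := three_point_genus cF xnc.
have Mg : (M <= g)%N.
  have un := generic_unramified cF xnc.
  by apply: (forms_le_genus xnc un gY (h := h)) => // j P; exact: hr.
have -> : \sum_(P <- ps) npole v P x = d%:Z.
  rewrite (sum_supp (p := fun P => v P x < 0)) => [|P]; last by rewrite /npole; case: ifP; rewrite ?eqxx.
  rewrite -(dp [seq P <- ps | v P x < 0] (filter_uniq _ ups)) => [|P].
    by rewrite !big_filter; apply: eq_bigr => P vP; rewrite /npole vP.
  by rewrite mem_filter; case vP : (v P x < 0) => //=; exact: psP.
have x0 : x != 0 by rewrite -(rmorph0 iota).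
have x10 : x - 1 != 0 by rewrite subr_eq0 -(rmorph1 iota).
pose S0 := [seq P <- S | 0 < v P x]; pose S1 := [seq P <- S | 0 < v P (x - 1)]; pose So := [seq P <- S | v P x < 0].
have := bd S0 S1 So; rewrite !size_filter.
have mS (p : pred {classic Y}) P : p P -> [|| 0 < v P x, 0 < v P (x - 1) | v P x < 0] -> P \in [seq P <- S | p P].
  by move=> pP /SP PS; rewrite mem_filter pP.
move=> H; have {H} := H (fun P H => mS (fun P => 0 < v P x) P H (introT or3P (Or31 _ _ H)))
  (fun P H => mS (fun P => 0 < v P (x - 1)) P H (introT or3P (Or32 _ _ H)))
  (fun P H => mS (fun P => v P x < 0) P H (introT or3P (Or33 _ _ H))).
have ex01 P : 0 < v P x -> 0 < v P (x - 1) -> False.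
  move=> a b; have : vge v P 1 (x - (x - 1)) by apply: (vgeB cF); rewrite vgeE.
  by rewrite opprB addrC subrK vgeE ?oner_neq0 // (v1 cF).
have ex1o P : v P x < 0 -> 0 < v P (x - 1) -> False.
  move=> a b; have : vge v P 0 ((x - 1) + 1).
    by apply: (v_add cF); rewrite vgeE ?oner_neq0 // ?(v1 cF) // ltW.
  by rewrite subrK vgeE // leNgt a.
pose p0 : pred {classic Y} := fun P => 0 < v P x; pose p1 : pred {classic Y} := fun P => 0 < v P (x - 1).
pose po : pred {classic Y} := fun P => v P x < 0.
have : (count p0 S + count p1 S + count po S <= size S)%N.
  apply: count_disjoint3 => P; rewrite /p0 /p1 /po.
  case a : (0 < v P x); case b : (0 < v P (x - 1)); case c : (v P x < 0) => //.
  - by case: (ex01 P).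
  - by case: (ex01 P).
  - by have := lt_trans a c; rewrite ltxx.
  - by case: (ex1o P).
rewrite -/p0 -/p1 -/po; move: Mg; move: (count p0 S) (count p1 S) (count po S) => *; lia.
Qed.
End Bound.

(** * The moduli space as a projective variety *)

Lemma homogXn (k : fieldType) (N e : nat) (i : 'I_N) : ('X_i ^+ e : {mpoly k[N]}) \is e.-homog.
Proof.
have := dhomogMn e (_ : ('X_i : {mpoly k[N]}) \is 1%N.-homog).
by rewrite mul1n; apply; rewrite dhomogX; apply/eqP; exact: mdeg1.
Qed.
Lemma homogX (k : fieldType) (N : nat) (i : 'I_N) : ('X_i : {mpoly k[N]}) \is 1%N.-homog.
Proof. exact: (homogXn k 1 i). Qed.

Lemma closed_immersion_sub (k : fieldType) (X : space k) (N : nat) (i : X -> Pn k N) (C : set X) :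
  closed_immersion i -> zclosed C ->
  closed_immersion (fun y : subspace C => i (val y)).
Proof.
move=> [inj cl io ir] cC.
have [V [Vo VE]] := (io (~` C)).1 cC.
have VP x : V (i x) <-> ~ C x by rewrite -[V (i x)]/((i @^-1` V) x) -VE.
split.
- by move=> x y /inj /val_inj.
- move=> L nL; have [[x _ xL]|nr] := pselect (range i L).
    have Vx : V L.
      by rewrite -xL; apply/VP => Cx; apply: nL; exists (exist _ x (mem_set Cx)).
    have [d [Q [hQ QL QV]]] := Vo L Vx; exists d, Q; split=> // M /QV VM [y _ yM].
    by move: VM; rewrite -yM => /VP; apply; have := valP y; rewrite in_setE.
  have [d [Q [hQ QL QV]]] := cl L nr; exists d, Q; split=> // M /QV nM [y _ yM].
  by apply: nM; exists (val y).
- move=> U; split=> [[W [/io [V' [Vo' ->]] ->]]|[V' [Vo' ->]]]; first by exists V'.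
  by exists (i @^-1` V'); split=> //; apply/io; exists V'.
- move=> x f; split=> [[g [/ir [h [rh [V1 [V1o V1x V1h]]]] [W [/io [V2 [V2o ->]] V2x V2g]]]]|].
    exists h; split=> //; exists (V1 `&` V2); split=> //; first exact: (open_I (Pn_ringed k N)).
    by move=> y [V1y V2y]; rewrite V2g // V1h.
  move=> [h [rh [V1 [V1o V1x V1h]]]]; exists (h \o i); split.
    apply/ir; exists h; split=> //; exists setT; split=> //; exact: (open_T (Pn_ringed k N)).
  exists (i @^-1` V1); split=> //; apply/io; by exists V1.
Qed.

(** * The Segre embedding *)

Section Segre.
Variables (k : fieldType) (I : finType).
Let C := {ffun I -> bool}.
(** Segre coordinates are indexed by the choice of one of the two homogeneous coordinates in each
    factor; there are 2^|I| of them. *)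
Definition segN := #|{: {ffun I -> bool}}|.-1.
Lemma segNE : segN.+1 = #|{: C}|.
Proof. by rewrite /segN prednK //; apply/card_gt0P; exists [ffun=> true]. Qed.
Definition segi (j : 'I_segN.+1) : C := enum_val (cast_ord segNE j).
Definition segr (c : C) : 'I_segN.+1 := cast_ord (esym segNE) (enum_rank c).
Lemma segiK : cancel segi segr.
Proof. by move=> j; rewrite /segi /segr enum_valK cast_ordK. Qed.
Lemma segrK : cancel segr segi.
Proof. by move=> c; rewrite /segi /segr cast_ordKV enum_rankK. Qed.

Definition hfac (z : P1 k) (b : bool) : k := if b then (hcrd z).1 else (hcrd z).2.
Definition segvec (x : I -> P1 k) (c : C) : k := \prod_i hfac (x i) (c i).

Lemma hfac_chart b z : (hfac z b != 0) = in_chart b z.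
Proof. by case: b; case: z => [a|] //=; rewrite ?eqxx ?oner_eq0 //. Qed.
Lemma segvec_chart (b : C) x : segvec x b != 0 <-> in_charts b x.
Proof.
rewrite /segvec; split=> [/prodf_neq0 H i|H]; first by rewrite -hfac_chart; exact: H.
by apply/prodf_neq0 => i _; rewrite hfac_chart; exact: H.
Qed.
Definition chartof (x : I -> P1 k) : C := [ffun i => x i == None].
Lemma chartofP x : in_charts (chartof x) x.
Proof. by move=> i; rewrite ffunE; case: (x i) => [a|]. Qed.

Lemma hfac_ratio b z : in_chart b z -> hfac z (~~ b) = hfac z b * chart b z.
Proof.
case: b; case: z => [a|] //=; rewrite ?mul1r ?mulr0 //.
by move=> a0; rewrite mulfV //; apply: contra_neq a0 => ->.
Qed.

(** Switching the choice in one factor multiplies the coordinate by the chart coordinate of that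
    factor; this matches polynomials on charts with homogeneous forms. *)
Lemma segvec_ratio (b c : C) x : in_charts b x ->
  segvec x c = segvec x b * \prod_(i | c i != b i) chart (b i) (x i).
Proof.
move=> xb; rewrite /segvec (bigID (fun i => c i != b i)) /= [in RHS](bigID (fun i => c i != b i)) /=.
rewrite [RHS]mulrAC -big_split /=; congr (_ * _).
  apply: eq_bigr => i cb; rewrite -hfac_ratio //; congr (hfac _ _).
  by move: cb; case: (c i); case: (b i).
by apply: eq_bigr => i; rewrite negbK => /eqP ->.
Qed.

Lemma segre_ex x : exists L : line k segN, exists l, l != 0 /\ forall j, hcoord L j = l * segvec x (segi j).
Proof.
apply: line_ex; exists (segr (chartof x)); rewrite segrK; apply/segvec_chart; exact: chartofP.
Qed.
Definition segre (x : P1s k I) : Pn k segN := sval (cid (segre_ex x)).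
Lemma segreP x : exists l, l != 0 /\ forall j, hcoord (segre x) j = l * segvec x (segi j).
Proof. by rewrite /segre; case: cid. Qed.

Lemma segre_neq0 x c : hcoord (segre x) (segr c) != 0 <-> in_charts c x.
Proof.
have [l [l0 ->]] := segreP x; rewrite segrK mulf_eq0 (negbTE l0) /=; exact: segvec_chart.
Qed.

Lemma segre_homog d (Q : {mpoly k[segN.+1]}) x : Q \is d.-homog -> exists2 l, l != 0 &
  Q.@[hcoord (segre x)] = l * Q.@[fun j => segvec x (segi j)].
Proof.
move=> hQ; have [l [l0 E]] := segreP x; exists (l ^+ d); first exact: expf_neq0.
by rewrite (meval_eq _ E) (meval_homog _ _ hQ).
Qed.

Lemma charts_rank (b : I -> bool) (x : I -> P1 k) i : charts b x (enum_rank i) = chart (b i) (x i).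
Proof. by rewrite /charts enum_rankK. Qed.

Lemma seg_dehomog (b : C) (Q : {mpoly k[segN.+1]}) : exists Q' : {mpoly k[#|I|]}, forall d x,
  Q \is d.-homog -> in_charts b x -> Q.@[fun j => segvec x (segi j)] = segvec x b ^+ d * Q'.@[charts b x].
Proof.
exists (Q \mPo [tuple \prod_(i | segi j i != b i) 'X_(enum_rank i) | j < segN.+1]) => d x hQ xb.
rewrite comp_mpoly_meval -(meval_homog _ _ hQ); apply: meval_eq => j.
rewrite (segvec_ratio _ xb) !tnth_mktuple rmorph_prod /=; congr (_ * _).
by apply: eq_bigr => i _; rewrite mevalXU charts_rank.
Qed.

Lemma seg_homog (b : C) (Q : {mpoly k[#|I|]}) : exists d (Q' : {mpoly k[segN.+1]}),
  Q' \is d.-homog /\ forall x, in_charts b x -> Q'.@[fun j => segvec x (segi j)] = segvec x b ^+ d * Q.@[charts b x].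
Proof.
pose H (Q : {mpoly k[#|I|]}) := exists d (Q' : {mpoly k[segN.+1]}),
  Q' \is d.-homog /\ forall x, in_charts b x -> Q'.@[fun j => segvec x (segi j)] = segvec x b ^+ d * Q.@[charts b x].
have HM P P' : H P -> H P' -> H (P * P').
  move=> [d [R [hR RE]]] [d' [R' [hR' RE']]]; exists (d + d')%N, (R * R').
  by split=> [|x xb]; [exact: dhomogM|rewrite !mevalM RE // RE' // exprD mulrACA].
have HD P P' : H P -> H P' -> H (P + P').
  move=> [d [R [hR RE]]] [d' [R' [hR' RE']]]; exists (d + d')%N, (R * 'X_(segr b) ^+ d' + R' * 'X_(segr b) ^+ d).
  split=> [|x xb].
    by apply: rpredD; [|rewrite addnC]; apply: dhomogM => //; exact: homogXn.
  rewrite !mevalD !mevalM !rmorphXn /= !mevalXU segrK RE // RE' // exprD.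
  by ring.
have HC c : H c%:MP.
  exists 0%N, c%:MP; split=> [|x xb]; last by rewrite !mevalC expr0 mul1r.
  by rewrite -[c%:MP]mulr1 mul_mpolyC rpredZ ?dhomog1.
have HXi i : H 'X_i.
  pose c : C := [ffun j => if j == enum_val i then ~~ b j else b j].
  exists 1%N, 'X_(segr c); split=> [|x xb]; first by rewrite dhomogX; apply/eqP; exact: mdeg1.
  rewrite !mevalXU segrK expr1 (segvec_ratio _ xb); congr (_ * _).
  rewrite (big_pred1 (enum_val i)) // => j; rewrite ffunE /=.
  by have [->|ji] := eqVneq j (enum_val i); [case: (b _)|rewrite eqxx].
elim/mpolyind: Q => [|c m P _ _ HP]; first by have := HC 0; rewrite mpolyC0.
apply: (HD) => //; rewrite -mul_mpolyC; apply: (HM); first exact: HC.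
rewrite mpolyXE_id; elim/big_ind: _ => [|R R' HR HR'|i _]; first by have := HC 1.
  exact: HM.
by elim: (m i) => [|e IH]; [have := HC 1|rewrite exprS; exact: HM].
Qed.

Lemma segre_open (U : set (P1s k I)) : zopen (P1s k I) U <-> pull_open segre U.
Proof.
split=> [Uo|[V [Vo ->]] x Vx].
  exists [set M | exists d (Q : {mpoly k[segN.+1]}),
    [/\ Q \is d.-homog, Q.@[hcoord (M : line k segN)] != 0 & forall y, Q.@[hcoord (segre y)] != 0 -> U y]]; split.
    by move=> M [d [Q [hQ QM QU]]]; exists d, Q; split=> // M' QM'; exists d, Q.
  apply/seteqP; split=> x /=; last by move=> [d [Q [_ Qx]]]; apply.
  move=> /Uo [b [Q [xb Qx QU]]]; pose b' : C := [ffun i => b i].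
  have bE : b = b' :> (I -> bool) by apply/funext => i; rewrite ffunE.
  rewrite bE in xb Qx QU; have [d [Q' [hQ' QE]]] := seg_homog b' Q.
  have hX := homogX k (segr b').
  exists (d + 1)%N, (Q' * 'X_(segr b')); split.
  - exact: dhomogM.
  - rewrite mevalM mevalXU mulf_neq0 //; last exact/segre_neq0.
    have [l l0 ->] := segre_homog x hQ'; rewrite QE // mulf_neq0 // mulf_neq0 // expf_neq0 //.
    exact/segvec_chart.
  - move=> y; rewrite mevalM mevalXU mulf_eq0 negb_or => /andP [Qy /segre_neq0 yb].
    apply: QU => //; move: Qy; have [l l0 ->] := segre_homog y hQ'; rewrite QE //.
    by rewrite !mulf_eq0 !negb_or => /andP [_ /andP []].
have [d [Q [hQ Qx QV]]] := Vo _ Vx; have xb := chartofP x.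
have [Q' QE] := seg_dehomog (chartof x) Q.
have key y : in_charts (chartof x) y -> (Q.@[hcoord (segre y)] != 0) = (Q'.@[charts (chartof x) y] != 0).
  move=> yb; have [l l0 ->] := segre_homog y hQ; rewrite (QE _ _ hQ yb) !mulf_eq0 (negbTE l0) /=.
  by rewrite (negbTE (expf_neq0 _ ((segvec_chart _ _).2 yb))).
exists (chartof x), Q'; split=> //; first by rewrite -key.
by move=> y yb; rewrite -key // => /QV.
Qed.

Lemma segre_regular (x : P1s k I) (f : P1s k I -> k) : regular x f <-> pull_regular segre x f.
Proof.
split=> [[b [P [Q [xb Qx fE]]]]|[g [[d [P [Q [hP hQ Qx gE]]]] [V [Vo Vx fE]]]]].
  pose b' : C := [ffun i => b i].
  have bE : b = b' :> (I -> bool) by apply/funext => i; rewrite ffunE.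
  rewrite bE in xb Qx fE.
  have [d [Q' [hQ' QE]]] := seg_homog b' Q; have [e [P' [hP' PE]]] := seg_homog b' P.
  have hX e' := homogXn k e' (segr b').
  pose P'' := P' * 'X_(segr b') ^+ d; pose Q'' := Q' * 'X_(segr b') ^+ e.
  have hP'' : P'' \is (e + d).-homog by exact: dhomogM.
  have hQ'' : Q'' \is (e + d).-homog by rewrite addnC; exact: dhomogM.
  exists (fun M : Pn k segN => P''.@[hcoord (M : line k segN)] / Q''.@[hcoord (M : line k segN)]).
  have Q''x : Q''.@[hcoord (segre x)] != 0.
    rewrite mevalM rmorphXn /= mevalXU mulf_neq0 ?expf_neq0 //; last exact/segre_neq0.
    have [l l0 ->] := segre_homog x hQ'; rewrite QE // mulf_neq0 // mulf_neq0 // expf_neq0 //.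
    exact/segvec_chart.
  split; first by exists (e + d)%N, P'', Q''.
  exists [set M | (Q'' * 'X_(segr b')).@[hcoord (M : line k segN)] != 0]; split.
  - by apply: (@Pn_openP _ _ (e + d + 1)); apply: dhomogM => //; exact: homogX.
  - by rewrite /= mevalM mulf_neq0 // mevalXU; exact/segre_neq0.
  - move=> y /=; rewrite mevalM mevalXU mulf_eq0 negb_or => /andP [Qy /segre_neq0 yb].
    have sb := (segvec_chart _ _).2 yb.
    have [l [l0 lE]] := segreP y.
    have ev e' (R : {mpoly k[segN.+1]}) : R \is e'.-homog -> R.@[hcoord (segre y)] = l ^+ e' * R.@[fun j => segvec y (segi j)].
      by move=> hR; rewrite (meval_eq _ lE) (meval_homog _ _ hR).
    have Qc : Q.@[charts b' y] != 0.
      move: Qy; rewrite mevalM rmorphXn /= (ev _ _ hQ') QE // !mulf_eq0 !negb_or.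
      by case/andP => /andP [_ /andP []].
    rewrite fE // (ev _ _ hP'') (ev _ _ hQ'') /P'' /Q'' !mevalM !rmorphXn /= !mevalXU segrK QE // PE //.
    have la : l ^+ (e + d) != 0 by rewrite expf_neq0.
    have sd : segvec y b' ^+ d != 0 by rewrite expf_neq0.
    have se : segvec y b' ^+ e != 0 by rewrite expf_neq0.
    by field; rewrite Qc la sd se.
have xb := chartofP x; have [P' PE] := seg_dehomog (chartof x) P; have [Q' QE] := seg_dehomog (chartof x) Q.
have [e [R [hR Rx RV]]] := Vo _ Vx; have [R' RE] := seg_dehomog (chartof x) R.
have key e' (S : {mpoly k[segN.+1]}) (S' : {mpoly k[#|I|]}) y : S \is e'.-homog -> in_charts (chartof x) y ->
    (forall d x0, S \is d.-homog -> in_charts (chartof x) x0 ->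
       S.@[fun j => segvec x0 (segi j)] = segvec x0 (chartof x) ^+ d * S'.@[charts (chartof x) x0]) ->
    (S.@[hcoord (segre y)] != 0) = (S'.@[charts (chartof x) y] != 0).
  move=> hS yb SE; have [l l0 ->] := segre_homog y hS; rewrite (SE _ _ hS yb) !mulf_eq0 (negbTE l0) /=.
  by rewrite (negbTE (expf_neq0 _ ((segvec_chart _ _).2 yb))).
exists (chartof x), (P' * R'), (Q' * R'); split=> //.
  by rewrite mevalM; apply: mulf_neq0; [rewrite -(key _ _ _ _ hQ xb QE)|rewrite -(key _ _ _ _ hR xb RE)].
move=> y yb; rewrite !mevalM mulf_eq0 negb_or => /andP [Qy Ry].
rewrite fE; last by apply: RV; rewrite (key _ _ _ _ hR yb RE).
rewrite gE ?(key _ _ _ _ hQ yb QE) // -mulf_div divff // mulr1.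
have [l [l0 lE]] := segreP y.
rewrite !(meval_eq _ lE) (meval_homog _ _ hP) (meval_homog _ _ hQ) (PE _ _ hP yb) (QE _ _ hQ yb).
have sd : segvec y (chartof x) ^+ d != 0 by rewrite expf_neq0 //; exact/segvec_chart.
have ld : l ^+ d != 0 by rewrite expf_neq0.
by field; rewrite Qy sd ld.
Qed.

Lemma chart_inj b z w : in_chart b z -> in_chart b w -> chart b z = chart b w :> k -> z = w.
Proof.
case: b; case: z => [a|]; case: w => [c|] //=.
- by move=> _ _ /invr_inj ->.
- by move=> a0 _ /eqP; rewrite invr_eq0 => /eqP E; rewrite E eqxx in a0.
- by move=> _ c0 /esym/eqP; rewrite invr_eq0 => /eqP E; rewrite E eqxx in c0.
- by move=> _ _ ->.
Qed.

Lemma segre_inj : injective segre.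
Proof.
move=> x y E; have xb := chartofP x; set b := chartof x in xb.
have yb : in_charts b y by apply/segre_neq0; rewrite -E; exact/segre_neq0.
apply/funext => i; apply: (chart_inj (xb i) (yb i)).
pose c : C := [ffun j => if j == i then ~~ b j else b j].
have cE z : in_charts b z -> chart (b i) (z i) = hcoord (segre z) (segr c) / hcoord (segre z) (segr b).
  move=> zb; have [l [l0 lE]] := segreP z; rewrite !lE !segrK (segvec_ratio c zb) (big_pred1 i).
    by rewrite -mulf_div divff // mul1r mulrAC mulfV ?mul1r //; exact/segvec_chart.
  by move=> j; rewrite ffunE /=; have [->|ji] := eqVneq j i; [case: (b _)|rewrite eqxx].
by rewrite !cE // E.
Qed.

Definition upd (c : C) (i : I) (a : bool) : C := [ffun j => if j == i then a else c j].

Lemma segvec_upd x c i a : segvec x c * hfac (x i) a = segvec x (upd c i a) * hfac (x i) (c i).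
Proof.
rewrite /segvec (bigD1 i) //= [in RHS](bigD1 i) //= ffunE eqxx.
rewrite [\prod_(_ | _) hfac _ (upd _ _ _ _)](eq_bigr (fun j => hfac (x j) (c j))) => [|j /negbTE ji].
  by ring.
by rewrite ffunE ji.
Qed.

(** The image is cut out by the quadrics that exchange the i-th entries of two indices. From a
    solution with nonzero coordinate [c0], the i-th factor is read off from the coordinates whose
    index differs from [c0] at most at [i]. *)
Lemma segre_range_closed : zclosed (range segre).
Proof.
move=> L nL; pose s c := hcoord (L : line k segN) (segr c).
have [rel|/existsNP [c /existsNP [c' /existsNP [i ne]]]] :=
    pselect (forall c c' i, s c * s c' = s (upd c i (c' i)) * s (upd c' i (c i))); last first.
  pose Q : {mpoly k[segN.+1]} := 'X_(segr c) * 'X_(segr c') - 'X_(segr (upd c i (c' i))) * 'X_(segr (upd c' i (c i))).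
  have h1 e := homogX k (segr e).
  have hQ : Q \is 2.-homog by rewrite rpredB // -[2%N]/(1 + 1)%N; apply: dhomogM.
  exists 2%N, Q; split=> //.
    by rewrite mevalB !mevalM !mevalXU subr_eq0; apply/eqP.
  move=> M QM [x _ xM]; move/negP: QM; apply; rewrite -xM; have [l l0 ->] := segre_homog x hQ.
  rewrite mevalB !mevalM !mevalXU !segrK; apply/eqP.
  have E : segvec x c * segvec x c' = segvec x (upd c i (c' i)) * segvec x (upd c' i (c i)).
    rewrite /segvec -!big_split; apply: eq_bigr => j _; rewrite !ffunE.
    by rewrite /=; case: eqP => [->|_] //; exact: mulrC.
  by rewrite E subrr mulr0.
exfalso; apply: nL.
have [c0 sc0] : exists c0, s c0 != 0.
  by have [j Lj] := hcoord_neq0 (L : line k segN); exists (segi j); rewrite /s segiK.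
pose x i : P1 k := if s (upd c0 i false) == 0 then None else Some (s (upd c0 i true) / s (upd c0 i false)).
have updK c i : upd c i (c i) = c by apply/ffunP => j; rewrite ffunE; case: eqP => [->|].
have xi i : s (upd c0 i true) * hfac (x i) false = s (upd c0 i false) * hfac (x i) true.
  rewrite /x /hfac; case: eqP => [->|/eqP n0] /=; first by rewrite mulr0 mul0r.
  by rewrite mulr1 mulrCA divff // mulr1.
have f0 i : hfac (x i) (c0 i) != 0.
  rewrite /x /hfac; have := updK c0 i; case: (c0 i) => E; rewrite E in sc0 *.
    case: ifP => [_|/negbT n0] /=; first exact: oner_neq0.
    by rewrite mulf_neq0 // invr_eq0.
  by rewrite (negbTE sc0) /= oner_neq0.
(* Induction on the number of entries in which [c] differs from [c0], changing one of them by a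
   quadric. *)
have key c : s c * segvec x c0 = s c0 * segvec x c.
  have [m] := ubnP #|[set i | c i != c0 i]%SET|; elim: m c => // m IH c; rewrite ltnS => cm.
  have [E|/eqP cc0] := pselect (c = c0); first by rewrite E.
  have [i ci] : exists i, c i != c0 i.
    apply: contrapT => no; move/eqP: cc0; apply; apply/ffunP => i; apply/eqP/negPn/negP => ne; by apply: no; exists i.
  pose c1 := upd c i (c0 i).
  have IH1 : s c1 * segvec x c0 = s c0 * segvec x c1.
    apply: IH; apply: leq_trans cm; apply: proper_card; apply/fintype.properP; split.
      apply/fintype.subsetP => j; rewrite !inE /c1 /upd ffunE; case: ifP => [/eqP ->|//].
      by rewrite eqxx.
    by exists i; rewrite !inE // ffunE !eqxx.
  have R := rel c c0 i; have S := segvec_upd x c i (c0 i).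
  have X : s (upd c0 i (c i)) * hfac (x i) (c0 i) = s c0 * hfac (x i) (c i).
    have Y := xi i; rewrite -[in RHS](updK c0 i).
    by move: ci Y; case: (c i); case: (c0 i).
  apply: (mulIf (f0 i)); apply: (mulfI sc0).
  transitivity (s c1 * (s (upd c0 i (c i)) * hfac (x i) (c0 i)) * segvec x c0).
    transitivity ((s c * s c0) * hfac (x i) (c0 i) * segvec x c0); first by ring.
    by rewrite R -/c1; ring.
  rewrite X; transitivity ((s c1 * segvec x c0) * (s c0 * hfac (x i) (c i))); first by ring.
  rewrite IH1; transitivity (s c0 * s c0 * (segvec x c1 * hfac (x i) (c i))); first by ring.
  by rewrite -S; ring.
exists x => //; apply: line_inj => j l.
have [la [la0 laE]] := segreP x; rewrite !laE.
have sj j' : hcoord (L : line k segN) j' * segvec x c0 = s c0 * segvec x (segi j').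
  by rewrite -key /s segiK.
have v0 : segvec x c0 != 0 by apply/prodf_neq0 => i _.
apply: (mulIf v0).
transitivity (la * segvec x (segi j) * (hcoord (L : line k segN) l * segvec x c0)); first by ring.
transitivity (la * segvec x (segi l) * (hcoord (L : line k segN) j * segvec x c0)); last by ring.
by rewrite !sj; ring.
Qed.

Theorem segre_closed_immersion : closed_immersion segre.
Proof.
split; [exact: segre_inj|exact: segre_range_closed|exact: segre_open|exact: segre_regular].
Qed.

Lemma P1s_ringed : ringed (P1s k I).
Proof. exact: pull_ringed segre_open segre_regular (Pn_ringed k _). Qed.
End Segre.

(** * Equations, charts and the interior of the moduli space *)

Section Moduli.
Variables (k : numClosedFieldType) (n : nat).
Hypothesis n3 : (3 <= n)%N.
Let X := Mbar0 k n.
Implicit Types x y : X.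

Lemma hcrd_chart b (z : P1 k) : in_chart b z -> exists2 l, l != 0 &
  hcrd z = (l * (if b then 1 else chart b z), l * (if b then chart b z else 1)).
Proof.
case: b; case: z => [a|] //=; rewrite ?mulr1 ?mulr0.
- move=> a0; have an : a != 0 by apply: contra_neq a0 => ->.
  by exists a => //; rewrite mulr1 mulfV.
- by move=> _; exists 1; rewrite ?oner_neq0 // mulr1 mulr0.
- by move=> _; exists 1; rewrite ?oner_neq0 // mul1r mulr1.
Qed.

(** In a chart, the homogeneous coordinates of all entries of [crel] are polynomials up to nonzero
    factors, so that each relation becomes one polynomial equation [Q]. *)
Lemma crsys_closed : zclosed (X := P1s k (quad n)) [set x | crsys x].
Proof.
move=> x /= nx; pose b := chartof x; have xb : in_charts b x := chartofP x.
have pr i j l m : exists A B : {mpoly k[#|{: quad n}|]}, forall y : quad n -> P1 k, in_charts b y ->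
    exists2 la, la != 0 & hcrd (xq y i j l m) = (la * A.@[charts b y], la * B.@[charts b y]).
  rewrite /xq; case: insubP => [q _ _|_].
    exists (if b q then 1 else 'X_(enum_rank q)), (if b q then 'X_(enum_rank q) else 1) => y yb.
    have [la la0 ->] := hcrd_chart (yb q); exists la => //.
    by case E : (b q); rewrite ?meval1 ?mevalXU ?charts_rank ?E.
  case: ifP => _; [|case: ifP => _].
  - by exists 0, 1 => y _; exists 1; rewrite ?oner_neq0 // meval0 meval1 mulr0 mulr1.
  - by exists 1, 1 => y _; exists 1; rewrite ?oner_neq0 // !meval1 mulr1.
  - by exists 1, 0 => y _; exists 1; rewrite ?oner_neq0 // meval0 meval1 mulr0 mulr1.
have /existsNP [i /existsNP [j /existsNP [l /not_implyP [u /existsNP [q nq]]]]] := nx.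
have [A0 [B0 E0]] := pr i j l (mark q (inord 0)); have [A1 [B1 E1]] := pr i j l (mark q (inord 1)).
have [A2 [B2 E2]] := pr i j l (mark q (inord 2)); have [A3 [B3 E3]] := pr i j l (mark q (inord 3)).
have [A4 [B4 E4]] : exists A B : {mpoly k[#|{: quad n}|]}, forall y : quad n -> P1 k, in_charts b y ->
    exists2 la, la != 0 & hcrd (y q) = (la * A.@[charts b y], la * B.@[charts b y]).
  have [A [B E]] := pr (mark q (inord 0)) (mark q (inord 1)) (mark q (inord 2)) (mark q (inord 3)).
  by exists A, B => y yb; have := E y yb; rewrite xq_quad.
pose Q := A4 * ((A3 * B2 - B3 * A2) * (A1 * B0 - B1 * A0)) - B4 * ((A3 * B0 - B3 * A0) * (A1 * B2 - B1 * A2)).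
have QP (y : quad n -> P1 k) : in_charts b y -> crel (xq y i j l (mark q (inord 0))) (xq y i j l (mark q (inord 1)))
   (xq y i j l (mark q (inord 2))) (xq y i j l (mark q (inord 3))) (y q) <-> Q.@[charts b y] = 0.
  move=> yb; rewrite /crel !bracketE.
  have [l0 l00 ->] := E0 y yb; have [l1 l10 ->] := E1 y yb; have [l2 l20 ->] := E2 y yb.
  have [l3 l30 ->] := E3 y yb; have [l4 l40 ->] := E4 y yb; rewrite /Q !(mevalB, mevalM) /=.
  have L : l0 * l1 * l2 * l3 * l4 != 0 by rewrite !mulf_neq0.
  split=> [R|R].
    by apply: (mulfI L); rewrite mulr0; move/eqP: R; rewrite -subr_eq0 => /eqP <-; ring.
  apply/eqP; rewrite -subr_eq0; apply/eqP.
  transitivity ((l0 * l1 * l2 * l3 * l4) * 0); last by rewrite mulr0.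
  by rewrite -R; ring.
exists b, Q; split=> //; first by apply/eqP => /(QP _ xb).
by move=> y yb Qy ys; move/eqP: Qy; apply; apply/(QP _ yb); exact: ys.
Qed.

Lemma Mbar0_set : [set x : P1s k (quad n) | exists S, represents x S] = [set x | crsys x].
Proof. by apply/seteqP; split=> x /=; move/(representableP x n3). Qed.

Definition segX (x : X) : Pn k (segN (quad n)) := segre (val x).

Lemma segX_ci : closed_immersion segX.
Proof.
apply: (closed_immersion_sub (@segre_closed_immersion k (quad n))).
rewrite Mbar0_set; exact: crsys_closed.
Qed.
Lemma X_ringed : ringed X. Proof. exact: (subspace_ringed _ (@P1s_ringed k (quad n))). Qed.

Lemma X_crsys x : crsys (val x).
Proof. by apply/(representableP _ n3); have := valP x; rewrite in_setE. Qed.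

Lemma X_nearP x (P : set X) : near_pt x P -> exists (b : quad n -> bool) (Q : {mpoly k[#|{: quad n}|]}),
  [/\ in_charts b (val x), Q.@[charts b (val x)] != 0 &
   forall y, in_charts b (val y) -> Q.@[charts b (val y)] != 0 -> P y].
Proof.
move=> [U [[V [Vo ->]] Vx VP]]; have [b [Q [xb Qx QV]]] := Vo _ Vx; exists b, Q; split=> // y yb Qy.
by apply: VP; exact: QV.
Qed.

Lemma X_near x (b : quad n -> bool) (Q : {mpoly k[#|{: quad n}|]}) : in_charts b (val x) -> Q.@[charts b (val x)] != 0 ->
   near_pt x [set y | in_charts b (val y) /\ Q.@[charts b (val y)] != 0].
Proof.
move=> xb Qx; exists [set y | in_charts b (val y) /\ Q.@[charts b (val y)] != 0]; split=> //.
exists [set z : P1s k (quad n) | in_charts b z /\ Q.@[charts b z] != 0]; split=> // z [zb Qz].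
by exists b, Q; split.
Qed.

Lemma X_regularP x (f : X -> k) : regular x f -> exists (b : quad n -> bool) (P Q : {mpoly k[#|{: quad n}|]}),
  [/\ in_charts b (val x), Q.@[charts b (val x)] != 0 &
   near_pt x [set y | [/\ in_charts b (val y), Q.@[charts b (val y)] != 0 &
     f y = P.@[charts b (val y)] / Q.@[charts b (val y)]]]].
Proof.
move=> [g [[b [P [Q [xb Qx gE]]]] [V [Vo Vx Vf]]]]; exists b, P, Q; split=> //.
have nV : near_pt x [set y | V (val y)].
  by exists [set y | V (val y)]; split=> //; exists V.
apply: near_sub (nearI X_ringed nV (X_near xb Qx)) => y [/= Vy [yb Qy]]; split=> //.
by rewrite Vf // gE.
Qed.

Lemma in_chart_near x q b : in_chart b (val x q) -> near_pt x [set y | in_chart b (val y q)].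
Proof.
move=> xq; pose b' : quad n -> bool := fun q' => if q' == q then b else val x q' == None.
have xb : in_charts b' (val x).
  by move=> q'; rewrite /b'; case: eqP => [->|] //; case: (val x q').
apply: near_sub (X_near xb (Q := 1) _) => [y [/= /(_ q)]|]; first by rewrite /b' eqxx.
by rewrite meval1 oner_neq0.
Qed.

Lemma chart_regular x q b : in_chart b (val x q) -> regular x (fun y => chart b (val y q)).
Proof.
move=> xq; pose b' : quad n -> bool := fun q' => if q' == q then b else val x q' == None.
have xb : in_charts b' (val x).
  by move=> q'; rewrite /b'; case: eqP => [->|] //; case: (val x q').
exists (fun z : P1s k (quad n) => chart b (z q)); split.
  exists b', 'X_(enum_rank q), 1; rewrite meval1 oner_neq0; split=> // z zb _.
  by rewrite meval1 divr1 mevalXU charts_rank /b' eqxx.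
by exists setT; split=> //; exact: (open_T (@P1s_ringed k (quad n))).
Qed.

Definition crp (p : 'I_n -> P1 k) : quad n -> P1 k := fun q =>
  cross_ratio (p (mark q (inord 0))) (p (mark q (inord 1))) (p (mark q (inord 2))) (p (mark q (inord 3))).

Definition smooth_curve (p : 'I_n -> P1 k) : pointed_curve k n :=
  @PointedCurve k n unit (fun _ _ => false) (fun _ _ => None) (fun=> tt) p.

Lemma crp_represents p : injective p -> represents (crp p : P1s k (quad n)) (smooth_curve p).
Proof.
move=> pinj; split; first split=> //=.
- move=> [] []; exists [::]; split; first by split.
  by case=> [|a s] [] //=.
- by split=> // i j _ /pinj.
- by move=> []; rewrite [X in (_ <= _ + X)%N](eq_card (B := predT)) ?card_ord ?(leq_trans n3) ?leq_addl // => i; rewrite !inE eqxx.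
move=> q; exists tt, (fun j => p (mark q j)); split=> //; first by move=> j; left.
have := quad_uniq q; rewrite /= !inE !negb_or => /and3P [/and3P [m01 m02 _] /andP [m12 _] _].
by split=> /pinj /eqP; apply/negP.
Qed.

Lemma crp_ex p : injective p -> exists2 y : X, val y = crp p & M0 y.
Proof.
move=> /crp_represents H.
have Hx : crp p \in [set x : P1s k (quad n) | exists S, represents x S] by rewrite in_setE; exists (smooth_curve p).
by exists (exist _ (crp p) Hx) => //; exists (smooth_curve p); split=> //=; rewrite card_unit.
Qed.

Lemma M0_ex : exists x : X, M0 x.
Proof.
have [|x _ Mx] := @crp_ex (fun i => Some i%:R); last by exists x.
by move=> i j [] /eqP; rewrite eqr_nat => /eqP /val_inj.
Qed.

Lemma near_all (I : finType) x (P : I -> set X) : (forall i, near_pt x (P i)) ->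
  near_pt x [set y | forall i, P i y].
Proof.
move=> H; suff /(_ (enum I)) : forall s : seq I, near_pt x [set y | forall i, i \in s -> P i y].
  by apply: near_sub => y /= Py i; apply: Py; rewrite mem_enum.
elim=> [|i s IH]; first by apply: (nearT _ X_ringed).
apply: near_sub (nearI X_ringed (H i) IH) => y [/= Pi Ps] j; rewrite inE => /orP [/eqP ->|] //.
exact: Ps.
Qed.

Lemma neq_near x q (c : k) : val x q != Some c -> near_pt x [set y | val y q != Some c].
Proof.
have rX := X_ringed; case E : (val x q) => [a|] xc.
  have xb : in_chart false (val x q) by rewrite E.
  have rc := reg_sub rX (chart_regular xb) (reg_const rX x c).
  have /(reg_neq0 rX rc) nz : chart false (val x q) - c != 0 by rewrite E /= subr_eq0; apply: contra_neq xc => ->.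
  apply: near_sub (nearI rX nz (in_chart_near xb)) => y [/=].
  by case: (val y q) => [d|] //=; rewrite subr_eq0 => dc _; apply: contra_neq dc => -[].
have xb : in_chart true (val x q) by rewrite E.
have rc := reg_sub rX (reg_mul rX (reg_const rX x c) (chart_regular xb)) (reg_const rX x 1).
have /(reg_neq0 rX rc) nz : c * chart true (val x q) - 1 != 0 by rewrite E /= mulr0 sub0r oppr_eq0 oner_neq0.
apply: near_sub (nearI rX nz (in_chart_near xb)) => y [/=] + yb.
by apply: contraNneq => yc; rewrite yc /= in yb *; rewrite mulfV ?subrr //; apply: contra_neq yb => ->.
Qed.

Lemma M0_open x : M0 x -> near_pt x [set y : X | M0 y].
Proof.
move=> /(M0P _ n3) Mx; have rX := X_ringed.
have : near_pt x [set y : X | forall q, [/\ val y q != Some 0, val y q != Some 1 & val y q != None]].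
  apply: near_all => q; have [x0 x1 xo] := Mx q.
  have nx : near_pt x [set y | in_chart false (val y q)] by apply: in_chart_near.
  by apply: near_sub (nearI rX (neq_near x0) (nearI rX (neq_near x1) nx)) => y [/= ? [? ?]].
by apply: near_sub => y /= H; apply/(M0P _ n3).
Qed.

Lemma M0_generic : generic [set y : X | M0 y].
Proof. by have [x Mx] := M0_ex; apply: near_generic (M0_open Mx). Qed.

(* The divisor where some cross ratio is infinite, with multiplicities. *)
Definition poleD (Q : {set quad n}) (x y : X) : k :=
  \prod_(q in Q | val x q == None) chart true (val y q).

Lemma poleD_regular Q x : regular x (poleD Q x).
Proof.
apply: (@reg_prod _ _ _ _ _ _ _ X_ringed) => q /andP [_ /eqP E]; apply: chart_regular.
by rewrite E.
Qed.

Lemma poleD_M0 Q x y : M0 y -> regular y (poleD Q x) /\ poleD Q x y != 0.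
Proof.
move=> /(M0P _ n3) My; split.
  by apply: (@reg_prod _ _ _ _ _ _ _ X_ringed) => q _; apply: chart_regular; case: (My q).
apply/prodf_neq0 => q _; have [y0 _ yo] := My q; case: (val y q) y0 yo => //= a a0 _.
by rewrite invr_neq0 //; apply: contra_neq a0 => ->.
Qed.

Let fullD : X -> X -> k := poleD [set: quad n]%SET.

Lemma linear_form_delta (c : {ffun quad n -> bool}) y :
  linear_form (fun j => (segi j == c)%:R) (segX y) = hcoord (segX y : line k _) (segr c).
Proof.
rewrite /linear_form (bigD1 (segr c)) //= segrK eqxx mul1r big1 ?addr0 // => j jc.
case: eqP => [E|]; last by rewrite mul0r.
by rewrite -E segiK eqxx in jc.
Qed.

(** The hyperplane is given by the product of all second homogeneous coordinates, which vanishes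
    where some cross ratio is oo. *)
Lemma fullD_segre x y : in_charts (chartof (val x)) (val y) ->
  hcoord (segX y : line k _) (segr [ffun=> false]) / hcoord (segX y : line k _) (segr (chartof (val x))) = fullD x y.
Proof.
move=> yb; have [l [l0 lE]] := segreP (val y); rewrite /segX !lE !segrK (segvec_ratio [ffun=> false] yb).
have s0 : segvec (val y) (chartof (val x)) != 0 by apply/segvec_chart.
rewrite mulrA mulrAC mulfV ?mulf_neq0 // mul1r /fullD /poleD.
apply: eq_big => [q|q]; rewrite ?inE !ffunE; first by case: (val x q == None).
by case: (val x q == None).
Qed.

Lemma fullD_ample : ample fullD.
Proof.
have rX := X_ringed.
have nb x : near_pt x [set y | in_charts (chartof (val x)) (val y)].
  have := X_near (chartofP (val x)) (Q := 1); rewrite meval1 => /(_ (oner_neq0 _)).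
  by apply: near_sub => y [].
split.
  move=> x; split.
    by apply: generic_sub M0_generic => y /= My; exact: poleD_M0.
  apply: near_sub (nb x) => y /= yb.
  pose w (z : X) : k := \prod_(q in [set: quad n]%SET | (val x q == None) && (val y q != None)) chart true (val z q).
  have rw : regular y w.
    apply: (@reg_prod _ _ _ _ _ _ _ rX) => q /and3P [_ xq yq]; apply: chart_regular.
    by have := yb q; rewrite ffunE xq.
  have w0 : w y != 0.
    apply/prodf_neq0 => q /and3P [_ xq yq]; have := yb q; rewrite ffunE xq -[sval y]/(val y).
    case: (val y q) yq => //= a _ a0; rewrite invr_neq0 //; by apply: contra_neq a0 => ->.
  exists (fun z => (w z)^-1); split; [exact: reg_inv|by rewrite invr_neq0|].
  have := near_generic (reg_neq0 rX rw w0); apply: generic_sub => z /= wz.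
  apply: (mulfI wz); rewrite mulVKf // /fullD /poleD [in RHS](bigID (fun q => val y q == None)) /= mulrC.
  congr (_ * _); apply: eq_bigl => q; rewrite inE //=.
  by have := yb q; rewrite ffunE; case: (val x q == None) => //=; case: (val y q).
exists 1%N, (segN (quad n)), segX, (fun j => (segi j == [ffun=> false])%:R),
  (fun x j => (segi j == chartof (val x))%:R); split=> //.
- exact: segX_ci.
- have [x /(M0P _ n3) Mx] := M0_ex; exists x; rewrite linear_form_delta; apply/segre_neq0 => q.
  by rewrite ffunE; case: (Mx q).
- by move=> x; rewrite linear_form_delta; apply/segre_neq0; exact: chartofP.
exists (fun=> 1); split.
  by apply: generic_sub M0_generic => y /= _; rewrite oner_neq0; split=> //; exact: (reg_const rX y 1).
move=> x; exists (fun=> 1); rewrite oner_neq0; split=> //; first exact: reg_const.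
apply: near_generic (near_sub _ (nb x)) => y /= yb.
by rewrite !linear_form_delta !mul1r fullD_segre // /mul_div expr1.
Qed.

End Moduli.

(** * Paths in the moduli space *)

Section Jets.
Variable k : numClosedFieldType.

(** A property of all but finitely many parameters. *)
Definition gen (E : k -> Prop) : Prop := exists2 P : {poly k}, P != 0 & forall s, P.[s] != 0 -> E s.

Lemma genI (E E' : k -> Prop) : gen E -> gen E' -> gen (fun s => E s /\ E' s).
Proof.
move=> [P P0 PE] [Q Q0 QE]; exists (P * Q); first by rewrite mulf_neq0.
by move=> s; rewrite hornerM mulf_eq0 negb_or => /andP [/PE ? /QE ?].
Qed.
Lemma gen_sub (E E' : k -> Prop) : (forall s, E s -> E' s) -> gen E -> gen E'.
Proof. by move=> EE' [P P0 PE]; exists P => // s /PE /EE'. Qed.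
Lemma genT (E : k -> Prop) : (forall s, E s) -> gen E.
Proof. by move=> ET; exists 1; rewrite ?oner_neq0. Qed.
Lemma gen_ex (E : k -> Prop) : gen E -> exists s, E s.
Proof. by move=> [P P0 PE]; have [s sP] := closed_nonrootP _ P0; exists s; exact: PE. Qed.
Lemma gen_all (I : finType) (E : I -> k -> Prop) : (forall i, gen (E i)) -> gen (fun s => forall i, E i s).
Proof.
move=> H; suff /(_ (enum I)) : forall s : seq I, gen (fun t => forall i, i \in s -> E i t).
  by apply: gen_sub => s Es i; apply: Es; rewrite mem_enum.
elim=> [|i s IH]; first exact: genT.
apply: gen_sub (genI (H i) IH) => t [Ei Es] j; rewrite inE => /orP [/eqP ->|] //; exact: Es.
Qed.
Lemma gen_horner (P : {poly k}) : P != 0 -> gen (fun s => P.[s] != 0).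
Proof. by move=> P0; exists P. Qed.
Lemma gen_opp1 (E : k -> Prop) : gen E -> gen (fun s => E (1 - s)).
Proof.
move=> [P P0 PE]; exists (P \Po (1 - 'X)).
  apply: contra P0 => /eqP E0; apply/eqP.
  have : (P \Po (1 - 'X)) \Po (1 - 'X) = 0 by rewrite E0 comp_poly0.
  rewrite -comp_polyA !(comp_polyB, comp_polyX) -[1]/(1%:P) comp_polyC /= opprB addrC subrK.
  by rewrite comp_polyXr.
by move=> s; rewrite horner_comp !hornerE => /PE.
Qed.

(* g agrees generically with a rational function with value a and derivative a' at 0. *)
Definition jet (g : k -> k) (a a' : k) : Prop := exists P Q : {poly k},
  [/\ Q.[0] != 0, gen (fun s => g s = P.[s] / Q.[s]), P.[0] = a * Q.[0] &
      P^`().[0] = a' * Q.[0] + a * Q^`().[0]].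

Lemma hpoly_neq0 (P : {poly k}) : P.[0] != 0 -> P != 0.
Proof. by apply: contra_neq => ->; rewrite horner0. Qed.

Lemma jet_gen f g a a' : gen (fun s => f s = g s) -> jet g a a' -> jet f a a'.
Proof.
move=> fg [P [Q [Q0 gE P0 P1]]]; exists P, Q; split=> //.
by apply: gen_sub (genI fg gE) => s [-> ->].
Qed.
Lemma jet_poly (P : {poly k}) : jet (fun s => P.[s]) P.[0] P^`().[0].
Proof.
exists P, 1; rewrite hornerC oner_neq0 -[1]/(1%:P) derivC horner0 !mulr1 mulr0 addr0; split=> //.
by apply: genT => s; rewrite hornerC divr1.
Qed.
Lemma jet_const c : jet (fun=> c) c 0.
Proof. by have := jet_poly c%:P; rewrite derivC horner0 hornerC; apply: jet_gen; apply: genT => s; rewrite hornerC. Qed.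
Local Notation hE := (hornerD, hornerN, hornerM).
Lemma jet_add f g a a' b b' : jet f a a' -> jet g b b' -> jet (fun s => f s + g s) (a + b) (a' + b').
Proof.
move=> [P [Q [Q0 fE P0 P1]]] [R [S [S0 gE R0 R1]]]; exists (P * S + R * Q), (Q * S); split.
- by rewrite hornerM mulf_neq0.
- apply: gen_sub (genI (genI fE gE) (genI (gen_horner (hpoly_neq0 Q0)) (gen_horner (hpoly_neq0 S0)))).
  by move=> s [[-> ->] [Qs Ss]]; rewrite !hE addf_div.
- by rewrite !hE P0 R0; ring.
- by rewrite !derivE !hE P0 R0 P1 R1; ring.
Qed.
Lemma jet_mul f g a a' b b' : jet f a a' -> jet g b b' -> jet (fun s => f s * g s) (a * b) (a * b' + b * a').
Proof.
move=> [P [Q [Q0 fE P0 P1]]] [R [S [S0 gE R0 R1]]]; exists (P * R), (Q * S); split.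
- by rewrite hornerM mulf_neq0.
- by apply: gen_sub (genI fE gE) => s [-> ->]; rewrite !hE mulf_div.
- by rewrite !hE P0 R0; ring.
- by rewrite !derivE !hE P0 R0 P1 R1; ring.
Qed.
Lemma jet_inv f a a' : jet f a a' -> a != 0 -> jet (fun s => (f s)^-1) a^-1 (- a' / a ^+ 2).
Proof.
move=> [P [Q [Q0 fE P0 P1]]] a0; have P0n : P.[0] != 0 by rewrite P0 mulf_neq0.
exists Q, P; split=> //.
- by apply: gen_sub fE => s ->; rewrite invf_div.
- by rewrite P0 mulKf.
- by rewrite P1 P0; field.
Qed.
Lemma jet_neq0 f a a' : jet f a a' -> a != 0 -> gen (fun s => f s != 0).
Proof.
move=> [P [Q [Q0 fE P0 P1]]] a0; have P0n : P.[0] != 0 by rewrite P0 mulf_neq0.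
apply: gen_sub (genI fE (genI (gen_horner (hpoly_neq0 Q0)) (gen_horner (hpoly_neq0 P0n)))).
by move=> s [-> [Qs Ps]]; rewrite mulf_neq0 // invr_eq0.
Qed.
Lemma gen_poly0 (P : {poly k}) : gen (fun s => P.[s] = 0) -> P = 0.
Proof.
move=> g0; apply/eqP/negPn/negP => P0; have [s [Ps /eqP]] := gen_ex (genI (gen_horner P0) g0).
by rewrite (negbTE Ps).
Qed.
Lemma jet_uniq f a a' b b' : jet f a a' -> jet f b b' -> a = b /\ a' = b'.
Proof.
move=> [P [Q [Q0 fE P0 P1]]] [R [S [S0 gE R0 R1]]].
have E : P * S - R * Q = 0.
  apply: gen_poly0; apply: gen_sub (genI (genI fE gE) (genI (gen_horner (hpoly_neq0 Q0)) (gen_horner (hpoly_neq0 S0)))).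
  move=> s [[E1 E2] [Qs Ss]]; rewrite E1 in E2; move/eqP: E2; rewrite eqr_div // !hE => /eqP ->; by rewrite subrr.
have E0 : (P * S - R * Q).[0] = 0 by rewrite E horner0.
have E1 : (P * S - R * Q)^`().[0] = 0 by rewrite E linear0 horner0.
have ab : a = b.
  apply: (mulIf (mulf_neq0 Q0 S0)); apply/eqP; rewrite -subr_eq0 -[X in _ == X]E0 !hE P0 R0.
  by apply/eqP; ring.
split=> //; apply: (mulIf (mulf_neq0 Q0 S0)); apply/eqP; rewrite -subr_eq0 -[X in _ == X]E1 !derivE !hE P0 R0 P1 R1 ab.
by apply/eqP; ring.
Qed.
Lemma jet_meval (N : nat) (Q : {mpoly k[N]}) (c : 'I_N -> k -> k) (a a' : 'I_N -> k) :
  (forall i, jet (c i) (a i) (a' i)) -> exists d, jet (fun s => Q.@[c ^~ s]) Q.@[a] d.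
Proof.
move=> jc; elim/mpolyind: Q => [|e m P _ _ [d IH]].
  exists 0; rewrite meval0; apply: jet_gen (jet_const 0); apply: genT => s; exact: meval0.
have [d' jm] : exists d', jet (fun s => \prod_i c i s ^+ m i) (\prod_i a i ^+ m i) d'.
  elim: (index_enum _) => [|i r [d' IHr]].
    by exists 0; rewrite big_nil; apply: jet_gen (jet_const 1); apply: genT => s; rewrite big_nil.
  have [d'' je] : exists d'', jet (fun s => c i s ^+ m i) (a i ^+ m i) d''.
    elim: (m i) => [|j [d'' IHj]]; first by exists 0; exact: jet_const.
    by eexists; rewrite exprS; apply: jet_gen (jet_mul (jc i) IHj); apply: genT => s; rewrite exprS.
  by eexists; rewrite big_cons; apply: jet_gen (jet_mul je IHr); apply: genT => s; rewrite big_cons.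
eexists; rewrite mevalD mevalZ mevalX; apply: jet_gen (jet_add (jet_mul (jet_const e) jm) IH).
by apply: genT => s; rewrite mevalD mevalZ mevalX.
Qed.

(** The path [z] tends to [z0] as its parameter tends to 0: in every chart around [z0] it is
    generically a rational function with the right value at 0. *)
Definition p1jet (z : k -> P1 k) (z0 : P1 k) : Prop := forall b, in_chart b z0 ->
  gen (fun s => in_chart b (z s)) /\ exists d, jet (fun s => chart b (z s)) (chart b z0) d.

Definition p1of (a b : k) : P1 k := if b == 0 then None else Some (a / b).

Lemma p1jet_poly (z : k -> P1 k) (N D : {poly k}) : (N.[0] != 0) || (D.[0] != 0) ->
  gen (fun s => z s = p1of N.[s] D.[s]) -> p1jet z (p1of N.[0] D.[0]).
Proof.
move=> ND zE [] zb.
  have N0 : N.[0] != 0.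
    apply: contraTneq zb => E; rewrite E eqxx /= in ND; by rewrite /p1of E (negbTE ND) mul0r /= eqxx.
  have gN := genI zE (gen_horner (hpoly_neq0 N0)); split.
    apply: gen_sub gN => s [-> Ns]; rewrite /p1of; case: eqP => //= /eqP Ds.
    by apply/eqP => -[/eqP]; rewrite mulf_eq0 invr_eq0 (negbTE Ns) (negbTE Ds).
  have E a c : chart true (p1of a c) = c / a :> k.
    by rewrite /p1of; case: eqP => [->|/eqP c0] /=; rewrite ?mul0r ?invf_div.
  rewrite E; eexists; apply: jet_gen (jet_mul (jet_poly D) (jet_inv (jet_poly N) N0)).
  by apply: gen_sub gN => s [-> Ns]; rewrite E.
have D0 : D.[0] != 0 by move: zb; rewrite /p1of; case: eqP => // /eqP.
have gD := genI zE (gen_horner (hpoly_neq0 D0)); split.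
  by apply: gen_sub gD => s [-> Ds]; rewrite /p1of (negbTE Ds).
have -> : chart false (p1of N.[0] D.[0]) = N.[0] / D.[0] by rewrite /p1of (negbTE D0).
eexists; apply: jet_gen (jet_mul (jet_poly N) (jet_inv (jet_poly D) D0)).
by apply: gen_sub gD => s [-> Ds]; rewrite /p1of (negbTE Ds).
Qed.

Section CrossPath.
Variables (I : finType) (pos : k -> I -> P1 k) (A B : I -> {poly k}) (pos0 : I -> P1 k).
Hypothesis H0 : forall l, exists2 la, la != 0 & (A l).[0] = la * (hcrd (pos0 l)).1 /\ (B l).[0] = la * (hcrd (pos0 l)).2.
Hypothesis Hs : gen (fun s => exists (ka : k) (mu : I -> k), [/\ ka != 0, forall l, mu l != 0 &
  forall l m, bracket (pos s l) (pos s m) = ka * mu l * mu m * ((A l).[s] * (B m).[s] - (B l).[s] * (A m).[s])]).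

(** The determinant [ka] and the scalars [mu] allow for a coordinate change that depends on the
    parameter, so that one family of curves can be watched on any component of its limit. *)
Lemma cross_path a b c d : pos0 a != pos0 b -> pos0 b != pos0 c -> pos0 a != pos0 c ->
  p1jet (fun s => cross_ratio (pos s a) (pos s b) (pos s c) (pos s d))
    (cross_ratio (pos0 a) (pos0 b) (pos0 c) (pos0 d)).
Proof.
move=> ab bc ac; pose br l m := A l * B m - B l * A m.
have br0 l m : exists2 la, la != 0 & (br l m).[0] = la * bracket (pos0 l) (pos0 m).
  have [u u0 [Al Bl]] := H0 l; have [w w0 [Am Bm]] := H0 m; exists (u * w); first exact: mulf_neq0.
  by rewrite !hE Al Bl Am Bm bracketE; ring.
pose N := br d a * br b c; pose D := br d c * br b a.
have -> : cross_ratio (pos0 a) (pos0 b) (pos0 c) (pos0 d) = p1of N.[0] D.[0].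
  apply/esym/cross_ratioP => //; rewrite /crel !hornerM.
  have [ua ua0 [Aa Ba]] := H0 a; have [ub ub0 [Ab Bb]] := H0 b.
  have [uc uc0 [Ac Bc]] := H0 c; have [ud ud0 [Ad Bd]] := H0 d.
  have U : ua * ub * uc * ud != 0 by rewrite !mulf_neq0.
  have NE : (br d a).[0] * (br b c).[0] = (ua * ub * uc * ud) * (bracket (pos0 d) (pos0 a) * bracket (pos0 b) (pos0 c)).
    by rewrite !hE Aa Ba Ab Bb Ac Bc Ad Bd !bracketE; ring.
  have DE : (br d c).[0] * (br b a).[0] = (ua * ub * uc * ud) * (bracket (pos0 d) (pos0 c) * bracket (pos0 b) (pos0 a)).
    by rewrite !hE Aa Ba Ab Bb Ac Bc Ad Bd !bracketE; ring.
  rewrite NE DE /p1of; case: eqP => [/eqP|/eqP]; rewrite mulf_eq0 (negbTE U) /= => D0.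
    by rewrite (eqP D0) mulr0 mul0r.
  by rewrite mul1r -mulf_div divff // mul1r divfK.
apply: p1jet_poly.
  rewrite !hornerM !mulf_eq0 !negb_or.
  have [u1 u10 ->] := br0 d a; have [u2 u20 ->] := br0 b c; have [u3 u30 ->] := br0 d c; have [u4 u40 ->] := br0 b a.
  rewrite !mulf_eq0 !negb_or u10 u20 u30 u40 /= !bracket_eq0 bc (eq_sym (pos0 b) (pos0 a)) ab !andbT.
  have [->|//] := eqVneq (pos0 d) (pos0 a); by rewrite ac.
have nz l m : pos0 l != pos0 m -> gen (fun s => (br l m).[s] != 0).
  move=> lm; apply/gen_horner/hpoly_neq0; have [u u0 ->] := br0 l m.
  by rewrite mulf_neq0 // bracket_eq0.
apply: gen_sub (genI Hs (genI (nz _ _ ab) (genI (nz _ _ bc) (nz _ _ ac)))).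
move=> s [[ka [mu [ka0 mu0 E]]] [nab [nbc nac]]].
have E' l m : bracket (pos s l) (pos s m) = ka * mu l * mu m * (br l m).[s] by rewrite E !hE.
have ne l m : (br l m).[s] != 0 -> pos s l != pos s m.
  by move=> n0; rewrite -bracket_eq0 E' !mulf_neq0.
apply/esym/cross_ratioP; rewrite ?ne // /crel !E' /p1of !hornerM.
have U : ka ^+ 2 * (mu a * mu b * mu c * mu d) != 0 by rewrite !mulf_neq0 // expf_neq0.
case: eqP => [D0|/eqP D0] /=.
  rewrite mul0r mul1r; transitivity (ka ^+ 2 * (mu a * mu b * mu c * mu d) * ((br d c).[s] * (br b a).[s])); first by ring.
  by rewrite D0 mulr0.
rewrite mul1r; transitivity (ka ^+ 2 * (mu a * mu b * mu c * mu d) * ((br d a).[s] * (br b c).[s])); last by ring.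
transitivity ((br d a).[s] * (br b c).[s] / ((br d c).[s] * (br b a).[s]) * (ka ^+ 2 * (mu a * mu b * mu c * mu d) * ((br d c).[s] * (br b a).[s]))).
  by congr (_ * _); ring.
by rewrite mulrCA divfK.
Qed.
End CrossPath.
End Jets.

Section Paths.
Variables (k : numClosedFieldType) (n : nat).
Hypothesis n3 : (3 <= n)%N.
Let X := Mbar0 k n.

Lemma path_charts (b : quad n -> bool) (Q : {mpoly k[#|{: quad n}|]}) (y : k -> X) (x : X) : in_charts b (val x) ->
  (forall q, p1jet (fun s => val (y s) q) (val x q)) ->
  gen (fun s => in_charts b (val (y s))) /\ exists d, jet (fun s => Q.@[charts b (val (y s))]) Q.@[charts b (val x)] d.
Proof.
move=> xb jy; split; first by apply: gen_all => q; case: (jy q (b q) (xb q)).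
pose c (i : 'I_#|{: quad n}|) (s : k) := charts b (val (y s)) i.
have ex i : exists d, jet (c i) (charts b (val x) i) d by case: (jy _ _ (xb (enum_val i))).
exact: (jet_meval Q (c := c) (a' := fun i => sval (cid (ex i))) (fun i => svalP (cid (ex i)))).
Qed.

(** A polynomial in chart coordinates defines the neighbourhood; along the path it is a rational
    function of the parameter that is nonzero at 0. *)
Lemma path_near (y : k -> X) (x : X) (U : set X) : near_pt x U ->
  (forall q, p1jet (fun s => val (y s) q) (val x q)) -> gen (fun s => U (y s)).
Proof.
move=> /X_nearP [b [Q [xb Qx QU]]] jy; have [gb [d jQ]] := path_charts Q xb jy.
by apply: gen_sub (genI gb (jet_neq0 jQ Qx)) => s [yb Qy]; exact: QU.
Qed.

Lemma path_regular (y : k -> X) (x : X) (f : X -> k) : regular x f ->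
  (forall q, p1jet (fun s => val (y s) q) (val x q)) -> exists d, jet (fun s => f (y s)) (f x) d.
Proof.
move=> /X_regularP [b [P [Q [xb Qx nE]]]] jy.
have [gb [d jQ]] := path_charts Q xb jy; have [_ [e jP]] := path_charts P xb jy.
have [_ _ ->] := near_self nE; eexists; apply: jet_gen (jet_mul jP (jet_inv jQ Qx)).
by apply: gen_sub (path_near nE jy) => s [_ _ ->].
Qed.

Lemma subn_chain a b c : (a <= b)%N -> (b <= c)%N -> (c - b + (b - a) = c - a)%N.
Proof. lia. Qed.

(** * Smoothing a stable curve *)

Section Smoothing.
Variables (x : quad n -> P1 k) (rho : 'I_n).
Hypothesis xs : crsys x.
Notation cluster := (cluster x rho).

Definition pv (C : cluster) (l : 'I_n) : k := chart false (pc C l).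
(** Marks in a cluster [C] come together like s^(n - |C|): smaller clusters are shrunk by higher
    powers of the parameter, around the positions given by the larger ones. *)
Definition zpoly (l : 'I_n) : {poly k} := \sum_(C : cluster | l \in val C) pv C l *: 'X^(n - #|val C|).

Lemma pc_pv (C : cluster) l : l \in val C -> pc C l = Some (pv C l).
Proof. by rewrite in_cluster // /pv; case: (pc C l). Qed.

Lemma card_cluster (C : cluster) : (#|val C| <= n)%N.
Proof. by rewrite -[X in (_ <= X)%N]card_ord max_card. Qed.

(** [D] is the smallest cluster with both marks. Larger ones give both marks the same position and
    cancel; the others that contribute are smaller and carry a higher power. *)
Lemma zpoly_diff l m : okpair rho l m -> exists (D : cluster) (w : {poly k}),
  [/\ l \in val D, m \in val D, (forall C : cluster, l \in val C -> m \in val C -> val D \subset val C),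
   zpoly m - zpoly l = 'X^(n - #|val D|) * w & w.[0] = pv D m - pv D l /\ w.[0] != 0].
Proof.
move=> ok; pose D : cluster := mkcluster x ok.
have lD : l \in val D by rewrite /= inE ps0.
have mD : m \in val D by rewrite /= inE ps1.
have lm : l != m by case/and3P: (ok).
have top (C : cluster) : l \in val C -> m \in val C -> C = D \/ (val D \proper val C /\ pc C l = pc C m).
  move=> lC mC; have [E|ne] := eqVneq (pc C l) (pc C m).
    by right; have [_ + _] := sub_cluster xs lC mC lm E.
  by left; apply: val_inj; have [_ <-] := same_cluster xs lC mC ne.
have Dne : pc D l != pc D m.
  by apply/eqP => E; have [_ + _] := sub_cluster xs lD mD lm E; rewrite /= fintype.properxx.
have vne : pv D m - pv D l != 0.
  by rewrite subr_eq0; apply: contra_neq Dne => E; rewrite (pc_pv lD) (pc_pv mD) E.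
pose t (C : cluster) : {poly k} := (if m \in val C then pv C m else 0)%:P - (if l \in val C then pv C l else 0)%:P.
have tE : zpoly m - zpoly l = \sum_(C : cluster) t C * 'X^(n - #|val C|).
  rewrite /zpoly !(big_mkcond (fun C : cluster => _ \in val C)) -sumrB; apply: eq_bigr => C _ /=.
  rewrite /t mulrBl !mul_polyC.
  by case: (m \in _); case: (l \in _); rewrite ?scale0r.
have tC (C : cluster) : C != D -> exists w, t C * 'X^(n - #|val C|) = 'X^(n - #|val D|) * ('X * w).
  move=> CD; have [tz|tn] := eqVneq (t C) 0; first by exists 0; rewrite tz mul0r !mulr0.
  have one : (m \in val C) || (l \in val C).
    by move: tn; rewrite /t; case: (m \in _); case: (l \in _) => //; rewrite subrr eqxx.
  have CsD : val C \proper val D.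
    have vn : val C != val D by apply: contra_neq CD; exact: val_inj.
    rewrite finset.properEneq vn /=.
    have [lC|lC] := boolP (l \in val C); have [mC|mC] := boolP (m \in val C).
    - case: (top C lC mC) => [E|[_ E]]; first by rewrite E eqxx in CD.
      by move: tn; rewrite /t lC mC /pv E subrr eqxx.
    - have := laminar xs lC lD; case/orP=> // /fintype.subsetP /(_ m mD).
      by rewrite (negbTE mC).
    - have := laminar xs mC mD; case/orP=> // /fintype.subsetP /(_ l lD).
      by rewrite (negbTE lC).
    - by move: one; rewrite (negbTE lC) (negbTE mC).
  have lt := proper_card CsD; have le := card_cluster D.
  exists (t C * 'X ^+ (#|val D| - #|val C|).-1).
  rewrite -(subn_chain (ltnW lt) le) exprD -[in X in _ * (_ * X)](prednK (_ : 0 < #|val D| - #|val C|)%N) ?subn_gt0 //.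
  by rewrite exprS; ring.
pose W (C : cluster) : {poly k} := if pselect (C != D) is left H then sval (cid (tC C H)) else 0.
have WE (C : cluster) : C != D -> t C * 'X^(n - #|val C|) = 'X^(n - #|val D|) * ('X * W C).
  by move=> CD; rewrite /W; case: pselect => // H; case: cid.
have w0 : (t D + \sum_(C : cluster | C != D) 'X * W C).[0] = pv D m - pv D l.
  rewrite hornerD horner_sum big1 ?addr0 => [|C _]; last by rewrite hornerM hornerX mul0r.
  by rewrite /t lD mD !hornerE.
exists D, (t D + \sum_(C : cluster | C != D) 'X * W C); split=> //; last by rewrite w0.
- by move=> C lC mC; case: (top C lC mC) => [->|[/proper_sub]]; rewrite ?fintype.subxx.
rewrite tE (bigD1 D) //= mulrDr mulr_sumr [t D * _]mulrC; congr (_ + _).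
by apply: eq_bigr => C CD; exact: WE.
Qed.

Definition zpos (s : k) (l : 'I_n) : P1 k := if l == rho then None else Some (zpoly l).[s].

Lemma zpos_inj : gen (fun s => injective (zpos s)).
Proof.
have : gen (fun s => forall lm : 'I_n * 'I_n, lm.1 != lm.2 -> zpos s lm.1 != zpos s lm.2).
  apply: gen_all => -[l m]; have [->|lm] := eqVneq l m; first by apply: genT => s; rewrite eqxx.
  rewrite /zpos /=; have [E|lr] := eqVneq l rho.
    by rewrite -E eq_sym (negbTE lm); apply: genT.
  have [E|mr] := eqVneq m rho; first exact: genT.
  have ok : okpair rho l m by rewrite /okpair lm lr mr.
  have [D [w [_ _ _ E [_ w0]]]] := zpoly_diff ok.
  have nz : zpoly m - zpoly l != 0.
    by rewrite E mulf_neq0 ?expf_neq0 ?polyX_eq0 //; exact: hpoly_neq0.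
  apply: gen_sub (gen_horner nz) => s; rewrite !hornerE subr_eq0 => ne _.
  by apply: contra_neq ne => -[->].
apply: gen_sub => s H l m E; apply/eqP/negPn/negP => lm.
by have := H (l, m) lm; rewrite E eqxx.
Qed.

Lemma smoothing_jet (y : k -> quad n -> P1 k) : gen (fun s => y s = crp (zpos s)) ->
  forall q, p1jet (fun s => y s q) (x q).
Proof.
move=> yE q.
have := quad_uniq q; rewrite -[[:: _; _; _; _]]/([:: _; _; _] ++ [:: _]) cat_uniq => /andP [u _].
have [C [ab bc ac]] := sep_cluster xs rho u.
have xE := cluster_cross_ratio xs (mark q (inord 3)) u ab bc ac; rewrite xq_quad in xE.
pose l0 := rep1 C; have l0C : l0 \in val C := rep1_in C.
have pl0 : pc C l0 = Some 0 := pc_rep1 C.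
have l0r : l0 != rho := in_cluster_rho l0C.
(* Homogeneous coordinates on the component [C]: positions relative to [l0], magnified by s^(|C| -
   n). A mark inside [C] has a finite limit; for a mark outside, the smallest common cluster with
   [l0] is larger, and the limit is oo. *)
have AB l : exists A B : {poly k}, (exists2 la, la != 0 & A.[0] = la * (hcrd (pc C l)).1 /\ B.[0] = la * (hcrd (pc C l)).2) /\
   (l != rho -> B != 0 /\ (zpoly l - zpoly l0) * B = 'X^(n - #|val C|) * A) /\ (l = rho -> A = 1%:P /\ B = 0).
  have [->|lr] := eqVneq l rho.
    exists 1%:P, 0; split; last by [].
    by exists 1; rewrite ?oner_neq0 // pc_rho //= !hornerE.
  have [->|ll] := eqVneq l l0.
    exists 0, 1; split; first by exists 1; rewrite ?oner_neq0 // pl0 /= !hornerE.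
    by split=> // [_|/eqP]; [rewrite oner_neq0 subrr mul0r mulr0|rewrite (negbTE l0r)].
  have ok : okpair rho l0 l by rewrite /okpair eq_sym ll l0r lr.
  have [D [w [l0D lD Dmin E [w0 wn]]]] := zpoly_diff ok.
  have cD := card_cluster D; have cC := card_cluster C.
  have [lC|lC] := boolP (l \in val C).
    have sub := Dmin C l0C lC.
    have le : (#|val D| <= #|val C|)%N by exact: subset_leq_card.
    exists ('X^(#|val C| - #|val D|) * w), 1; split.
      exists 1; rewrite ?oner_neq0 // (pc_pv lC) /= hornerM hornerXn hornerC !mul1r; split=> //.
      have [DC|DC] := eqVneq D C.
        by rewrite DC subnn expr0 mul1r w0 -DC; rewrite -DC in pl0; rewrite /pv pl0 subr0.
      have vn : val D != val C by apply: contra_neq DC; exact: val_inj.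
      have pr : val D \proper val C by rewrite finset.properEneq sub vn.
      have lt := proper_card pr; rewrite expr0n subn_eq0 leqNgt lt mul0r.
      by have := pc_const xs pr l0D lD; rewrite pl0 (pc_pv lC) => -[].
    split=> [_|/eqP]; last by rewrite (negbTE lr).
    by rewrite oner_neq0 mulr1 E mulrA -exprD (subn_chain le cC).
  have CD : val C \subset val D.
    have := laminar xs l0C l0D; case/orP=> // /fintype.subsetP /(_ l lD); by rewrite (negbTE lC).
  have pr : val C \proper val D by apply/fintype.properP; split=> //; exists l.
  have lt := proper_card pr.
  exists w, 'X^(#|val D| - #|val C|); split.
    have pn : pc C l = None by apply/eqP; move: lC; rewrite in_cluster // negbK.
    by exists w.[0]; rewrite // pn /= mulr1 mulr0 hornerXn expr0n subn_eq0 leqNgt lt.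
  split=> [_|/eqP]; last by rewrite (negbTE lr).
  by rewrite expf_neq0 ?polyX_eq0 // E mulrAC -exprD (subn_chain (ltnW lt) cD).
pose A l := sval (cid (AB l)); pose B l := sval (cid (svalP (cid (AB l)))).
have ABP l : (exists2 la, la != 0 & (A l).[0] = la * (hcrd (pc C l)).1 /\ (B l).[0] = la * (hcrd (pc C l)).2) /\
   (l != rho -> B l != 0 /\ (zpoly l - zpoly l0) * B l = 'X^(n - #|val C|) * A l) /\ (l = rho -> A l = 1%:P /\ B l = 0).
  exact: (svalP (cid (svalP (cid (AB l))))).
have jet0 : p1jet (fun s => crp (zpos s) q) (x q).
  rewrite xE; apply: (cross_path (A := A) (B := B)) => // [l|]; first by case: (ABP l).
  have gB : gen (fun s => forall l, l != rho -> (B l).[s] != 0).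
    apply: gen_all => l; have [->|lr] := eqVneq l rho; first exact: genT.
    have [_ [/(_ lr) [B0 _] _]] := ABP l; apply: gen_sub (gen_horner B0) => s //.
  have X0 : ('X ^+ (n - #|val C|) : {poly k}) != 0 by rewrite expf_neq0 // polyX_eq0.
  have gX := gen_horner X0.
  apply: gen_sub (genI gB gX) => s [Bs]; rewrite hornerXn; set e := s ^+ _ => e0.
  (* The magnification by 1/e enters through [ka] and through the scalar of [rho]. *)
  exists e, (fun l => if l == rho then e^-1 else (B l).[s]^-1); split=> // [l|l m].
    by case: ifP => [_|/negbT lr]; rewrite invr_neq0 // Bs.
  have fin l' : l' != rho -> (zpoly l').[s] = (zpoly l0).[s] + e * (A l').[s] / (B l').[s].
    move=> lr; have [_ [/(_ lr) [_ E] _]] := ABP l'; have := congr1 (fun p : {poly k} => p.[s]) E.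
    rewrite !hornerE -/e => <-; rewrite mulfK ?Bs //; by rewrite addrC subrK.
  rewrite /zpos; case: eqP => [->|/eqP lr]; case: eqP => [->|/eqP mr] /=.
  - by have [_ [_ /(_ erefl) [-> ->]]] := ABP rho; rewrite hornerC horner0; ring.
  - have [_ [_ /(_ erefl) [-> ->]]] := ABP rho; rewrite hornerC horner0.
    by field; rewrite e0 Bs.
  - have [_ [_ /(_ erefl) [-> ->]]] := ABP rho; rewrite hornerC horner0.
    by field; rewrite e0 Bs.
  - by rewrite (fin l) // (fin m) //; field; rewrite !Bs.
move=> b xb; have [g1 [d j1]] := jet0 b xb; split.
  by apply: gen_sub (genI yE g1) => s [-> ?].
by exists d; apply: jet_gen j1; apply: gen_sub yE => s ->.
Qed.

End Smoothing.

Lemma smoothing (x : X) (rho : 'I_n) (U : set X) : near_pt x U -> exists (z : 'I_n -> k) (y : X),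
  [/\ injective (fun l => if l == rho then None else Some (z l)), U y &
   val y = crp (fun l => if l == rho then None else Some (z l))].
Proof.
move=> nU; have xs : crsys (val x) := X_crsys n3 x; pose zp := zpos (val x) rho.
pose y s : X := if pselect (injective (zp s)) is left H then s2val (cid2 (crp_ex n3 H)) else x.
have zi := zpos_inj rho xs : gen (fun s => injective (zp s)).
have yE : gen (fun s => val (y s) = crp (zp s)).
  by apply: gen_sub zi => s H; rewrite /y; case: pselect => // H'; case: cid2.
have [s [[Us Is] Es]] := gen_ex (genI (genI (path_near nU (smoothing_jet xs yE)) zi) yE).
by exists (fun l => (zpoly (val x) rho l).[s]), (y s).
Qed.

(* Points of M0 with marked point [rho] at infinity are joined by lines. *)
Lemma X_irreducible : irreducible [set: X].
Proof.
have [x0 _] := M0_ex k n3; split; first by exists x0.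
move=> A B Ao Bo AB; apply: contrapT => /not_orP [nA nB].
have [u Au] : exists u, ~ A u by apply: contrapT => H; apply: nA => u _; apply: contrapT => Au; apply: H; exists u.
have [w Bw] : exists w, ~ B w by apply: contrapT => H; apply: nB => w _; apply: contrapT => Bu; apply: H; exists w.
have rho : 'I_n := Ordinal (ltn_trans (ltn0Sn 1) n3).
have nu : near_pt u (~` A) by exists (~` A); split.
have nw : near_pt w (~` B) by exists (~` B); split.
have [z [p [zi Ap pE]]] := smoothing rho nu; have [z' [p' [zi' Bp pE']]] := smoothing rho nw.
pose pos (z z' : 'I_n -> k) s l : P1 k := if l == rho then None else Some ((1 - s) * z l + s * z' l).
have key (a c : 'I_n -> k) (e : X) (y : k -> X) : injective (fun l => if l == rho then None else Some (a l)) ->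
    val e = crp (fun l => if l == rho then None else Some (a l)) ->
    gen (fun s => injective (pos a c s) -> val (y s) = crp (pos a c s)) ->
    gen (fun s => injective (pos a c s)) /\ forall q, p1jet (fun s => val (y s) q) (val e q).
  move=> ai eE yE; pose zl l : {poly k} := (1 - 'X) * (a l)%:P + 'X * (c l)%:P.
  have zlE s l : (zl l).[s] = (1 - s) * a l + s * c l by rewrite !hornerE.
  have gi : gen (fun s => injective (pos a c s)).
    have : gen (fun s => forall lm : 'I_n * 'I_n, lm.1 != lm.2 -> pos a c s lm.1 != pos a c s lm.2).
      apply: gen_all => -[l m]; have [->|lm] := eqVneq l m; first by apply: genT => s; rewrite eqxx.
      rewrite /pos /=; have [E|lr] := eqVneq l rho.
        by rewrite -E eq_sym (negbTE lm); apply: genT.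
      have [E|mr] := eqVneq m rho; first exact: genT.
      have zlm : a l != a m.
        apply: contra_neq lm => E; apply: ai; by rewrite (negbTE lr) (negbTE mr) E.
      have nz : zl l - zl m != 0.
        apply: hpoly_neq0; rewrite hornerD hornerN !zlE; move: zlm; rewrite -subr_eq0.
        by rewrite subr0 !mul1r !mul0r !addr0.
      apply: gen_sub (gen_horner nz) => s; rewrite hornerD hornerN !zlE subr_eq0 => ne _.
      by apply: contra_neq ne => -[->].
    apply: gen_sub => s H l m E; apply/eqP/negPn/negP => lm.
    by have := H (l, m) lm; rewrite E eqxx.
  split=> // q; have yE' : gen (fun s => val (y s) = crp (pos a c s)).
    by apply: gen_sub (genI gi yE) => s [H]; apply.
  have := quad_uniq q; rewrite /= !inE !negb_or => /and3P [/and3P [m01 m02 _] /andP [m12 _] _].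
  have jet0 : p1jet (fun s => crp (pos a c s) q) (val e q).
    rewrite eE; apply: (cross_path (pos0 := fun l => if l == rho then None else Some (a l))
      (A := fun l => if l == rho then 1%:P else zl l) (B := fun l => if l == rho then 0 else 1%:P)).
    - move=> l; exists 1; rewrite ?oner_neq0 //; case: ifP => _ /=; rewrite ?hornerC ?horner0 ?mul1r //.
      by rewrite zlE subr0 mul0r addr0 !mul1r.
    - apply: genT => s; exists 1, (fun=> 1); rewrite oner_neq0; split=> // l m.
      rewrite /pos !mul1r; case: ifP => _; case: ifP => _ /=; rewrite ?hornerC ?horner0 ?zlE; ring.
    - by apply: contra_neq m01; exact: ai.
    - by apply: contra_neq m12; exact: ai.
    - by apply: contra_neq m02; exact: ai.
  move=> b xb; have [g1 [d j1]] := jet0 b xb; split.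
    by apply: gen_sub (genI yE' g1) => s [-> ?].
  by exists d; apply: jet_gen j1; apply: gen_sub yE' => s ->.
pose y s : X := if pselect (injective (pos z z' s)) is left H then s2val (cid2 (crp_ex n3 H)) else p.
have yE s : injective (pos z z' s) -> val (y s) = crp (pos z z' s).
  by move=> H; rewrite /y; case: pselect => // H'; case: cid2.
have [gi jy] := key z z' p y zi pE (genT yE).
have posE s : pos z' z s = pos z z' (1 - s).
  by apply/funext => l; rewrite /pos; case: ifP => // _; congr Some; ring.
have [_ jy'] : gen (fun s => injective (pos z' z s)) /\ forall q, p1jet (fun s => val (y (1 - s)) q) (val p' q).
  apply: (key z' z p' (fun s => y (1 - s)) zi' pE'); apply: genT => s H.
  by rewrite posE; apply: yE; rewrite -posE.
have nAp : near_pt p (~` A) by exists (~` A); split.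
have nBp : near_pt p' (~` B) by exists (~` B); split.
(* Generic points of the line avoid [A], because it passes through [p], and avoid [B], because it
   passes through [p']. *)
have gA := path_near nAp jy; have gB := gen_opp1 (path_near nBp jy').
have [s [As Bs]] := gen_ex (genI gA gB).
by case: (AB (y s) I) => [|H]; [exact: As|apply: Bs; rewrite subKr].
Qed.
End Paths.

(** * Degrees of divisors on curves *)

Section Pullback.
Variables (k : numClosedFieldType) (Y : space k) (N : nat) (i : Y -> Pn k N).
Hypothesis ci : closed_immersion i.
Hypothesis nsY : nonsingular_curve Y.
Let rY : ringed Y := proj_ringed ci.
Let iY := curve_irr nsY.
Let F := kY ci nsY.
Let cl := clY ci nsY.
Let iota := iotaY ci nsY.
Let O := Oy (ci := ci) (nsY := nsY).
Let ev := evy (ci := ci) (nsY := nsY).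
Let v := vY (ci := ci) (nsY := nsY).
Let cF : curve_field iota v := curve_fieldY ci nsY.

Lemma cl_rM f g : rational f -> rational g -> cl (fun z => f z * g z) = cl f * cl g.
Proof. by move=> rf rg; rewrite /cl /clY clsM. Qed.
Lemma cl_eq f g : rational f -> rational g -> generic [set z | f z = g z] -> cl f = cl g.
Proof. by move=> rf rg E; apply/(cls_eq rY iY rf rg). Qed.
Lemma cl_neq0 f : rational f -> generic [set z : Y | f z != 0] -> cl f != 0.
Proof.
move=> rf f0; apply/negP => /(cls_eq0 rY iY rf) E.
have [z /near_self [/= /eqP fz E0]] := generic_ex (genericI rY iY f0 E).
exact: fz.
Qed.

Lemma cl_unit y f : regular y f -> f y != 0 -> cl f != 0 /\ v y (cl f) = 0.
Proof.
move=> rf fy; have u : is_unit (O y) (ev y) (cl f).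
  by split; [exact: reg_at_cls|rewrite /ev /evy ffval_cls].
have f0 : cl f != 0 by apply: cl_neq0 (near_generic (reg_neq0 rY rf fy)); exact: (regular_rational rY rf).
by split=> //; apply/(vY_unitP _ f0).
Qed.
Lemma cl_zero y f : regular y f -> f y = 0 -> cl f != 0 -> 1 <= v y (cl f).
Proof.
move=> rf fy f0; rewrite -(vgeE v y 1 f0); apply/vY_ge1; split; first exact: reg_at_cls.
by rewrite /evy ffval_cls.
Qed.
Lemma cl_ge0 y f : regular y f -> cl f != 0 -> 0 <= v y (cl f).
Proof. by move=> rf f0; rewrite -(vgeE v y 0 f0); apply/vY_ge0; exact: reg_at_cls. Qed.

(** The chosen parameter has order 1 and is a multiple of [t] modulo terms of order 2, so [t] cannot
    have order 2 or more. *)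
Lemma param_order y (t : 'I_1 -> Y -> k) : local_params y t -> cl (t ord0) != 0 /\ v y (cl (t ord0)) = 1.
Proof.
move=> [tr tm]; have [rt t0] := tr ord0.
have inmt : inm (O y) (ev y) (cl (t ord0)).
  by split; [exact: reg_at_cls|rewrite /ev /evy ffval_cls].
have [c [[r [a [b [ab nE]]]] _]] := tm _ (tpar_reg nsY y) (tpar0 nsY y).
have E : ty ci nsY y = iota (c 0 ord0) * cl (t ord0) + \sum_j cl (a j) * cl (b j).
  have rc : regular y (fun=> c 0 ord0) := reg_const rY y _.
  have rs : regular y (fun z : Y => \sum_j a j z * b j z).
    by apply: (@reg_sum _ _ _ _ _ _ _ rY) => j _; have [ra _ rb _] := ab j; exact: (reg_mul rY).
  have rct := reg_mul rY rc rt.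
  rewrite -[iota _]/(cl (fun=> c 0 ord0)) -[_ * cl (t ord0)](clYM ci nsY rc rt).
  rewrite (eq_bigr (fun j => cl (fun z => a j z * b j z))) => [|j _]; last first.
    by have [ra _ rb _] := ab j; rewrite /cl (clYM ci nsY ra rb).
  rewrite -(@clY_sum _ _ _ _ ci nsY _ _ _ _ y) => [|j _]; last by have [ra _ rb _] := ab j; exact: (reg_mul rY).
  rewrite -(clYD ci nsY rct rs); apply: (clY_near ci nsY (tpar_reg nsY y)); first exact: (reg_add rY).
  by apply: near_sub nE => z /= <-; rewrite big_ord1 addrC subrK.
have key (l : int) : vge v y 2 (\sum_j cl (a j) * cl (b j)).
  apply: (vge_sum cF) => j _; have [ra a0 rb b0] := ab j.
  by rewrite -[2]/(1 + 1 : int); apply: (vgeM cF); apply/vY_ge1; split; try exact: reg_at_cls; rewrite /evy ffval_cls.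
have n2 : ~~ vge v y 2 (cl (t ord0)).
  apply/negP => v2; have : vge v y 2 (ty ci nsY y).
    by rewrite E; apply: (v_add cF); [exact: vge_constM|exact: (key 0)].
  by rewrite vgeE ?ty_neq0 // [v y _](vY_t ci nsY y).
have tn0 : cl (t ord0) != 0 by apply: contraNneq n2 => ->; exact: vge0.
split=> //; have := proj2 (vY_ge1 y _) inmt; move: n2; rewrite !vgeE // -/v.
by move: (v y _) => m *; lia.
Qed.

Lemma generic_neq (y : Y) : generic [set z : Y | z <> y].
Proof.
exists (~` [set y]); split; first exact: (proj_point_closed ci).
  apply: contrapT => E; case: nsY => -[_ _ ns _] _; apply: ns; exists y; apply/seteqP.
  split=> z // _; apply: contrapT => zy; apply: E; by exists z.
by move=> z.
Qed.

Lemma is_order_v y f m : rational f -> is_order y f m -> cl f != 0 /\ v y (cl f) = m.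
Proof.
move=> rf [t [u [lt ru u0 nE]]]; have [t0 vt] := param_order lt.
have [un0 vu] := cl_unit ru u0; have rt : regular y (t ord0) by case: lt => /(_ ord0) [].
have rrt := regular_rational rY rt.
have rX (n : nat) : rational (fun z => t ord0 z ^+ n) /\ cl (fun z => t ord0 z ^+ n) = cl (t ord0) ^+ n.
  elim: n => [|n [r1 E1]].
    by split; [exact: (rational_const rY iY 1)|].
  split; last by rewrite exprS -E1 -(cl_rM rrt r1); apply: cls_ext => z; rewrite exprS.
  by have := rational_mul rY iY rrt r1; congr rational; apply/funext => z; rewrite exprS.
have [rtm tmE] : rational (fun z => t ord0 z ^ m) /\ cl (fun z => t ord0 z ^ m) = cl (t ord0) ^ m.
  case: m {nE} => n; first exact: rX.
  have [r1 E1] := rX n.+1; split; first exact: (rational_inv rY iY r1).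
  by rewrite NegzE -exprnN -E1 -[RHS](clsV rY iY r1).
have E : cl f = cl (t ord0) ^ m * cl u.
  rewrite -tmE -(cl_rM rtm (regular_rational rY ru)); apply: cl_eq => //.
    exact: (rational_mul rY iY rtm (regular_rational rY ru)).
  by apply: generic_sub (genericI rY iY (near_generic nE) (generic_neq y)) => z /= [H /H].
rewrite E; split; first by rewrite mulf_neq0 // expfz_neq0.
rewrite (v_mul cF) ?expfz_neq0 // vu addr0.
case: m {nE rtm tmE E} => n; first by rewrite -exprnP (vX cF) // vt mulr1.
by rewrite NegzE -exprnN (vV cF) ?expf_neq0 // (vX cF) // vt mulr1.
Qed.

Variables (X : space k) (rX : ringed X) (iX : irreducible [set: X]) (f : Y -> X).
Hypothesis freg : forall y (h : X -> k), regular (f y) h -> regular y (h \o f).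
Hypothesis fnear : forall y (U : set X), near_pt (f y) U -> near_pt y (f @^-1` U).

Definition meets (h : X -> k) : Prop := generic [set z : Y | regular (f z) h].

Lemma meets_near y h : near_pt (f y) [set x | regular x h] -> meets h.
Proof. by move=> /fnear /near_generic. Qed.
Lemma meets_regular y h : regular (f y) h -> meets h.
Proof. by move=> /(reg_near rX); exact: meets_near. Qed.
Lemma meets_rational h : meets h -> rational (h \o f).
Proof. by apply: generic_sub => z /=; exact: freg. Qed.
Lemma meetsM h g : meets h -> meets g -> meets (fun x => h x * g x).
Proof. by move=> mh mg; apply: generic_sub (genericI rY iY mh mg) => z [/= ? ?]; exact: (reg_mul rX). Qed.
(** The curve need not meet the open set where [h] and [g] agree. But both are regular at a general
    point of the curve, and there generic equality implies equality. *)
Lemma meets_eq h g : meets h -> meets g -> generic [set x | h x = g x] -> cl (h \o f) = cl (g \o f).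
Proof.
move=> mh mg E; apply: cl_eq; try exact: meets_rational.
apply: generic_sub (genericI rY iY mh mg) => z /= [rh rg].
by have := near_self (regular_eq rX iX rh rg E).
Qed.

(** The degree is computed with the moved divisor [B]. On the curve, div B = div A' + div h - div
    alpha, where [h] has degree 0 and [alpha] is effective. *)
Lemma degree_le (A A' alpha : X -> X -> k) (y0 : Y) (d : int) (ps : seq {classic Y}) :
  (forall B, lin_equiv A B -> exists H : X -> k, forall x, exists u, [/\ regular x u, u x != 0 &
     generic [set z | alpha x z * B x z = u z * H z * A' x z]]) ->
  (forall y, regular (f y) (alpha (f y))) -> alpha (f y0) (f y0) != 0 ->
  (forall y, meets (A' (f y)) /\ cl (A' (f y) \o f) != 0) ->
  uniq ps -> (forall y : Y, v y (cl (A' (f y) \o f)) != 0 -> (y : {classic Y}) \in ps) ->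
  is_degree f A d -> d <= \sum_(y <- ps) v y (cl (A' (f y) \o f)).
Proof.
move=> HB ar a0 mA ups psP [B [cB lB By [r [p [m [pinj po o0 ->]]]]]].
have [H HP] := HB B lB.
have mB y : meets (B (f y)) /\ cl (B (f y) \o f) != 0.
  have [y' nB] := By y; have mB : meets (B (f y)).
    by apply: (meets_near (y := y')); apply: near_sub nB => z [].
  split=> //; apply: cl_neq0; first exact: meets_rational.
  by apply: generic_sub (near_generic (fnear nB)) => z [].
have uex x : exists u, [/\ regular x u, u x != 0 & generic [set z | alpha x z * B x z = u z * H z * A' x z]] := HP x.
pose u x := sval (cid (uex x)).
have uP x : [/\ regular x (u x), u x x != 0 & generic [set z | alpha x z * B x z = u x z * H z * A' x z]].
  by rewrite /u; case: cid.
have ma y : meets (alpha (f y)) := meets_regular (ar y).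
have mu y : meets (u (f y)) by have [ru _ _] := uP (f y); exact: meets_regular ru.
have u0 y : cl (u (f y) \o f) != 0 /\ v y (cl (u (f y) \o f)) = 0.
  by have [ru un _] := uP (f y); apply: cl_unit => //; exact: freg.
have a00 : cl (alpha (f y0) \o f) != 0 by case: (cl_unit (freg (ar y0)) a0).
have key y : cl (alpha (f y) \o f) * cl (B (f y) \o f) * (cl (u (f y0) \o f) * cl (A' (f y0) \o f)) =
    cl (u (f y) \o f) * cl (A' (f y) \o f) * (cl (alpha (f y0) \o f) * cl (B (f y0) \o f)).
  have R h g : meets h -> meets g -> cl (h \o f) * cl (g \o f) = cl ((fun x => h x * g x) \o f).
    by move=> mh mg; rewrite -cl_rM //; exact: meets_rational.
  have [mA1 _] := mA y; have [mA0 _] := mA y0; have [mB1 _] := mB y; have [mB0 _] := mB y0.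
  have mL := meetsM (ma y) mB1; have mL0 := meetsM (ma y0) mB0.
  have mR := meetsM (mu y) mA1; have mR0 := meetsM (mu y0) mA0.
  rewrite (R _ _ (ma y) mB1) (R _ _ (ma y0) mB0) (R _ _ (mu y) mA1) (R _ _ (mu y0) mA0).
  rewrite (R _ _ mL mR0) (R _ _ mR mL0); apply: meets_eq; try exact: meetsM.
  have [_ _ E1] := uP (f y); have [_ _ E0] := uP (f y0).
  apply: generic_sub (genericI rX iX E1 E0) => z /= [Ez Ez0].
  by rewrite Ez Ez0; ring.
(* [H] itself may be undefined along the curve. Its pullback is expressed through the equations at
   [y0]; by [key] those at every other [y] lead to the same function. *)
pose h := cl (alpha (f y0) \o f) * cl (B (f y0) \o f) / (cl (u (f y0) \o f) * cl (A' (f y0) \o f)).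
have den0 : cl (u (f y0) \o f) * cl (A' (f y0) \o f) != 0.
  by rewrite mulf_neq0 //; [case: (u0 y0)|case: (mA y0)].
have h0 : h != 0 by rewrite !mulf_neq0 ?invr_eq0 //; case: (mB y0).
have hE : h * (cl (u (f y0) \o f) * cl (A' (f y0) \o f)) = cl (alpha (f y0) \o f) * cl (B (f y0) \o f) by rewrite divfK.
clearbody h.
have vB y : v y (cl (B (f y) \o f)) <= v y (cl (A' (f y) \o f)) + v y h.
  have E : cl (alpha (f y) \o f) * cl (B (f y) \o f) = cl (u (f y) \o f) * cl (A' (f y) \o f) * h.
    by apply: (mulIf den0); rewrite key -hE; ring.
  have [_ An] := mA y; have [_ Bn] := mB y; have [un vu] := u0 y.
  have an : cl (alpha (f y) \o f) != 0.
    have : cl (u (f y) \o f) * cl (A' (f y) \o f) * h != 0 by rewrite !mulf_neq0.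
    by rewrite -E mulf_eq0 negb_or => /andP [].
  have <- : v y (cl (alpha (f y) \o f)) + v y (cl (B (f y) \o f)) = v y (cl (A' (f y) \o f)) + v y h.
    have uA := mulf_neq0 un An.
    by rewrite -(v_mul cF y an Bn) E (v_mul cF y uA h0) (v_mul cF y un An) [v y (cl (u (f y) \o f))]vu add0r.
  by rewrite ler_wpDl //; apply: cl_ge0 => //; apply: freg; exact: ar.
have vBp j : v (p j) (cl (B (f (p j)) \o f)) = m j.
  by case: (is_order_v (meets_rational (mB (p j)).1) (po j)).
pose p' : 'I_r -> {classic Y} := p.
have vB0 (y : {classic Y}) : y \notin codom p' -> v y (cl (B (f y) \o f)) = 0.
  move=> yp; have [|_ ->] // := is_order_v (meets_rational (mB y).1) (o0 y _).
  by move=> [j pj]; move/negP: yp; apply; rewrite -pj; exact: (codom_f p').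
have [hs hsP] := vY_fin h0.
pose qs : seq {classic Y} := undup (ps ++ codom p' ++ hs).
have uqs : uniq qs := undup_uniq _.
have E1 : \sum_(y <- qs) v y (cl (B (f y) \o f)) = \sum_j m j.
  rewrite (sum_supp (p := fun y : {classic Y} => y \in codom p')) => [|y]; last by apply: contraNT => /vB0 ->.
  under [RHS]eq_bigr => j _ do rewrite -vBp.
  rewrite -[RHS](big_image _ _ _ _ (fun y => v y (cl (B (f y) \o f)))).
  apply: perm_big; apply: uniq_perm; first exact: filter_uniq.
    by rewrite map_inj_uniq ?enum_uniq.
  move=> y; rewrite mem_filter mem_undup !mem_cat.
  by case: (y \in codom p'); rewrite ?orbT.
have E2 : \sum_(y <- qs) v y h = 0.
  by apply: (principal_degree cF h0 uqs) => y /hsP; rewrite mem_undup !mem_cat => ->; rewrite !orbT.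
have E3 : \sum_(y <- qs) v y (cl (A' (f y) \o f)) = \sum_(y <- ps) v y (cl (A' (f y) \o f)).
  rewrite (sum_supp (p := fun y : {classic Y} => y \in ps)) => [|y]; last exact: psP.
  apply: perm_big; apply: uniq_perm; [exact: filter_uniq|exact: ups|] => y.
  by rewrite mem_filter mem_undup !mem_cat; case: (y \in ps).
rewrite -E1 -E3.
have : \sum_(y <- qs) v y (cl (B (f y) \o f)) <= \sum_(y <- qs) (v y (cl (A' (f y) \o f)) + v y h).
  by apply: ler_sum => y _; exact: vB.
by rewrite big_split /= E2 addr0.
Qed.

End Pullback.

Lemma card_seq (T : choiceType) (A : set T) (m : nat) : (A #= `I_m)%card ->
  exists s : seq T, [/\ uniq s, size s = m & forall y, y \in s <-> A y].
Proof.
move=> /card_bijP [h [g hg gh]]; pose e (j : 'I_m) : T := val (g (exist _ (j : nat) (mem_set (ltn_ord j : `I_m j)))).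
exists [seq e j | j <- enum 'I_m]; split.
- rewrite map_inj_uniq ?enum_uniq // => a b /val_inj /(can_inj gh) /(congr1 val) /= ab; exact: val_inj.
- by rewrite size_map size_enum_ord.
- move=> y; split=> [/mapP [j _ ->]|Ay]; first exact: set_mem (valP (g _)).
  pose w : A := exist _ y (mem_set Ay); have hm : (val (h w) < m)%N by exact: set_mem (valP (h w)).
  apply/mapP; exists (Ordinal hm); first by rewrite mem_enum.
  have -> : y = val (g (h w)) by rewrite hg.
  by congr (val (g _)); exact: val_inj.
Qed.

(** * Cross ratios on a curve in the moduli space *)

Section Curve.
Variables (k : numClosedFieldType) (n : nat).
Hypothesis n3 : (3 <= n)%N.
Let X := Mbar0 k n.
Variables (C : set X).
Hypothesis hC : integral_curve C.
Hypothesis CB : ~ (C `<=` boundary k n).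
Variables (Y : space k) (f : Y -> subspace C).
Hypothesis nf : normalization f.
Variables (N : nat) (i : Y -> Pn k N).
Hypothesis ci : closed_immersion i.
Let nsY : nonsingular_curve Y. Proof. by case: nf. Qed.
Let rX : ringed X := X_ringed k n.
Let rY : ringed Y := proj_ringed ci.
Let iX : irreducible [set: X] := X_irreducible k n3.
Let iY := curve_irr nsY.
Let cl := clY ci nsY.
Let iota := iotaY ci nsY.
Let v := vY (ci := ci) (nsY := nsY).
Let cF : curve_field iota v := curve_fieldY ci nsY.

Definition toX (y : Y) : X := val (f y).

Let freg y (h : X -> k) : regular (toX y) h -> regular y (h \o toX).
Proof.
move=> rh; case: nf => _ _ mf _ _; have [_ H] := mf y I.
apply: (H (h \o (fun c : subspace C => val c))); exists h; split=> //.
by exists setT; split=> //; exact: (open_T rX).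
Qed.
Let fnear y (U : set X) : near_pt (toX y) U -> near_pt y (toX @^-1` U).
Proof.
move=> [V [oV Vy VU]]; case: nf => _ _ mf _ _; have [H _] := mf y I.
have : near_pt y (f @^-1` ((fun c : subspace C => val c : X) @^-1` V)).
  by apply: H => //; exists V.
by apply: near_sub => z /= /VU.
Qed.

Let ex_M0 : exists y, M0 (toX y).
Proof.
apply: contrapT => H; apply: CB => c Cc Mc; apply: H.
case: nf => _ _ _ sf _; have [y fy] := sf (exist _ c (mem_set Cc)).
by exists y; rewrite /toX fy.
Qed.

Definition cr (q : quad n) (b : bool) (z : Y) : k := chart b (val (toX z) q).
Definition xi (q : quad n) : kY ci nsY := cl (cr q false).

Let cr_regular y q b : in_chart b (val (toX y) q) -> regular y (cr q b).
Proof. by move=> yb; exact: freg (chart_regular yb). Qed.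
Let M0_gen : generic [set z | M0 (toX z)].
Proof. by have [y My] := ex_M0; exact: near_generic (fnear (M0_open n3 My)). Qed.
Let M0_val y : M0 (toX y) -> forall q, [/\ val (toX y) q != Some 0, val (toX y) q != Some 1 & val (toX y) q != None].
Proof. by move=> /(M0P _ n3). Qed.
Let cr_rational q b : rational (cr q b).
Proof.
apply: generic_sub M0_gen => z /M0_val /(_ q) [z0 _ zo].
by apply: cr_regular; case: b.
Qed.
Let xi_inv q : cl (cr q true) = (xi q)^-1.
Proof.
rewrite /xi -[RHS](clsV rY iY) //; apply: cls_ext => z; rewrite /cr.
by case: (val (toX z) q) => //=; rewrite invr0.
Qed.
Let xi_neq0 q : xi q != 0.
Proof.
apply: cl_neq0 => //; apply: generic_sub M0_gen => z /M0_val /(_ q); rewrite /cr /=.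
by case: (val (toX z) q) => [a|] [] //= a0 _ _; apply: contra_neq a0 => ->.
Qed.

Lemma xi_pole y q : (v y (xi q) < 0) = (val (toX y) q == None).
Proof.
case E : (val (toX y) q) => [a|] /=.
  apply/negbTE; rewrite -leNgt; apply: cl_ge0; last exact: xi_neq0.
  by apply: cr_regular; rewrite E.
rewrite eqxx; have xn := xi_neq0 q.
have : 1 <= v y (cl (cr q true)).
  apply: cl_zero; first by apply: cr_regular; rewrite E.
    by rewrite /cr E.
  by rewrite [clY _ _ _]xi_inv invr_eq0.
by rewrite [v y _](congr1 _ (xi_inv q)) (vV cF) //; move: (v y (xi q)) => m; lia.
Qed.

(** Over [M0] no cross ratio takes the values 0, 1, oo, so it and its difference with 1 are units
    there. *)
Lemma xi_boundary y q : [|| 0 < v y (xi q), 0 < v y (xi q - 1) | v y (xi q) < 0] -> ~ M0 (toX y).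
Proof.
move=> + /M0_val /(_ q) []; case E : (val (toX y) q) => [a|] // => + a0 a1 _.
have ry : regular y (cr q false) by apply: cr_regular; rewrite E.
have r1 : regular y (fun=> 1 : k) := reg_const rY y 1.
have [_ ->] : cl (cr q false) != 0 /\ v y (xi q) = 0.
  by apply: cl_unit => //; rewrite /cr E /=; apply: contra_neq a0 => ->.
have -> : xi q - 1 = cl (fun z => cr q false z + - 1).
  rewrite /cl (clYD ci nsY ry (reg_opp rY r1)); congr (_ + _).
  by rewrite -[1]/(iota 1) -[RHS]/(iota (-1)) rmorphN.
have [|_ E1] := @cl_unit _ _ _ _ ci nsY y (fun z => cr q false z + - 1) (reg_add rY ry (reg_opp rY r1)).
  by rewrite /cr E /= subr_eq0; apply: contra_neq a1 => ->.
by rewrite [v y (cl _)]E1 ltxx.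
Qed.

Lemma xi_const q c : xi q = iota c -> forall y, val (toX y) q = Some c.
Proof.
move=> E y; have c0 : c != 0 by have := xi_neq0 q; rewrite E fmorph_eq0.
have : ~~ (v y (xi q) < 0) by rewrite E (v_const cF) // ltxx.
rewrite xi_pole; case E' : (val (toX y) q) => [a|] // _.
have ry : regular y (cr q false) by apply: cr_regular; rewrite E'.
have := @ffval_cls _ _ rY iY y _ ry; rewrite {2}/cr E' /= => <-.
by rewrite -[cls _ _ _]/(xi q) E ffval_const.
Qed.

(** Points are determined by their cross ratios: if all were constant, the curve would be a
    point. *)
Lemma xi_nonconst : exists q, forall c, xi q != iota c.
Proof.
apply: contrapT => H; have H' q : exists c, xi q = iota c.
  apply: contrapT => nc; apply: H; exists q => c; apply/eqP => E; by apply: nc; exists c.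
have [y0 _] := ex_M0; case: hC => _ _ + _; apply; exists (toX y0).
have FE y : toX y = toX y0.
  apply: val_inj; apply/funext => q; have [c E] := H' q.
  by rewrite (xi_const E y) (xi_const E y0).
apply/seteqP; split=> [c Cc|_ ->]; last exact: set_mem (valP (f y0)).
case: nf => _ _ _ sf _; have [y fy] := sf (exist _ c (mem_set Cc)).
by rewrite /= -(FE y) /toX fy.
Qed.

Variables (g s : nat).
Hypothesis gY : is_genus Y g.
Hypothesis cs : ([set y : Y | boundary k n (toX y)] #= `I_s)%card.

(** A constant cross ratio has no poles; the right side is then nonnegative thanks to a nonconstant
    one. *)
Lemma xi_degree q (ps : seq {classic Y}) : uniq ps -> (forall y, v y (xi q) < 0 -> y \in ps) ->
  \sum_(y <- ps) npole v y (xi q) <= 2 * g%:Z - 2 + s%:Z.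
Proof.
have [S [uS Ss SP]] := card_seq (T := {classic Y}) cs.
have bd q' qs : (forall c, xi q' != iota c) -> uniq qs -> (forall y, v y (xi q') < 0 -> y \in qs) ->
    \sum_(y <- qs) npole v y (xi q') <= 2 * g%:Z - 2 + s%:Z.
  move=> nc uqs qsP.
  have := pole_bound nc gY uqs qsP uS; rewrite Ss.
  suff H : forall P : {classic Y}, [|| 0 < v P (xi q'), 0 < v P (xi q' - 1) | v P (xi q') < 0] -> P \in S.
    by move=> /(_ H); rewrite -/v; move: (\sum_(_ <- _) _) => m; lia.
  by move=> P /xi_boundary nM; apply/SP.
move=> ups psP; have [nc|] := pselect (forall c, xi q != iota c); first exact: bd.
move=> /existsNP [c /negP/negPn/eqP E].
rewrite big1 => [|y _]; last first.
  by rewrite /npole xi_pole (xi_const E).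
have [q' nc] := xi_nonconst; have [rs rsP] := vY_fin (xi_neq0 q').
have H : forall y, v y (xi q') < 0 -> y \in undup rs.
  by move=> y vy; rewrite mem_undup; apply: rsP; rewrite -/v; apply/eqP => E0; rewrite E0 ltxx in vy.
apply: le_trans (bd q' (undup rs) nc (undup_uniq _) H).
by apply: sumr_ge0 => y _; rewrite /npole; case: ifP => // /ltW; rewrite oppr_ge0.
Qed.

Lemma slack_ge0 : 0 <= 2 * g%:Z - 2 + s%:Z.
Proof.
have [q _] := xi_nonconst; have [rs rsP] := vY_fin (xi_neq0 q).
have H : forall y, v y (xi q) < 0 -> y \in undup rs.
  by move=> y vy; rewrite mem_undup; apply: rsP; rewrite -/v; apply/eqP => E0; rewrite E0 ltxx in vy.
apply: le_trans (xi_degree (undup_uniq rs) H).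
by apply: sumr_ge0 => y _; rewrite /npole; case: ifP => // /ltW; rewrite oppr_ge0.
Qed.

(** This is [degree_le] for the pole divisors of the cross ratios in [Q], each with multiplicity [e]
    and bounded by [xi_degree]. *)
Lemma curve_bound (A alpha : X -> X -> k) (Q : {set quad n}) (e : nat) d :
  (forall B, lin_equiv A B -> exists H : X -> k, forall x, exists u, [/\ regular x u, u x != 0 &
     generic [set z | alpha x z * B x z = u z * H z * poleD Q x z ^+ e]]) ->
  (forall x, regular x (alpha x)) -> (forall x, M0 x -> alpha x x != 0) ->
  is_degree toX A d -> d <= (#|Q| * e)%:Z * (2 * g%:Z - 2 + s%:Z).
Proof.
move=> HB ar a0 dA; have [y0 My0] := ex_M0.
have rP x : regular x (poleD Q x) := poleD_regular Q x.
have vx q y : v y (xi q) < 0 -> v y (xi q) != 0 by move=> + ; case: ltgtP.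
have prodE (I : Type) (r : seq I) (P : pred I) (G : I -> Y -> k) : (forall j, P j -> rational (G j)) ->
    rational (fun z => \prod_(j <- r | P j) G j z) /\ cl (fun z => \prod_(j <- r | P j) G j z) = \prod_(j <- r | P j) cl (G j).
  move=> rG; elim: r => [|j r [r1 E1]].
    rewrite big_nil; split; last by apply: (cls_ext rY iY) => z; rewrite big_nil.
    by have := rational_const rY iY 1; congr rational; apply/funext => z; rewrite big_nil.
  rewrite big_cons; case: ifP => Pj; last first.
    split; last by rewrite -E1; apply: cls_ext => z; rewrite big_cons Pj.
    by move: r1; congr rational; apply/funext => z; rewrite big_cons Pj.
  split; last by rewrite -E1 -(cl_rM _ _ (rG j Pj) r1); apply: cls_ext => z; rewrite big_cons Pj.
  by have := rational_mul rY iY (rG j Pj) r1; congr rational; apply/funext => z; rewrite big_cons Pj.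
have clA y : cl ((fun z => poleD Q (toX y) z ^+ e) \o toX) =
    (\prod_(q in Q | val (toX y) q == None) (xi q)^-1) ^+ e.
  have [r1 E1] := prodE _ (index_enum (quad n)) (fun q => (q \in Q) && (val (toX y) q == None)) (fun q => cr q true) (fun q _ => cr_rational q true).
  have [_ E2] := prodE _ (index_iota 0 e) predT (fun=> fun z => \prod_(q in Q | val (toX y) q == None) cr q true z) (fun _ _ => r1).
  transitivity (cl (fun z => \prod_(0 <= j < e) \prod_(q in Q | val (toX y) q == None) cr q true z)).
    by apply: cls_ext => z; rewrite prodr_const_nat subn0.
  rewrite E2 prodr_const_nat subn0 E1; congr (_ ^+ _); apply: eq_bigr => q _; exact: xi_inv.
have clA0 y : cl ((fun z => poleD Q (toX y) z ^+ e) \o toX) != 0.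
  by rewrite clA expf_neq0 //; apply/prodf_neq0 => q _; rewrite invr_eq0.
have vprod y (P : pred (quad n)) : v y (\prod_(q | P q) (xi q)^-1) = - \sum_(q | P q) v y (xi q).
  suff [] : v y (\prod_(q | P q) (xi q)^-1) = - \sum_(q | P q) v y (xi q) /\ \prod_(q | P q) (xi q)^-1 != 0 by [].
  apply: (big_ind2 (fun a b => v y a = - b /\ a != 0)).
  - by rewrite (v1 cF) oppr0 oner_neq0.
  - by move=> a b a' b' [E n0] [E' n0']; rewrite (v_mul cF) // E E' opprD mulf_neq0.
  - by move=> q _; rewrite (vV cF) // invr_eq0.
have vA y : v y (cl ((fun z => poleD Q (toX y) z ^+ e) \o toX)) = e%:Z * \sum_(q in Q) npole v y (xi q).
  rewrite clA (vX cF) ?vprod; last by apply/prodf_neq0 => q _; rewrite invr_eq0.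
  congr (_ * _); rewrite -sumrN big_mkcondr; apply: eq_bigr => q _.
  by rewrite /npole xi_pole.
pose pz q := sval (cid (vY_fin (xi_neq0 q))).
have pzP q y : v y (xi q) != 0 -> y \in pz q by rewrite /pz; case: cid => /= r; apply.
pose ps : seq {classic Y} := undup (flatten [seq pz q | q <- enum {: quad n}]).
have psP q y : v y (xi q) < 0 -> y \in ps.
  move=> /vx /pzP yq; rewrite mem_undup; apply/flattenP; exists (pz q) => //.
  by apply: map_f; rewrite mem_enum.
have := @degree_le k Y N i ci nsY X rX iX toX freg fnear A (fun x z => poleD Q x z ^+ e) alpha y0 d ps HB.
move=> /(_ (fun y => ar _) (a0 _ My0)) H.
have rPe (x : X) : regular x (fun z => poleD Q x z ^+ e).
  have : regular x (fun z => \prod_(0 <= j < e) poleD Q x z) by apply: (@reg_prod _ _ _ _ _ _ _ rX) => j _; exact: rP.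
  by congr regular; apply/funext => z; rewrite prodr_const_nat subn0.
have {}H := H (fun y => conj (meets_regular rX fnear (rPe _)) (clA0 y)) (undup_uniq _).
have {}H : d <= \sum_(y <- ps) v y (cl ((fun z => poleD Q (toX y) z ^+ e) \o toX)).
  apply: H => // y; rewrite -[vY _ _]/(v y (cl ((fun z => poleD Q (toX y) z ^+ e) \o toX))) vA => nz.
  have : \sum_(q in Q) npole v y (xi q) != 0 by apply: contra_neq nz => ->; rewrite mulr0.
  apply: contraNT => yn; rewrite big1 // => q _; rewrite /npole; case: ifP => // /psP yp.
  by rewrite yp in yn.
apply: le_trans H _; rewrite (eq_bigr (fun y => e%:Z * \sum_(q in Q) npole v y (xi q))) => [|y _]; last exact: vA.
rewrite -mulr_sumr exchange_big /= PoszM [#|Q|%:Z * _]mulrC -mulrA ler_wpM2l //.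
have : \sum_(q in Q) \sum_(y <- ps) npole v y (xi q) <= \sum_(q in Q) (2 * g%:Z - 2 + s%:Z).
  by apply: ler_sum => q _; apply: xi_degree => [|y]; [exact: undup_uniq|exact: psP].
by rewrite sumr_const -[X in _ <= X -> _]mulr_natl natz.
Qed.
End Curve.

Lemma hyperbolic_ex (R : realType) (n : nat) (A alpha : Mbar0 R[i] n -> Mbar0 R[i] n -> R[i]) (Q : {set quad n}) (e c : nat) :
  (3 <= n)%N -> (0 < c)%N -> (#|Q| * e <= c)%N ->
  (forall B, lin_equiv A B -> exists H : Mbar0 R[i] n -> R[i], forall x, exists u, [/\ regular x u, u x != 0 &
     generic [set z | alpha x z * B x z = u z * H z * poleD Q x z ^+ e]]) ->
  (forall x, regular x (alpha x)) -> (forall x, M0 x -> alpha x x != 0) ->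
  hyperbolic_bound (boundary R[i] n) (c%:R^-1 : R) A.
Proof.
move=> n3 c0 Qc HB ar a0 C hC CB Y f nf g s d gY cs dA.
have [N [i ci]] : projective Y by case: nf.
have sl := slack_ge0 n3 hC CB nf ci gY cs.
have le := curve_bound n3 hC CB nf ci gY cs HB ar a0 dA.
have {}le : d <= c%:Z * (2 * g%:Z - 2 + s%:Z) by apply: le_trans le _; rewrite ler_wpM2r.
rewrite mulrC ler_pdivrMr ?ltr0n //.
have : (d%:~R : R) <= (c%:Z * (2 * g%:Z - 2 + s%:Z))%:~R by rewrite ler_int.
by rewrite !(intrM, intrD, rmorphN) /= mulrC.
Qed.

Lemma part1 (R : realType) (n : nat) : (3 <= n)%N -> algebraically_hyperbolic (boundary R[i] n).
Proof.
(* The successor keeps the constant positive for n = 3, where there are no quadruples. *)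
move=> n3; exists (#|{: quad n}|.+1%:R^-1), (poleD [set: quad n]%SET); split.
- by rewrite invr_gt0 ltr0n.
- exact: fullD_ample.
apply: (@hyperbolic_ex R n _ (fun _ _ => 1) [set: quad n]%SET 1 _ n3) => //.
- by rewrite muln1 cardsT.
- move=> B [h [_ hB]]; exists h => x; have [u [ru u0 E]] := hB x.
  by exists u; split=> //; apply: generic_sub E => z /= ->; rewrite mul1r expr1 mulrA.
- by move=> x; exact: (reg_const (X_ringed _ _) x 1).
- by move=> x _; rewrite oner_neq0.
Qed.

(** * Top forms in the positions of the marked points *)

Section Tangent.
Variables (k : fieldType) (X : space k) (rX : ringed X) (x : X) (D : (X -> k) -> k).
Hypothesis tD : tangent x D.
Implicit Types f g : X -> k.

Lemma tan_near f g : regular x f -> regular x g -> near_pt x [set y | f y = g y] -> D f = D g.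
Proof. by case: tD => H _ _; exact: H. Qed.
Lemma tan_mul f g : regular x f -> regular x g -> D (fun y => f y * g y) = f x * D g + g x * D f.
Proof. by case: tD => _ _; apply. Qed.
Lemma tan_lin c f g : regular x f -> regular x g -> D (fun y => c * f y + g y) = c * D f + D g.
Proof. by case: tD => _ H _; exact: H. Qed.
Lemma tan_const c : D (fun=> c) = 0.
Proof.
have r a : regular x (fun=> a : k) := reg_const rX x a.
have D0 : D (fun=> 0) = 0.
  have := tan_mul (r 0) (r 0).
  have -> : (fun _ : X => 0 * 0 : k) = fun=> 0 by apply/funext => y; rewrite mul0r.
  by rewrite !mul0r addr0.
have D1 : D (fun=> 1) = 0.
  have := tan_mul (r 1) (r 1).
  have -> : (fun _ : X => 1 * 1 : k) = fun=> 1 by apply/funext => y; rewrite mul1r.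
  by rewrite !mul1r => E; apply: (addrI (D (fun=> 1))); rewrite -E addr0.
have <- : D (fun=> c * 1 + 0) = 0 by rewrite (tan_lin c (r 1) (r 0)) D0 D1 mulr0 addr0.
by congr D; apply/funext => y; rewrite mulr1 addr0.
Qed.
Lemma tan_add f g : regular x f -> regular x g -> D (fun y => f y + g y) = D f + D g.
Proof.
move=> rf rg; have := tan_lin 1 rf rg; rewrite mul1r => <-.
by congr D; apply/funext => y; rewrite mul1r.
Qed.
Lemma tan_scale c f : regular x f -> D (fun y => c * f y) = c * D f.
Proof. by move=> rf; rewrite (tan_mul (reg_const rX x c) rf) tan_const mulr0 addr0. Qed.
Lemma tan_sum (I : Type) (r : seq I) (P : pred I) (f : I -> X -> k) : (forall i, P i -> regular x (f i)) ->
  D (fun y => \sum_(i <- r | P i) f i y) = \sum_(i <- r | P i) D (f i).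
Proof.
move=> rf; elim: r => [|i r IH].
  by rewrite big_nil -[RHS](tan_const 0); congr D; apply/funext => y; rewrite big_nil.
rewrite big_cons; case: ifP => Pi; last first.
  by rewrite -IH; congr D; apply/funext => y; rewrite big_cons Pi.
rewrite -IH -tan_add; [|exact: rf|by apply: (@reg_sum _ _ _ _ _ _ _ rX)].
by congr D; apply/funext => y; rewrite big_cons Pi.
Qed.
Lemma tan_inv f : regular x f -> f x != 0 -> D (fun y => (f y)^-1) = - D f / f x ^+ 2.
Proof.
move=> rf f0; have rV := reg_inv rX rf f0.
have E : D (fun y => f y * (f y)^-1) = 0.
  rewrite -(tan_const 1); apply: tan_near; [exact: (reg_mul rX)|exact: (reg_const rX x 1)|].
  by apply: near_sub (reg_neq0 rX rf f0) => y /= fy; rewrite divff.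
move: E; rewrite (tan_mul rf rV) => /eqP; rewrite addr_eq0 => /eqP E.
by apply: (mulfI f0); rewrite E; field.
Qed.
Lemma tan_max2 f : regular x f -> in_max2 x f -> D f = 0.
Proof.
move=> rf [r [a [b [ab nE]]]].
have rab j : regular x (fun y => a j y * b j y) by have [ra _ rb _] := ab j; exact: (reg_mul rX).
rewrite (tan_near rf _ nE); last by apply: (@reg_sum _ _ _ _ _ _ _ rX) => j _; exact: rab.
rewrite tan_sum // big1 // => j _; have [ra a0 rb b0] := ab j.
by rewrite (tan_mul ra rb) a0 b0 !mul0r addr0.
Qed.

Lemma tan_sub_lin (d : nat) f (c : 'I_d -> k) (t : 'I_d -> X -> k) : regular x f -> (forall j, regular x (t j)) ->
  regular x (fun y => f y - \sum_j c j * t j y) /\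
  D (fun y => f y - \sum_j c j * t j y) = D f - \sum_j c j * D (t j).
Proof.
move=> rf rt; have rct j : regular x (fun y => - c j * t j y) by apply: (reg_mul rX (reg_const rX x _)).
have rs : regular x (fun y => \sum_j - c j * t j y) by apply: (@reg_sum _ _ _ _ _ _ _ rX).
have E : (fun y => f y - \sum_j c j * t j y) = (fun y => f y + \sum_j - c j * t j y).
  by apply/funext => y; rewrite -sumrN; congr (_ + _); apply: eq_bigr => j _; rewrite mulNr.
rewrite E; split; first exact: (reg_add rX).
rewrite (tan_add rf rs) (tan_sum _ (P := predT) (fun j _ => rct j)) -sumrN; congr (_ + _); apply: eq_bigr => j _.
by rewrite tan_scale // mulNr.
Qed.

Definition dl f := D f / f x.
Lemma dl_mul f g : regular x f -> regular x g -> f x != 0 -> g x != 0 -> dl (fun y => f y * g y) = dl f + dl g.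
Proof. by move=> rf rg f0 g0; rewrite /dl (tan_mul rf rg); field; rewrite f0 g0. Qed.
Lemma dl_inv f : regular x f -> f x != 0 -> dl (fun y => (f y)^-1) = - dl f.
Proof. by move=> rf f0; rewrite /dl (tan_inv rf f0) invrK expr2 invfM !mulNr -!mulrA mulVf // mulr1. Qed.
Lemma dl_near f g : regular x f -> regular x g -> near_pt x [set y | f y = g y] -> dl f = dl g.
Proof. by move=> rf rg E; rewrite /dl (tan_near rf rg E) (near_self E). Qed.

End Tangent.

Section Square.
Variables (k : fieldType) (X : space k) (rX : ringed X) (x : X).
Implicit Types f g : X -> k.

Lemma max2_near f g : near_pt x [set y | f y = g y] -> in_max2 x f -> in_max2 x g.
Proof.
move=> E [r [a [b [ab nE]]]]; exists r, a, b; split=> //.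
by apply: near_sub (nearI rX E nE) => y /= [<-].
Qed.
Lemma max2_mul f g : regular x f -> f x = 0 -> regular x g -> g x = 0 -> in_max2 x (fun y => f y * g y).
Proof.
move=> *; exists 1%N, (fun=> f), (fun=> g); split=> //.
by apply: nearT => // y /=; rewrite big_ord1.
Qed.
Lemma max2_add f g : in_max2 x f -> in_max2 x g -> in_max2 x (fun y => f y + g y).
Proof.
move=> [r [a [b [ab nE]]]] [r' [a' [b' [ab' nE']]]].
pose c (T : Type) (u : 'I_r -> T) (u' : 'I_r' -> T) (j : 'I_(r + r')) := match split j with inl l => u l | inr l => u' l end.
exists (r + r')%N, (c _ a a'), (c _ b b'); split=> [j|].
  by rewrite /c; case: split => l; [exact: ab|exact: ab'].
apply: near_sub (nearI rX nE nE') => y /= [-> ->]; rewrite big_split_ord /=; congr (_ + _); apply: eq_bigr => j _.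
  by rewrite /c -[lshift _ _]/(unsplit (inl j)) unsplitK.
by rewrite /c -[rshift _ _]/(unsplit (inr j)) unsplitK.
Qed.
Lemma max2_scale c f : regular x c -> in_max2 x f -> in_max2 x (fun y => c y * f y).
Proof.
move=> rc [r [a [b [ab nE]]]]; exists r, (fun j y => c y * a j y), b; split=> [j|].
  by have [ra a0 rb b0] := ab j; split=> //; [exact: (reg_mul rX)|rewrite a0 mulr0].
by apply: near_sub nE => y /= ->; rewrite mulr_sumr; apply: eq_bigr => j _; rewrite mulrA.
Qed.
Lemma max2_0 : in_max2 x (fun=> 0 : k).
Proof.
exists 0%N, (fun _ _ => 0), (fun _ _ => 0); split=> [[]//|].
by apply: nearT => // y /=; rewrite big_ord0.
Qed.
Lemma max2_sum (d : nat) (c : 'I_d -> k) (f : 'I_d -> X -> k) : (forall j, in_max2 x (f j)) ->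
  in_max2 x (fun y => \sum_j c j * f j y).
Proof.
move=> H; elim: (index_enum _) => [|j r IH].
  by apply: max2_near max2_0; apply: nearT => // y /=; rewrite big_nil.
apply: max2_near (max2_add (max2_scale (reg_const rX x (c j)) (H j)) IH).
by apply: nearT => // y /=; rewrite big_cons.
Qed.
End Square.

Section RegularInd.
Variables (k : numClosedFieldType) (n : nat).
Let X := Mbar0 k n.

(** The local ring at [x] is generated by chart coordinates under sums, products and inverses; a
    coordinate in the other chart is an inverse. *)
Lemma regular_ind (x : X) (S : (X -> k) -> Prop) :
  (forall f g, near_pt x [set y | f y = g y] -> S f -> S g) ->
  (forall c, S (fun=> c)) ->
  (forall f g, S f -> S g -> S (fun y => f y + g y)) ->
  (forall f g, S f -> S g -> S (fun y => f y * g y)) ->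
  (forall f, S f -> f x != 0 -> S (fun y => (f y)^-1)) ->
  (forall q, S (fun y => chart (val x q == None) (val y q))) ->
  forall f, regular x f -> S f.
Proof.
move=> Sn Sc Sa Sm Si Sq f /X_regularP [b [P [Q [xb Qx nE]]]].
have ext g h : (forall y, g y = h y) -> S h -> S g.
  by move=> E; congr S; apply/esym/funext.
have Sb (j : 'I_#|{: quad n}|) : S (fun y => charts b (val y) j).
  rewrite /charts; set q := enum_val j; have := xb q; have := Sq q.
  case E : (val x q) => [a|] /=; rewrite ?eqxx; case: (b q) => //= S0 a0.
  apply: ext (Si _ S0 _) => [y|]; last by rewrite E /=; apply: contra_neq a0 => ->.
  by case: (val y q) => //=; rewrite invr0.
have SP (p : {mpoly k[#|{: quad n}|]}) : S (fun y => p.@[charts b (val y)]).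
  elim/mpolyind: p => [|e m p _ _ IH]; first by apply: ext (Sc 0) => y; exact: meval0.
  have Sp : S (fun y => \prod_i charts b (val y) i ^+ m i).
    elim: (index_enum _) => [|i r IHr]; first by apply: ext (Sc 1) => y; rewrite big_nil.
    have Se : S (fun y => charts b (val y) i ^+ m i).
      by elim: (m i) => [|j IHj]; [exact: Sc|apply: ext (Sm _ _ (Sb i) IHj) => y; rewrite exprS].
    by apply: ext (Sm _ _ Se IHr) => y; rewrite big_cons.
  by apply: ext (Sa _ _ (Sm _ _ (Sc e) Sp) IH) => y; rewrite mevalD mevalZ mevalX.
apply: Sn (Sm _ _ (SP P) (Si _ (SP Q) Qx)).
by apply: near_sub nE => y /= [_ _ ->].
Qed.
End RegularInd.

(** * Positions of the marked points and their derivations *)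

Section Positions.
Variables (k : numClosedFieldType) (m : nat).
Let n := m.+3.
Let X := Mbar0 k n.
Let n3 : (3 <= n)%N. Proof. by []. Qed.
Let rX : ringed X := X_ringed k n.

Definition o0 : 'I_m.+3 := @Ordinal m.+3 0 isT.
Definition o1 : 'I_m.+3 := @Ordinal m.+3 1 isT.
Definition o2 : 'I_m.+3 := @Ordinal m.+3 2 isT.
Definition bi (i : 'I_m) : 'I_m.+3 := rshift 3 i.

Lemma bi_inj : injective bi. Proof. exact: (@rshift_inj 3 m). Qed.
Lemma base_cases (l : 'I_m.+3) : [\/ l = o0, l = o1, l = o2 | exists i, l = bi i].
Proof.
case: l => [[|[|[|l]]] Hl]; [constructor 1|constructor 2|constructor 3|constructor 4]; try exact: val_inj.
have Hm : (l < m)%N by rewrite !ltnS in Hl.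
by exists (Ordinal Hm); apply: val_inj.
Qed.
Lemma base_uniq i : uniq [:: o0; o1; o2; bi i]. Proof. by []. Qed.

Definition pos (y : X) (l : 'I_m.+3) : P1 k := xq (val y) o0 o1 o2 l.
Definition qb (i : 'I_m) : quad n := exist _ [tuple o0; o1; o2; bi i] (base_uniq i).

Lemma qb_inj : injective qb.
Proof. by move=> i j /(congr1 (fun q : quad n => tnth (val q) (inord 3))); rewrite !(tnth_nth o0) /= !inordK // => /bi_inj. Qed.

Lemma pos_o0 y : pos y o0 = Some 0. Proof. exact: xq0. Qed.
Lemma pos_o1 y : pos y o1 = Some 1. Proof. exact: xq1. Qed.
Lemma pos_o2 y : pos y o2 = None. Proof. exact: xqoo. Qed.
Lemma pos_bi y i : pos y (bi i) = val y (qb i).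
Proof.
rewrite -(xq_quad (val y) (qb i)) /pos; congr xq;
  by rewrite /mark /qb /= (tnth_nth o0) /= inordK.
Qed.

Lemma pos_crel y (q : quad n) : crel (pos y (mark q (inord 0))) (pos y (mark q (inord 1)))
  (pos y (mark q (inord 2))) (pos y (mark q (inord 3))) (val y q).
Proof. exact: (X_crsys n3 y (i := o0) (j := o1) (l := o2)). Qed.

Lemma pos_inj_crp y : injective (pos y) -> val y = crp (pos y).
Proof.
move=> pinj; apply/funext => q; apply/cross_ratioP; last exact: pos_crel.
- have := quad_uniq q; rewrite /= !inE !negb_or => /and3P [/and3P [m01 _ _] _ _].
  by apply: contra_neq m01; exact: pinj.
- have := quad_uniq q; rewrite /= !inE !negb_or => /and3P [_ /andP [m12 _] _].
  by apply: contra_neq m12; exact: pinj.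
- have := quad_uniq q; rewrite /= !inE !negb_or => /and3P [/and3P [_ m02 _] _ _].
  by apply: contra_neq m02; exact: pinj.
Qed.

Lemma pos_crp (y : X) (P : 'I_m.+3 -> P1 k) : P o0 = Some 0 -> P o1 = Some 1 -> P o2 = None ->
  val y = crp P -> pos y = P.
Proof.
move=> P0 P1' P2 yE; apply/funext => l.
case: (base_cases l) => [->|->|->|[i ->]]; rewrite ?pos_o0 ?pos_o1 ?pos_o2 //.
rewrite pos_bi yE /crp /mark /qb /= !(tnth_nth o0) /= !inordK //= P0 P1' P2.
have s01 : Some 0 != Some 1 :> P1 k by apply/eqP => -[/eqP]; rewrite eq_sym oner_eq0.
by apply/esym/cross_ratioP => //; rewrite /crel; case: (P (bi i)) => [a|] /=; ring.
Qed.

(** Two free points at the same position would make their cross ratio with the points at 0 and 1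
    infinite. *)
Lemma M0_pos y : M0 y <-> injective (pos y).
Proof.
split=> [My|pinj]; last first.
  have [z zE Mz] := crp_ex n3 pinj; suff -> : y = z by [].
  by apply: val_inj; rewrite zE; exact: pos_inj_crp.
have nd := (M0P y n3).1 My => a b E.
apply/eqP/negPn/negP => ab.
have s01 : Some 0 != Some 1 :> P1 k by apply/eqP => -[/eqP]; rewrite eq_sym oner_eq0.
have nb i : [/\ pos y (bi i) != Some 0, pos y (bi i) != Some 1 & pos y (bi i) != None] by rewrite pos_bi.
case: (base_cases a) (base_cases b) => [Ea|Ea|Ea|[i Ea]] [Eb|Eb|Eb|[j Eb]]; move: E ab; rewrite Ea Eb.
all: rewrite ?pos_o0 ?pos_o1 ?pos_o2 ?eqxx // => /eqP.
all: try by rewrite (negbTE s01).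
all: try by rewrite eq_sym (negbTE s01).
all: try by (have [z1 z2 z3] := nb i; rewrite ?(negbTE z1) ?(negbTE z2) ?(negbTE z3)).
all: try by (have [z1 z2 z3] := nb j; rewrite eq_sym ?(negbTE z1) ?(negbTE z2) ?(negbTE z3)).
move=> /eqP E; rewrite (inj_eq bi_inj) => ij.
have u : uniq [:: o0; o1; bi i; bi j] by rewrite /= !inE !(inj_eq bi_inj) (negbTE ij).
have [q [q0 q1 q2 q3]] := quad_ex u; have := pos_crel y q; rewrite q0 q1 q2 q3 pos_o0 pos_o1 -E.
have [z0 z1 _] := nb i; have [_ _] := nd q; rewrite /crel bracketzz mul0r mulr0.
case: (val y q) => // c _ /esym/eqP; rewrite mul1r mulf_eq0 !bracket_eq0 (negbTE z0).
by rewrite eq_sym (negbTE z1).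
Qed.

(* The path through y that moves the i-th free marked point with speed 1. *)
Definition ppos (y : X) (i : 'I_m) (s : k) (l : 'I_m.+3) : P1 k :=
  if l == bi i then Some (chart false (pos y l) + s) else pos y l.
Definition path_at (y : X) (i : 'I_m) (s : k) : X :=
  if pselect (injective (ppos y i s)) is left H then s2val (cid2 (crp_ex n3 H)) else y.

Section Path.
Variables (y : X) (i : 'I_m).
Hypothesis My : M0 y.

Lemma pos_fin j : pos y (bi j) = Some (chart false (pos y (bi j))).
Proof. by rewrite pos_bi; have [_ _] := (M0P y n3).1 My (qb j); case: (val y _). Qed.

Let A l : {poly k} := (hcrd (pos y l)).1%:P + (if l == bi i then 'X else 0).
Let B l : {poly k} := (hcrd (pos y l)).2%:P.

Lemma ppos_hcrd s l : hcrd (ppos y i s l) = ((A l).[s], (B l).[s]).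
Proof.
rewrite /ppos /A /B hornerD !hornerC; case: eqP => [->|_]; last first.
  by rewrite horner0 addr0; case: (hcrd _).
by rewrite hornerX pos_fin.
Qed.

Lemma ppos_inj : gen (fun s => injective (ppos y i s)).
Proof.
have pinj := (M0_pos y).1 My.
have hE (P Q R S : {poly k}) s : (P * Q - R * S).[s] = P.[s] * Q.[s] - R.[s] * S.[s] by rewrite !hornerE.
have : gen (fun s => forall ab : 'I_m.+3 * 'I_m.+3, ab.1 != ab.2 -> ppos y i s ab.1 != ppos y i s ab.2).
  apply: gen_all => -[a b] /=; have [->|ab] := eqVneq a b; first by apply: genT => s.
  have nz : A a * B b - B a * A b != 0.
    apply: hpoly_neq0; have := pinj a b; rewrite hE.
    have H0 l : (A l).[0] = (hcrd (pos y l)).1 by rewrite /A hornerD hornerC; case: ifP; rewrite ?hornerX ?horner0 addr0.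
    by rewrite !H0 /B !hornerC -bracketE bracket_eq0 => H; apply: contra_neq ab.
  apply: gen_sub (gen_horner nz) => s; rewrite hE => ne _.
  by rewrite -bracket_eq0 bracketE !ppos_hcrd.
apply: gen_sub => s H a b E; apply/eqP/negPn/negP => ab.
by have := H (a, b) ab; rewrite E eqxx.
Qed.

Lemma path_at_crp : gen (fun s => val (path_at y i s) = crp (ppos y i s)).
Proof. by apply: gen_sub ppos_inj => s H; rewrite /path_at; case: pselect => // H'; case: cid2. Qed.

Lemma path_at_pos : gen (fun s => pos (path_at y i s) = ppos y i s).
Proof.
by apply: gen_sub path_at_crp => s E; apply: pos_crp E; rewrite /ppos ?pos_o0 ?pos_o1 ?pos_o2.
Qed.

Lemma path_at_jet q : p1jet (fun s => val (path_at y i s) q) (val y q).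
Proof.
have pinj := (M0_pos y).1 My.
have := quad_uniq q; rewrite /= !inE !negb_or => /and3P [/and3P [m01 m02 _] /andP [m12 _] _].
have jet0 : p1jet (fun s => crp (ppos y i s) q) (val y q).
  rewrite (pos_inj_crp pinj); apply: (cross_path (A := A) (B := B)).
  - move=> l; exists 1; rewrite ?oner_neq0 // !mul1r /A /B hornerD !hornerC.
    by case: ifP; rewrite ?hornerX ?horner0 addr0.
  - apply: genT => s; exists 1, (fun=> 1); rewrite oner_neq0; split=> // l l'.
    by rewrite bracketE !ppos_hcrd !mul1r.
  - by apply: contra_neq m01; exact: pinj.
  - by apply: contra_neq m12; exact: pinj.
  - by apply: contra_neq m02; exact: pinj.
move=> b xb; have [g1 [d j1]] := jet0 b xb; split.
  by apply: gen_sub (genI path_at_crp g1) => s [-> ?].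
by exists d; apply: jet_gen j1; apply: gen_sub path_at_crp => s ->.
Qed.
End Path.

(** The derivation with respect to the position z_i at [y], defined for all functions with default
    0. *)
Definition dpos (y : X) (i : 'I_m) (f : X -> k) : k :=
  if pselect (exists d, jet (fun s => f (path_at y i s)) (f y) d) is left H then sval (cid H) else 0.

Lemma dpos_jet y i f d : jet (fun s => f (path_at y i s)) (f y) d -> dpos y i f = d.
Proof.
move=> jd; rewrite /dpos; case: pselect => [H|[]]; last by exists d.
by case: cid => d' /= jd'; case: (jet_uniq jd' jd).
Qed.

Section Derivation.
Variables (y : X) (i : 'I_m).
Hypothesis My : M0 y.

Lemma dposP f : regular y f -> jet (fun s => f (path_at y i s)) (f y) (dpos y i f).
Proof. by move=> rf; have [d jd] := path_regular rf (path_at_jet i My); rewrite (dpos_jet jd). Qed.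

Lemma dpos_tangent : tangent y (dpos y i).
Proof.
split=> [f g rf rg nE|c f g rf rg|f g rf rg].
- apply: dpos_jet; have := dposP rg; rewrite -(near_self nE); apply: jet_gen.
  exact: path_near nE (path_at_jet i My).
- apply: dpos_jet; have := jet_add (jet_mul (jet_const c) (dposP rf)) (dposP rg).
  by rewrite mulr0 addr0.
- by apply: dpos_jet; exact: jet_mul (dposP rf) (dposP rg).
Qed.

Lemma dpos_other (h : P1 k -> k) l : l != bi i -> dpos y i (fun z => h (pos z l)) = 0.
Proof.
move=> li; apply: dpos_jet; apply: jet_gen (jet_const _).
by apply: gen_sub (path_at_pos i My) => s ->; rewrite /ppos (negbTE li).
Qed.

Lemma dpos_self (h : P1 k -> k) d : jet (fun s => h (Some (chart false (pos y (bi i)) + s))) (h (pos y (bi i))) d ->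
  dpos y i (fun z => h (pos z (bi i))) = d.
Proof.
move=> jd; apply: dpos_jet; apply: jet_gen jd.
by apply: gen_sub (path_at_pos i My) => s ->; rewrite /ppos eqxx.
Qed.
End Derivation.
End Positions.

Lemma fresh (k : numClosedFieldType) (s : seq (P1 k)) : exists kappa : k, Some kappa \notin s.
Proof.
have P0 : \prod_(z <- s) ('X - (chart false z)%:P) != 0.
  by rewrite prodf_seq_neq0; apply/allP => z _; rewrite polyXsubC_eq0.
have [kappa kP] := closed_nonrootP _ P0; exists kappa.
by apply: contra kP => zs; rewrite (big_rem _ zs) /= rootM root_XsubC eqxx.
Qed.

(** * Logarithmic derivatives of cross ratios *)

Section Gauge.
Variables (k : numClosedFieldType) (m : nat).
Let n := m.+3.
Let X := Mbar0 k n.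
Let n3 : (3 <= n)%N. Proof. by []. Qed.
Let rX : ringed X := X_ringed k n.

Variable kappa : k.

(* The coordinate 1 / (z - kappa), in which the point oo is finite. *)
Definition gau (z : P1 k) : k := if z is Some a then (a - kappa)^-1 else 0.
(** The factor by which homogeneous coordinates are rescaled in [gau_diff]; unlike [gau] it is
    nonzero at oo. *)
Definition lam (z : P1 k) : k := if z is Some a then (a - kappa)^-1 else 1.

Lemma lam_neq0 z : z != Some kappa -> lam z != 0.
Proof. by case: z => [a|] ak /=; rewrite ?oner_neq0 // invr_eq0 subr_eq0; apply: contra_neq ak => ->. Qed.

Lemma gau_diff z w : z != Some kappa -> w != Some kappa -> gau z - gau w = bracket w z * (lam z * lam w).
Proof.
have ne a : Some a != Some kappa -> a - kappa != 0 by move=> ak; rewrite subr_eq0; apply: contra_neq ak => ->.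
move=> zk wk; case: z zk => [a|] zk; case: w wk => [b|] wk /=; rewrite ?mulr1 ?subrr ?mul0r //.
- by have := ne a zk; have := ne b wk => *; field; apply/andP.
- by rewrite subr0 mul1r.
- by rewrite sub0r mul1r mulN1r.
Qed.

Lemma gau_regular (x : X) l : pos x l != Some kappa -> regular x (fun y => gau (pos y l)).
Proof.
have rc c : regular x (fun=> c : k) := reg_const rX x c.
case: (base_cases l) => [->|->|->|[i ->]] xk.
- by have := rc (gau (Some 0)); congr regular; apply/funext => y; rewrite pos_o0.
- by have := rc (gau (Some 1)); congr regular; apply/funext => y; rewrite pos_o1.
- by have := rc (gau None); congr regular; apply/funext => y; rewrite pos_o2.
rewrite pos_bi in xk; have nk := neq_near xk.
case E : (val x (qb i)) => [a|].
  have xc : in_chart false (val x (qb i)) by rewrite E.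
  have rf := chart_regular xc; have rk := reg_sub rX rf (rc kappa).
  have k0 : chart false (val x (qb i)) - kappa != 0.
    by rewrite E /= subr_eq0; move: xk; rewrite E; apply: contra_neq => ->.
  apply: (reg_ext rX (reg_inv rX rk k0)).
  by apply: near_sub (in_chart_near xc) => y /=; rewrite pos_bi -[sval y]/(val y); case: (val y (qb i)).
have xc : in_chart true (val x (qb i)) by rewrite E.
have rf := chart_regular xc; have rk := reg_sub rX (rc 1) (reg_mul rX (rc kappa) rf).
have k0 : 1 - kappa * chart true (val x (qb i)) != 0 by rewrite E /= mulr0 subr0 oner_neq0.
apply: (reg_ext rX (reg_mul rX rf (reg_inv rX rk k0))).
apply: near_sub (nearI rX nk (in_chart_near xc)) => y /= [yk yc]; rewrite pos_bi.
move: yk yc; rewrite -[sval y]/(val y); case: (val y (qb i)) => [b|] /=; last by rewrite mul0r.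
move=> bk b0; have b0' : b != 0 by apply: contra_neq b0 => ->.
have bk' : b - kappa != 0 by rewrite subr_eq0; apply: contra_neq bk => ->.
by rewrite -invfM mulrBr mulr1 mulrCA divff // mulr1.
Qed.

Lemma pos_neq_near (x : X) l : pos x l != Some kappa -> near_pt x [set y | pos y l != Some kappa].
Proof.
case: (base_cases l) => [->|->|->|[i ->]].
- by rewrite pos_o0 => H; apply: nearT => // y /=; rewrite pos_o0.
- by rewrite pos_o1 => H; apply: nearT => // y /=; rewrite pos_o1.
- by rewrite pos_o2 => H; apply: nearT => // y /=; rewrite pos_o2.
by rewrite pos_bi => /neq_near; apply: near_sub => y /=; rewrite pos_bi.
Qed.

Definition Zf (a b : 'I_m.+3) (y : X) : k := gau (pos y a) - gau (pos y b).

Definition gauge_ok (y : X) : Prop := forall l, pos y l != Some kappa.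

Lemma gauge_ok_near x : gauge_ok x -> near_pt x [set y | gauge_ok y].
Proof. by move=> gx; apply: near_all => l; exact: pos_neq_near. Qed.

Lemma Zf_regular x a b : gauge_ok x -> regular x (Zf a b).
Proof. by move=> gx; apply: (reg_sub rX); exact: gau_regular. Qed.

Lemma Zf_bracket x a b : gauge_ok x -> Zf a b x = bracket (pos x b) (pos x a) * (lam (pos x a) * lam (pos x b)).
Proof. by move=> gx; exact: gau_diff. Qed.

Lemma Zf_neq0 x a b : gauge_ok x -> pos x a != pos x b -> Zf a b x != 0.
Proof. by move=> gx ab; rewrite Zf_bracket // !mulf_neq0 ?lam_neq0 // bracket_eq0 eq_sym. Qed.

Section AtPoint.
Variable p : X.
Hypotheses (Mp : M0 p) (gp : gauge_ok p).
Variable i : 'I_m.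
Let tD := dpos_tangent i Mp.
Let pinj := (M0_pos p).1 Mp.

Lemma dpos_gau l : dpos p i (fun z => gau (pos z l)) = - gau (pos p (bi i)) ^+ 2 * (l == bi i)%:R.
Proof.
case: eqP => [->|/eqP li]; last by rewrite mulr0 (dpos_other _ gau).
rewrite mulr1; apply: (dpos_self Mp (h := gau)).
have E := pos_fin Mp i; set z := chart _ _ in E *; rewrite E /=.
have zk : z - kappa != 0 by have := gp (bi i); rewrite E subr_eq0; apply: contra_neq => ->.
have P0 : ((z - kappa)%:P + 'X : {poly k}).[0] != 0 by rewrite !hornerE.
have := jet_inv (jet_poly ((z - kappa)%:P + 'X)) P0; rewrite !derivE !hornerE => jj.
have -> : - (z - kappa)^-1 ^+ 2 = -1 / (z - kappa) ^+ 2 by rewrite mulN1r exprVn.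
apply: jet_gen jj.
by apply: genT => s; rewrite !hornerE addrAC.
Qed.

Lemma dl_Zf a b : a != b -> dl p (dpos p i) (Zf a b) =
  - gau (pos p (bi i)) ^+ 2 * ((a == bi i)%:R - (b == bi i)%:R) / Zf a b p.
Proof.
move=> ab; rewrite /dl; congr (_ / _).
have ra := gau_regular (gp a); have rb := gau_regular (gp b).
have := tan_add tD ra (reg_opp rX rb); rewrite -/(Zf a b) => ->.
have -> : dpos p i (fun y => - gau (pos y b)) = - dpos p i (fun y => gau (pos y b)).
  by rewrite -mulN1r -(tan_scale rX tD _ rb); congr dpos; apply/funext => y; rewrite mulN1r.
by rewrite !dpos_gau; ring.
Qed.

Lemma cr_gauge y q : M0 y -> gauge_ok y -> chart false (val y q) =
   Zf (mark q (inord 3)) (mark q (inord 0)) y * Zf (mark q (inord 1)) (mark q (inord 2)) y *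
   (Zf (mark q (inord 3)) (mark q (inord 2)) y * Zf (mark q (inord 1)) (mark q (inord 0)) y)^-1.
Proof.
move=> My gy; have yinj := (M0_pos y).1 My.
have := quad_uniq q; rewrite /= !inE !negb_or => /and3P [/and3P [m01 m02 m03] /andP [m12 m13] /andP [m23 _]].
rewrite (pos_inj_crp yinj) /crp /cross_ratio.
set a := mark q _ in m01 m02 m03 *; set b := mark q _ in m01 m12 m13 *; set c := mark q _ in m02 m12 m23 *.
set d := mark q _ in m03 m13 m23 *; rewrite !(Zf_bracket _ _ gy) !mulf_eq0 !bracket_eq0.
rewrite (inj_eq yinj) eq_sym (negbTE m23) (inj_eq yinj) eq_sym (negbTE m01) /=.
have nz u v : u != v -> bracket (pos y u) (pos y v) != 0 by move=> uv; rewrite bracket_eq0 (inj_eq yinj).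
have l0 u : lam (pos y u) != 0 by apply: lam_neq0; exact: gy.
have anti u v : bracket (pos y u) (pos y v) = - bracket (pos y v) (pos y u) by rewrite !bracketE; ring.
rewrite (anti a d) (anti c b) (anti c d) (anti a b).
have da := nz d a; have dc := nz d c; have bc := nz b c; have ba := nz b a.
rewrite eq_sym in da; rewrite eq_sym in dc; rewrite eq_sym in ba.
move: {da dc bc ba} (da m03) (dc m23) (bc m12) (ba m01) (l0 a) (l0 b) (l0 c) (l0 d).
move: (lam _) (lam _) (lam _) (lam _) (bracket _ _) (bracket _ _) (bracket _ _) (bracket _ _) => la lb lc ld B1 B2 B3 B4 *.
by field; do ?[apply/andP; split].
Qed.

Definition esgn (b : bool) (e : 'I_4) : k := (-1) ^+ b * (if (e < 2)%N then 1 else -1).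
(** The four differences of [cr_gauge], as pairs of labels: e = 0, 1 for the numerator, e = 2, 3 for
    the denominator, which [esgn] counts with the opposite sign. *)
Definition eend (q : quad m.+3) (e : 'I_4) : 'I_m.+3 * 'I_m.+3 :=
  (mark q (inord (if odd e then 1 else 3)%N), mark q (inord (if (e == 0 :> nat) || (e == 3 :> nat) then 0 else 2)%N)).

Lemma dl_cross b q : dl p (dpos p i) (fun y => chart b (val y q)) =
  \sum_e esgn b e * dl p (dpos p i) (Zf (eend q e).1 (eend q e).2).
Proof.
have pq := (M0P p n3).1 Mp q.
have in_c b' : in_chart b' (val p q) by case: pq; case: b'.
have rc b' := chart_regular (in_c b').
have rZ u v := Zf_regular u v gp.
have ne0 : chart false (val p q) != 0 by case: pq; case: (val p q) => //= a a0 _ _; apply: contra_neq a0 => ->.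
suff main : dl p (dpos p i) (fun y => chart false (val y q)) =
    \sum_e esgn false e * dl p (dpos p i) (Zf (eend q e).1 (eend q e).2).
  case: b; last exact: main.
  have -> : (fun y : X => chart true (val y q)) = (fun y => (chart false (val y q))^-1).
    by apply/funext => y; case: (val y q) => //=; rewrite invr0.
  rewrite (dl_inv rX tD (rc false) ne0) main -sumrN; apply: eq_bigr => e _.
  by rewrite /esgn expr1 expr0 mul1r !mulN1r mulNr.
have := quad_uniq q; rewrite /= !inE !negb_or => /and3P [/and3P [m01 m02 m03] /andP [m12 m13] /andP [m23 _]].
have Zn u v : u != v -> Zf u v p != 0 by move=> uv; apply: Zf_neq0 => //; rewrite (inj_eq pinj).
have n30 : Zf (mark q (inord 3)) (mark q (inord 0)) p != 0 by rewrite Zn // eq_sym.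
have n12 : Zf (mark q (inord 1)) (mark q (inord 2)) p != 0 by rewrite Zn.
have n32 : Zf (mark q (inord 3)) (mark q (inord 2)) p != 0 by rewrite Zn // eq_sym.
have n10 : Zf (mark q (inord 1)) (mark q (inord 0)) p != 0 by rewrite Zn // eq_sym.
have rN := reg_mul rX (rZ (mark q (inord 3)) (mark q (inord 0))) (rZ (mark q (inord 1)) (mark q (inord 2))).
have rD := reg_mul rX (rZ (mark q (inord 3)) (mark q (inord 2))) (rZ (mark q (inord 1)) (mark q (inord 0))).
have N0 := mulf_neq0 n30 n12; have D0 := mulf_neq0 n32 n10.
have rV := reg_inv rX rD D0.
rewrite (dl_near tD (rc false) (reg_mul rX rN rV)); last first.
  by apply: near_sub (nearI rX (M0_open n3 Mp) (gauge_ok_near gp)) => y [My gy]; exact: cr_gauge.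
rewrite (dl_mul tD rN rV N0) ?invr_eq0 // (dl_inv rX tD rD D0) (dl_mul tD) // (dl_mul tD) //.
by rewrite !big_ord_recl big_ord0 /esgn /eend /= !mul1r !mulN1r; ring.
Qed.
End AtPoint.

(** By [regular_ind], df is a combination of the differentials of chart coordinates. The point [x]
    may lie on the boundary: the coefficients are regular there, while derivatives are taken only at
    nearby points of [M0]. *)
Lemma dpos_span (x : X) f : regular x f -> exists tau : quad m.+3 -> X -> k,
  (forall q, regular x (tau q)) /\
  near_pt x [set p | M0 p -> forall i, dpos p i f = \sum_q tau q p * dpos p i (fun y => chart (val x q == None) (val y q))].
Proof.
move=> rf; pose c q (y : X) := chart (val x q == None) (val y q).
suff [] : regular x f /\ exists tau : quad m.+3 -> X -> k, (forall q, regular x (tau q)) /\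
    near_pt x [set p | M0 p -> forall i, dpos p i f = \sum_q tau q p * dpos p i (c q)] by [].
have rc0 a : regular x (fun=> a : k) := reg_const rX x a.
have rC q : regular x (c q) by apply: chart_regular; case: (val x q).
move: f rf; apply: regular_ind.
- move=> f g E [rf [tau [rt nt]]]; have rg : regular x g by apply: (reg_ext rX rf); apply: near_sub E => y /= ->.
  split=> //; exists tau; split=> //.
  apply: near_sub (nearI rX nt (nearI rX (near_open E) (nearI rX (reg_near rX rf) (reg_near rX rg)))).
  move=> p /= [H [Ep [rfp rgp]]] Mp i; rewrite -(H Mp i); apply/esym.
  exact: (tan_near (dpos_tangent i Mp)).
- move=> a; split; first exact: rc0.
  exists (fun _ => fun=> 0); split=> [q|]; first exact: rc0.
  apply: nearT => // p Mp i; rewrite (tan_const rX (dpos_tangent i Mp)) big1 // => q _; exact: mul0r.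
- move=> f g [rf [tau [rt nt]]] [rg [tau' [rt' nt']]]; split; first exact: (reg_add rX).
  exists (fun q y => tau q y + tau' q y); split=> [q|]; first exact: (reg_add rX).
  apply: near_sub (nearI rX (nearI rX nt nt') (nearI rX (reg_near rX rf) (reg_near rX rg))).
  move=> p /= [[H H'] [rfp rgp]] Mp i; rewrite (tan_add (dpos_tangent i Mp)) // (H Mp) (H' Mp) -big_split /=.
  by apply: eq_bigr => q _; rewrite mulrDl.
- move=> f g [rf [tau [rt nt]]] [rg [tau' [rt' nt']]]; split; first exact: (reg_mul rX).
  exists (fun q y => f y * tau' q y + g y * tau q y); split=> [q|].
    by apply: (reg_add rX); exact: (reg_mul rX).
  apply: near_sub (nearI rX (nearI rX nt nt') (nearI rX (reg_near rX rf) (reg_near rX rg))).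
  move=> p /= [[H H'] [rfp rgp]] Mp i; rewrite (tan_mul (dpos_tangent i Mp)) // (H Mp) (H' Mp).
  by rewrite !mulr_sumr -big_split /=; apply: eq_bigr => q _; rewrite mulrDl !mulrA.
- move=> f [rf [tau [rt nt]]] f0; split; first exact: (reg_inv rX).
  exists (fun q y => - ((f y)^-1 * (f y)^-1) * tau q y); split=> [q|].
    by apply: (reg_mul rX) => //; apply: (reg_opp rX); apply: (reg_mul rX); exact: (reg_inv rX).
  apply: near_sub (nearI rX nt (nearI rX (reg_near rX rf) (reg_neq0 rX rf f0))).
  move=> p /= [H [rfp fp0]] Mp i; rewrite (tan_inv rX (dpos_tangent i Mp)) // (H Mp) mulNr mulr_suml -sumrN.
  by apply: eq_bigr => q _; rewrite expr2 invfM; ring.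
move=> q; split; first exact: rC.
exists (fun q' => fun=> (q' == q)%:R); split=> [q'|]; first exact: rc0.
apply: nearT => // p Mp i; rewrite (bigD1 q) //= eqxx mul1r big1 ?addr0 // => q' /negbTE ->.
exact: mul0r.
Qed.

End Gauge.

(** * Cotangent spaces at interior points *)

Section Taylor.
Variables (k : numClosedFieldType) (m : nat).
Let n := m.+3.
Let X := Mbar0 k n.
Let n3 : (3 <= n)%N. Proof. by []. Qed.
Let rX : ringed X := X_ringed k n.
Variable p : X.
Hypothesis Mp : M0 p.

Definition zc (i : 'I_m) (y : X) : k := chart false (pos y (bi i)).
Definition zd (i : 'I_m) (y : X) : k := zc i y - zc i p.

Lemma zc_regular i : regular p (zc i).
Proof.
have c : in_chart false (val p (qb i)) by have [] := (M0P p n3).1 Mp (qb i).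
by have := chart_regular c; congr regular; apply/funext => y; rewrite /zc pos_bi.
Qed.

Lemma zd_regular i : regular p (zd i) /\ zd i p = 0.
Proof. by split; [exact: (reg_sub rX (zc_regular i) (reg_const rX p _))|rewrite /zd subrr]. Qed.

Lemma dpos_zd i j : dpos p i (zd j) = (j == i)%:R.
Proof.
have := tan_add (dpos_tangent i Mp) (zc_regular j) (reg_const rX p (- zc j p)).
rewrite -/(zd j) (tan_const rX (dpos_tangent i Mp)) addr0 => ->.
case: eqP => [->|/eqP ji]; last by apply: (dpos_other Mp (chart false)); rewrite (inj_eq (@bi_inj m)).
apply: (dpos_self Mp (h := chart false)); have E := pos_fin Mp i; set z := chart _ _ in E *.
have := jet_poly (z%:P + 'X); rewrite !derivE !hornerE => jj.
by apply: jet_gen jj; apply: genT => s; rewrite !hornerE.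
Qed.

Definition lin_approx (f : X -> k) : Prop := regular p f /\ exists l : 'I_m -> k,
  in_max2 p (fun y => f y - f p - \sum_i l i * zd i y).

Let la_ext f g : (forall y, f y = g y) -> lin_approx f -> lin_approx g.
Proof. by move=> E; congr lin_approx; apply/funext. Qed.

Let la_near f g : near_pt p [set y | f y = g y] -> lin_approx f -> lin_approx g.
Proof.
move=> E [rf [l lE]]; have fgp : f p = g p := near_self E.
split; first by apply: (reg_ext rX rf); apply: near_sub E => y /= ->.
exists l; apply: (max2_near rX) lE; apply: near_sub E => y /= ->.
by rewrite fgp.
Qed.

Let la_const c : lin_approx (fun=> c).
Proof.
split; first exact: (reg_const rX p c); exists (fun=> 0).
apply: (max2_near rX) (max2_0 rX p); apply: nearT => // y /=.
by rewrite subrr big1 ?subr0 // => i _; rewrite mul0r.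
Qed.

Let la_add f g : lin_approx f -> lin_approx g -> lin_approx (fun y => f y + g y).
Proof.
move=> [rf [l lE]] [rg [l' lE']]; split; first exact: (reg_add rX).
exists (fun i => l i + l' i); apply: (max2_near rX) (max2_add rX lE lE'); apply: nearT => // y /=.
by under [in RHS]eq_bigr => i _ do rewrite mulrDl; rewrite big_split /=; ring.
Qed.

Let max2_dev f g : regular p f -> regular p g -> in_max2 p (fun y => (f y - f p) * (g y - g p)).
Proof.
move=> rf rg; apply: (max2_mul rX); rewrite ?subrr //.
  exact: (reg_sub rX rf (reg_const rX p _)).
exact: (reg_sub rX rg (reg_const rX p _)).
Qed.

Let la_mul f g : lin_approx f -> lin_approx g -> lin_approx (fun y => f y * g y).
Proof.
move=> [rf [l lE]] [rg [l' lE']]; split; first exact: (reg_mul rX).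
exists (fun i => g p * l i + f p * l' i).
have E1 := max2_scale rX (reg_const rX p (g p)) lE; have E2 := max2_scale rX (reg_const rX p (f p)) lE'.
apply: (max2_near rX) (max2_add rX (max2_dev rf rg) (max2_add rX E1 E2)); apply: nearT => // y /=.
have -> : \sum_i (g p * l i + f p * l' i) * zd i y = g p * \sum_i l i * zd i y + f p * \sum_i l' i * zd i y.
  by rewrite !mulr_sumr -big_split; apply: eq_bigr => i _ /=; rewrite mulrDl !mulrA.
ring.
Qed.

Let la_inv f : lin_approx f -> f p != 0 -> lin_approx (fun y => (f y)^-1).
Proof.
move=> [rf [l lE]] f0; have rV := reg_inv rX rf f0; split=> //.
exists (fun i => - (f p) ^- 2 * l i).
have E1 := max2_scale rX (reg_const rX p (- (f p) ^- 2)) lE.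
have E2 := max2_scale rX (reg_mul rX rV (reg_const rX p ((f p) ^- 2))) (max2_dev rf rf).
apply: (max2_near rX) (max2_add rX E1 E2); apply: near_sub (reg_neq0 rX rf f0) => y /= fy.
have -> : \sum_i - (f p) ^- 2 * l i * zd i y = - (f p) ^- 2 * \sum_i l i * zd i y.
  by rewrite mulr_sumr; apply: eq_bigr => i _; rewrite mulrA.
move: (\sum_i _) (f y) (f p) f0 fy => S a b b0 a0.
by field; rewrite a0 b0.
Qed.

(** Linear approximation by the z_i is preserved by ring operations and inverses and holds for the
    differences [Zf], of whose products the cross ratios are quotients; applying [dpos] identifies
    the coefficients. *)
Lemma taylor f : regular p f -> in_max2 p (fun y => f y - f p - \sum_i dpos p i f * zd i y).
Proof.
move=> rf; suff [_ [l lE]] : lin_approx f.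
  suff El i : l i = dpos p i f.
    by apply: (max2_near rX) lE; apply: nearT => // y /=; under eq_bigr => i _ do rewrite El.
  have tD := dpos_tangent i Mp.
  have rd := reg_sub rX rf (reg_const rX p (f p)).
  have [rs E] := tan_sub_lin rX tD l rd (fun j => (zd_regular j).1).
  move: E; rewrite (tan_max2 rX tD rs lE) (tan_add tD rf (reg_const rX p _)) (tan_const rX tD) addr0.
  move/eqP; rewrite eq_sym subr_eq0 => /eqP ->.
  rewrite (bigD1 i) //= dpos_zd eqxx mulr1 big1 ?addr0 // => j /negbTE ji.
  by rewrite dpos_zd ji mulr0.
have [kappa kf] := @fresh k (codom (pos p)).
have gp : gauge_ok kappa p by move=> l; apply: contraNneq kf => <-; exact: codom_f.
have lz i : lin_approx (zc i).
  split; first exact: zc_regular; exists (fun j => (j == i)%:R).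
  apply: (max2_near rX) (max2_0 rX p); apply: nearT => // y /=.
  rewrite (bigD1 i) //= eqxx mul1r big1 ?addr0 ?subrr // => j /negbTE ->; exact: mul0r.
have lg l : lin_approx (fun y => gau kappa (pos y l)).
  case: (base_cases l) => [->|->|->|[i ->]].
  - by apply: la_ext (la_const (gau kappa (Some 0))) => y; rewrite pos_o0.
  - by apply: la_ext (la_const (gau kappa (Some 1))) => y; rewrite pos_o1.
  - by apply: la_ext (la_const (gau kappa None)) => y; rewrite pos_o2.
  apply: la_near (la_inv (la_add (lz i) (la_const (- kappa))) _); last first.
    rewrite subr_eq0; have := gp (bi i); rewrite (pos_fin Mp i); by apply: contra_neq => /= <-.
  apply: near_sub (M0_open n3 Mp) => y /= My; by rewrite /zc (pos_fin My i).
have lZ a b : lin_approx (Zf kappa a b).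
  by apply: la_ext (la_add (lg a) (la_mul (la_const (-1)) (lg b))) => y; rewrite mulN1r.
move: f rf; apply: regular_ind; [exact: la_near|exact: la_const|exact: la_add|exact: la_mul|exact: la_inv|].
move=> q; have [_ _ /negbTE ->] := (M0P p n3).1 Mp q.
have pinj := (M0_pos p).1 Mp.
have := quad_uniq q; rewrite /= !inE !negb_or => /and3P [/and3P [m01 m02 m03] /andP [m12 m13] /andP [m23 _]].
apply: la_near (la_mul (la_mul (lZ (mark q (inord 3)) (mark q (inord 0))) (lZ (mark q (inord 1)) (mark q (inord 2))))
  (la_inv (la_mul (lZ (mark q (inord 3)) (mark q (inord 2))) (lZ (mark q (inord 1)) (mark q (inord 0)))) _)).
  by apply: near_sub (nearI rX (M0_open n3 Mp) (gauge_ok_near gp)) => y [My gy]; rewrite /= -(cr_gauge _ My gy).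
by rewrite mulf_neq0 // Zf_neq0 // (inj_eq pinj) eq_sym.
Qed.

(** By [taylor] the z_i - z_i(p) span the cotangent space, as do the [t j]; [C] and the Jacobian
    matrix express one system through the other. *)
Lemma local_params_M0 d (t : 'I_d -> X -> k) : local_params p t -> exists C : 'M[k]_(m, d),
  C *m (\matrix_(j, i) dpos p i (t j)) = 1%:M /\ (\matrix_(j, i) dpos p i (t j)) *m C = 1%:M.
Proof.
move=> [tr tm]; have rc c : regular p (fun=> c : k) := reg_const rX p c.
have cx i : exists c : 'rV[k]_d, in_max2 p (fun y => zd i y - \sum_j c 0 j * t j y).
  by have [c [Hc _]] := tm _ (zd_regular i).1 (zd_regular i).2; exists c.
pose C : 'M[k]_(m, d) := \matrix_(i, j) sval (cid (cx i)) 0 j.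
have CP i : in_max2 p (fun y => zd i y - \sum_j C i j * t j y).
  have := svalP (cid (cx i)); apply: (max2_near rX); apply: nearT => // y /=.
  by congr (_ - _); apply: eq_bigr => j _; rewrite mxE.
exists C; split; apply/matrixP => i j; rewrite !mxE.
  have tD := dpos_tangent j Mp; have [rz _] := zd_regular i.
  have [rs E] := tan_sub_lin rX tD (C i) rz (fun l => (tr l).1).
  move: E; rewrite (tan_max2 rX tD rs (CP i)) dpos_zd => /eqP.
  by rewrite eq_sym subr_eq0 => /eqP ->; apply: eq_bigr => l _; rewrite !mxE.
have [c [_ cu]] := tm _ (tr i).1 (tr i).2.
have E1 : c = \row_l (i == l)%:R.
  apply: cu; apply: (max2_near rX) (max2_0 rX p); apply: nearT => // y /=.
  by rewrite (bigD1 i) //= mxE eqxx mul1r big1 ?addr0 ?subrr // => l /negbTE E; rewrite mxE eq_sym E mul0r.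
have E2 : c = \row_l \sum_j dpos p j (t i) * C j l.
  apply: cu; have := max2_add rX (taylor (tr i).1) (max2_sum rX (fun j => dpos p j (t i)) CP).
  apply: (max2_near rX); apply: nearT => // y /=; rewrite (tr i).2 subr0.
  have -> : \sum_j dpos p j (t i) * (zd j y - \sum_l C j l * t l y) =
      \sum_j dpos p j (t i) * zd j y - \sum_l (\sum_j dpos p j (t i) * C j l) * t l y.
    rewrite (eq_bigr _ (fun l _ => mulr_suml _ _ _ _)) exchange_big /= -sumrB; apply: eq_bigr => j' _.
    by rewrite mulrBr mulr_sumr; congr (_ - _); apply: eq_bigr => l _; rewrite mulrA.
  by rewrite addrA subrK; congr (_ - _); apply: eq_bigr => l _; rewrite mxE.
have := congr1 (fun r : 'rV_d => r 0 j) (etrans (esym E2) E1); rewrite !mxE => <-.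
by apply: eq_bigr => l _; rewrite !mxE.
Qed.

Lemma local_params_dim d (t : 'I_d -> X -> k) : local_params p t -> d = m.
Proof.
move=> /local_params_M0 [C [E1 E2]]; apply/eqP; rewrite eqn_leq.
by rewrite (mulmx1_min E1) (mulmx1_min E2).
Qed.

Lemma local_params_det (t : 'I_m -> X -> k) : local_params p t ->
  \det (\matrix_(i, j) dpos p i (t j)) != 0.
Proof.
move=> /local_params_M0 [C [E1 _]]; have [_] := mulmx1_unit E1.
rewrite unitmxE unitfE -det_tr; congr (\det _ != 0); by apply/matrixP => i j; rewrite !mxE.
Qed.

End Taylor.

Lemma crel_chart0 (k : fieldType) beta (a b c d z : P1 k) : crel a b c d z -> in_chart beta z ->
  d != c -> b != a -> (d == a) || (b == c) -> chart beta z = 0.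
Proof.
rewrite -!bracket_eq0 /crel => R zc dc ba; rewrite -mulf_eq0 => /eqP E; move/eqP: R.
rewrite E mulr0 mulf_eq0 (negbTE (mulf_neq0 dc ba)) orbF.
case: z zc => [u|] /= zc; rewrite ?oner_eq0 // => /eqP u0; move: zc; rewrite u0.
by case: beta; rewrite /= ?eqxx.
Qed.
Lemma crel_chartoo (k : fieldType) beta (a b c d z : P1 k) : crel a b c d z -> in_chart beta z ->
  d != a -> b != c -> (d == c) || (b == a) -> chart beta z = 0.
Proof.
rewrite -!bracket_eq0 /crel => R zc da bc; rewrite -mulf_eq0 => /eqP E; move/eqP: R.
rewrite E mulr0 eq_sym mulf_eq0 (negbTE (mulf_neq0 da bc)) orbF.
by case: z zc => [u|] /=; rewrite ?oner_eq0.
Qed.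

(** * The top form with its logarithmic poles cleared *)

Section TopForms.
Variables (k : numClosedFieldType) (m : nat).
Let n := m.+3.
Let X := Mbar0 k n.
Let n3 : (3 <= n)%N. Proof. by []. Qed.
Let rX : ringed X := X_ringed k n.

Definition Qb : {set quad m.+3} := [set qb i | i : 'I_m]%SET.
Lemma card_Qb : #|Qb| = m.
Proof. by rewrite card_imset ?card_ord //; exact: qb_inj. Qed.

Lemma poleD_Qb (x p : X) : poleD Qb x p =
  \prod_i (if val x (qb i) == None then chart true (val p (qb i)) else 1).
Proof.
rewrite /poleD big_mkcondr big_imset /=; last by move=> i j _ _; exact: qb_inj.
by apply: eq_bigl => i; rewrite !inE.
Qed.

(* The discriminant of the marked points, in homogeneous coordinates. *)
Definition disc (p : X) : k := \prod_(e in free_pairs m) bracket (pos p e.2) (pos p e.1).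

Lemma eend_neq (q : quad m.+3) e : (eend q e).1 != (eend q e).2.
Proof.
have := quad_uniq q; rewrite /= !inE !negb_or => /and3P [/and3P [m01 m02 m03] /andP [m12 m13] /andP [m23 _]].
by case: e => [[|[|[|[|e]]]] He] //=; rewrite /eend /= eq_sym // eq_sym.
Qed.

Variables (x : X) (kappa : k) (tau : 'I_m -> quad m.+3 -> X -> k).
Hypothesis gx : gauge_ok kappa x.
Hypothesis rtau : forall j q, regular x (tau j q).

Let S : finType := (quad m.+3 * 'I_4)%type.
Let bq (q : quad m.+3) : bool := val x q == None.
Let c q (y : X) : k := chart (bq q) (val y q).
Let sedge (s : S) := cano (eend s.1 s.2).
Let beta j (s : S) y : k := tau j s.1 y * c s.1 y * esgn k (bq s.1) s.2.
Let Nd (f : {ffun 'I_m -> S}) : k := \det (\matrix_(j, i) inc k (sedge (f j)) i).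
Let Zn (e : 'I_m.+3 * 'I_m.+3) (y : X) : k := Zf kappa e.1 e.2 y.
Let used (f : {ffun 'I_m -> S}) := [set sedge (f j) | j : 'I_m]%SET.
(* [Nd f] vanishes unless the edges chosen by [f] are distinct and form a forest, so that
   the product over the unused pairs clears their denominators. *)
Let term f y : k := Nd f * ((\prod_j beta j (f j) y) * \prod_(e in free_pairs m :\: used f) Zn e y).
Let Sw y : k := \sum_f term f y.
(** Times the gauge coordinate of the i-th free point this is 1 or 1 / z_i, as in [poleD]. *)
Let uh i (y : X) : k := if val x (qb i) == None then 1 - kappa * chart true (val y (qb i)) else chart false (val y (qb i)) - kappa.
(** The sign comes from d(1/(z - kappa)) = - (z - kappa)^(-2) dz in each of the m columns; the power
    m is the degree of the fixed points in [prod_free_pairs]. *)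
Let cst : k := (-1) ^+ m / (lam kappa (Some 0) * lam kappa (Some 1) * lam kappa None) ^+ m.

Definition top_form (y : X) : k := cst * (\prod_i uh i y ^+ m) * Sw y.

Let sedge_lt s : ((sedge s).1 < (sedge s).2)%N.
Proof. by apply: cano_lt; exact: eend_neq. Qed.

Let Zn_cano p e : e.1 != e.2 -> orient k e * Zn (cano e) p = Zn e p.
Proof.
by move=> _; rewrite /orient /cano /Zn /Zf; case: ifP => _ /=; rewrite ?mul1r // mulN1r opprB.
Qed.

Lemma top_form_regular : regular x top_form.
Proof.
have rc a : regular x (fun=> a : k) := reg_const rX x a.
have rq q : regular x (c q) by apply: chart_regular; rewrite /bq; case: (val x q).
apply: (reg_mul rX); first apply: (reg_mul rX (rc _)).
  apply: (@reg_prod _ _ _ _ _ _ _ rX) => i _.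
  have ru : regular x (uh i).
    have := rq (qb i); rewrite /uh /c /bq; case: (val x (qb i) == None) => H.
      by apply: (reg_sub rX (rc 1)); exact: (reg_mul rX (rc kappa)).
    exact: (reg_sub rX H).
  have : regular x (fun y => \prod_(0 <= j < m) uh i y) by apply: (@reg_prod _ _ _ _ _ _ _ rX) => j _.
  by congr regular; apply/funext => y; rewrite prodr_const_nat subn0.
apply: (@reg_sum _ _ _ _ _ _ _ rX) => f _; apply: (reg_mul rX (rc _)); apply: (reg_mul rX).
  apply: (@reg_prod _ _ _ _ _ _ _ rX) => j _; apply: (reg_mul rX) => //; exact: (reg_mul rX).
by apply: (@reg_prod _ _ _ _ _ _ _ rX) => e _; exact: Zf_regular.
Qed.

(** If just the two ends of one of the four differences collide, the cross ratio is 0 or oo, and a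
    chart that contains this value has coordinate 0 there. *)
Let collision_chart p (q : quad m.+3) e : in_chart (bq q) (val p q) ->
  pos p (eend q e).1 = pos p (eend q e).2 ->
  (forall l, l != (eend q e).1 -> l != (eend q e).2 -> pos p l != pos p (eend q e).1) -> c q p = 0.
Proof.
move=> pc E oth; have R := pos_crel p q.
have := quad_uniq q; rewrite /= !inE !negb_or => /and3P [/and3P [m01 m02 m03] /andP [m12 m13] /andP [m23 _]].
have c0 := crel_chart0 R pc; have coo := crel_chartoo R pc; case: e E oth => [[|[|[|[|e]]]] He] //; rewrite /eend /= -/(c q p) => E oth.
- apply: c0; [rewrite eq_sym; apply: oth|rewrite -E; apply: oth|by rewrite E eqxx]; by rewrite // eq_sym.
- apply: c0; [rewrite -E; apply: oth|rewrite eq_sym; apply: oth|by rewrite E eqxx orbT]; by rewrite // eq_sym.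
- apply: coo; [rewrite eq_sym; apply: oth|rewrite -E; apply: oth|by rewrite E eqxx]; by rewrite // eq_sym.
- apply: coo; [rewrite -E; apply: oth|rewrite eq_sym; apply: oth|by rewrite E eqxx orbT]; by rewrite // eq_sym.
Qed.

Lemma top_form_vanish p : gauge_ok kappa p -> (forall q, in_chart (val x q == None) (val p q)) -> ~ M0 p ->
  top_form p = 0.
Proof.
move=> gp pc nM; rewrite /top_form [Sw p]big1 ?mulr0 // => f _; rewrite /term.
have [->|nz] := eqVneq (Nd f) 0; first exact: mul0r.
have [a [b [ab E]]] : exists a b, a != b /\ pos p a = pos p b.
  apply: contrapT => H; apply: nM; apply/M0_pos => a b E; apply/eqP/negPn/negP => ab.
  by apply: H; exists a, b.
have freeP u v : u != v -> pos p u = pos p v -> cano (u, v) \in free_pairs m.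
  move=> uv Euv; rewrite inE cano_lt //= leqNgt; apply/negP => e2.
  have base (u' v' : 'I_m.+3) : (u' < v' < 3)%N -> pos p u' = pos p v' -> False.
    case: (base_cases u') => [->|->|->|[i ->]]; case: (base_cases v') => [->|->|->|[j ->]] //.
    - by rewrite pos_o0 pos_o1 => _ [/eqP]; rewrite eq_sym oner_eq0.
    - by rewrite pos_o0 pos_o2.
    - by rewrite pos_o1 pos_o2.
    - by case/andP=> _; rewrite ltnNge leq_addr.
  have lt := @cano_lt m (u, v) uv; apply: (base _ _ (introT andP (conj lt e2))).
  by rewrite /cano; case: ifP.
have Z0 u v : u != v -> pos p u = pos p v -> cano (u, v) \notin used f ->
    \prod_(e in free_pairs m :\: used f) Zn e p = 0.
  move=> uv Euv nu; rewrite (bigD1 (cano (u, v))) /=; last by rewrite inE nu freeP.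
  suff -> : Zn (cano (u, v)) p = 0 by rewrite mul0r.
  by rewrite /cano; case: ifP => _; rewrite /Zn /Zf /= Euv subrr.
have [ua|nu] := boolP (cano (a, b) \in used f); last by rewrite (Z0 a b) // !mulr0.
have nz' := nz; rewrite /Nd in nz'.
have [[l0 [la lb El]]|none] := pselect (exists l, [/\ l != a, l != b & pos p l = pos p a]).
  have [ul|nu] := boolP (cano (a, l0) \in used f); last by rewrite (Z0 a l0) ?mulr0 // eq_sym.
  have [ul'|nu] := boolP (cano (b, l0) \in used f); last by rewrite (Z0 b l0) ?mulr0 // -?E // eq_sym.
  case/imsetP: ua => j1 _ E1; case/imsetP: ul => j3 _ E3; case/imsetP: ul' => j2 _ E2.
  exfalso; apply: (no_triangle (E := fun j => sedge (f j)) nz' ab (_ : b != l0) (_ : a != l0) (esym E1) (esym E2) (esym E3)).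
    by rewrite eq_sym.
  by rewrite eq_sym.
case/imsetP: ua => j _ Ej; suff b0 : beta j (f j) p = 0.
  by rewrite (bigD1 j) //= b0 !mul0r mulr0.
rewrite /beta; suff -> : c (f j).1 p = 0 by rewrite mulr0 mul0r.
have oth l : l != a -> l != b -> pos p l != pos p a.
  by move=> la lb; apply/eqP => El; apply: none; exists l.
apply: (collision_chart (e := (f j).2)); first exact: pc.
  by case: (cano_eq (esym Ej)) => ->.
case: (cano_eq (esym Ej)) => -> /= l l1 l2; first exact: oth.
by rewrite -E; exact: oth.
Qed.

(** In [prod_free_pairs] the gauge coordinate of a free point has exponent m + 2: two of these
    factors match the derivative of the gauge, the other m combine with [uh] to [poleD]. *)
Lemma top_form_det (t : 'I_m -> X -> k) p : M0 p -> gauge_ok kappa p ->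
  (forall i j, dpos p i (t j) = \sum_q tau j q p * dpos p i (fun y => chart (val x q == None) (val y q))) ->
  top_form p = disc p * poleD Qb x p ^+ m * \det (\matrix_(i, j) dpos p i (t j)).
Proof.
move=> Mp gp H; have pinj := (M0_pos p).1 Mp.
pose g i := gau kappa (pos p (bi i)).
pose w j s := beta j s p / Zn (sedge s) p.
have Zn0 e : e.1 != e.2 -> Zn e p != 0 by move=> ne; apply: Zf_neq0 => //; rewrite (inj_eq pinj).
have ltne (e : 'I_m.+3 * 'I_m.+3) : (e.1 < e.2)%N -> e.1 != e.2 by move=> lt; rewrite -val_eqE neq_ltn lt.
have c0 q : c q p != 0.
  rewrite /c; have [+ _] := (M0P p n3).1 Mp q; case: (val p q) => [a|] // a0 _.
  by case: (bq q); rewrite /= ?invr_eq0; apply: contra_neq a0 => ->.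
have dE i j : dpos p i (t j) = (\sum_s w j s * inc k (sedge s) i) * (- g i ^+ 2).
  rewrite H -(pair_bigA _ (fun q e => w j (q, e) * inc k (sedge (q, e)) i)) /= mulr_suml.
  apply: eq_bigr => q _.
  have -> : dpos p i (fun y => chart (val x q == None) (val y q)) = c q p * dl p (dpos p i) (c q).
    by rewrite /dl mulrCA divff // mulr1.
  rewrite (dl_cross Mp gp) mulr_sumr mulr_suml mulr_sumr; apply: eq_bigr => e _.
  rewrite (dl_Zf Mp gp i (eend_neq q e)) /w /beta /sedge /=.
  have := @inc_cano k m (eend q e) i; rewrite {2}/inc => <-.
  rewrite -[Zf _ _ _ p]/(Zn (eend q e) p) -(Zn_cano p (eend_neq q e)) -/(g i).
  have z0 := Zn0 _ (ltne _ (cano_lt (eend_neq q e))); have o0 := orient_neq0 k (eend q e).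
  by rewrite /bq; field; rewrite z0 o0.
have -> : \matrix_(i, j) dpos p i (t j) = ((\matrix_(j, i) \sum_s w j s * inc k (sedge s) i) *m diag_mx (\row_i - g i ^+ 2))^T.
  by apply/matrixP => i j; rewrite mul_mx_diag !mxE dE.
rewrite det_tr det_mulmx det_diag det_sum_rows.
have -> : \prod_i (\row_i - g i ^+ 2) 0 i = (-1) ^+ m * \prod_i g i ^+ 2.
  rewrite (eq_bigr (fun i => -1 * g i ^+ 2)) => [|i _]; last by rewrite mxE mulN1r.
  by rewrite big_split /= prodr_const card_ord.
pose V' := \prod_(e in free_pairs m) Zn e p.
have SwE : Sw p = V' * \sum_(f : {ffun 'I_m -> S}) (\prod_j w j (f j)) * \det (\matrix_(j, i) inc k (sedge (f j)) i).
  rewrite mulr_sumr; apply: eq_bigr => f _; rewrite /term -/(Nd f).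
  have [->|nz] := eqVneq (Nd f) 0; first by rewrite mul0r !mulr0.
  have sub : used f \subset free_pairs m.
    by apply/fintype.subsetP => e /imsetP [j _ ->]; exact: (edges_free (E := fun j => sedge (f j)) (fun j => sedge_lt _) nz).
  have P0 : \prod_j Zn (sedge (f j)) p != 0.
    by apply/prodf_neq0 => j _; apply: Zn0; exact: ltne (sedge_lt _).
  have -> : V' = (\prod_j Zn (sedge (f j)) p) * \prod_(e in free_pairs m :\: used f) Zn e p.
    rewrite /V' (bigID (fun e => e \in used f)) /=; congr (_ * _); last by apply: eq_bigl => e; rewrite finset.in_setD andbC.
    rewrite (eq_bigl (fun e => e \in used f)) => [|e]; last first.
      by apply: andb_idl => /(fintype.subsetP sub).
    rewrite big_imset /=; first by apply: eq_bigl => j; rewrite !inE.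
    by move=> j j' _ _; exact: (edges_inj (E := fun j => sedge (f j)) nz).
  rewrite -/(Nd f) /w prodf_div; move: P0; move: (\prod_j Zn _ p) (\prod_j beta _ _ _) (\prod_(e in _) _) => P1 P2 P3 P0.
  by field.
have gE i : lam kappa (pos p (bi i)) = g i by rewrite /g (pos_fin Mp).
pose C0 := lam kappa (Some 0) * lam kappa (Some 1) * lam kappa None.
have V'E : V' = disc p * (C0 ^+ m * (\prod_i g i ^+ m * \prod_i g i ^+ 2)).
  rewrite /V' /disc (eq_bigr _ (fun e _ => Zf_bracket e.1 e.2 gp)) big_split /=; congr (_ * _).
  rewrite (prod_free_pairs (fun l => lam kappa (pos p l))); congr (_ ^+ _ * _).
    rewrite !big_ord_recl big_ord0 mulr1 mulrA /C0; congr (lam _ _ * lam _ _ * lam _ _).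
    - by rewrite -(pos_o0 p); congr pos; apply: val_inj.
    - by rewrite -(pos_o1 p); congr pos; apply: val_inj.
    - by rewrite -(pos_o2 p); congr pos; apply: val_inj.
  by rewrite -big_split; apply: eq_bigr => i _ /=; rewrite -exprD addn2 -gE.
have C00 : C0 != 0.
  by rewrite !mulf_neq0 ?lam_neq0 // -?(pos_o0 p) -?(pos_o1 p) -?(pos_o2 p); exact: gp.
have -> : poleD Qb x p ^+ m = \prod_i uh i p ^+ m * \prod_i g i ^+ m.
  rewrite poleD_Qb -prodrXl -big_split; apply: eq_bigr => i _ /=; rewrite -exprMn; congr (_ ^+ _).
  rewrite /uh /g; have := pos_fin Mp i; move: (chart _ _) => z Ep; have := Ep; rewrite pos_bi => Ez.
  have [z0 _ _] := (M0P p n3).1 Mp (qb i); have zk := gp (bi i); rewrite Ep in zk *; rewrite Ez in z0 *.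
  have zk' : z - kappa != 0 by rewrite subr_eq0; apply: contra_neq zk => ->.
  have z0' : z != 0 by apply: contra_neq z0 => ->.
  rewrite -[sval p _]/(val p (qb i)) -[sval x _]/(val x (qb i)) Ez.
  by case: ifP => _ /=; field; rewrite ?z0' ?zk'.
rewrite /top_form SwE V'E /cst -/C0.
have Cm : C0 ^+ m != 0 by rewrite expf_neq0.
move: (C0 ^+ m) (\prod_i g i ^+ m) (\prod_i g i ^+ 2) (\prod_i uh i p ^+ m) (disc p) (\sum_f _) ((-1) ^+ m) Cm => *.
by field.
Qed.
End TopForms.

Lemma top_form_ex (k : numClosedFieldType) (m : nat) (x : Mbar0 k m.+3) (t : 'I_m -> Mbar0 k m.+3 -> k) :
  (forall j, regular x (t j)) -> exists w : Mbar0 k m.+3 -> k, [/\ regular x w,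
    near_pt x [set p | boundary k m.+3 p -> w p = 0] &
    near_pt x [set p | M0 p -> w p = disc p * poleD (Qb m) x p ^+ m * \det (\matrix_(i, j) dpos p i (t j))]].
Proof.
move=> rt; have rX : ringed (Mbar0 k m.+3) := X_ringed _ _.
have [kappa kf] := @fresh k (codom (pos x)).
have gx : gauge_ok kappa x by move=> l; apply: contraNneq kf => <-; exact: codom_f.
pose tau j := sval (cid (dpos_span (rt j))).
have tauP j : (forall q, regular x (tau j q)) /\ near_pt x [set p | M0 p -> forall i,
    dpos p i (t j) = \sum_q tau j q p * dpos p i (fun y => chart (val x q == None) (val y q))].
  by rewrite /tau; case: cid.
have rtau j q : regular x (tau j q) by case: (tauP j).
have ntau := near_all (I := 'I_m) (fun j => (tauP j).2).
exists (top_form x kappa tau); split; first exact: top_form_regular.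
  have nc : near_pt x [set p : Mbar0 k m.+3 | forall q : quad m.+3, in_chart (val x q == None) (val p q)].
    by apply: near_all => q; apply: in_chart_near; case: (val x q).
  by apply: near_sub (nearI rX nc (gauge_ok_near gx)) => p /= [pc gp] Bp; exact: top_form_vanish.
apply: near_sub (nearI rX ntau (gauge_ok_near gx)) => p /= [H gp] Mp.
by apply: top_form_det => // i j; exact: H.
Qed.

Lemma disc_neq0 (k : numClosedFieldType) (m : nat) (p : Mbar0 k m.+3) : M0 p -> disc p != 0.
Proof.
move=> /M0_pos pinj; apply/prodf_neq0 => e; rewrite inE => /andP [lt _].
by rewrite bracket_eq0 (inj_eq pinj) -val_eqE neq_ltn lt orbT.
Qed.

(** Near each point, [top_form_ex] gives a regular function that vanishes on the boundary, hence a
    multiple alpha * E of its equation. On [M0] it is disc * poleD^m times the Jacobian of the local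
    parameters, so that alpha * K * E is poleD^m times a rational function that does not depend on
    the point. *)
Lemma log_canonical_bound (R : realType) (m : nat) (K E : Mbar0 R[i] m.+3 -> Mbar0 R[i] m.+3 -> R[i]) :
  (0 < m)%N -> canonical_divisor K -> reduced_divisor (boundary R[i] m.+3) E ->
  hyperbolic_bound (boundary R[i] m.+3) (((m * m)%N%:R)^-1 : R) (add_div K E).
Proof.
move=> m0 [d [phi [g HK]]] HE; pose X := Mbar0 R[i] m.+3.
have n3 : (3 <= m.+3)%N by [].
have rX : ringed X := X_ringed _ _.
(* The degree of the form that defines [K] is forced by the cotangent space at a point of [M0]. *)
have dm : d = m.
  have [x0 Mx0] := M0_ex R[i] n3; have [_ [t [lt _]]] := HK x0.
  exact: (local_params_dim Mx0 lt).
subst d.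
have tx x : exists t : 'I_m -> X -> R[i], local_params x t /\ generic [set y |
    [/\ regular y phi, regular y (K x), (forall j, regular y (g j) /\ regular y (t j)) &
      forall D : 'I_m -> (X -> R[i]) -> R[i], (forall i, tangent y (D i)) ->
        phi y * \det (\matrix_(i, j) D i (g j)) = K x y * \det (\matrix_(i, j) D i (t j))]].
  by case: (HK x).
have ax x : exists a : X -> R[i], [/\ regular x a, M0 x -> a x != 0 &
    generic [set z | K x z * (a z * E x z) = disc z * poleD (Qb m) x z ^+ m * (phi z * \det (\matrix_(i, j) dpos z i (g j)))]].
  have [t [lt gt]] := tx x; have rt j : regular x (t j) by case: lt => /(_ j) [].
  have [w [rw wB wM]] := top_form_ex rt.
  have [_ _ HEx] := HE x; have [a [ra aE]] := (HEx w rw).1 wB.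
  exists a; split=> //.
    move=> Mx; have wn0 : w x != 0.
      rewrite (near_self wM Mx) !mulf_neq0 ?disc_neq0 ?expf_neq0 ?(local_params_det Mx lt) //.
      by have [] := poleD_M0 n3 (Qb m) x Mx.
    by move: wn0; rewrite (near_self aE) mulf_eq0 negb_or => /andP [].
  have iX := X_irreducible R[i] n3.
  apply: generic_sub (genericI rX iX (genericI rX iX gt (M0_generic _ n3)) (genericI rX iX (near_generic wM) (near_generic aE))).
  move=> z /= [[[_ _ _ HD] Mz] [wz az]].
  by rewrite -az (wz Mz) (HD _ (fun i => dpos_tangent i Mz)) mulrCA.
pose alpha x := sval (cid (ax x)).
have aP x : [/\ regular x (alpha x), M0 x -> alpha x x != 0 &
    generic [set z | K x z * (alpha x z * E x z) = disc z * poleD (Qb m) x z ^+ m * (phi z * \det (\matrix_(i, j) dpos z i (g j)))]].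
  by rewrite /alpha; case: cid.
apply: (@hyperbolic_ex R m.+3 _ alpha (Qb m) m (m * m) n3).
- by rewrite muln_gt0 m0.
- by rewrite card_Qb.
(* Besides [poleD], only disc * phi * det(dg / dz) remains, the same for all [x]; it goes into
   [H]. *)
- move=> B [h [_ hB]]; exists (fun z => h z * (disc z * (phi z * \det (\matrix_(i, j) dpos z i (g j))))) => x.
  have [u [ru u0 uE]] := hB x; have [_ _ aE] := aP x; exists u; split=> //.
  apply: generic_sub (genericI rX (X_irreducible R[i] n3) uE aE) => z /= [-> az].
  rewrite /add_div; transitivity (u z * h z * (K x z * (alpha x z * E x z))); first by ring.
  by rewrite az; ring.
- by move=> x; have [] := aP x.
- by move=> x; have [] := aP x.
Qed.

Theorem theorem1p2 (R : realType) (n : nat) (hn : (3 <= n)%N) :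
  algebraically_hyperbolic (boundary R[i] n) /\
  ((4 <= n)%N ->
   forall K E : Mbar0 R[i] n -> Mbar0 R[i] n -> R[i],
     canonical_divisor K -> reduced_divisor (boundary R[i] n) E ->
     hyperbolic_bound (boundary R[i] n) (((n - 3)%:R ^+ 2)^-1) (add_div K E)).
Proof.
split; first exact: part1.
case: n hn => [|[|[|m]]] // _ m0 K E cK rE.
have -> : (m.+3 - 3)%:R ^+ 2 = (m * m)%N%:R :> R by rewrite !subSS subn0 -natrX mulnn.
exact: log_canonical_bound.
Qed.
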